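(* In the setting described in the context, let $\mu_n\in C(\overline\Gamma)$ and consider the double-layer potential $w^{(n)}(x)=\int_\Gamma\mu_n(\xi)B^\alpha_{N\xi}[q_n(\xi;x)]\,d_\xi\Gamma$. For $t\in\Gamma$ let $w_i^{(n)}(t)$ and $w_e^{(n)}(t)$ denote the limiting values of $w^{(n)}$ at $t$ from inside $\Omega$ and from outside $\Omega$, respectively. Then $$w_i^{(n)}(t)=-\tfrac12\mu_n(t)+\int_\Gamma\mu_n(s)K_n(s;t)\,d_s\Gamma,\qquad w_e^{(n)}(t)=\tfrac12\mu_n(t)+\int_\Gamma\mu_n(s)K_n(s;t)\,d_s\Gamma,$$ where $K_n(s;t)=B^\alpha_{Ns}[q_n(s;t)]$ for $s,t\in\Gamma$ (conormal derivative in $s$ along the outer normal at $s$).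
   Context: Let $m>2$ and $1\le n\le m$ be integers, $K=\{1,\dots,n\}$, $\alpha=(\alpha_1,\dots,\alpha_n)$ real with $0<2\alpha_k<1$, $\mathbb R_m^{n+}=\{x\in\mathbb R^m:x_1>0,\dots,x_n>0\}$. Lauricella's function: $F_A^{(n)}[a,b_1,\dots,b_n;c_1,\dots,c_n;y]=\sum_{m_1,\dots,m_n\ge0}\frac{(a)_{m_1+\dots+m_n}(b_1)_{m_1}\cdots(b_n)_{m_n}}{(c_1)_{m_1}\cdots(c_n)_{m_n}}\prod_k\frac{y_k^{m_k}}{m_k!}$. Put $\bar\alpha_n=\frac{m-2}{2}+\sum_{k=1}^n(1-\alpha_k)$, $\kappa_n=2^{2\bar\alpha_n-m}\frac{\Gamma(\bar\alpha_n)}{\pi^{m/2}}\prod_{k=1}^n\frac{\Gamma(1-\alpha_k)}{\Gamma(2-2\alpha_k)}$, $r^2=\sum_{i=1}^m(\xi_i-x_i)^2$, $r_k^2=(\xi_k+x_k)^2+\sum_{i\ne k}(\xi_i-x_i)^2$, $\sigma_k=1-r_k^2/r^2$, and $q_n(\xi;x)=\kappa_n r^{-2\bar\alpha_n}\prod_{k=1}^n(\xi_kx_k)^{1-2\alpha_k}F_A^{(n)}[\bar\alpha_n,1-\alpha_1,\dots,1-\alpha_n;2-2\alpha_1,\dots,2-2\alpha_n;\sigma_1,\dots,\sigma_n]$, a fundamental solution of $\sum_i u_{x_ix_i}+\sum_k\frac{2\alpha_k}{x_k}u_{x_k}=0$. Conormal derivative: $B^\alpha_{N\xi}[f]=\big(\prod_{k=1}^n\xi_k^{2\alpha_k}\big)\sum_{i=1}^m\frac{\partial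 f}{\partial\xi_i}\cos(N,\xi_i)$. $\Gamma$ is a surface in $\mathbb R_m^{n+}$ which together with the hyperplanes $x_1=0,\dots,x_n=0$ bounds a finite domain $\Omega\subset\mathbb R_m^{n+}$; $\Gamma$ is a Lyapunov surface: (i) definite normal at every point; (ii) constants $a,\kappa>0$ with angle between normals at $x,\xi\in\Gamma$ at most $a|x-\xi|^\kappa$; (iii) $\Gamma$ meets the hyperplanes $x_k=0$ at right angles. $N$ is the outer normal to $\Gamma$ with respect to $\Omega$.
   Formalization: Lauricella's F_A is taken as its Euler integral over [0,1]^n instead of the power series, which diverges near the diagonal because σ_k = −4ξ_k x_k/r² → −∞; the integral agrees with the series where that converges and is its standard continuation to σ_k ≤ 0. *)

(* Defs.v *)
From mathcomp Require Import all_boot all_order all_algebra.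
From mathcomp Require Import all_classical all_reals all_analysis.
Set Implicit Arguments. Unset Strict Implicit. Unset Printing Implicit Defensive.
Import Order.TTheory GRing.Theory Num.Theory numFieldNormedType.Exports.
Local Open Scope classical_set_scope.
Local Open Scope ring_scope.

Section Defs.
Variable R : realType.

Definition Gamma (s : R) : R :=
  \int[lebesgue_measure]_(t in `]0%R, +oo[) (t `^ (s - 1) * expR (- t)).

(* ---------- points of R^m, coordinates (1-based x_{k+1} is xc x k) ---------- *)
Definition xc (m : nat) (x : 'rV[R]_m) (k : nat) : R :=
  if (insub k : option 'I_m) is Some i then x ord0 i else 0.

Definition dotp (m : nat) (x y : 'rV[R]_m) : R := \sum_(i < m) x ord0 i * y ord0 i.
Definition enorm (m : nat) (x : 'rV[R]_m) : R := Num.sqrt (dotp x x).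

Definition orthant (m : nat) (n : nat) : set ('rV[R]_m) :=
  [set x | forall k, (k < n)%N -> 0 < xc x k].

Fixpoint cube_int (k : nat) (F : (nat -> R) -> R) : R :=
  match k with
  | 0 => F (fun _ => 0)
  | k'.+1 => \int[lebesgue_measure]_(s in `[0%R, 1%R])
               cube_int k' (fun t => F (fun j => if j == k' then s else t j))
  end.

(* Lauricella's F_A^{(n)}[a, b_1..b_n; c_1..c_n; y_1..y_n] given by its
   Euler-type integral representation (valid for c_k > b_k > 0 and
   1 - sum y_k t_k > 0 on the cube, in particular for y_k <= 0): it coincides
   with the defining power series where the series converges and is its
   analytic continuation elsewhere. *)
Definition lauricellaFA (n : nat) (a : R) (b c y : nat -> R) : R :=
  (\prod_(k < n) (Gamma (c k) / (Gamma (b k) * Gamma (c k - b k)))) *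
  cube_int n (fun t =>
    (\prod_(k < n) (t k `^ (b k - 1) * (1 - t k) `^ (c k - b k - 1))) *
    (1 - \sum_(k < n) y k * t k) `^ (- a)).

Definition abar (m n : nat) (alpha : nat -> R) : R :=
  (m%:R - 2) / 2 + \sum_(k < n) (1 - alpha k).

Definition kappa (m n : nat) (alpha : nat -> R) : R :=
  2 `^ (2 * abar m n alpha - m%:R) * Gamma (abar m n alpha) / pi `^ (m%:R / 2) *
  \prod_(k < n) (Gamma (1 - alpha k) / Gamma (2 - 2 * alpha k)).

Definition rr2 (m : nat) (xi x : 'rV[R]_m) : R :=
  \sum_(i < m) (xi ord0 i - x ord0 i) ^+ 2.

(* r_k^2 (k 0-based, i.e. the paper's r_{k+1}^2) *)
Definition rk2 (m : nat) (k : nat) (xi x : 'rV[R]_m) : R :=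
  (xc xi k + xc x k) ^+ 2 +
  \sum_(i < m | val i != k) (xi ord0 i - x ord0 i) ^+ 2.

Definition sigmak (m : nat) (k : nat) (xi x : 'rV[R]_m) : R :=
  1 - rk2 k xi x / rr2 xi x.

Definition qn (m n : nat) (alpha : nat -> R) (xi x : 'rV[R]_m) : R :=
  kappa m n alpha * (rr2 xi x) `^ (- abar m n alpha) *
  (\prod_(k < n) (xc xi k * xc x k) `^ (1 - 2 * alpha k)) *
  lauricellaFA n (abar m n alpha) (fun k => 1 - alpha k)
     (fun k => 2 - 2 * alpha k) (fun k => sigmak k xi x).

Definition evec (m : nat) (i : 'I_m) : 'rV[R]_m := delta_mx ord0 i.
Definition partial (m : nat) (i : 'I_m) (f : 'rV[R]_m -> R) (xi : 'rV[R]_m) : R :=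
  'D_(evec i) f xi.

(* cos(N, xi_i) is the i-th component of the unit normal N *)
Definition conormal (m n : nat) (alpha : nat -> R) (N : 'rV[R]_m -> 'rV[R]_m)
    (f : 'rV[R]_m -> R) (xi : 'rV[R]_m) : R :=
  (\prod_(k < n) xc xi k `^ (2 * alpha k)) *
  \sum_(i < m) partial i f xi * N xi ord0 i.

(* ---------- surface measure: (m-1)-dimensional Hausdorff measure ---------- *)
Definition ediam (m : nat) (A : set 'rV[R]_m) : \bar R :=
  ereal_sup ([set 0%E] `|`
             [set (enorm (x - y))%:E | x in A & y in A]).

(* normalisation constant making H^s the Lebesgue measure on R^s *)
Definition hconst (s : R) : R := pi `^ (s / 2) / (2 `^ s * Gamma (s / 2 + 1)).

Definition hausdorff_delta (m : nat) (s delta : R) (A : set 'rV[R]_m) : \bar R :=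
  ereal_inf ((fun U : nat -> set 'rV[R]_m =>
                (\sum_(0 <= i <oo) (hconst s * (fine (ediam (U i))) `^ s)%:E)%E) @`
             [set U | A `<=` \bigcup_i U i /\ forall i, (ediam (U i) <= delta%:E)%E]).

Definition hausdorff (m : nat) (s : R) (A : set 'rV[R]_m) : \bar R :=
  ereal_sup ((fun delta => hausdorff_delta s delta A) @` `]0%R, +oo[).

Definition borelRm (m : nat) := g_sigma_algebraType (@open 'rV[R]_m).

Definition lyapunov_surface (m n : nat) (Omega Gam : set 'rV[R]_m)
    (N : 'rV[R]_m -> 'rV[R]_m) : Prop :=
  (* Gamma is the part of the boundary of Omega lying in R_m^{n+}; the rest of
     the boundary of Omega lies on the hyperplanes x_k = 0 *)
  Gam = (closure Omega `\` Omega) `&` orthant n /\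
  (* (i) definite (unit) normal at every point: tangent hyperplane exists *)
  (forall t, Gam t -> enorm (N t) = 1) /\
  (forall t, Gam t ->
     (fun xi => dotp (xi - t) (N t) / enorm (xi - t)) x
        @[x --> within (Gam `\ t) (nbhs t)] --> 0) /\
  (forall t, Gam t -> exists2 e0 : R, 0 < e0 &
     forall e : R, 0 < e < e0 ->
       Omega (t - e *: N t) /\ ~ closure Omega (t + e *: N t)) /\
  (exists a kap : R, 0 < a /\ 0 < kap /\
     forall x xi, Gam x -> Gam xi ->
       acos (dotp (N x) (N xi)) <= a * enorm (x - xi) `^ kap) /\
  (* (iii) Gamma meets the hyperplanes x_k = 0 at right angles *)
  (forall k, (k < n)%N -> forall t, closure Gam t -> xc t k = 0 ->
     xc (N x) k @[x --> within Gam (nbhs t)] --> 0).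

Definition finite_domain (m : nat) (Omega : set 'rV[R]_m) : Prop :=
  open Omega /\ connected Omega /\ Omega !=set0 /\
  exists M : R, forall x, Omega x -> enorm x <= M.

End Defs.
Arguments orthant {R} m n.

(* Main.v *)
(** Euler's integral for Lauricella's function together with the integral of the
    Gamma function writes [q_n(xi; x)] as a constant times
      [prod_k (xi_k x_k)^(1-2alpha_k) int_0^oo y^(a-1) e^(-r^2 y) prod_k B_k(4 xi_k x_k y) dy],
    with [B_k] the Laplace transform of a Beta weight, [B_k(w) ~ Gamma(1-alpha_k) w^(alpha_k-1)].
    Differentiating under the integral sign, the conormal derivative in [xi] is
      [- c0 ((xi - x) . N(xi)) / r^m (1 + o(1)) + O(r^(2-m))], [c0 = Gamma(m/2) / (2 pi^(m/2))],
    near the diagonal of the orthant, and it is continuous and bounded away from it.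

    For [x] near [t], off [Gamma], let [y] be the point of [Gamma] nearest to [x], so that
    [x = y -+ d N(y)].  The Lyapunov condition gives [(xi - y) . N(xi) = O(|xi - y|^(1+kappa))] on
    [Gamma].  Hence on a small patch the leading term is, up to an integrable error, the Poisson
    kernel [-+ c0 d / (|xi - y|^2 + d^2)^(m/2)], whose integral over the patch tends to 1/2 up to
    sign: near [y] the surface is an almost flat Lipschitz graph, so balls of [Gamma] have
    asymptotically the Hausdorff measure of flat balls.  The latter is computed from the
    isodiametric inequality, proved by Steiner symmetrization.  The error terms are Riesz
    potentials, small uniformly in [x] on a small patch, and off the patch dominated convergence
    applies. *)
Require Import Defs.
From HB Require Import structures.
From mathcomp Require Import all_boot all_order all_algebra.
From mathcomp Require Import all_classical all_reals all_analysis.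
From mathcomp Require Import measurable_realfun.
From mathcomp Require Import ring lra.
Set Implicit Arguments. Unset Strict Implicit. Unset Printing Implicit Defensive.
Import Order.TTheory GRing.Theory Num.Theory numFieldNormedType.Exports.
Local Open Scope classical_set_scope.
Local Open Scope ring_scope.

(** [Gam] is not given as a graph: only unit normals with a Hölder bound and the two sides of each
    normal line are known. All local geometry rests on one fact: a segment whose direction makes a
    positive product with the normal at every surface point it meets leaves the domain at each of
    them, so it cannot have both ends on the surface. Cone bounds, the Lyapunov inequality and the
    size of tangent projections follow from it. No area formula or parametrisation enters. The
    kernels to be integrated depend on the distance to one point, hence are mixtures of Gaussians of
    that distance; the integral of a Gaussian is determined by the masses of balls, and these come
    from tangent projections. The one-half of the jump is then an identity between Gamma values,
    [jump_const]. Differentiation produces a pole [1 / xi_k] on each hyperplane; the weight of the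
    conormal derivative leaves a factor [xi_k] that absorbs it, so away from the diagonal the kernel
    stays bounded up to the hyperplanes. *)

Lemma in_setb (T : Type) (b : T -> bool) (x : T) : (x \in [set z | b z]) = b x.
Proof. by apply/idP/idP; rewrite inE. Qed.

Lemma ge0_integralZl_fin d (T : measurableType d) (R : realType)
    (mu : {measure set T -> \bar R}) (D : set T) (f : T -> R) (k : R) :
  measurable D -> measurable_fun D f -> (forall x, D x -> 0 <= f x) -> 0 <= k ->
  (\int[mu]_(x in D) (k * f x)%:E = k%:E * \int[mu]_(x in D) (f x)%:E)%E.
Proof.
move=> mD mf f0 k0; rewrite -ge0_integralZl_EFin//.
exact/measurable_EFinP.
Qed.

(** * The Gamma integral *)

Section affine_substitution.
Variable R : realType.
Local Notation leb := (@lebesgue_measure R).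

(** The image of Lebesgue measure under the affine map, multiplied by [a], gives every half-open
    interval its length, hence is Lebesgue measure. *)
Lemma ge0_integral_affine (a b : R) (f : R -> \bar R) : 0 < a ->
  measurable_fun setT f -> (forall x, 0 <= f x)%E ->
  (\int[leb]_x f (a * x + b)%R = (a^-1)%:E * \int[leb]_x f x)%E.
Proof.
move=> a0 mf f0.
pose phi : measurableTypeR R -> measurableTypeR R := fun x => a * x + b.
have mphi : measurable_fun setT phi.
  by apply: measurable_funD => //; exact: measurable_funM.
pose push : {measure set (measurableTypeR R) -> \bar R} :=
  measure_function_pushforward__canonical__measure_function_Measure leb mphi.
pose nu : {measure set (measurableTypeR R) -> \bar R} := mscale (NngNum (ltW a0)) push.
have nuE A : measurable A -> leb A = nu A.
  move=> mA; apply: (@lebesgue_measure_unique R nu) => // X [[u v] _ <-].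
  rewrite /nu /= /mscale /= /push /pushforward /=.
  have -> : phi @^-1` `]u, v] = `]((u - b) / a), ((v - b) / a)]%classic.
    apply/seteqP; split => x /=; rewrite !in_itv/= ltr_pdivrMr// ler_pdivlMr//;
    rewrite ltrBlDr lerBrDr mulrC//.
  rewrite !lebesgue_measure_itv/= !lte_fin ltr_pM2r ?invr_gt0// ltrD2r.
  case: ifPn => _; last by rewrite mule0.
  rewrite -!EFinB -EFinM; congr EFin; field; exact: lt0r_neq0.
have -> : (\int[leb]_x f x = \int[nu]_x f x)%E.
  by apply: eq_measure_integral => A mA _; exact: nuE.
rewrite ge0_integral_mscale// ge0_integral_pushforward//= muleA -EFinM mulVf ?lt0r_neq0//.
by rewrite mul1e.
Qed.

Lemma continuous_powR (p x : R) : 0 < x -> {for x, continuous (fun t : R => t `^ p)}.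
Proof.
move=> x0; apply: differentiable_continuous; apply/derivable1_diffP.
by have := is_derive1_powR p x0; case.
Qed.

(** For [p < 1] the integrand is unbounded at 0, so the fundamental theorem is applied from
    [1 / (n + 1)] to [u] and the interval is exhausted by monotone convergence. *)
Lemma integral_powR_itv0 (p u : R) : 0 < p -> 0 <= u ->
  (\int[leb]_(t in `]0%R, u]) (t `^ (p - 1))%:E = (u `^ p / p)%:E)%E.
Proof.
move=> p0; rewrite le_eqVlt => /predU1P[<-|u0].
  by rewrite set_itv_ge ?bnd_simp ?ltxx// integral_set0 powR0 ?lt0r_neq0// mul0r.
have mpow : measurable_fun setT (fun t : R => (t `^ (p - 1))%:E).
  by apply/measurable_EFinP; exact: measurable_powR.
pose F (n : nat) : set (measurableTypeR R) := `[n.+1%:R^-1, u]%classic.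
have FE : \bigcup_n F n = `]0, u]%classic.
  apply/seteqP; split => x /=.
    by move=> [n _]; rewrite /F /= !in_itv/= => /andP[h ->]; rewrite (lt_le_trans _ h)// invr_gt0.
  rewrite in_itv/= => /andP[x0 xu].
  have [k hk] := ltr_add_invr x0; exists k => //=; rewrite /F /= in_itv/= xu andbT.
  by rewrite add0r in hk; exact: ltW.
have H := @ge0_nondecreasing_set_cvg_integral _ _ _ F (fun t : R => (t `^ (p - 1))%:E) leb.
rewrite FE in H; apply: (cvg_unique (@ereal_hausdorff R) (H _ _ _ _)) => {H} //=.
- move=> i j ij; apply/subsetPset => x /=; rewrite /F/= !in_itv/= => /andP[h ->].
  by rewrite (le_trans _ h)// lef_pV2 ?posrE// ler_nat.
- by move=> i; exact: measurable_itv.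
- by move=> i; apply: measurable_funTS.
- by move=> i x _; rewrite lee_fin powR_ge0.
apply: (@cvg_trans _ ((fun n => ((u `^ p - n.+1%:R^-1 `^ p) / p)%:E) @ \oo)); last first.
  apply: cvg_EFin; first by apply: nearW.
  have -> : u `^ p / p = (u `^ p - 0) / p by rewrite subr0.
  apply: cvgMl; apply: cvgB; first exact: cvg_cst.
  have /cvg_at_rightP := powR_cvg0 p0; apply; split => //.
  exact: cvg_harmonic.
apply: near_eq_cvg; near=> n.
have nu : n.+1%:R^-1 < u.
  by near: n; exact: (cvgr_lt _ (@cvg_harmonic R)).
rewrite (@continuous_FTC2 R (fun t => t `^ (p - 1)) (fun t => t `^ p / p))//.
- by rewrite -EFinB mulrBl.
- apply/continuous_in_subspaceT => x; rewrite inE/= in_itv/= => /andP[h _].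
  by apply: continuous_powR; rewrite (lt_le_trans _ h)// invr_gt0.
- split.
  + move=> x; rewrite in_itv/= => /andP[h _]; apply: derivableM => //.
    by apply: derivable_powR; rewrite in_itv/= andbT (lt_trans _ h)// invr_gt0.
  + apply: cvg_at_right_filter; apply: cvgMl; apply: continuous_powR; rewrite invr_gt0//.
  + by apply: cvg_at_left_filter; apply: cvgMl; apply: continuous_powR.
- move=> x; rewrite in_itv/= => /andP[h _].
  have x0 : 0 < x by rewrite (lt_trans _ h)// invr_gt0.
  have D := is_derive1_powR p x0.
  rewrite derive1E (_ : (fun t => t `^ p / p) = p^-1 *: (fun t : R => t `^ p)); last first.
    by apply/funext => t; rewrite mulrC.
  rewrite deriveZ; last exact: (@ex_derive _ _ _ _ _ _ _ D).
  by rewrite derive_val /GRing.scale/= mulrA mulVf ?mul1r// lt0r_neq0.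
Unshelve. all: by end_near. Qed.

Lemma measurable_powR_expR (p r : R) : measurable_fun setT (fun t : R => t `^ p * expR (- (r * t))).
Proof.
apply: measurable_funM; first exact: measurable_powR.
by apply: measurableT_comp => //; apply: measurableT_comp => //; exact: measurable_funM.
Qed.

Lemma integral_expR_tail (a t : R) : 0 < a ->
  (\int[leb]_(u in `[t, +oo[) (expR (- (a * u)))%:E = (expR (- (a * t)) / a)%:E)%E.
Proof.
move=> a0; rewrite (@ge0_continuous_FTC2y R _ (fun x => - (expR (- (a * x)) / a)) _ 0).
- by rewrite sub0e -EFinN opprK.
- by move=> x _; exact: expR_ge0.
- apply: continuous_subspaceT => x; apply: continuous_comp; last exact: continuous_expR.
  by apply: cvgN; apply: cvgM; [exact: cvg_cst|exact: cvg_id].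
- rewrite -oppr0 -(mul0r a^-1); apply: cvgN; apply: cvgMl.
  apply: (cvg_comp (fun x => a * x) (fun x => expR (- x))); last exact: cvgr_expR.
  exact: gt0_cvgMry.
- by move=> x _; apply: ex_derive.
- apply: cvg_at_right_filter; apply: cvgN; apply: cvgMl.
  apply: continuous_comp; last exact: continuous_expR.
  by apply: cvgN; apply: cvgM; [exact: cvg_cst|exact: cvg_id].
- move=> x _; rewrite derive1E derive_val /=.
  rewrite /GRing.scale/=; field; exact: lt0r_neq0.
Qed.

(** The Gamma integral with rate [r], kept in the extended reals: [Gamma] takes the finite part and
    would hide a divergence, so identities are proved here before finiteness is known. *)
Definition egamma (p r : R) : \bar R :=
  (\int[leb]_(t in `]0%R, +oo[) (t `^ (p - 1) * expR (- (r * t)))%:E)%E.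

(** Two orders of integration of [t^(p-1) e^(-u)] over the region [0 < t <= u]: the [u]-integral
    leaves [e^(-t)], the [t]-integral leaves [u^p / p]. *)
Lemma egammaS (p : R) : 0 < p -> (egamma (p + 1) 1 = p%:E * egamma p 1)%E.
Proof.
move=> p0; pose f (z : R * R) := ((z.1 `^ (p - 1) * expR (- z.2)) * (\1_[set z : R * R | (0 < z.1) && (z.1 <= z.2)] z))%:E.
have mA : measurable [set z : R * R | (0 < z.1) && (z.1 <= z.2)].
  have -> : [set z : R * R | (0 < z.1) && (z.1 <= z.2)] =
    (setT `&` [set z : R * R | z.1 <= z.2]) `&` (setT `&` (fst @^-1` `]0, +oo[)).
    by apply/seteqP; split => z/=; rewrite in_itv/= andbT; [move=> /andP[]|move=> [[_ ->] [_ ->]]].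
  apply: measurableI; first exact: measurable_fun_le.
  exact: measurable_fst.
have mf : measurable_fun setT f.
  apply/measurable_EFinP; apply: measurable_funM; last exact: measurable_indic.
  apply: measurable_funM; first exact: (measurableT_comp (measurable_powR _)).
  by apply: measurableT_comp => //; apply: measurableT_comp.
have f0 z : (0 <= f z)%E.
  by rewrite lee_fin mulr_ge0// mulr_ge0 ?powR_ge0 ?expR_ge0.
have := @fubini_tonelli _ _ _ _ R leb leb f mf f0.
have -> : (\int[leb]_x \int[leb]_y f (x, y) = egamma p 1)%E.
  rewrite /egamma [RHS]integral_mkcond; apply: eq_integral => x _.
  rewrite patchE; case: ifPn => [|xn].
    rewrite inE/= in_itv/= andbT => x0.
    transitivity (\int[leb]_(y in `[x, +oo[) ((x `^ (p - 1))%:E * (expR (- (1 * y)))%:E))%E.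
      rewrite [RHS]integral_mkcond; apply: eq_integral => y _; rewrite patchE /f/= indicE.
      rewrite (in_setb (fun z : R * R => 0 < z.1 <= z.2))/= x0/=; case: ifPn => h.
        by move: h; rewrite inE/= in_itv/= andbT => ->; rewrite mulr1 -EFinM mul1r.
      by move: h; rewrite notin_setE/= in_itv/= andbT => /negP/negbTE ->; rewrite mulr0.
    rewrite ge0_integralZl_EFin ?powR_ge0//.
    - by rewrite integral_expR_tail// divr1 -EFinM mul1r.
    - by apply/measurable_EFinP; do 2! (apply: measurableT_comp => //); apply: measurable_funTS; exact: measurable_funM.
  rewrite integral0_eq// => y _; rewrite /f/= indicE (in_setb (fun z : R * R => 0 < z.1 <= z.2))/=.
  by move: xn; rewrite notin_setE/= in_itv/= andbT => /negP/negbTE ->; rewrite mulr0.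
move=> ->.
have -> : (\int[leb]_y \int[leb]_x f (x, y) = (p^-1)%:E * egamma (p + 1) 1)%E.
  rewrite /egamma -ge0_integralZl_fin//; first last.
  - by rewrite invr_ge0 ltW.
  - by move=> x _; rewrite mulr_ge0 ?powR_ge0 ?expR_ge0.
  - by apply: measurable_funTS; exact: measurable_powR_expR.
  rewrite [RHS]integral_mkcond; apply: eq_integral => y _.
  rewrite patchE; case: ifPn => [|yn].
    rewrite inE/= in_itv/= andbT => y0.
    transitivity (\int[leb]_(x in `]0%R, y]) ((expR (- (1 * y)))%:E * (x `^ (p - 1))%:E))%E.
      rewrite [RHS]integral_mkcond; apply: eq_integral => x _; rewrite patchE /f/= indicE (in_setb (fun z : R * R => 0 < z.1 <= z.2))/=.
      case: ifPn => h.
        by move: h; rewrite inE/= in_itv/= => ->; rewrite mulr1 -EFinM mul1r mulrC.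
      by move: h; rewrite notin_setE/= in_itv/= => /negP/negbTE ->; rewrite mulr0.
    rewrite ge0_integralZl_EFin ?expR_ge0//.
    - by rewrite integral_powR_itv0 ?ltW// -!EFinM addrK; congr EFin; ring.
    - by move=> x _; rewrite lee_fin powR_ge0.
    - by apply/measurable_EFinP; apply: measurable_funTS; exact: measurable_powR.
  rewrite integral0_eq// => x _; rewrite /f/= indicE (in_setb (fun z : R * R => 0 < z.1 <= z.2))/=.
  case: (ltP 0 x) => x0; last by rewrite mulr0.
  case: leP => xy; last by rewrite mulr0.
  by move: yn; rewrite notin_setE/= in_itv/= andbT (lt_le_trans x0 xy).
by rewrite muleA -EFinM divff ?mul1e// lt0r_neq0.
Qed.

Lemma egamma_scale (p r : R) : 0 < r -> (egamma p r = (r `^ (- p))%:E * egamma p 1)%E.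
Proof.
move=> r0; rewrite /egamma [in LHS]integral_mkcond [in RHS]integral_mkcond.
set g := (X in (\int[_]_x X x = _)%E); set h := (X in (_ = _ * \int[_]_x X x)%E).
have mh : measurable_fun setT h.
  apply/(measurable_restrictT _ _).1 => //; apply: measurable_funTS; apply/measurable_EFinP; exact: measurable_powR_expR.
have h0 x : (0 <= h x)%E.
  by rewrite /h patchE; case: ifP => // _; rewrite lee_fin mulr_ge0 ?powR_ge0 ?expR_ge0.
have gh x : g x = ((r `^ (1 - p))%:E * h (r * x + 0)%R)%E.
  rewrite /g /h !patchE addr0 !mem_setE /= !in_itv/= !andbT pmulr_rgt0//.
  case: ifPn => x0; last by rewrite mule0.
  rewrite -EFinM mul1r powRM ?ltW// !mulrA -powRD; last by rewrite lt0r_neq0// implybT.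
  by rewrite [1 - p + _](_ : _ = 0) ?powRr0 ?mul1r//; ring.
rewrite (_ : g = (fun x => (r `^ (1 - p))%:E * h (r * x + 0)%R))%E; last by apply/funext => x; exact: gh.
have mh' : measurable_fun setT (fun x : measurableTypeR R => h (r * x + 0)%R).
  by apply: measurableT_comp => //; apply: measurable_funD => //; exact: measurable_funM.
rewrite (ge0_integralZl_EFin _ measurableT (fun x _ => h0 _) mh' (powR_ge0 _ _)).
rewrite ge0_integral_affine// muleA -EFinM; congr ((_)%:E * _)%E.
by rewrite -powR_inv1 ?ltW// -powRD ?lt0r_neq0 ?implybT//; congr (_ `^ _); ring.
Qed.

Lemma egamma1_fin (p : R) : 1 <= p -> (egamma p 1 < +oo)%E.
Proof.
move=> p1.
have [C C0 HC] : exists2 C : R, 0 <= C & forall t : R, 0 < t -> t `^ (p - 1) <= C * expR (t / 2).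
  (* From [u <= e^u] at [u = t / (2 (p - 1))], raised to the power [p - 1]; half of the exponential
     is left for the integration. *)
  exists ((2 * (p - 1)) `^ (p - 1)); first exact: powR_ge0.
  move=> t t0; have [->|pn1] := eqVneq p 1.
    rewrite subrr !powRr0 mul1r -expR0 ler_expR divr_ge0// ltW//.
  have q0 : 0 < p - 1 by rewrite subr_gt0 lt_neqAle eq_sym pn1.
  have -> : expR (t / 2) = (expR (t / (2 * (p - 1)))) `^ (p - 1).
    rewrite -expRM; congr expR; field; exact: lt0r_neq0.
  rewrite -powRM ?expR_ge0//; last by rewrite mulr_ge0// ltW.
  rewrite ge0_ler_powR ?nnegrE ?(ltW q0) ?(ltW t0)//; first by rewrite !mulr_ge0 ?expR_ge0// ltW.
  rewrite mulrC -ler_pdivrMr; last by rewrite mulr_gt0.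
  apply: le_trans (expR_ge1Dx _); rewrite lerDr//.
apply: (@le_lt_trans _ _ (\int[leb]_(t in `[0%R, +oo[) (C%:E * (expR (- (2^-1 * t)))%:E))%E).
  rewrite /egamma -integral_itv_obnd_cbnd; last first.
    apply: measurable_funeM; apply/measurable_EFinP; do 2! (apply: measurableT_comp => //); apply: measurable_funTS; exact: measurable_funM.
  apply: ge0_le_integral => //.
  - by move=> x _; rewrite lee_fin mulr_ge0 ?powR_ge0 ?expR_ge0.
  - by apply/measurable_EFinP; apply: measurable_funTS; exact: measurable_powR_expR.
  - apply: measurable_funeM; apply/measurable_EFinP; do 2! (apply: measurableT_comp => //); apply: measurable_funTS; exact: measurable_funM.
  - move=> x /=; rewrite in_itv/= andbT => x0; rewrite -EFinM lee_fin.
    rewrite (_ : C * _ = C * expR (x / 2) * expR (- (1 * x))); last first.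
      by rewrite -mulrA -expRD; congr (_ * expR _); field.
    by rewrite ler_wpM2r ?expR_ge0// HC.
rewrite ge0_integralZl_EFin//.
- by rewrite integral_expR_tail// -EFinM ltry.
- apply/measurable_EFinP; do 2! (apply: measurableT_comp => //); apply: measurable_funTS; exact: measurable_funM.
Qed.

(** Finiteness for [p < 1] is pulled back from [p + 1] by the functional equation: an infinite value
    at [p] would make the value at [p + 1] infinite. *)
Lemma egammaE (p r : R) : 0 < p -> 0 < r -> egamma p r = (Gamma p * r `^ (- p))%:E.
Proof.
move=> p0 r0; rewrite egamma_scale// mulrC EFinM; congr (_ * _)%E.
have fin : (egamma p 1 < +oo)%E.
  have : (egamma (p + 1) 1 < +oo)%E by rewrite egamma1_fin// lerDr ltW.
  rewrite egammaS// => h; rewrite ltey; apply/eqP => e.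
  by move: h; rewrite e gt0_muley ?lte_fin// ltxx.
rewrite /Gamma /Rintegral -[LHS]fineK; last first.
  rewrite ge0_fin_numE// integral_ge0// => x _.
  by rewrite lee_fin mulr_ge0 ?powR_ge0 ?expR_ge0.
by rewrite /egamma; congr (fine _)%:E; apply: eq_integral => x _; rewrite mul1r.
Qed.

Lemma GammaS (p : R) : 0 < p -> Gamma (p + 1) = p * Gamma p.
Proof.
move=> p0; have := egammaS p0; rewrite !egammaE ?addr_gt0// !powR1 !mulr1 -EFinM.
by case.
Qed.

Lemma min1_powR_le (q x : R) : 1 <= x -> x <= 2 -> Num.min 1 (2 `^ q) <= x `^ q.
Proof.
move=> x1 x2; rewrite ge_min; case: (leP 0 q) => h; apply/orP; [left|right].
  by apply: le_trans (ler_powR x1 h); rewrite powRr0.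
rewrite -[q]opprK !(powRN _ (- q)) lef_pV2 ?posrE ?powR_gt0 ?(lt_le_trans _ x1)//.
by rewrite ge0_ler_powR ?nnegrE//; lra.
Qed.

(** Restricting the integral to [[1, 2]], where the integrand is at least a positive constant, rules
    out the value 0. *)
Lemma Gamma_gt0 (p : R) : 0 < p -> 0 < Gamma p.
Proof.
move=> p0; have := egammaE p0 (@ltr01 R); rewrite powR1 mulr1 => E.
rewrite lt_neqAle Rintegral_ge0 ?andbT => [|x _]; last by rewrite mulr_ge0 ?powR_ge0 ?expR_ge0.
apply/eqP => G0; move: E; rewrite -G0; apply/eqP; rewrite gt_eqF//.
have c0 : 0 < Num.min 1 (2 `^ (p - 1)) * expR (- 2) :> R.
  by rewrite mulr_gt0 ?expR_gt0// lt_min ltr01 powR_gt0.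
apply: (@lt_le_trans _ _ (\int[leb]_(t in `[1%R, 2%R]) (cst (Num.min 1 (2 `^ (p - 1)) * expR (- 2))%:E t))%E).
  rewrite integral_cst//= lebesgue_measure_itv/= lte_fin ltr1n -EFinB -EFinM lte_fin mulr_gt0//.
apply: (@le_trans _ _ (\int[leb]_(t in `[1%R, 2%R]) (t `^ (p - 1) * expR (- (1 * t)))%:E)%E).
  apply: ge0_le_integral => //.
  - by move=> x _; rewrite lee_fin ltW.
  - by apply/measurable_EFinP; apply: measurable_funTS; exact: measurable_powR_expR.
  - move=> x /=; rewrite in_itv/= => /andP[x1 x2]; rewrite lee_fin ler_pM ?expR_ge0 ?le_min ?ler01 ?powR_ge0//.
    + exact: min1_powR_le.
    + by rewrite ler_expR mul1r lerN2.
apply: ge0_subset_integral => //.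
- by apply/measurable_EFinP; apply: measurable_funTS; exact: measurable_powR_expR.
- by move=> x _; rewrite lee_fin mulr_ge0 ?powR_ge0 ?expR_ge0.
- move=> x /=; rewrite !in_itv/= => /andP[x1 x2]; lra.
Qed.

Lemma integral_gamma (p r : R) : 0 < p -> 0 < r ->
  (\int[leb]_(t in `]0%R, +oo[) (t `^ (p - 1) * expR (- (r * t)))%:E = (Gamma p * r `^ (- p))%:E)%E.
Proof. exact: egammaE. Qed.

End affine_substitution.

(** * Borel sets and Lebesgue measure on row vectors *)

Section borel_rV.
Variable R : realType.

Lemma open_borelRm m (U : set 'rV[R]_m) : open U -> measurable (U : set (borelRm R m)).
Proof. by move=> oU; apply: sub_sigma_algebra. Qed.

Lemma closed_borelRm m (U : set 'rV[R]_m) : closed U -> measurable (U : set (borelRm R m)).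
Proof.
by move=> cU; rewrite -[U]setCK; apply: measurableC; apply: open_borelRm; exact: closed_openC.
Qed.

Lemma continuous_borelRm m (f : 'rV[R]_m -> R) : continuous f ->
  measurable_fun setT (f : borelRm R m -> R).
Proof.
move=> cf; apply: (measurability (@RGenOpens.G R)); first exact: RGenOpens.measurableE.
move=> _ [_ [a [b ->] <-]]; rewrite setTI; apply: open_borelRm.
by apply: open_comp; [move=> x _; exact: cf|exact: interval_open].
Qed.

Lemma measurable_coord_rV m (i : 'I_m) :
  measurable_fun setT (fun x : borelRm R m => (x : 'rV[R]_m) ord0 i).
Proof. by apply: continuous_borelRm; exact: coord_continuous. Qed.

(** Rational cubes form a countable base; an open set is the union of those it contains. This
    reduces Borel measurability of a vector-valued map to its coordinates. *)
Lemma open_rV_boxes m (U : set 'rV[R]_m) : open U ->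
  exists P : 'rV[rat]_m -> nat -> Prop, U = \bigcup_(c : 'rV[rat]_m) \bigcup_(k in P c)
    [set x : 'rV[R]_m | forall i, `|x ord0 i - ratr (c ord0 i)| < k.+1%:R^-1].
Proof.
move=> oU; pose B (c : 'rV[rat]_m) (k : nat) :=
  [set x : 'rV[R]_m | forall i, `|x ord0 i - ratr (c ord0 i)| < k.+1%:R^-1].
exists (fun c k => B c k `<=` U); apply/seteqP; split => [x Ux|x [c _ [k]]]; last exact.
have /nbhs_ballP[e /= e0 Ue] : nbhs x U by exact: open_nbhs_nbhs.
have [k hk] := ltr_add_invr (divr_gt0 e0 (@ltr0n R 2)).
rewrite add0r in hk.
have /choice[c Hc] (i : 'I_m) : exists q : rat, `|x ord0 i - ratr q| < k.+1%:R^-1.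
  have [|q] := @rat_in_itvoo R (x ord0 i - k.+1%:R^-1) (x ord0 i + k.+1%:R^-1).
    by rewrite ltrD2l gtrN// invr_gt0.
  by rewrite in_itv/= -ltr_distlC => h; exists q.
exists (\row_i c i) => //; exists k; last by move=> i; rewrite mxE; exact: Hc.
move=> y By; apply: Ue; split => // i j; rewrite (ord1 i) /ball/=.
have := By j; have := Hc j; rewrite !mxE => h1 h2.
rewrite (le_lt_trans (ler_distD (ratr (c j)) _ _))//.
rewrite [ltRHS]splitr ltrD// ?(lt_trans h1)// distrC (lt_trans h2)//.
Qed.

Lemma measurable_fun_rV d (T : measurableType d) m (f : T -> borelRm R m) :
  (forall i, measurable_fun setT (fun t => (f t : 'rV[R]_m) ord0 i)) ->
  measurable_fun setT f.
Proof.
move=> mf; apply: (@measurability _ _ _ (borelRm R m) setT f (@open 'rV[R]_m)) => //.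
move=> _ [U oU <-]; rewrite setTI.
have [P ->] := open_rV_boxes oU.
rewrite preimage_bigcup; apply: countable_bigcupT_measurable => [|c]; first exact: countableP.
rewrite preimage_bigcup; apply: bigcup_measurable => k _.
rewrite (_ : _ @^-1` _ = \bigcap_(i in [set: 'I_m])
  ((fun t => (f t : 'rV[R]_m) ord0 i) @^-1` (ball (ratr (c ord0 i) : R) k.+1%:R^-1))).
  apply: fin_bigcap_measurable => // i _.
  by rewrite -[X in measurable X]setTI; apply: mf => //; exact: measurable_ball.
apply/seteqP; split => t /=.
  by move=> h i _; rewrite /ball/= distrC.
by move=> h i; have := h i I; rewrite /ball/= distrC.
Qed.

(** The identification of R x R^m with R^(m+1) that splits off coordinate [i]; inductions on the
    dimension and fibres of sets go through it. *)
Definition ins m (i : 'I_m.+1) (u : R) (x : 'rV[R]_m) : 'rV[R]_m.+1 :=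
  \row_j (if unlift i j is Some k then x ord0 k else u).

Lemma ins_same m (i : 'I_m.+1) u x : ins i u x ord0 i = u.
Proof. by rewrite mxE unlift_none. Qed.

Lemma ins_lift m (i : 'I_m.+1) u x k : ins i u x ord0 (lift i k) = x ord0 k.
Proof. by rewrite mxE liftK. Qed.

Lemma ins_swap m (j : 'I_m.+1) a u (y : 'rV[R]_m) :
  ins (lift ord0 j) u (ins ord0 a y) = ins ord0 a (ins j u y).
Proof.
apply/rowP => k; case: (unliftP ord0 k) => [k' ->|->].
  rewrite ins_lift; case: (unliftP j k') => [k2 ->|->]; last by rewrite !ins_same.
  rewrite ins_lift (_ : lift ord0 (lift j k2) = lift (lift ord0 j) (lift ord0 k2)).
    by rewrite !ins_lift.
  by apply: val_inj => /=; rewrite /bump /= !add1n ltnS; case: (j <= k2)%N.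
rewrite ins_same; have -> : ord0 = lift (lift ord0 j) (ord0 : 'I_m.+1).
  by apply: val_inj.
by rewrite ins_lift ins_same.
Qed.

Lemma ins_row m (x : 'rV[R]_m.+1) (i : 'I_m.+1) : ins i (x ord0 i) (\row_k x ord0 (lift i k)) = x.
Proof.
by apply/rowP => j; case: (unliftP i j) => [k ->|->]; rewrite ?ins_same ?ins_lift ?mxE.
Qed.

Lemma measurable_ins d (T : measurableType d) m (i : 'I_m.+1) (f : T -> R) (g : T -> borelRm R m) :
  measurable_fun setT f -> measurable_fun setT g ->
  measurable_fun setT (fun t => ins i (f t) (g t) : borelRm R m.+1).
Proof.
move=> mf mg; apply: measurable_fun_rV => j; case: (unliftP i j) => [k ->|->].
  rewrite (_ : (fun t => _) = (fun t => (g t : 'rV[R]_m) ord0 k)).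
    exact: (measurableT_comp (measurable_coord_rV k) mg).
  by apply/funext => t; rewrite ins_lift.
by rewrite (_ : (fun t => _) = f)//; apply/funext => t; rewrite ins_same.
Qed.

Lemma measurable_insE d (T : measurableType d) m (i : 'I_m.+1) (F : borelRm R m.+1 -> \bar R) (f : T -> R) (g : T -> borelRm R m) :
  measurable_fun setT F -> measurable_fun setT f -> measurable_fun setT g ->
  measurable_fun setT (fun t => F (ins i (f t) (g t))).
Proof. by move=> mF mf mg; apply: (measurableT_comp mF); exact: measurable_ins. Qed.

Definition insf m (z : measurableTypeR R * borelRm R m) : borelRm R m.+1 := ins ord0 z.1 z.2.

Lemma measurable_insf m : measurable_fun setT (@insf m).
Proof. by apply: measurable_ins. Qed.

Definition lebS_fun m (mu : {sigma_finite_measure set (borelRm R m) -> \bar R}) :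
    set (borelRm R m.+1) -> \bar R :=
  pushforward (@lebesgue_measure R \x mu)%E (@insf m).

HB.instance Definition _ m (mu : {sigma_finite_measure set (borelRm R m) -> \bar R}) :=
  Measure.copy (lebS_fun mu) (measure_function_pushforward__canonical__measure_function_Measure
    (@lebesgue_measure R \x mu)%E (@measurable_insf m)).

Lemma sigma_finite_lebS m (mu : {sigma_finite_measure set (borelRm R m) -> \bar R}) :
  sigma_finite setT (lebS_fun mu).
Proof.
pose l : {sigma_finite_measure set (measurableTypeR R) -> \bar R} := @lebesgue_measure R.
have /sigma_finiteP[F [FT ndF Ff]] := sigma_finiteT l.
have /sigma_finiteP[G [GT ndG Gf]] := sigma_finiteT mu.
pose g (x : borelRm R m.+1) : measurableTypeR R * borelRm R m :=
  ((x : 'rV[R]_m.+1) ord0 ord0, \row_k (x : 'rV[R]_m.+1) ord0 (lift ord0 k)).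
have mg : measurable_fun setT g.
  apply/measurable_fun_pairP; split; first exact: measurable_coord_rV.
  apply: measurable_fun_rV => i; rewrite (_ : (fun t => _) = (fun x : borelRm R m.+1 => (x : 'rV[R]_m.+1) ord0 (lift ord0 i))).
    exact: measurable_coord_rV.
  by apply/funext => t; rewrite /= mxE.
have gK z : g (insf z) = z.
  case: z => u x; rewrite /g /insf ins_same; congr pair.
  by apply/rowP => k; rewrite mxE ins_lift.
exists (fun k => g @^-1` (F k `*` G k)).
  apply/esym/seteqP; split => // x _.
  have [i _ Fi] : (\bigcup_i F i) (g x).1 by rewrite -FT.
  have [j _ Gj] : (\bigcup_i G i) (g x).2 by rewrite -GT.
  exists (maxn i j) => //; split.
    by have /subsetPset := ndF _ _ (leq_maxl i j); exact.
  by have /subsetPset := ndG _ _ (leq_maxr i j); exact.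
move=> k; have [mF fF] := Ff k; have [mG fG] := Gf k; split.
  by rewrite -[X in measurable X]setTI; apply: mg => //; exact: measurableX.
rewrite /lebS_fun /pushforward -comp_preimage (_ : _ @^-1` _ = F k `*` G k); last first.
  by rewrite (_ : g \o _ = id) ?preimage_id//; apply/funext => z; exact: gK.
by rewrite product_measure1E// lte_mul_pinfty// ge0_fin_numE.
Qed.

HB.instance Definition _ m (mu : {sigma_finite_measure set (borelRm R m) -> \bar R}) :=
  @Measure_isSigmaFinite.Build _ _ _ (lebS_fun mu) (sigma_finite_lebS mu).

(** The unit mass in dimension 0 starts the recursion. Sigma-finiteness is kept in the type because
    Tonelli needs it at every step. *)
Fixpoint leb_rV (m : nat) : {sigma_finite_measure set (borelRm R m) -> \bar R} :=
  match m return {sigma_finite_measure set (borelRm R m) -> \bar R} with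
  | 0 => dirac ((0 : 'rV[R]_0) : borelRm R 0)
  | k.+1 => lebS_fun (leb_rV k)
  end.

Lemma integral_leb_rV0 (f : borelRm R 0 -> \bar R) : (forall x, 0 <= f x)%E ->
  measurable_fun setT f -> (\int[leb_rV 0]_x f x = f (GRing.zero : 'rV[R]_0))%E.
Proof. by move=> f0 mf; rewrite integral_dirac// diracT mul1e. Qed.

Lemma integral_leb_rVS m (f : borelRm R m.+1 -> \bar R) : (forall x, 0 <= f x)%E ->
  measurable_fun setT f ->
  (\int[leb_rV m.+1]_x f x = \int[@lebesgue_measure R]_u \int[leb_rV m]_x f (ins ord0 u x))%E.
Proof.
move=> f0 mf; rewrite [LHS](@ge0_integral_pushforward _ _ _ _ R (@insf m) (measurable_insf (m := m)) (@lebesgue_measure R \x leb_rV m)%E)//.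
rewrite preimage_setT [LHS]fubini_tonelli1//.
  exact: (measurableT_comp mf (@measurable_insf m)).
by move=> x; exact: f0.
Qed.

Opaque leb_rV.

Lemma measurable_integral_ins d (T : measurableType d) m (i : 'I_m.+1) (f : borelRm R m.+1 -> \bar R) (g : T -> R) :
  (forall x, 0 <= f x)%E -> measurable_fun setT f -> measurable_fun setT g ->
  measurable_fun setT (fun t => \int[leb_rV m]_x f (ins i (g t) x))%E.
Proof.
move=> f0 mf mg.
have h : measurable_fun setT (fun z : T * borelRm R m => f (ins i (g z.1) z.2)).
  by apply: measurable_insE => //; exact: (measurableT_comp mg).
exact: (@measurable_fun_fubini_tonelli_F _ _ _ _ R (leb_rV m) _ h).
Qed.

(** The recursion splits off coordinate 0 only. Tonelli for two split coordinates, together with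
    [ins_swap], frees any coordinate, as symmetrization in every direction requires. *)
Lemma integral_leb_rV_ins m (i : 'I_m.+1) (f : borelRm R m.+1 -> \bar R) : (forall x, 0 <= f x)%E ->
  measurable_fun setT f ->
  (\int[leb_rV m.+1]_x f x = \int[@lebesgue_measure R]_u \int[leb_rV m]_x f (ins i u x))%E.
Proof.
elim: m i f => [|m IH] i f f0 mf; first by rewrite (ord1 i); exact: integral_leb_rVS.
case: (unliftP ord0 i) => [j ->|->]; last exact: integral_leb_rVS.
rewrite (@integral_leb_rVS m.+1 f f0 mf).
pose F (z : measurableTypeR R * measurableTypeR R) := (\int[leb_rV m]_y f (ins ord0 z.1 (ins j z.2 y)))%E.
have mF : measurable_fun setT F.
  have h : measurable_fun setT (fun z : (measurableTypeR R * measurableTypeR R) * borelRm R m => f (ins ord0 z.1.1 (ins j z.1.2 z.2))).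
    apply: measurable_insE => //; first exact: (measurableT_comp measurable_fst).
    by apply: measurable_ins => //; exact: (measurableT_comp measurable_snd).
  exact: (@measurable_fun_fubini_tonelli_F _ _ _ _ R (leb_rV m) _ h).
transitivity (\int[@lebesgue_measure R]_a \int[@lebesgue_measure R]_u F (a, u))%E.
  apply: eq_integral => a _; rewrite (IH j (fun x => f (ins ord0 a x)))//.
  exact: measurable_insE.
rewrite (fubini_tonelli F)//; last by move=> z; exact: integral_ge0.
apply: eq_integral => u _; rewrite (@integral_leb_rVS m (fun x => f (ins (lift ord0 j) u x))); last 2 first.
- by move=> x; exact: f0.
- exact: measurable_insE.
by apply: eq_integral => a _; apply: eq_integral => y _; rewrite ins_swap.
Qed.

End borel_rV.


(** * Euclidean norm and its topology *)

Section euclid.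
Variables (R : realType) (m : nat).
Implicit Types (x y z : 'rV[R]_m) (a : R).

Lemma dotpC x y : dotp x y = dotp y x.
Proof. by apply: eq_bigr => i _; rewrite mulrC. Qed.

Lemma dotpDl x y z : dotp (x + y) z = dotp x z + dotp y z.
Proof. by rewrite -big_split; apply: eq_bigr => i _; rewrite mxE mulrDl. Qed.

Lemma dotpDr x y z : dotp z (x + y) = dotp z x + dotp z y.
Proof. by rewrite dotpC dotpDl !(dotpC z). Qed.

Lemma dotpZl a x y : dotp (a *: x) y = a * dotp x y.
Proof. by rewrite /dotp mulr_sumr; apply: eq_bigr => i _; rewrite mxE mulrA. Qed.

Lemma dotpZr a x y : dotp y (a *: x) = a * dotp y x.
Proof. by rewrite dotpC dotpZl dotpC. Qed.

Lemma dotpNl x y : dotp (- x) y = - dotp x y.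
Proof. by rewrite -scaleN1r dotpZl mulN1r. Qed.

Lemma dotpNr x y : dotp y (- x) = - dotp y x.
Proof. by rewrite dotpC dotpNl dotpC. Qed.

Lemma dotpBl x y z : dotp (x - y) z = dotp x z - dotp y z.
Proof. by rewrite dotpDl dotpNl. Qed.

Lemma dotpBr x y z : dotp z (x - y) = dotp z x - dotp z y.
Proof. by rewrite dotpDr dotpNr. Qed.

Lemma dotp0l x : dotp 0 x = 0.
Proof. by rewrite -(scale0r 0) dotpZl mul0r. Qed.

Lemma dotp0r x : dotp x 0 = 0.
Proof. by rewrite dotpC dotp0l. Qed.

Lemma dotp_ge0 x : 0 <= dotp x x.
Proof. by apply: sumr_ge0 => i _; rewrite -expr2 sqr_ge0. Qed.

Lemma enorm_ge0 x : 0 <= enorm x.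
Proof. exact: sqrtr_ge0. Qed.

Lemma enorm_sqr x : enorm x ^+ 2 = dotp x x.
Proof. by rewrite sqr_sqrtr// dotp_ge0. Qed.

Lemma enorm0 : enorm (0 : 'rV[R]_m) = 0.
Proof. by rewrite /enorm dotp0l sqrtr0. Qed.

Lemma enormZ a x : enorm (a *: x) = `|a| * enorm x.
Proof.
by rewrite /enorm dotpZl dotpZr mulrA -expr2 sqrtrM ?sqr_ge0// sqrtr_sqr.
Qed.

Lemma enormN x : enorm (- x) = enorm x.
Proof. by rewrite -scaleN1r enormZ normrN normr1 mul1r. Qed.

Lemma enormC x y : enorm (x - y) = enorm (y - x).
Proof. by rewrite -enormN opprB. Qed.

Lemma coord_le_enorm x (i : 'I_m) : `|x ord0 i| <= enorm x.
Proof.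
rewrite -sqrtr_sqr ler_wsqrtr// /dotp (bigD1 i)//= -expr2 lerDl.
by apply: sumr_ge0 => j _; rewrite -expr2 sqr_ge0.
Qed.

Lemma enorm_eq0 x : enorm x = 0 -> x = 0.
Proof.
move=> h; apply/rowP => i; rewrite mxE; apply/eqP; rewrite -normr_le0 -h.
exact: coord_le_enorm.
Qed.

Lemma enorm_gt0 x : (0 < enorm x) = (x != 0).
Proof.
rewrite lt_neqAle enorm_ge0 andbT eq_sym; congr negb; apply/eqP/eqP; first exact: enorm_eq0.
by move=> ->; rewrite enorm0.
Qed.

Lemma cauchy_schwarz x y : `|dotp x y| <= enorm x * enorm y.
Proof.
have [->|y0] := eqVneq y 0; first by rewrite dotp0r enorm0 mulr0 normr0.
have yy : 0 < dotp y y by rewrite -enorm_sqr exprn_gt0// enorm_gt0.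
have := dotp_ge0 (dotp y y *: x - dotp x y *: y).
rewrite dotpBl !dotpBr !dotpZl !dotpZr (dotpC y x) => h.
have {}h : dotp x y ^+ 2 <= dotp x x * dotp y y.
  by rewrite -subr_ge0 -(pmulr_rge0 _ yy); apply: le_trans h _; rewrite le_eqVlt; apply/orP; left; apply/eqP; ring.
by rewrite -ler_sqr ?nnegrE ?mulr_ge0 ?enorm_ge0// real_normK ?num_real// exprMn !enorm_sqr.
Qed.

Lemma ler_enormD x y : enorm (x + y) <= enorm x + enorm y.
Proof.
rewrite -ler_sqr ?nnegrE ?addr_ge0 ?enorm_ge0// sqrrD !enorm_sqr dotpDl !dotpDr (dotpC y x).
have := cauchy_schwarz x y; have := ler_norm (dotp x y); lra.
Qed.

Lemma ler_enormB x y : enorm (x - y) <= enorm x + enorm y.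
Proof. by rewrite -(enormN y); exact: ler_enormD. Qed.

Lemma enorm_triangle z x y : enorm (x - y) <= enorm (x - z) + enorm (z - y).
Proof. by rewrite (_ : x - y = (x - z) + (z - y)) ?ler_enormD//; rewrite addrA subrK. Qed.

Lemma enorm_le_mx_norm x : enorm x <= m%:R * `|x|.
Proof.
rewrite -ler_sqr ?nnegrE ?mulr_ge0 ?enorm_ge0// enorm_sqr exprMn.
have h (i : 'I_m) : `|x ord0 i| <= `|x|.
  have -> : `|x| = \big[Num.max/0]_ij `|x ij.1 ij.2| by exact: mx_normrE.
  exact: (@le_bigmax _ _ _ 0 (fun ij => `|x ij.1 ij.2|) (ord0, i)).
apply: (@le_trans _ _ (\sum_(i < m) `|x| ^+ 2)).
  apply: ler_sum => i _; rewrite -expr2 -(@real_normK _ (x ord0 i)) ?num_real//.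
  by rewrite ler_sqr ?nnegrE.
rewrite sumr_const card_ord -[leLHS]mulr_natl; apply: ler_wpM2r; first exact: sqr_ge0.
rewrite expr2 -natrM ler_nat; by case: (m) => // k; rewrite leq_pmulr.
Qed.

Lemma mx_norm_le_enorm x : `|x| <= enorm x.
Proof.
have -> : `|x| = \big[Num.max/0]_ij `|x ij.1 ij.2| by exact: mx_normrE.
apply/bigmax_leP => /=; split; first exact: enorm_ge0.
by move=> [i j] _ /=; rewrite (ord1 i); exact: coord_le_enorm.
Qed.

Definition eball x (r : R) : set 'rV[R]_m := [set y | enorm (y - x) < r].
Definition ecball x (r : R) : set 'rV[R]_m := [set y | enorm (y - x) <= r].

(** The topology of row vectors comes from the maximum norm; the two-sided comparison of the norms
    makes Euclidean balls a neighbourhood base as well. *)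
Lemma nbhs_eballP x (A : set 'rV[R]_m) :
  nbhs x A <-> exists2 e : R, 0 < e & eball x e `<=` A.
Proof.
split.
  move=> /nbhs_ballP[e /= e0 h]; exists e => // y xy; apply: h.
  by rewrite mx_norm_ball /ball_ /= -normrN opprB (le_lt_trans (mx_norm_le_enorm _)).
(* The denominator [m%:R + 1] is positive also in dimension 0. *)
move=> [e e0 h]; apply/nbhs_ballP; exists (e / (m%:R + 1)) => /=.
  by rewrite divr_gt0// ltr_wpDl.
move=> y; rewrite mx_norm_ball /ball_ /= -normrN opprB => hy; apply: h.
rewrite /eball /= (le_lt_trans (enorm_le_mx_norm _))//.
have m1 : 0 < m%:R + 1 :> R by rewrite ltr_wpDl.
rewrite ltr_pdivlMr// in hy; apply: le_lt_trans hy.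
by rewrite mulrC ler_wpM2l// lerDl.
Qed.

Lemma continuous_at_enorm (f : 'rV[R]_m -> R) x :
  (forall e : R, 0 < e -> exists2 d : R, 0 < d & forall y, enorm (y - x) < d -> `|f y - f x| < e) ->
  {for x, continuous f}.
Proof.
move=> h A /nbhs_ballP[e /= e0 eA]; apply/nbhs_eballP; have [d d0 hd] := h _ e0.
by exists d => // y /hd yx; apply: eA; rewrite /ball/= distrC.
Qed.

Lemma dist_continuous x : continuous (fun y => enorm (y - x)).
Proof.
move=> y; apply: continuous_at_enorm => e e0; exists e => // z zy.
have h1 := enorm_triangle y z x; have h2 := enorm_triangle z y x; rewrite (enormC y z) in h2.
by rewrite (le_lt_trans _ zy)// ler_norml; apply/andP; split; lra.
Qed.

Lemma enorm_continuous : continuous (@enorm R m).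
Proof. by move=> x; have := @dist_continuous 0 x; under eq_fun do rewrite subr0. Qed.

Lemma dotp_continuous y : continuous (fun x => dotp x y).
Proof.
move=> x; apply: continuous_at_enorm => e e0.
have y1 : 0 < enorm y + 1 by rewrite ltr_wpDl// enorm_ge0.
exists (e / (enorm y + 1)); first by rewrite divr_gt0.
move=> z; rewrite ltr_pdivlMr// => h.
rewrite -dotpBl (le_lt_trans (cauchy_schwarz _ _))// (le_lt_trans _ h)//.
by rewrite ler_wpM2l ?enorm_ge0// lerDl.
Qed.

Lemma open_eball x r : open (eball x r).
Proof.
rewrite (_ : eball x r = (fun y => enorm (y - x)) @^-1` [set u | u < r])//.
by apply: open_comp => [y _|]; [exact: dist_continuous|exact: open_lt].
Qed.

Lemma closed_ecball x r : closed (ecball x r).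
Proof.
rewrite (_ : ecball x r = (fun y => enorm (y - x)) @^-1` [set u | u <= r])//.
by apply: closed_comp => [y _|]; [exact: dist_continuous|exact: closed_le].
Qed.

Lemma compact_ecball x r (A : set 'rV[R]_m) : closed A -> A `<=` ecball x r -> compact A.
Proof.
move=> cA Ax; apply: bounded_closed_compact => //.
exists (enorm x + r); split; first exact: num_real.
move=> M hM y Ay /=; apply: le_trans (mx_norm_le_enorm _) _; apply: le_trans (ltW hM).
have := ler_enormD (y - x) x; rewrite subrK; have := Ax _ Ay; rewrite /ecball/=; lra.
Qed.

Lemma closureP_enorm (A : set 'rV[R]_m) x : closure A x <->
  forall e : R, 0 < e -> exists2 y, A y & enorm (y - x) < e.
Proof.
split.
  move=> cA e e0; have [y [Ay xy]] : A `&` eball x e !=set0.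
    by apply: cA; apply/nbhs_eballP; exists e.
  by exists y.
move=> h B /nbhs_eballP[e e0 eB]; have [y Ay xy] := h _ e0.
by exists y; split => //; exact: eB.
Qed.

Lemma open_enormP (A : set 'rV[R]_m) x : open A -> A x -> exists2 e : R, 0 < e & eball x e `<=` A.
Proof. by move=> oA Ax; apply/nbhs_eballP; exact: open_nbhs_nbhs. Qed.

Lemma rr2E x y : rr2 x y = enorm (x - y) ^+ 2.
Proof. by rewrite enorm_sqr; apply: eq_bigr => i _; rewrite !mxE expr2. Qed.

End euclid.

Lemma dotp_ins (R : realType) m (i : 'I_m.+1) (u v : R) (x y : 'rV[R]_m) :
  dotp (ins i u x) (ins i v y) = u * v + dotp x y.
Proof.
rewrite /dotp (bigD1_ord i)//= !ins_same; congr (_ + _).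
by apply: eq_bigr => k _; rewrite !ins_lift.
Qed.

Lemma ins_linear (R : realType) m (i : 'I_m.+1) (a u v : R) (x y : 'rV[R]_m) :
  ins i (a * u + v) (a *: x + y) = a *: ins i u x + ins i v y.
Proof.
by apply/rowP => j; case: (unliftP i j) => [k ->|->]; rewrite ?ins_lift ?ins_same !mxE ?liftK ?unlift_none.
Qed.

Lemma insB (R : realType) m (i : 'I_m.+1) (u v : R) (x y : 'rV[R]_m) :
  ins i u x - ins i v y = ins i (u - v) (x - y).
Proof.
have := ins_linear i (-1) v u y x; rewrite mulN1r [- v + u]addrC scaleN1r [- y + x]addrC.
by move=> ->; rewrite scaleN1r addrC.
Qed.

Lemma enorm_ins_sqr (R : realType) m (i : 'I_m.+1) (u : R) (x : 'rV[R]_m) :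
  enorm (ins i u x) ^+ 2 = u ^+ 2 + enorm x ^+ 2.
Proof. by rewrite !enorm_sqr dotp_ins expr2. Qed.

(** * Volumes of Euclidean balls *)

Section leb_rV_balls.
Variable R : realType.
Local Notation leb := (@lebesgue_measure R).

(** Since [e^(-g)] is the integral of [e^(-u)] over [u >= g], Tonelli expresses the integral through
    the masses of the sublevel sets of [g]. *)
Lemma exp_layer_cake d (T : measurableType d) (mu : {sigma_finite_measure set T -> \bar R})
    (D : set T) (g : T -> R) : measurable D -> measurable_fun setT g -> (forall x, 0 <= g x) ->
  (\int[mu]_(x in D) (expR (- g x))%:E =
   \int[leb]_(u in `]0%R, +oo[) ((expR (- u))%:E * mu (D `&` [set x | (g x <= u)%R])))%E.
Proof.
move=> mD mg g0.
pose A : set (T * measurableTypeR R) := [set z | D z.1] `&` [set z | g z.1 <= z.2].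
have mA : measurable A.
  apply: measurableI.
    rewrite (_ : [set z | D z.1] = D `*` setT); first exact: measurableX.
    by apply/seteqP; split => z //= -[].
  rewrite -[X in measurable X]setTI; apply: measurable_fun_le => //.
  exact: (measurableT_comp mg).
pose f (z : T * measurableTypeR R) := ((expR (- z.2)) * \1_A z)%:E.
have mf : measurable_fun setT f.
  apply/measurable_EFinP; apply: measurable_funM; last exact: measurable_indic.
  by apply: measurableT_comp => //; apply: measurableT_comp.
have f0 z : (0 <= f z)%E by rewrite lee_fin mulr_ge0 ?expR_ge0.
have := @fubini_tonelli _ _ _ _ R mu leb f mf f0.
have -> : (\int[mu]_x \int[leb]_y f (x, y) = \int[mu]_(x in D) (expR (- g x))%:E)%E.
  rewrite [RHS]integral_mkcond; apply: eq_integral => x _; rewrite patchE; case: ifPn => [xD|xD].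
    transitivity (\int[leb]_(y in `[g x, +oo[) (expR (- (1 * y)))%:E)%E; last first.
      by rewrite integral_expR_tail// divr1 mul1r.
    rewrite [RHS]integral_mkcond; apply: eq_integral => y _; rewrite patchE /f/= indicE.
    have -> : ((x, y) \in A) = (y \in `[g x, +oo[%classic).
      by apply/idP/idP; rewrite !inE /A /= in_itv/= andbT; [case|split => //; exact: set_mem].
    by case: ifPn => _; rewrite ?mulr1 ?mulr0 ?mul1r.
  rewrite integral0_eq// => y _; rewrite /f/= indicE (_ : _ \in _ = false) ?mulr0//.
  by apply/negbTE; apply/negP; rewrite inE => -[/= Dx _]; move/negP : xD; apply; rewrite inE.
move=> ->; pose G y := (\int[mu]_x f (x, y))%E.
have mG : measurable_fun setT G by exact: measurable_fun_fubini_tonelli_G.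
have GE y : G y = ((expR (- y))%:E * mu (D `&` [set x | (g x <= y)%R]))%E.
  transitivity (\int[mu]_(x in D `&` [set x | (g x <= y)%R]) (cst (expR (- y))%:E x))%E.
    rewrite [RHS]integral_mkcond; apply: eq_integral => x _; rewrite patchE /f/= indicE.
    have -> : ((x, y) \in A) = (x \in D `&` [set x | (g x <= y)%R]) by apply/idP/idP; rewrite !inE.
    by case: ifPn => _; rewrite ?mulr1 ?mulr0.
  rewrite integral_cst//.
  apply: measurableI => //; rewrite -[X in measurable X]setTI; exact: measurable_fun_le.
transitivity (\int[leb]_(y in `[0%R, +oo[) G y)%E.
  rewrite [RHS]integral_mkcond; apply: eq_integral => y _; rewrite patchE -/(G y).
  case: ifPn => //; rewrite notin_setE /= in_itv/= andbT => /negP; rewrite -ltNge => y0.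
  rewrite GE (_ : _ `&` _ = set0) ?measure0 ?mule0//.
  apply/seteqP; split => // x [_ /=] h; by have := g0 x; rewrite leNgt (le_lt_trans h y0).
rewrite -integral_itv_obnd_cbnd; last exact: measurable_funTS.
by apply: eq_integral => y _; exact: GE.
Qed.

Lemma integral_leb_rV_affine m (r : R) (c : 'rV[R]_m) (f : borelRm R m -> \bar R) : 0 < r ->
  (forall x, 0 <= f x)%E -> measurable_fun setT f ->
  (\int[leb_rV R m]_x f ((r *: (x : 'rV[R]_m) + c)%R : 'rV[R]_m) = (r ^- m)%:E * \int[leb_rV R m]_x f x)%E.
Proof.
move=> r0; elim: m c f => [|m IH] c f f0 mf.
  have fE (x : 'rV[R]_0) : f x = f (GRing.zero : 'rV[R]_0) by congr f; apply/rowP => -[].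
  rewrite (eq_integral f); last by move=> x _; rewrite fE [RHS]fE.
  by rewrite expr0 invr1 mul1e.
have mS n (c' : 'rV[R]_n) : measurable_fun setT (fun x : borelRm R n => (r *: (x : 'rV[R]_n) + c') : borelRm R n).
  apply: measurable_fun_rV => i; rewrite (_ : (fun t => _) = fun x : borelRm R n => r * (x : 'rV[R]_n) ord0 i + c' ord0 i).
    by apply: measurable_funD => //; apply: measurable_funM => //; exact: measurable_coord_rV.
  by apply/funext => x; rewrite !mxE.
rewrite integral_leb_rVS//; last by apply: (measurableT_comp mf); exact: mS.
pose c' : 'rV[R]_m := \row_k c ord0 (lift ord0 k).
have cE : c = ins ord0 (c ord0 ord0) c' by rewrite ins_row.
transitivity (\int[leb]_u ((r ^- m)%:E * \int[leb_rV R m]_x f (ins ord0 (r * u + c ord0 ord0)%R x)))%E.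
  apply: eq_integral => u _; rewrite -(IH c' (fun x => f (ins ord0 (r * u + c ord0 ord0)%R x)))//.
    by apply: eq_integral => x _; rewrite ins_linear -cE.
  exact: measurable_insE.
rewrite ge0_integralZl_EFin//; last 3 first.
- by move=> u _; exact: integral_ge0.
- by apply: (measurable_integral_ins ord0) => //; apply: measurable_funD => //; exact: measurable_funM.
- by rewrite invr_ge0 exprn_ge0// ltW.
rewrite (@ge0_integral_affine R r (c ord0 ord0) (fun u => \int[leb_rV R m]_x f (ins ord0 u x))%E)//; last 2 first.
- exact: measurable_integral_ins.
- by move=> u; exact: integral_ge0.
by rewrite -integral_leb_rVS// muleA -EFinM exprS invfM mulrC.
Qed.

Lemma leb_rV_affine m (r : R) (c : 'rV[R]_m) (A : set (borelRm R m)) : 0 < r -> measurable A ->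
  (leb_rV R m [set x | A ((r *: (x : 'rV[R]_m) + c)%R : 'rV[R]_m)] = (r ^- m)%:E * leb_rV R m A)%E.
Proof.
move=> r0 mA.
have E (B : set (borelRm R m)) : measurable B -> (leb_rV R m B = \int[leb_rV R m]_x (\1_B x)%:E)%E.
  by move=> mB; rewrite integral_indic// setIT.
have mA' : measurable ([set x | A ((r *: (x : 'rV[R]_m) + c)%R : 'rV[R]_m)] : set (borelRm R m)).
  have mS : measurable_fun setT (fun x : borelRm R m => (r *: (x : 'rV[R]_m) + c) : borelRm R m).
    apply: measurable_fun_rV => i; rewrite (_ : (fun t => _) = fun x : borelRm R m => r * (x : 'rV[R]_m) ord0 i + c ord0 i).
      by apply: measurable_funD => //; apply: measurable_funM => //; exact: measurable_coord_rV.
    by apply/funext => x; rewrite !mxE.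
  by rewrite -[X in measurable X]setTI; exact: mS.
rewrite (E _ mA) (E _ mA') -(@integral_leb_rV_affine m r c)//.
by apply/measurable_EFinP; exact: measurable_indic.
Qed.

Lemma measurable_enorm m : measurable_fun setT (@enorm R m : borelRm R m -> R).
Proof. by apply: continuous_borelRm; exact: enorm_continuous. Qed.

Lemma gauss_leb_rV m :
  (\int[leb_rV R m]_x (expR (- (enorm (x : 'rV[R]_m)) ^+ 2))%:E = (Num.sqrt pi ^+ m)%:E)%E.
Proof.
have mE n : measurable_fun setT (fun x : borelRm R n => (expR (- (enorm (x : 'rV[R]_n)) ^+ 2))%:E).
  apply/measurable_EFinP; do 2! (apply: measurableT_comp => //).
  by apply: measurable_funX; exact: measurable_enorm.
elim: m => [|m IH].
  rewrite (_ : (fun x => _) = cst 1%E); last first.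
    apply/funext => x; rewrite (_ : enorm (x : 'rV[R]_0) = 0) ?expr0n ?oppr0 ?expR0//.
    by rewrite /enorm /dotp big_ord0 sqrtr0.
  by rewrite integral_leb_rV0.
rewrite integral_leb_rVS//.
transitivity (\int[leb]_u ((Num.sqrt pi ^+ m) * gauss_fun u)%:E)%E.
  apply: eq_integral => u _; rewrite mulrC EFinM -IH -ge0_integralZl_EFin ?expR_ge0//.
  by apply: eq_integral => x _; rewrite enorm_ins_sqr -EFinM /gauss_fun -expRD opprD.
rewrite ge0_integralZl_fin//.
- by rewrite integralT_gauss -EFinM exprSr.
- exact: measurable_gauss_fun.
- by move=> x _; exact: gauss_fun_ge0.
Qed.

Lemma leb_rV_ecball_scale m (c : 'rV[R]_m) (r : R) : 0 < r ->
  (leb_rV R m (ecball c r) = (r ^+ m)%:E * leb_rV R m (ecball 0 1))%E.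
Proof.
move=> r0; have mB (x : 'rV[R]_m) t : measurable (ecball x t : set (borelRm R m)).
  by apply: closed_borelRm; exact: closed_ecball.
have := @leb_rV_affine m r c (ecball c r) r0 (mB _ _).
rewrite (_ : [set x | _] = ecball 0 1); last first.
  by apply/seteqP; split => x /=; rewrite /ecball /= addrK subr0 enormZ gtr0_norm// ger_pMr.
by move=> ->; rewrite muleA -EFinM divff ?mul1e// expf_neq0// lt0r_neq0.
Qed.

Lemma hconst_gt0 (s : R) : 0 <= s -> 0 < hconst s.
Proof.
move=> s0; rewrite /hconst divr_gt0 ?powR_gt0 ?pi_gt0// mulr_gt0 ?powR_gt0// Gamma_gt0//.
by rewrite ltr_wpDl// divr_ge0.
Qed.

(** The Gaussian integral computed twice: as a product it is [pi^(m/2)], by layers it is the volume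
    of the unit ball times [Gamma (m/2 + 1)]. Thus [hconst] is exactly the constant for which a ball
    of diameter [d] has volume [hconst * d^m]. *)
Lemma leb_rV_ecball m (c : 'rV[R]_m) (r : R) : 0 < r ->
  leb_rV R m (ecball c r) = (hconst m%:R * (2 * r) `^ m%:R)%:E.
Proof.
move=> r0; rewrite leb_rV_ecball_scale//; set v := leb_rV R m _.
have mB (x : 'rV[R]_m) t : measurable (ecball x t : set (borelRm R m)).
  by apply: closed_borelRm; exact: closed_ecball.
have G0 : 0 < Gamma (m%:R / 2 + 1 : R) by rewrite Gamma_gt0// ltr_wpDl.
have vE : (v * (Gamma (m%:R / 2 + 1 : R))%:E = (pi `^ (m%:R / 2))%:E)%E.
  have := @exp_layer_cake _ _ (leb_rV R m) setT (fun x : borelRm R m => (enorm (x : 'rV[R]_m)) ^+ 2)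
    measurableT (measurable_funX 2 (@measurable_enorm m)) (fun x => sqr_ge0 _).
  rewrite gauss_leb_rV -powR12_sqrt ?pi_ge0// -powR_mulrn ?powR_ge0// -powRrM mulrC => ->.
  have m0 : 0 < m%:R / 2 + 1 :> R by rewrite ltr_wpDl.
  have := integral_gamma m0 ltr01; rewrite powR1 mulr1 => <-.
  rewrite muleC -ge0_integralZr//; last 3 first.
  - by apply/measurable_EFinP; apply: measurable_funTS; exact: measurable_powR_expR.
  - by move=> x _; rewrite lee_fin mulr_ge0 ?powR_ge0 ?expR_ge0.
  - exact: measure_ge0.
  apply: eq_integral => u; rewrite inE/= in_itv/= andbT => u0.
  rewrite setTI mul1r mulrC EFinM -muleA; congr (_ * _)%E.
  rewrite (_ : [set x | _] = ecball 0 (Num.sqrt u)); last first.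
    apply/seteqP; split => x /=; rewrite /ecball /= subr0.
      by move=> h; rewrite -(ger0_norm (enorm_ge0 x)) -sqrtr_sqr ler_wsqrtr.
    by move=> h; rewrite -(sqr_sqrtr (ltW u0)) ler_sqr ?nnegrE ?enorm_ge0 ?sqrtr_ge0.
  rewrite leb_rV_ecball_scale ?sqrtr_gt0//; congr (_%:E * _)%E.
  by rewrite addrK -powR12_sqrt ?(ltW u0)// -powR_mulrn ?powR_ge0// -powRrM mulrC.
have {}vE : v = (pi `^ (m%:R / 2) / Gamma (m%:R / 2 + 1))%:E.
  move: vE; have v0 : (0 <= v)%E by exact: measure_ge0.
  case: v v0 => [v|_|//]; last by rewrite gt0_mulye ?lte_fin.
  by move=> _; rewrite -EFinM => -[<-]; rewrite mulfK// lt0r_neq0.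
rewrite vE -EFinM; congr EFin; rewrite /hconst powRM ?(ltW r0)// !powR_mulrn ?(ltW r0)//.
have : 2 ^+ m != 0 :> R by rewrite expf_neq0.
have := lt0r_neq0 G0; move: (2 ^+ m) (Gamma _) (r ^+ m) => a b t h1 h2; field; exact/andP.
Qed.

End leb_rV_balls.

(** * Steiner symmetrization and the isodiametric inequality *)

Section isodiametric.
Variable R : realType.
Local Notation leb := (@lebesgue_measure R).

Definition diam_le m (A : set 'rV[R]_m) (d : R) := forall x y, A x -> A y -> enorm (x - y) <= d.

Definition refl_sym m (i : 'I_m.+1) (A : set 'rV[R]_m.+1) :=
  forall u x, A (ins i u x) -> A (ins i (- u) x).

Lemma integral_leb_rV_ins' m (i : 'I_m.+1) (f : borelRm R m.+1 -> \bar R) : (forall x, 0 <= f x)%E ->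
  measurable_fun setT f ->
  (\int[leb_rV R m.+1]_x f x = \int[leb_rV R m]_x \int[leb]_u f (ins i u x))%E.
Proof.
move=> f0 mf; rewrite (integral_leb_rV_ins i)//.
have mF : measurable_fun setT (fun z : measurableTypeR R * borelRm R m => f (ins i z.1 z.2)).
  exact: measurable_insE.
by rewrite (@fubini_tonelli _ _ _ _ R leb (leb_rV R m) _ mF).
Qed.

Lemma leb_sym_itv (L : \bar R) : (0 <= L)%E -> leb [set u : R | ((2 * `|u|)%:E < L)%E] = L.
Proof.
case: L => [l| _|//]; rewrite ?lee_fin; last first.
  rewrite (_ : [set u | _] = setT); last by apply/seteqP; split => u //= _; rewrite ltry.
  have := @lebesgue_measure_itv R `]-oo, +oo[; rewrite set_itvNyy /= => ->.
  by [].
move=> l0; rewrite (_ : [set u | _] = `](- (l / 2)), (l / 2)[%classic).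
  rewrite lebesgue_measure_itv /= lte_fin; case: ifPn => h; first by rewrite -EFinB; congr EFin; lra.
  by congr EFin; lra.
apply/seteqP; split => u /=; rewrite in_itv/= lte_fin -ltr_norml; lra.
Qed.

Lemma leb_le_diam (A : set R) (a b : R) : measurable (A : set (measurableTypeR R)) ->
  (forall x, A x -> a <= x <= b) -> a <= b -> (leb A <= (b - a)%:E)%E.
Proof.
move=> mA h ab; apply: (@le_trans _ _ (leb `[a, b]%classic)).
  by apply: le_measure; rewrite ?inE// => x /h; rewrite /= in_itv.
rewrite lebesgue_measure_itv/= lte_fin; case: ifPn => // _; by rewrite lee_fin subr_ge0.
Qed.

(* If every point of A were within t of every point of B, then
   |A| + |B| <= (sup A - inf A) + (sup B - inf B) <= 2 t. *)
Lemma far_points (A B : set R) (t : R) : measurable (A : set (measurableTypeR R)) ->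
  measurable (B : set (measurableTypeR R)) -> A !=set0 -> B !=set0 ->
  ((2 * t)%:E < leb A + leb B)%E -> exists p q, [/\ A p, B q & t <= `|p - q|].
Proof.
move=> mA mB A0 B0 tAB; apply: contrapT => H.
have {}H p q : A p -> B q -> `|p - q| < t.
  by move=> Ap Bq; rewrite ltNge; apply/negP => h; apply: H; exists p, q.
have [p0 Ap0] := A0; have [q0 Bq0] := B0.
have hA : has_sup A by split=> //; exists (q0 + t) => p Ap; have := H _ _ Ap Bq0; rewrite ltr_norml; lra.
have hA' : has_inf A by split=> //; exists (q0 - t) => p Ap; have := H _ _ Ap Bq0; rewrite ltr_norml; lra.
have hB : has_sup B by split=> //; exists (p0 + t) => q Bq; have := H _ _ Ap0 Bq; rewrite ltr_norml; lra.
have hB' : has_inf B by split=> //; exists (p0 - t) => q Bq; have := H _ _ Ap0 Bq; rewrite ltr_norml; lra.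
have supA x : A x -> inf A <= x <= sup A.
  by move=> Ax; apply/andP; split; [apply: ge_inf => //; case: hA'|apply: sup_upper_bound].
have supB x : B x -> inf B <= x <= sup B.
  by move=> Ax; apply/andP; split; [apply: ge_inf => //; case: hB'|apply: sup_upper_bound].
have iA : inf A <= sup A by have /andP[h1 h2] := supA _ Ap0; exact: le_trans h1 h2.
have iB : inf B <= sup B by have /andP[h1 h2] := supB _ Bq0; exact: le_trans h1 h2.
have h1 : sup A - t <= inf B.
  apply: lb_le_inf => // q Bq; rewrite lerBlDr; apply: ge_sup => // p Ap.
  by have := H _ _ Ap Bq; rewrite ltr_norml; lra.
have h2 : sup B - t <= inf A.
  apply: lb_le_inf => // p Ap; rewrite lerBlDr; apply: ge_sup => // q Bq.
  by have := H _ _ Ap Bq; rewrite ltr_norml; lra.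
have := lt_le_trans tAB (leeD (leb_le_diam mA supA iA) (leb_le_diam mB supB iB)).
rewrite -EFinD lte_fin; lra.
Qed.

Definition fiber m (i : 'I_m.+1) (A : set 'rV[R]_m.+1) (x : 'rV[R]_m) : set R := [set u | A (ins i u x)].

(** Each fibre along coordinate [i] becomes the centred open interval of the same length. The strict
    inequality turns null fibres into empty ones, so a point of the new set always lies over a
    nonempty fibre of [A]. *)
Definition steiner m (i : 'I_m.+1) (A : set 'rV[R]_m.+1) : set 'rV[R]_m.+1 :=
  [set z | ((2 * `|z ord0 i|)%:E < leb (fiber i A (\row_k z ord0 (lift i k))))%E].

Lemma steinerE m (i : 'I_m.+1) (A : set 'rV[R]_m.+1) u x :
  steiner i A (ins i u x) = ((2 * `|u|)%:E < leb (fiber i A x))%E.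
Proof.
rewrite /steiner /= ins_same; congr (_ < leb (fiber i A _))%E.
by apply/rowP => k; rewrite mxE ins_lift.
Qed.

Lemma measurable_fiber m (i : 'I_m.+1) (A : set (borelRm R m.+1)) (x : 'rV[R]_m) :
  measurable A -> measurable (fiber i A x : set (measurableTypeR R)).
Proof.
move=> mA; have : measurable_fun setT (fun u : measurableTypeR R => ins i u x : borelRm R m.+1).
  by apply: measurable_ins => //; exact: measurable_cst.
by move=> h; rewrite -[X in measurable X]setTI; exact: h.
Qed.

Lemma measurable_leb_fiber m (i : 'I_m.+1) (A : set (borelRm R m.+1)) : measurable A ->
  measurable_fun setT (fun x : borelRm R m => leb (fiber i A x)).
Proof.
move=> mA.
pose B : set (borelRm R m * measurableTypeR R) := [set z | A (ins i z.2 z.1)].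
have mB : measurable B.
  have h : measurable_fun setT (fun z : borelRm R m * measurableTypeR R => ins i z.2 z.1 : borelRm R m.+1).
    by apply: measurable_ins.
  by rewrite -[X in measurable X]setTI; exact: h.
have := @measurable_fun_xsection _ _ _ _ R leb B mB.
rewrite (_ : _ \o _ = fun x : borelRm R m => leb (fiber i A x))//.
by apply/funext => x /=; congr (leb _); apply/seteqP; split => u; rewrite /xsection /= inE.
Qed.

Lemma measurable_steiner m (i : 'I_m.+1) (A : set (borelRm R m.+1)) : measurable A ->
  measurable (steiner i A : set (borelRm R m.+1)).
Proof.
move=> mA; rewrite -[X in measurable X]setTI; apply: emeasurable_fun_lt => //.
  apply/measurable_EFinP; apply: measurable_funM => //; apply: measurableT_comp => //.
  exact: measurable_coord_rV.
apply: (measurableT_comp (measurable_leb_fiber i mA)).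
apply: measurable_fun_rV => k; rewrite (_ : (fun t => _) = fun x : borelRm R m.+1 => (x : 'rV[R]_m.+1) ord0 (lift i k)).
  exact: measurable_coord_rV.
by apply/funext => x; rewrite mxE.
Qed.

Lemma leb_rV_fiber m (i : 'I_m.+1) (A : set (borelRm R m.+1)) : measurable A ->
  (leb_rV R m.+1 A = \int[leb_rV R m]_x leb (fiber i A x))%E.
Proof.
move=> mA; rewrite -[X in leb_rV R m.+1 X]setIT -(@integral_indic _ _ _ (leb_rV R m.+1) setT)//.
rewrite (integral_leb_rV_ins' i)//; last by apply/measurable_EFinP; exact: measurable_indic.
apply: eq_integral => x _; rewrite -[X in leb X]setIT -(@integral_indic _ _ _ leb setT)//.
exact: measurable_fiber.
Qed.

Lemma leb_rV_steiner m (i : 'I_m.+1) (A : set (borelRm R m.+1)) : measurable A ->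
  leb_rV R m.+1 (steiner i A) = leb_rV R m.+1 A.
Proof.
move=> mA; rewrite !(leb_rV_fiber i)//; last exact: measurable_steiner.
apply: eq_integral => x _; rewrite -[RHS]leb_sym_itv ?measure_ge0//; congr (leb _).
by apply/seteqP; split => u; rewrite /fiber /= steinerE.
Qed.

(** Points at heights [u] and [v] of the symmetrized set lie over fibres of total length above
    [2 (|u| + |v|)]. By [far_points] these fibres contain [p] and [q] with
    [|p - q| >= |u| + |v| >= |u - v|], over the same base points. *)
Lemma diam_le_steiner m (i : 'I_m.+1) (A : set (borelRm R m.+1)) d : measurable A ->
  diam_le A d -> diam_le (steiner i A) d.
Proof.
move=> mA Ad z w; rewrite -(ins_row z i) -(ins_row w i) !steinerE.
set u := z ord0 i; set x := \row_k _; set v := w ord0 i; set y := \row_k _ => hu hv.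
have ne (B : set R) (t : R) : ((2 * `|t|)%:E < leb B)%E -> B !=set0.
  move=> h; apply/set0P; apply/eqP => B0; move: h; rewrite B0 measure0 lte_fin ltNge.
  by rewrite mulr_ge0.
have [|p [q [Ap Aq pq]]] := far_points (measurable_fiber i x mA) (measurable_fiber i y mA) (ne _ _ hu) (ne _ _ hv) (t := `|u| + `|v|).
  by rewrite mulrDr EFinD lteD.
have d0 : 0 <= d by apply: le_trans (Ad _ _ Ap Ap); exact: enorm_ge0.
apply: le_trans (Ad _ _ Ap Aq).
rewrite -ler_sqr ?nnegrE ?enorm_ge0// !insB !enorm_ins_sqr lerD2r.
rewrite -(@real_normK _ (u - v)) ?num_real// -(@real_normK _ (p - q)) ?num_real//.
by rewrite ler_sqr ?nnegrE// (le_trans (ler_normB _ _)).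
Qed.

Lemma refl_sym_steiner m (i : 'I_m.+1) (A : set 'rV[R]_m.+1) : refl_sym i (steiner i A).
Proof. by move=> u x; rewrite !steinerE normrN. Qed.

Lemma refl_sym_coord m (i : 'I_m.+1) (A : set 'rV[R]_m.+1) : refl_sym i A <->
  forall x, A x -> A (\row_j (if j == i then - x ord0 j else x ord0 j)).
Proof.
have E u x : ins i (- u) x = \row_j (if j == i then - (ins i u x) ord0 j else (ins i u x) ord0 j).
  apply/rowP => j; rewrite [RHS]mxE; case: (unliftP i j) => [k ->|->].
    by rewrite eq_sym (negbTE (neq_lift _ _)) !ins_lift.
  by rewrite eqxx !ins_same.
split=> h; last by move=> u x /h; rewrite E.
by move=> x; rewrite -{1}(ins_row x i) => /h; rewrite E ins_row.
Qed.

(** The fibres over a base point and over its reflection coincide, hence so do the intervals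
    replacing them. *)
Lemma refl_sym_steiner_other m (i j : 'I_m.+1) (A : set 'rV[R]_m.+1) : i != j ->
  refl_sym j A -> refl_sym j (steiner i A).
Proof.
move=> ij /refl_sym_coord Aj; apply/refl_sym_coord => z; rewrite /steiner /= mxE (negbTE ij).
set x := \row_k _; set y := \row_k _.
suff -> : fiber i A y = fiber i A x by [].
have sub (x1 x2 : 'rV[R]_m) : (forall k, x2 ord0 k = if lift i k == j then - x1 ord0 k else x1 ord0 k) ->
    fiber i A x1 `<=` fiber i A x2.
  move=> h u /Aj; rewrite /fiber /=; congr (A _); apply/rowP => k; rewrite mxE.
  case: (unliftP i k) => [k' ->|->]; first by rewrite !ins_lift h.
  by rewrite (negbTE ij) !ins_same.
by apply/seteqP; split; apply: sub => k; rewrite /x /y !mxE; case: (lift i k == j); rewrite ?opprK.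
Qed.

(** One symmetrization per coordinate; the symmetries already obtained survive the later steps. *)
Lemma steiner_iter m (A : set (borelRm R m.+1)) d : measurable A -> diam_le A d ->
  exists B : set (borelRm R m.+1), [/\ measurable B, leb_rV R m.+1 B = leb_rV R m.+1 A,
    diam_le B d & forall i, refl_sym i B].
Proof.
move=> mA Ad.
suff /(_ m.+1 (leqnn _)) [B [mB BA Bd Bs]] : forall k, (k <= m.+1)%N -> exists B : set (borelRm R m.+1),
    [/\ measurable B, leb_rV R m.+1 B = leb_rV R m.+1 A, diam_le B d &
     forall i : 'I_m.+1, (i < k)%N -> refl_sym i B].
  by exists B; split => // i; exact: Bs.
elim=> [_|k IH km]; first by exists A; split.
have [B [mB BA Bd Bs]] := IH (ltnW km).
exists (steiner (Ordinal km) B); split.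
- exact: measurable_steiner.
- by rewrite leb_rV_steiner.
- exact: diam_le_steiner.
- move=> i; rewrite ltnS leq_eqVlt => /predU1P[ik|ik].
    by rewrite (_ : i = Ordinal km); [exact: refl_sym_steiner|apply: val_inj].
  apply: refl_sym_steiner_other; last exact: Bs.
  by apply: contraTneq ik => <- /=; rewrite ltnn.
Qed.

Lemma refl_sym_opp m (A : set 'rV[R]_m.+1) : (forall i, refl_sym i A) -> forall x, A x -> A (- x).
Proof.
move=> As x Ax.
suff /(_ m.+1 (leqnn _)) : forall k, (k <= m.+1)%N -> A (\row_j (if (j < k)%N then - x ord0 j else x ord0 j)).
  by congr A; apply/rowP => j; rewrite !mxE ltn_ord.
elim=> [_|k IH km]; first by congr A: Ax; apply/rowP => j; rewrite mxE.
have /refl_sym_coord /(_ _ (IH (ltnW km))) := As (Ordinal km); congr A.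
apply/rowP => j; rewrite !mxE -val_eqE /= ltnS [in RHS]leq_eqVlt.
by case: eqP => [->|_] //=; rewrite ltnn.
Qed.

(** Symmetry in every coordinate gives central symmetry, so [2 |x| = |x - (-x)| <= d] places the
    symmetrized set in the ball of radius [d / 2]. *)
Lemma isodiametric m (A : set (borelRm R m.+1)) d : measurable A -> diam_le A d -> 0 <= d ->
  (leb_rV R m.+1 A <= (hconst m.+1%:R * d `^ m.+1%:R)%:E)%E.
Proof.
move=> mA Ad.
have main (e : R) : d <= e -> 0 < e -> (leb_rV R m.+1 A <= (hconst m.+1%:R * e `^ m.+1%:R)%:E)%E.
  move=> de e0; have [B [mB <- Bd Bs]] := steiner_iter mA Ad.
  have e20 : 0 < e / 2 by rewrite divr_gt0.
  have := leb_rV_ecball (0 : 'rV[R]_m.+1) e20; rewrite (_ : 2 * (e / 2) = e); last by field.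
  move=> <-; apply: le_measure; rewrite ?inE//.
    by apply: closed_borelRm; exact: closed_ecball.
  move=> x Bx; have := Bd _ _ Bx (refl_sym_opp Bs Bx); rewrite opprK -mulr2n -scaler_nat enormZ.
  by rewrite ger0_norm// /ecball/= subr0 => h; rewrite ler_pdivlMr// mulrC (le_trans h).
rewrite le_eqVlt => /predU1P[d0|d0]; last exact: main.
rewrite -d0 powR0 ?pnatr_eq0// mulr0.
apply/lee_addgt0Pr => e e0; rewrite add0e.
have h0 : 0 < hconst (m.+1%:R : R) by exact: hconst_gt0.
(* The case [d = 0], where no ball of positive radius is at hand: the set has diameter at most [t]
   for every [t > 0]. Here [t <= 1] gives [t^(m+1) <= t], and [t <= e / hconst] finishes. *)
pose t := Num.min 1 (e / hconst m.+1%:R).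
have t0 : 0 < t by rewrite lt_min ltr01 divr_gt0.
apply: le_trans (main t _ t0) _; first by rewrite -d0 ltW.
rewrite lee_fin -ler_pdivlMl// mulrC; apply: (@le_trans _ _ t); last by rewrite ge_min lexx orbT.
have t1 : t <= 1 by rewrite ge_min lexx.
rewrite powR_mulrn ?(ltW t0)// exprS; apply: ler_piMr; first exact: ltW.
by apply: exprn_ile1; [exact: ltW|].
Qed.

End isodiametric.

(** * Lower bound for Hausdorff measure by projection *)

Section hausdorff_lower.
Variable R : realType.

Lemma ediam_le m (U : set 'rV[R]_m) (d : R) : 0 <= d -> diam_le U d -> (ediam U <= d%:E)%E.
Proof.
move=> d0 Ud; apply: ge_ereal_sup => _ [->|[x Ux [y Uy <-]]]; rewrite lee_fin//.
exact: Ud.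
Qed.

Lemma ediam_ge0 m (U : set 'rV[R]_m) : (0 <= ediam U)%E.
Proof. by apply: ereal_sup_ubound; left. Qed.

Lemma diam_le_ediam m (U : set 'rV[R]_m) : (ediam U < +oo)%E -> diam_le U (fine (ediam U)).
Proof.
move=> Uoo x y Ux Uy; rewrite -lee_fin fineK; last by rewrite ge0_fin_numE// ediam_ge0.
by apply: ereal_sup_ubound; right; exists x => //; exists y.
Qed.

Lemma diam_le_closure m (U : set 'rV[R]_m) d : diam_le U d -> diam_le (closure U) d.
Proof.
move=> Ud x y /closureP_enorm cx /closureP_enorm cy; apply/ler_addgt0Pr => e e0.
have e20 : 0 < e / 2 by rewrite divr_gt0.
have [x' Ux' hx] := cx _ e20; have [y' Uy' hy] := cy _ e20.
have := Ud _ _ Ux' Uy'; have := enorm_triangle x' x y; have := enorm_triangle y' x' y.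
by rewrite (enormC x x'); lra.
Qed.

(** The projections of a cover of [A] cover [B] without larger diameters, and the isodiametric
    inequality bounds the volume of each by its term in the Hausdorff sum. Closures are taken to
    work with Borel sets; they keep the diameter bounds. *)
Lemma hausdorff_ge m s (P : 'rV[R]_m -> 'rV[R]_s.+1) (A : set 'rV[R]_m) (B : set (borelRm R s.+1)) :
  (forall x y, enorm (P x - P y) <= enorm (x - y)) -> measurable B -> B `<=` P @` A ->
  (leb_rV R s.+1 B <= hausdorff s.+1%:R A)%E.
Proof.
(* Any single scale bounds the supremum from below; scale 1 already makes all diameters finite. *)
move=> PL mB BA; apply: (@le_trans _ _ (hausdorff_delta s.+1%:R 1 A)); last first.
  by apply: ereal_sup_ubound; exists 1 => //=; rewrite in_itv/= ltr01.
apply: le_ereal_inf_tmp => _ [U [AU Ud] <-].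
have Uoo i : (ediam (U i) < +oo)%E by apply: le_lt_trans (Ud i) _; exact: ltry.
apply: (@le_trans _ _ (\sum_(0 <= i <oo) leb_rV R s.+1 (closure (P @` U i)))%E).
  apply: measure_sigma_subadditive => //.
    by move=> i; apply: closed_borelRm; exact: closed_closure.
  move=> y /BA[x /AU[i _ Ui] <-]; exists i => //; apply: subset_closure.
  by exists x.
apply: lee_nneseries => i _ //.
apply: isodiametric.
- by apply: closed_borelRm; exact: closed_closure.
- apply: diam_le_closure => _ _ [x Ux <-] [y Uy <-]; apply: le_trans (PL _ _) _.
  exact: diam_le_ediam.
- by rewrite fine_ge0// ediam_ge0.
Qed.

End hausdorff_lower.

(** * Efficient coverings of cubes and balls; upper bound for Hausdorff measure *)

Section cells.
Variable R : realType.

(** Half-open, so that the cells of a grid are disjoint and together fill the cube. *)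
Definition cell s (c : 'rV[R]_s) (h : R) : set 'rV[R]_s :=
  [set x | forall i, c ord0 i <= x ord0 i < c ord0 i + h].

Lemma measurable_cell s (c : 'rV[R]_s) h : measurable (cell c h : set (borelRm R s)).
Proof.
rewrite (_ : cell c h = \bigcap_(i in [set: 'I_s])
  ((fun x : borelRm R s => (x : 'rV[R]_s) ord0 i) @^-1` `[c ord0 i, c ord0 i + h[%classic)).
  apply: fin_bigcap_measurable => // i _; rewrite -[X in measurable X]setTI.
  by apply: measurable_coord_rV => //; exact: measurable_itv.
apply/seteqP; split => x /= cx i; first by move=> _; rewrite /= in_itv/=; exact: cx.
by have := cx i I; rewrite /= in_itv.
Qed.

Lemma leb_rV_cell s (c : 'rV[R]_s) (h : R) : 0 < h -> leb_rV R s (cell c h) = (h ^+ s)%:E.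
Proof.
move=> h0; elim: s c => [|s IH] c.
  have -> : cell c h = (setT : set (borelRm R 0)) by apply/seteqP; split => // x _ [].
  rewrite -[X in leb_rV R 0 X]setIT -(@integral_indic _ _ _ (leb_rV R 0) setT)//.
  rewrite (eq_integral (fun _ => 1%E)); last by move=> x _; rewrite indicT.
  by rewrite integral_leb_rV0// expr0.
rewrite (leb_rV_fiber ord0); last exact: measurable_cell.
pose c' : 'rV[R]_s := \row_k c ord0 (lift ord0 k).
transitivity (\int[leb_rV R s]_x (h * \1_(cell c' h : set (borelRm R s)) x)%:E)%E.
  apply: eq_integral => x _; rewrite indicE.
  have sub : forall u, cell c h (ins ord0 u x) <-> (c ord0 ord0 <= u < c ord0 ord0 + h /\ cell c' h x).
    move=> u; split.
      move=> H; split; first by have := H ord0; rewrite ins_same.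
      by move=> k; have := H (lift ord0 k); rewrite ins_lift mxE.
    move=> [h1 h2] j; case: (unliftP ord0 j) => [k ->|->]; last by rewrite ins_same.
    by have := h2 k; rewrite ins_lift mxE.
  case: (boolP (x \in _)) => xc /=.
    rewrite (_ : fiber _ _ _ = `[c ord0 ord0, c ord0 ord0 + h[%classic); last first.
      apply/seteqP; split => u; rewrite /fiber /= in_itv/=; first by move=> /sub[].
      by move=> h1; apply/sub; split => //; exact: set_mem.
    by rewrite lebesgue_measure_itv/= lte_fin ltrDl h0 mulr1 -EFinB addrC addKr.
  rewrite (_ : fiber _ _ _ = set0) ?measure0 ?mulr0//.
  by apply/seteqP; split => // u /sub[_ /mem_set]; rewrite (negbTE xc).
rewrite ge0_integralZl_fin ?(ltW h0)//.
- rewrite integral_indic//; last exact: measurable_cell.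
  rewrite setIT exprS EFinM; congr (_ * _)%E; exact: IH.
- by apply: measurable_indic; exact: measurable_cell.
Qed.

End cells.

Lemma measure_finType_bigcup d (T : measurableType d) (R : realType) (mu : {measure set T -> \bar R})
    (I : finType) (P : pred I) (F : I -> set T) : (forall i, measurable (F i)) ->
  (forall i j x, F i x -> F j x -> i = j) ->
  mu (\bigcup_(i in [set i | P i]) F i) = (\sum_(i | P i) mu (F i))%E.
Proof.
move=> mF dF; rewrite measure_fin_bigcup; last 3 first.
- exact: finite_finset.
- by move=> i j _ _ [x [Fi Fj]]; exact: dF Fi Fj.
- by [].
rewrite fsbig_finite/=; last exact: finite_finset.
rewrite -[RHS]big_filter; apply: perm_big; apply: uniq_perm.
- exact: finmap.fset_uniq.
- by rewrite filter_uniq// index_enum_uniq.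
- move=> i; rewrite mem_filter mem_index_enum andbT -(in_setb P).
  by rewrite -[RHS](in_fset_set (@finite_finset _ [set i | P i])).
Qed.

Section grid.
Variables (R : realType) (s : nat).
Local Notation vec := 'rV[R]_s.+1.
Local Notation V := (leb_rV R s.+1).
Local Notation hc := (hconst (s.+1%:R : R)).

(** A finite cover at scale [delta] with Hausdorff sum at most [v]. The [d i] are mere upper bounds
    of the diameters, which spares the computation of suprema. *)
Definition fcov (delta v : R) (A : set vec) := exists (I : finType) (U : I -> set vec) (d : I -> R),
  [/\ A `<=` \bigcup_i U i, (forall i, diam_le (U i) (d i)), (forall i, 0 <= d i <= delta) &
      \sum_i hc * d i ^+ s.+1 <= v].

Lemma fcov_sub delta v v' A A' : A' `<=` A -> v <= v' -> fcov delta v A -> fcov delta v' A'.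
Proof.
move=> AA vv [I [U [d [AU Ud d0 dv]]]]; exists I, U, d; split => //.
- exact: subset_trans AU.
- exact: le_trans vv.
Qed.

Lemma fcov_bigcup delta (J : finType) (v : J -> R) (A : J -> set vec) :
  (forall j, fcov delta (v j) (A j)) -> fcov delta (\sum_j v j) (\bigcup_j A j).
Proof.
move=> H.
have /choice[F HF] (j : J) : exists F : {I : finType & ((I -> set vec) * (I -> R))%type},
    [/\ A j `<=` \bigcup_i (tagged F).1 i, (forall i, diam_le ((tagged F).1 i) ((tagged F).2 i)),
      (forall i, 0 <= (tagged F).2 i <= delta) & \sum_i hc * (tagged F).2 i ^+ s.+1 <= v j].
  by have [I [U [d h]]] := H j; exists (existT _ I (U, d)).
exists {j : J & tag (F j)}, (fun p => (tagged (F (tag p))).1 (tagged p)),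
  (fun p => (tagged (F (tag p))).2 (tagged p)); split.
- move=> x [j _ Ajx]; have [/(_ _ Ajx)[i _ xi] _ _ _] := HF j.
  by exists (Tagged (fun j => tag (F j)) i).
- by move=> [j i] /=; have [_ h _ _] := HF j; exact: h.
- by move=> [j i] /=; have [_ _ h _] := HF j; exact: h.
- rewrite -(sig_big_dep (fun _ => true) (fun _ _ => true) (fun j i => hc * (tagged (F j)).2 i ^+ s.+1))/=.
  by apply: ler_sum => j _; have [_ _ _ h] := HF j.
Qed.

Lemma fcov_set0 delta v : 0 <= v -> fcov delta v set0.
Proof.
move=> v0; exists void, (fun _ => set0), (fun _ => 0); split => //; try by case.
by rewrite big_pred0 => // -[].
Qed.

Lemma fcov_one delta d A : diam_le A d -> 0 <= d <= delta -> fcov delta (hc * d ^+ s.+1) A.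
Proof.
move=> Ad dd; exists unit, (fun _ => A), (fun _ => d); split => //.
  by move=> x Ax; exists tt.
by rewrite (big_pred1 tt)// => -[].
Qed.

Lemma diam_cell (c : vec) h : 0 <= h -> diam_le (cell c h) (s.+1%:R * h).
Proof.
move=> h0 x y cx cy; apply: le_trans (enorm_le_mx_norm _) _; rewrite ler_wpM2l//.
have -> : `|x - y| = \big[Num.max/0]_ij `|(x - y) ij.1 ij.2| by exact: mx_normrE.
apply/bigmax_leP; split => // -[i j] _ /=; rewrite !mxE (ord1 i).
by have := cx j; have := cy j; rewrite ler_norml; lra.
Qed.

Definition subc (c : vec) (h : R) N (k : {ffun 'I_s.+1 -> 'I_N}) : vec :=
  \row_i (c ord0 i + h * (k i)%:R).

Lemma cell_grid c h N : 0 < h -> (0 < N)%N ->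
  cell c h = \bigcup_(k : {ffun 'I_s.+1 -> 'I_N}) cell (subc c (h / N%:R) k) (h / N%:R).
Proof.
move=> h0 N0; have N0' : 0 < N%:R :> R by rewrite ltr0n.
have t0 : 0 < h / N%:R by rewrite divr_gt0.
apply/seteqP; split => [x cx|x [k _ kx] i]; last first.
  have := kx i; rewrite mxE; set t := h / N%:R => /andP[h1 h2].
  have h3 : 0 <= t * (k i)%:R by rewrite mulr_ge0// ltW.
  have h4 : t * (k i).+1%:R <= h.
    by rewrite /t mulrAC ler_pdivrMr// ler_wpM2l ?(ltW h0)// ler_nat.
  by move: h4; rewrite -natr1 mulrDr mulr1; lra.
have H (i : 'I_s.+1) : exists k : 'I_N, (h / N%:R) * k%:R <= x ord0 i - c ord0 i < (h / N%:R) * k.+1%:R.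
  set u := x ord0 i - c ord0 i.
  have u0 : 0 <= u by have := cx i; rewrite /u; lra.
  have uh : u < h by have := cx i; rewrite /u; lra.
  have := truncn_itv (divr_ge0 u0 (ltW t0)); set k := Num.trunc _ => /andP[k1 k2].
  have kN : (k < N)%N.
    rewrite -(ltr_nat R); apply: le_lt_trans k1 _.
    by rewrite invf_div mulrA ltr_pdivrMr// mulrC ltr_pM2l.
  exists (Ordinal kN) => /=; rewrite mulrC -ler_pdivlMr// k1/= mulrC -ltr_pdivrMr//.
have /choice[k Hk] := H.
exists [ffun i => k i] => // i; rewrite mxE ffunE; have := Hk i; rewrite -natr1 mulrDr mulr1; lra.
Qed.

Lemma cell_disj c h N (k k' : {ffun 'I_s.+1 -> 'I_N}) x : 0 < h ->
  cell (subc c h k) h x -> cell (subc c h k') h x -> k = k'.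
Proof.
move=> h0 cx cx'; apply/ffunP => i; apply: val_inj => /=.
have := cx i; have := cx' i; rewrite !mxE => /andP[a1 a2] /andP[b1 b2].
have le1 (p q : nat) : c ord0 i + h * p%:R < c ord0 i + h * q%:R + h -> (p <= q)%N.
  by rewrite -addrA ltrD2l -[X in _ + X]mulr1 -mulrDr ltr_pM2l// natr1 ltr_nat.
by apply/eqP; rewrite eqn_leq !le1//; [exact: le_lt_trans a1 b2|exact: le_lt_trans b1 a2].
Qed.

Lemma sum_cells (h v : R) N : (0 < N)%N ->
  \sum_(k : {ffun 'I_s.+1 -> 'I_N}) v * (h / N%:R) ^+ s.+1 = v * h ^+ s.+1.
Proof.
move=> N0; have N0' : N%:R != 0 :> R by rewrite pnatr_eq0 -lt0n.
by rewrite sumr_const card_ffun !card_ord -[LHS]mulr_natr natrX -mulrA -exprMn divfK.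
Qed.

Lemma exists_grid (e : R) : 0 < e -> exists2 N : nat, (0 < N)%N & N%:R^-1 < e.
Proof. by move=> e0; have [k] := ltr_add_invr e0; rewrite add0r => hk; exists k.+1. Qed.

(** The cost [c * h ^+ s.+1] is additive under cutting a cube into equal cubes, so only cubes that
    are small compared with [delta] have to be covered. *)
Lemma fcov_subdivide delta c : 0 < delta ->
  (forall c0 h, 0 < h -> s.+1%:R * h <= delta -> fcov delta (c * h ^+ s.+1) (cell c0 h)) ->
  forall c0 h, 0 < h -> fcov delta (c * h ^+ s.+1) (cell c0 h).
Proof.
move=> d0 H c0 h h0; have sh : 0 < s.+1%:R * h by rewrite mulr_gt0.
have [N N0 hN] := exists_grid (divr_gt0 d0 sh).
have N0' : 0 < N%:R :> R by rewrite ltr0n.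
rewrite (cell_grid c0 h0 N0) -(sum_cells h c N0); apply: fcov_bigcup => k.
apply: H; first by rewrite divr_gt0.
by rewrite mulrA -ler_pdivlMl// mulrC ltW.
Qed.

(** [c] is admissible when every cube can be covered, at every scale, at a cost of at most [c] times
    its volume. The aim is that all [c > 1] are admissible. *)
Definition cubecov (c : R) :=
  forall c0 h delta, 0 < h -> 0 < delta -> fcov delta (c * h ^+ s.+1) (cell c0 h).

Lemma hc_gt0 : 0 < hc. Proof. exact: hconst_gt0. Qed.

(** A small cube covers itself; its diameter is crudely at most [s.+1%:R * h]. *)
Lemma cubecov_init : cubecov (hc * s.+1%:R ^+ s.+1).
Proof.
move=> c0 h delta h0 d0; apply: fcov_subdivide => // {}c0 {}h {}h0 hd.
rewrite -mulrA -exprMn; apply: fcov_one; last by rewrite hd mulr_ge0// ltW.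
by apply: diam_cell; exact: ltW.
Qed.

Lemma fcov_ge0 delta v A : fcov delta v A -> 0 <= v.
Proof.
move=> [I [U [d [_ _ d0 dv]]]]; apply: le_trans dv; apply: sumr_ge0 => i _.
by rewrite mulr_ge0 ?(ltW hc_gt0)// exprn_ge0//; case/andP: (d0 i).
Qed.

Lemma cubecov_ge0 c : cubecov c -> 0 <= c.
Proof. by move=> /(_ 0 1 1 ltr01 ltr01)/fcov_ge0; rewrite expr1n mulr1. Qed.

Lemma fcovU delta v1 v2 A1 A2 : fcov delta v1 A1 -> fcov delta v2 A2 ->
  fcov delta (v1 + v2) (A1 `|` A2).
Proof.
move=> h1 h2; have := @fcov_bigcup delta bool (fun b => if b then v1 else v2) (fun b => if b then A1 else A2).
rewrite big_bool /= => H; apply: fcov_sub (lexx _) (H _); last by case.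
by move=> x [xA|xA]; [exists true|exists false].
Qed.

Lemma measurable_ecball (z : vec) r : measurable (ecball z r : set (borelRm R s.+1)).
Proof. by apply: closed_borelRm; exact: closed_ecball. Qed.

Lemma leb_rV_ecballE (z : vec) r : 0 < r -> V (ecball z r) = (hc * (2 * r) ^+ s.+1)%:E.
Proof. by move=> r0; rewrite leb_rV_ecball// powR_mulrn// mulr_ge0// ltW. Qed.

Lemma leb_rV_cells (c0 : vec) (t : R) N (P : pred {ffun 'I_s.+1 -> 'I_N}) : 0 < t ->
  V (\bigcup_(k in [set k | P k]) cell (subc c0 t k) t) = (\sum_(k | P k) t ^+ s.+1)%:E.
Proof.
move=> t0; rewrite measure_finType_bigcup//.
- by rewrite -sumEFin; apply: eq_bigr => k _; exact: leb_rV_cell.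
- by move=> k; exact: measurable_cell.
- by move=> k k' x; exact: cell_disj.
Qed.

Lemma measurable_cells (c0 : vec) (t : R) N (P : pred {ffun 'I_s.+1 -> 'I_N}) :
  measurable (\bigcup_(k in [set k | P k]) cell (subc c0 t k) t : set (borelRm R s.+1)).
Proof. by apply: fin_bigcup_measurable => // k _; exact: measurable_cell. Qed.

(** The inscribed ball covers itself at a cost equal to its volume, and constant [c] is paid only
    for the small cells not inside the ball. The cells inside fill at least the concentric ball
    shrunk by [1 - 2 (s + 1) / N], and [c] times this volume is saved. *)
Lemma cubecov_step c N : cubecov c -> (2 * s.+1 < N)%N ->
  cubecov (hc + c * (1 - hc * (1 - 2 * s.+1%:R / N%:R) ^+ s.+1)).
Proof.
move=> cc sN c0 h delta h0 d0; have c_ge0 := cubecov_ge0 cc.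
apply: fcov_subdivide => // {}c0 {}h {}h0 hd.
have N0 : (0 < N)%N by apply: leq_ltn_trans sN.
have N0' : 0 < N%:R :> R by rewrite ltr0n.
set th := 1 - 2 * s.+1%:R / N%:R.
have th0 : 0 < th.
  by rewrite subr_gt0 ltr_pdivrMr// mul1r -natrM ltr_nat.
have th1 : th < 1 by rewrite gtrBl divr_gt0// mulr_gt0.
pose z : vec := \row_i (c0 ord0 i + h / 2); pose t := h / N%:R.
have t0 : 0 < t by rewrite divr_gt0.
have ht0 : 0 < h * th / 2 by rewrite divr_gt0// mulr_gt0.
(* A cell has diameter at most [s.+1%:R * t], so a cell that meets the shrunken ball stays inside
   the full one. *)
have tE : h * th / 2 + s.+1%:R * t = h / 2.
  by rewrite /th /t; field; exact: lt0r_neq0.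
pose inB (k : {ffun 'I_s.+1 -> 'I_N}) := `[< cell (subc c0 t k) t `<=` ecball z (h / 2) >].
have cov : cell c0 h `<=` ecball z (h / 2) `|`
    \bigcup_(k : {ffun 'I_s.+1 -> 'I_N}) (if inB k then set0 else cell (subc c0 t k) t).
  rewrite (cell_grid c0 h0 N0) => x [k _ kx]; case: (boolP (inB k)) => [/asboolP|nk].
    by move=> /(_ _ kx); left.
  by right; exists k => //; rewrite (negbTE nk).
have fB : fcov delta (hc * h ^+ s.+1) (ecball z (h / 2)).
  apply: fcov_one.
    move=> x y; rewrite /ecball /= => hx hy; have := enorm_triangle z x y.
    by rewrite (enormC z y); lra.
  by rewrite (ltW h0)/= (le_trans _ hd)// ler_peMl ?(ltW h0)// ler1n.
have fC (k : {ffun 'I_s.+1 -> 'I_N}) : fcov delta (if inB k then 0 else c * t ^+ s.+1)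
    (if inB k then set0 else cell (subc c0 t k) t).
  by case: ifPn => _; [exact: fcov_set0|exact: cc].
apply: fcov_sub cov _ (fcovU fB (fcov_bigcup fC)).
have E : \sum_k (if inB k then 0 else c * t ^+ s.+1) = c * h ^+ s.+1 - c * \sum_(k | inB k) t ^+ s.+1.
  rewrite -(sum_cells h c N0) mulr_sumr [X in X - _](bigID inB)/= addrAC subrr add0r.
  by rewrite big_mkcond [RHS]big_mkcond/=; apply: eq_bigr => k _; case: (inB k).
have low : hc * (h * th) ^+ s.+1 <= \sum_(k | inB k) t ^+ s.+1.
  rewrite -lee_fin -(@leb_rV_cells c0 t N inB)//.
  have -> : h * th = 2 * (h * th / 2) by field.
  rewrite -(leb_rV_ecballE z ht0).
  apply: le_measure; rewrite ?inE; [exact: measurable_ecball|exact: measurable_cells|].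
  move=> x xz; have : cell c0 h x.
    move=> i; have := le_trans (coord_le_enorm (x - z) i) xz; rewrite !mxE ler_norml.
    have : h * th < h by rewrite gtr_pMr.
    lra.
  rewrite (cell_grid c0 h0 N0) => -[k _ kx]; exists k => //=; apply/asboolP => y ky.
  rewrite /ecball/= -tE; apply: le_trans (enorm_triangle x y z) _; rewrite addrC lerD//.
  exact: (diam_cell (ltW t0) ky kx).
rewrite E exprMn in low *; have := ler_wpM2l c_ge0 low; lra.
Qed.

Lemma bernoulli_ineq (x : R) k : 0 <= x <= 1 -> 1 - k%:R * x <= (1 - x) ^+ k.
Proof.
move=> /andP[x0 x1]; elim: k => [|k IH]; first by rewrite mul0r subr0.
rewrite exprS -natr1; have h : 0 <= 1 - x by rewrite subr_ge0.
apply: le_trans (ler_wpM2l h IH).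
have : 0 <= k%:R * x * x by rewrite !mulr_ge0.
lra.
Qed.

(** By the previous step the infimum [i] of the admissible constants satisfies
    [i <= hc + i (1 - hc th^(s+1))], that is [i th^(s+1) <= 1], and [th] tends to 1 as [N] grows;
    hence [i <= 1]. This self-improvement takes the place of a Vitali covering argument. *)
Lemma cubecov_gt1 c : 1 < c -> cubecov c.
Proof.
move=> c1; pose S := [set c | cubecov c].
have S0 : has_inf S.
  split; first by exists (hc * s.+1%:R ^+ s.+1); exact: cubecov_init.
  by exists 0 => x /cubecov_ge0.
have i0 : 0 <= inf S by apply: lb_le_inf; [case: S0|move=> x /cubecov_ge0].
have i1 : inf S <= 1.
  have H N : (2 * s.+1 < N)%N -> inf S * (1 - s.+1%:R * (2 * s.+1%:R / N%:R)) <= 1.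
    move=> sN; have N0' : 0 < N%:R :> R by rewrite ltr0n (leq_ltn_trans _ sN).
    pose th : R := 1 - 2 * s.+1%:R / N%:R.
    suff : inf S * th ^+ s.+1 <= 1.
      apply: le_trans; rewrite ler_wpM2l// bernoulli_ineq//.
      apply/andP; split; first by rewrite divr_ge0 ?mulr_ge0.
      by rewrite ler_pdivrMr// mul1r -natrM ler_nat ltnW.
    rewrite -(ler_pM2l hc_gt0) mulr1.
    suff : inf S - hc + hc * (inf S * th ^+ s.+1) <= inf S by lra.
    apply: lb_le_inf; first by case: S0.
    move=> x Sx; have := ge_inf (proj2 S0) (cubecov_step Sx sN); rewrite -/th.
    have : inf S <= x by apply: ge_inf => //; case: S0.
    have th0 : 0 <= th ^+ s.+1.
      by rewrite exprn_ge0// subr_ge0 ler_pdivrMr// mul1r -natrM ler_nat ltnW.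
    move=> ix; have := ler_wpM2r (mulr_ge0 (ltW hc_gt0) th0) ix; lra.
  apply/ler_addgt0Pr => e e0.
  pose b : R := (1 + inf S) * (s.+1%:R * (2 * s.+1%:R)).
  have b0 : 0 < b by rewrite !mulr_gt0// ltr_pwDl.
  have [N N0 hN] := exists_grid (divr_gt0 e0 b0).
  pose M := maxn N (2 * s.+1).+1.
  have M0 : 0 < M%:R :> R by rewrite ltr0n leq_max N0.
  have := H M; rewrite leq_max ltnSn orbT => /(_ isT).
  have : inf S * (s.+1%:R * (2 * s.+1%:R / M%:R)) <= e.
    apply: (@le_trans _ _ (b * N%:R^-1)); last by rewrite -ler_pdivlMl// mulrC ltW.
    rewrite /b !mulrA; apply: ler_pM; rewrite ?mulr_ge0 ?invr_ge0//.
      by rewrite -!mulrA ler_wpM2r ?mulr_ge0// lerDr.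
    have N0' : 0 < N%:R :> R by rewrite ltr0n.
    by rewrite lef_pV2 ?posrE// ler_nat leq_maxl.
  lra.
have [x Sx xc] : exists2 x, S x & x < c.
  have ci : 0 < c - inf S by rewrite subr_gt0 (le_lt_trans i1).
  have [x Sx xc] := inf_adherent ci S0.
  by exists x => //; move: xc; rewrite addrC subrK.
by move=> c0 h delta h0 d0; apply: fcov_sub (Sx c0 h delta h0 d0) => //; rewrite ler_pM2r ?exprn_gt0// ltW.
Qed.

(** The ratio [v / w > 1] is split into [s.+2] equal factors [y]: one pays for the admissible
    constant [y > 1], the other [s.+1] for enlarging the ball so that it contains all grid cells
    meeting it. *)
Lemma fcov_ecball (z : vec) r delta v : 0 < r -> 0 < delta -> hc * (2 * r) ^+ s.+1 < v ->
  fcov delta v (ecball z r).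
Proof.
move=> r0 d0 hv; set w := hc * (2 * r) ^+ s.+1 in hv.
have w0 : 0 < w by rewrite mulr_gt0 ?hc_gt0// exprn_gt0// mulr_gt0.
pose y := (v / w) `^ (s.+2%:R^-1).
have vw : 1 < v / w by rewrite ltr_pdivlMr// mul1r.
have yE : y ^+ s.+2 = v / w.
  by rewrite -powR_mulrn ?powR_ge0// -powRrM mulVf ?powRr1// ltW// (lt_trans ltr01).
have y1 : 1 < y.
  by rewrite ltNge; apply/negP => h; move: vw; rewrite -yE ltNge exprn_ile1// powR_ge0.
have y10 : 0 < y - 1 by rewrite subr_gt0.
have s40 : 0 < 4 * s.+1%:R :> R by rewrite mulr_gt0.
have [N N0 hN] := exists_grid (divr_gt0 y10 s40).
have N0' : 0 < N%:R :> R by rewrite ltr0n.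
(* The grid fills a cube of side [4 * r]; with half-open cells a side of [2 * r] would miss points
   of the closed ball. *)
pose c0 : vec := \row_i (z ord0 i - 2 * r); pose t := 4 * r / N%:R.
have t0 : 0 < t by rewrite divr_gt0// mulr_gt0.
have r40 : 0 < 4 * r by rewrite mulr_gt0.
pose P (k : {ffun 'I_s.+1 -> 'I_N}) := `[< ecball z r `&` cell (subc c0 t k) t !=set0 >].
have cov : ecball z r `<=` \bigcup_(k : {ffun 'I_s.+1 -> 'I_N}) (if P k then cell (subc c0 t k) t else set0).
  move=> x xz; have : cell c0 (4 * r) x.
    move=> i; have := le_trans (coord_le_enorm (x - z) i) xz; rewrite !mxE ler_norml; lra.
  rewrite (cell_grid c0 r40 N0) => -[k _ kx]; exists k => //.
  by rewrite ifT//; apply/asboolP; exists x.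
have fC (k : {ffun 'I_s.+1 -> 'I_N}) : fcov delta (if P k then y * t ^+ s.+1 else 0)
    (if P k then cell (subc c0 t k) t else set0).
  by case: ifPn => _; [exact: cubecov_gt1|exact: fcov_set0].
apply: fcov_sub cov _ (fcov_bigcup fC).
rewrite -big_mkcond/= -mulr_sumr.
have up : \sum_(k | P k) t ^+ s.+1 <= hc * (2 * (r + s.+1%:R * t)) ^+ s.+1.
  have rt : 0 < r + s.+1%:R * t by rewrite addr_gt0// mulr_gt0.
  rewrite -lee_fin -(@leb_rV_cells c0 t N P)// -(leb_rV_ecballE z)//.
  apply: le_measure; rewrite ?inE; [exact: measurable_cells|exact: measurable_ecball|].
  move=> x [k /asboolP[x' [zx' kx']] kx]; rewrite /ecball /= [leRHS]addrC.
  apply: le_trans (enorm_triangle x' x z) _; rewrite lerD//.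
  exact: (diam_cell (ltW t0) kx kx').
apply: le_trans (ler_wpM2l (ltW (lt_trans ltr01 y1)) up) _.
rewrite (_ : 2 * _ = (2 * r) * (1 + 4 * s.+1%:R / N%:R)); last first.
  by rewrite /t; field; exact: lt0r_neq0.
have x1 : 1 + 4 * s.+1%:R / N%:R <= y.
  by rewrite addrC -lerBrDr -ler_pdivlMl ?mulr_gt0// mulrC ltW.
have y0 : 0 < y by rewrite (lt_trans ltr01).
rewrite exprMn (_ : y * _ = w * (y * (1 + 4 * s.+1%:R / N%:R) ^+ s.+1)); last by rewrite /w; ring.
rewrite -ler_pdivlMl// [leRHS]mulrC -yE [leRHS]exprS; apply: ler_wpM2l; first exact: ltW.
by apply: lerXn2r; rewrite ?nnegrE ?(ltW y0)//.
Qed.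

(** A cheap cover of the ball containing the projection is pulled back to [A]. Distances in [A]
    exceed those of the projections at most by the factor [L], so the Hausdorff sum grows at most by
    [L ^+ s.+1]. *)
Lemma hausdorff_le m (P : 'rV[R]_m -> vec) (A : set 'rV[R]_m) (z : vec) (L r : R) : 0 < L -> 0 < r ->
  (forall x y, A x -> A y -> enorm (x - y) <= L * enorm (P x - P y)) ->
  (forall x, A x -> enorm (P x - z) <= r) ->
  (hausdorff s.+1%:R A <= (hc * (2 * L * r) ^+ s.+1)%:E)%E.
Proof.
move=> L0 r0 PL Pr; apply: ge_ereal_sup => u [delta d0 <-]; rewrite /= in_itv/= andbT in d0; clear u.
apply/lee_addgt0Pr => e e0.
have Ls : 0 < L ^+ s.+1 by rewrite exprn_gt0.
have [I [U [d [BU Ud dd dv]]]] : fcov (delta / L) (hc * (2 * r) ^+ s.+1 + e / L ^+ s.+1) (ecball z r).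
  by apply: fcov_ecball; rewrite ?divr_gt0// ltrDl divr_gt0.
(* [hausdorff_delta] asks for a sequence: the finite family is continued by empty sets, whose
   diameter 0 contributes nothing. *)
pose W (n : nat) : set 'rV[R]_m := if (insub n : option 'I_#|I|) is Some i
  then A `&` (P @^-1` U (enum_val i)) else set0.
have Wd n (i : 'I_#|I|) : insub n = Some i -> diam_le (W n) (L * d (enum_val i)).
  move=> ni; rewrite /W ni => x y [Ax Ux] [Ay Uy]; apply: le_trans (PL _ _ Ax Ay) _.
  by rewrite ler_pM2l//; exact: Ud.
have W0 n : insub n = None :> option 'I_#|I| -> ediam (W n) = 0%E.
  move=> ni; apply/eqP; rewrite eq_le ediam_ge0 andbT; apply: ediam_le => //.
  by rewrite /W ni => x y [].
apply: (@le_trans _ _ (\sum_(0 <= i <oo) (hconst (s.+1%:R : R) * (fine (ediam (W i))) `^ s.+1%:R)%:E)%E).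
  apply: ereal_inf_lbound; exists W => //; split.
    move=> x Ax; have [i _ Ui] := BU _ (Pr _ Ax).
    exists (enum_rank i) => //; rewrite /W insubT/=; first exact: ltn_ord.
    move=> h; split => //=; rewrite (_ : Sub _ _ = enum_rank i) ?enum_rankK//.
    exact: val_inj.
  move=> n; case E : (insub n : option 'I_#|I|) => [i|]; last by rewrite W0// lee_fin ltW.
  have /andP[di0 did] := dd (enum_val i).
  apply: le_trans (ediam_le _ (Wd _ _ E)) _; first by rewrite mulr_ge0// ltW.
  by rewrite lee_fin mulrC -ler_pdivlMr.
rewrite (nneseries_split 0 #|I|); last by move=> k _; rewrite lee_fin mulr_ge0 ?powR_ge0// ltW// hc_gt0.
rewrite [X in (_ + X)%E]eseries0 ?adde0; last first.
  move=> k; rewrite add0n => Ik _; rewrite W0 ?powR0 ?pnatr_eq0 ?mulr0//.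
  by rewrite insubN// -leqNgt.
rewrite add0n big_mkord sumEFin -EFinD lee_fin.
apply: (@le_trans _ _ (\sum_(i < #|I|) L ^+ s.+1 * (hc * d (enum_val i) ^+ s.+1))).
  apply: ler_sum => i _; have /andP[di0 did] := dd (enum_val i).
  have ni : insub (val i) = Some i by rewrite valK.
  have h := ediam_le (_ : 0 <= L * d (enum_val i)) (Wd _ _ ni).
  have {}h := h (mulr_ge0 (ltW L0) di0).
  have f0 : 0 <= fine (ediam (W i)) by rewrite fine_ge0// ediam_ge0.
  rewrite mulrCA ler_pM2l ?hc_gt0// -exprMn powR_mulrn// lerXn2r ?nnegrE ?mulr_ge0 ?(ltW L0)//.
  by rewrite -lee_fin fineK// ge0_fin_numE ?ediam_ge0// (le_lt_trans h)// ltry.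
rewrite -mulr_sumr -(big_enum_val (fun i => hc * d i ^+ s.+1))/=.
apply: le_trans (ler_wpM2l (ltW Ls) dv) _.
rewrite mulrDr mulrCA -exprMn mulrA (mulrC L) [X in _ + X]mulrC divfK ?lt0r_neq0//.
Qed.

End grid.

(** * Coordinates and segments in the orthant *)

Section orthant_geometry.
Variables (R : realType) (m n : nat).
Local Notation O := (@orthant R m n).

Lemma xcE (x : 'rV[R]_m) (i : 'I_m) : xc x i = x ord0 i.
Proof. by rewrite /xc valK. Qed.

Lemma xc_ord (x : 'rV[R]_m) k (km : (k < m)%N) : xc x k = x ord0 (Ordinal km).
Proof. by rewrite -xcE. Qed.

Lemma xcD (x y : 'rV[R]_m) k : xc (x + y) k = xc x k + xc y k.
Proof. by rewrite /xc; case: insub => [i|]; rewrite ?mxE ?addr0. Qed.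

Lemma xcZ a (x : 'rV[R]_m) k : xc (a *: x) k = a * xc x k.
Proof. by rewrite /xc; case: insub => [i|]; rewrite ?mxE ?mulr0. Qed.

Lemma xc_continuous k : continuous (fun x : 'rV[R]_m => xc x k).
Proof.
rewrite /xc; case: insub => [i|]; last first.
  by move=> x; apply: continuous_at_enorm => e e0; exists 1 => // y _; rewrite subrr normr0.
exact: coord_continuous.
Qed.

Lemma orthant_open : open O.
Proof.
suff H k : (k <= n)%N -> open [set x : 'rV[R]_m | forall j, (j < k)%N -> 0 < xc x j] by exact: H (leqnn _).
elim: k => [_|k IH kn].
  by rewrite (_ : [set x | _] = setT); [exact: openT|apply/seteqP; split].
rewrite (_ : [set x | _] = [set x : 'rV[R]_m | forall j, (j < k)%N -> 0 < xc x j] `&`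
   ((fun x => xc x k) @^-1` [set u | 0 < u])).
  apply: openI; first exact: IH (ltnW kn).
  by apply: open_comp => [x _|]; [exact: xc_continuous|exact: open_gt].
apply/seteqP; split => x /=.
  by move=> h; split => [j jk|]; apply: h => //; rewrite ltnS ltnW.
by move=> [h1 h2] j; rewrite ltnS leq_eqVlt => /predU1P[->|/h1].
Qed.

Lemma orthant_convex x y t : O x -> O y -> 0 <= t <= 1 -> O (x + t *: (y - x)).
Proof.
move=> Ox Oy /andP[t0 t1] k kn; rewrite xcD xcZ xcD -scaleN1r xcZ.
have := Ox k kn; have := Oy k kn; set u := xc x k; set v := xc y k => v0 u0.
rewrite (_ : _ + _ = (1 - t) * u + t * v); last by ring.
have [->|tn] := eqVneq t 0; first by lra.
apply: ltr_wpDl; first by rewrite mulr_ge0 ?subr_ge0// ltW.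
by rewrite mulr_gt0// lt_neqAle eq_sym tn.
Qed.

Lemma ecball_convex (c x y : 'rV[R]_m) r t : ecball c r x -> ecball c r y -> 0 <= t <= 1 -> ecball c r (x + t *: (y - x)).
Proof.
move=> hx hy /andP[t0 t1]; rewrite /ecball/=.
have -> : x + t *: (y - x) - c = (1 - t) *: (x - c) + t *: (y - c).
  by apply/rowP => i; rewrite !mxE; ring.
apply: le_trans (ler_enormD _ _) _; rewrite !enormZ !ger0_norm ?subr_ge0//.
have h1 : (1 - t) * enorm (x - c) <= (1 - t) * r by rewrite ler_wpM2l ?subr_ge0.
have h2 : t * enorm (y - c) <= t * r by rewrite ler_wpM2l.
lra.
Qed.

Lemma line_continuous (x w : 'rV[R]_m) : continuous (fun t : R => x + t *: w).
Proof.
move=> t A /nbhs_eballP[e e0 eA]; apply/nbhs_ballP.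
have w0 : 0 < enorm w + 1 by rewrite ltr_wpDl ?enorm_ge0.
exists (e / (enorm w + 1)); first by rewrite /= divr_gt0.
move=> u; rewrite /ball/= ltr_pdivlMr// => h; apply: eA; rewrite /eball/=.
rewrite (_ : _ - _ = (u - t) *: w); last by apply/rowP => i; rewrite !mxE; ring.
rewrite enormZ distrC; apply: le_lt_trans h; apply: ler_wpM2l => //.
by rewrite lerDl.
Qed.

End orthant_geometry.

(** * Sides of the surface, cones and crossings *)

Section surface_geometry.
Variables (R : realType) (m n : nat) (Omega Gam : set 'rV[R]_m) (N : 'rV[R]_m -> 'rV[R]_m).
Local Notation O := (@orthant R m n).
Hypothesis Omega_open : open Omega.
Hypothesis GamE : Gam = (closure Omega `\` Omega) `&` O.
Hypothesis N_unit : forall t, Gam t -> enorm (N t) = 1.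
Hypothesis N_tangent : forall t, Gam t ->
     (fun xi => dotp (xi - t) (N t) / enorm (xi - t)) x
        @[x --> within (Gam `\ t) (nbhs t)] --> 0.
Hypothesis N_sides : forall t, Gam t -> exists2 e0 : R, 0 < e0 &
     forall e : R, 0 < e < e0 ->
       Omega (t - e *: N t) /\ ~ closure Omega (t + e *: N t).

Lemma Gam_orthant x : Gam x -> O x.
Proof. by rewrite GamE => -[]. Qed.

Lemma Gam_closure x : Gam x -> closure Omega x.
Proof. by rewrite GamE => -[[]]. Qed.

Lemma Gam_NOmega x : Gam x -> ~ Omega x.
Proof. by rewrite GamE => -[[]]. Qed.

Lemma closure_cases x : O x -> ~ Gam x -> closure Omega x -> Omega x.
Proof. by move=> Ox nG cx; apply: contrapT => nO; apply: nG; rewrite GamE. Qed.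

(** Off [Gam] the orthant does not distinguish [Omega] from its closure, so the trace of [Omega] on
    the segment is both open and closed in [[0, 1]], and it contains 0. *)
Lemma segment_Omega x y : (forall t, 0 <= t <= 1 -> O (x + t *: (y - x))) ->
  (forall t, 0 <= t <= 1 -> ~ Gam (x + t *: (y - x))) -> Omega x -> Omega y.
Proof.
move=> HO HG Ox; pose g (t : R) := x + t *: (y - x).
have cg : continuous g by exact: line_continuous.
have : `[0, 1]%classic `&` (g @^-1` Omega) = `[0, 1]%classic :> set R.
  apply: (@segment_connected R 0 1).
  - by exists 0; split; rewrite /= ?in_itv/= ?lexx ?ler01// /g scale0r addr0.
  - by exists (g @^-1` Omega) => //; apply: open_comp => // t _; exact: cg.
  - exists (g @^-1` closure Omega); first by apply: closed_comp => [t _|]; [exact: cg|exact: closed_closure].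
    apply/seteqP; split => t [] /=; rewrite in_itv/= => h1 h2; split => //.
      exact: subset_closure.
    by apply: closure_cases => //; [exact: HO|exact: HG].
move=> /seteqP[_ /(_ 1)]; rewrite /= in_itv/= lexx ler01 => /(_ isT)[_].
by rewrite /preimage/= /g scale1r addrC subrK.
Qed.

(** If [y] were in the closure it would be in [Omega], and the previous lemma along the reversed
    segment would put [x] there. *)
Lemma segment_NOmega x y : (forall t, 0 <= t <= 1 -> O (x + t *: (y - x))) ->
  (forall t, 0 <= t <= 1 -> ~ Gam (x + t *: (y - x))) -> ~ closure Omega x -> ~ closure Omega y.
Proof.
move=> HO HG nx cy; apply: nx; apply: subset_closure; apply: (@segment_Omega y x).
- move=> t /andP[t0 t1]; have -> : y + t *: (x - y) = x + (1 - t) *: (y - x).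
    by apply/rowP => i; rewrite !mxE; ring.
  by apply: HO; rewrite subr_ge0 t1 lerBlDr lerDl.
- move=> t /andP[t0 t1]; have -> : y + t *: (x - y) = x + (1 - t) *: (y - x).
    by apply/rowP => i; rewrite !mxE; ring.
  by apply: HG; rewrite subr_ge0 t1 lerBlDr lerDl.
- have E : y = x + 1 *: (y - x) by rewrite scale1r addrC subrK.
  by apply: closure_cases => //; rewrite E; [apply: HO|apply: HG]; rewrite lexx ler01.
Qed.

Section cone.
Variables (p : 'rV[R]_m) (b rho : R).
Hypothesis Gp : Gam p.
Hypothesis b01 : 0 <= b < 1.
Hypothesis rho0 : 0 < rho.
Hypothesis ballO : eball p rho `<=` O.
Hypothesis cone_ineq : forall xi, Gam xi -> enorm (xi - p) < rho ->
  `|dotp (xi - p) (N p)| <= b * enorm (xi - p).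

(** The region [b |v| < sg (v . N)] is convex, the left side being convex and the right side linear
    in [v]; it is disjoint from the cone that contains the surface. *)
Lemma cone_segment (sg : R) (v w : 'rV[R]_m) t : `|sg| = 1 -> enorm v < rho -> enorm w < rho ->
  b * enorm v < sg * dotp v (N p) -> b * enorm w < sg * dotp w (N p) -> 0 <= t <= 1 ->
  O ((p + v) + t *: ((p + w) - (p + v))) /\ ~ Gam ((p + v) + t *: ((p + w) - (p + v))).
Proof.
move=> sg1 vr wr hv hw /andP[t0 t1].
set u := (1 - t) *: v + t *: w.
have -> : (p + v) + t *: ((p + w) - (p + v)) = p + u.
  by apply/rowP => i; rewrite !mxE; ring.
have t1' : 0 <= 1 - t by rewrite subr_ge0.
have nu : enorm u <= (1 - t) * enorm v + t * enorm w.
  by apply: le_trans (ler_enormD _ _) _; rewrite !enormZ !ger0_norm.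
have du : sg * dotp u (N p) = (1 - t) * (sg * dotp v (N p)) + t * (sg * dotp w (N p)).
  by rewrite dotpDl !dotpZl; ring.
have comb (a1 a2 c1 c2 : R) : a1 < c1 -> a2 < c2 -> (1 - t) * a1 + t * a2 < (1 - t) * c1 + t * c2.
  move=> h1 h2; have [->|tn] := eqVneq t 0; first by rewrite subr0; lra.
  by apply: ler_ltD; [rewrite ler_wpM2l// ltW|rewrite ltr_pM2l// lt_neqAle eq_sym tn].
have ur : enorm u < rho.
  by apply: le_lt_trans nu _; have := comb _ _ _ _ vr wr; lra.
have hu : b * enorm u < sg * dotp u (N p).
  rewrite du; apply: le_lt_trans (comb _ _ _ _ hv hw).
  have b0 : 0 <= b by case/andP: b01.
  by apply: le_trans (ler_wpM2l b0 nu) _; lra.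
split; first by apply: ballO; rewrite /eball/= addrC addKr.
move=> G; have := cone_ineq G; rewrite (_ : p + u - p = u); last by rewrite addrC addKr.
move=> /(_ ur); rewrite leNgt => /negP; apply; apply: lt_le_trans hu _.
by apply: le_trans (ler_norm _) _; rewrite normrM sg1 mul1r.
Qed.

Lemma small_normal : exists2 e : R, 0 < e < rho &
  Omega (p - e *: N p) /\ ~ closure Omega (p + e *: N p).
Proof.
have [e0 e00 h] := N_sides Gp; pose e := Num.min (e0 / 2) (rho / 2).
have e_gt0 : 0 < e by rewrite lt_min !divr_gt0.
have e_e0 : e < e0 by rewrite gt_min; apply/orP; left; lra.
have e_rho : e < rho by rewrite gt_min; apply/orP; right; move: rho0; lra.
by exists e; [rewrite e_gt0|apply: h; rewrite e_gt0].
Qed.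

(** Inside the convex region above the cone, [p + v] is joined to a point [p + e N(p)] of the
    normal, which is known to be outside. *)
Lemma cone_out v : enorm v < rho -> b * enorm v < dotp v (N p) -> ~ closure Omega (p + v).
Proof.
move=> vr hv; have [e /andP[e0 er] [_ no]] := small_normal.
have eN : enorm (e *: N p) = e by rewrite enormZ N_unit// mulr1 gtr0_norm.
have he : b * enorm (e *: N p) < 1 * dotp (e *: N p) (N p).
  rewrite eN dotpZl -enorm_sqr N_unit// expr1n mul1r mulr1; case/andP: b01 => _ b1.
  by rewrite gtr_pMl.
rewrite -eN in er.
rewrite -(mul1r (dotp v _)) in hv; have n1 : `|1 : R| = 1 by rewrite normr1.
apply: segment_NOmega no => t ht.
  by have [] := cone_segment n1 er vr he hv ht.
by have [] := cone_segment n1 er vr he hv ht.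
Qed.

Lemma cone_in v : enorm v < rho -> dotp v (N p) < - (b * enorm v) -> Omega (p + v).
Proof.
move=> vr hv; have [e /andP[e0 er] [yo _]] := small_normal.
have eN : enorm (- (e *: N p)) = e by rewrite enormN enormZ N_unit// mulr1 gtr0_norm.
have he : b * enorm (- (e *: N p)) < -1 * dotp (- (e *: N p)) (N p).
  rewrite eN dotpNl dotpZl -enorm_sqr N_unit// expr1n mulN1r opprK mulr1; case/andP: b01 => _ b1.
  by rewrite gtr_pMl.
rewrite -eN in er; rewrite ltrNr -mulN1r in hv.
have n1 : `|-1 : R| = 1 by rewrite normrN normr1.
apply: segment_Omega yo => t ht.
  by have [] := cone_segment n1 er vr he hv ht.
by have [] := cone_segment n1 er vr he hv ht.
Qed.

End cone.

Lemma eball_orthant p : O p -> exists2 rho : R, 0 < rho & eball p rho `<=` O.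
Proof. exact: open_enormP (@orthant_open R m n). Qed.

Lemma tangent_cone p b : Gam p -> 0 < b -> exists2 rho : R, 0 < rho &
  eball p rho `<=` O /\ forall xi, Gam xi -> enorm (xi - p) < rho ->
  `|dotp (xi - p) (N p)| <= b * enorm (xi - p).
Proof.
move=> Gp b0; have [r1 r10 h1] := eball_orthant (Gam_orthant Gp).
have /cvgr0Pnorm_le/(_ _ b0) := N_tangent Gp.
rewrite near_withinE => /nbhs_eballP[r2 r20 h2].
exists (Num.min r1 r2); first by rewrite lt_min r10.
split; first by move=> x; rewrite /eball/= lt_min => /andP[xr _]; exact: h1.
move=> xi Gxi; rewrite lt_min => /andP[_ xr].
have [->|xp] := eqVneq xi p; first by rewrite subrr dotp0l normr0 enorm0 mulr0.
have n0 : 0 < enorm (xi - p) by rewrite enorm_gt0 subr_eq0.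
have := h2 _ xr; rewrite /= => /(_ (conj Gxi _)); rewrite normrM normfV (ger0_norm (enorm_ge0 _)) ler_pdivrMr//.
by apply; move=> e; rewrite e eqxx in xp.
Qed.

(** For a cone slope [b] below [(w . N) / |w|] the direction [w] points above the cone and [- w]
    below it, so the line passes from [Omega] to the exterior at [p]. *)
Lemma crossing p w : Gam p -> 0 < dotp w (N p) -> exists2 e : R, 0 < e &
  forall t, 0 < t < e -> Omega (p - t *: w) /\ ~ closure Omega (p + t *: w).
Proof.
move=> Gp hw.
have w0 : 0 < enorm w.
  by rewrite enorm_gt0; apply: contraTneq hw => ->; rewrite dotp0l ltxx.
pose b := Num.min (1 / 2) (dotp w (N p) / (2 * enorm w)).
have b0 : 0 < b by rewrite lt_min divr_gt0//= divr_gt0// mulr_gt0.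
have b1 : 0 <= b < 1 by rewrite ltW//= gt_min; apply/orP; left; lra.
have bw : b * enorm w < dotp w (N p).
  apply: (@le_lt_trans _ _ (dotp w (N p) / (2 * enorm w) * enorm w)).
    by apply: ler_wpM2r; [exact: enorm_ge0|rewrite ge_min lexx orbT].
  have -> : dotp w (N p) / (2 * enorm w) * enorm w = dotp w (N p) / 2 by field; exact: lt0r_neq0.
  lra.
have [rho rho0 [ballO cone]] := tangent_cone Gp b0.
exists (rho / enorm w); first by rewrite divr_gt0.
move=> t /andP[t0]; rewrite ltr_pdivlMr// => tw; split.
  rewrite -scaleNr; apply: (cone_in Gp b1 rho0 ballO cone); first by rewrite enormZ normrN gtr0_norm.
  by rewrite enormZ normrN gtr0_norm// dotpZl mulNr ltrN2 mulrCA ltr_pM2l.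
apply: (cone_out Gp b1 rho0 ballO cone); first by rewrite enormZ gtr0_norm.
by rewrite enormZ gtr0_norm// dotpZl mulrCA ltr_pM2l.
Qed.

(** Just after [xi] the segment is outside. Where it first meets the closure again, at time [t0], it
    cannot be in the open set [Omega], hence it is on [Gam]; there the positive normal component
    means that it arrives from [Omega], yet just before [t0] it is outside. *)
Lemma single_crossing xi w : (forall t, 0 <= t <= 1 -> O (xi + t *: w)) ->
  (forall t, 0 <= t <= 1 -> Gam (xi + t *: w) -> 0 < dotp w (N (xi + t *: w))) ->
  Gam xi -> Gam (xi + w) -> False.
Proof.
move=> HO HN Gxi Gw; have cg : continuous (fun t : R => xi + t *: w) by exact: line_continuous.
have [e0 e00 he] : exists2 e : R, 0 < e & forall t, 0 < t < e -> ~ closure Omega (xi + t *: w).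
  have h : 0 < dotp w (N xi) by have := HN 0; rewrite scale0r addr0 lexx ler01; exact.
  by have [e e_gt0 H] := crossing Gxi h; exists e => // t /H[].
pose T := [set t : R | 0 < t <= 1 /\ closure Omega (xi + t *: w)].
have T1 : T 1 by split; rewrite ?ltr01 ?lexx// scale1r; exact: Gam_closure.
have Te t : T t -> e0 <= t.
  by move=> [/andP[t0 t1] ct]; rewrite leNgt; apply/negP => te; apply: (he t) => //; rewrite t0.
have hT : has_inf T by split; [exists 1|exists e0 => t /Te].
pose t0 := inf T.
have t0e : e0 <= t0 by apply: lb_le_inf; [exists 1|move=> t /Te].
have t01 : t0 <= 1 by apply: ge_inf => //; case: hT.
have t00 : 0 < t0 by exact: lt_le_trans t0e.
have ct0 : closure Omega (xi + t0 *: w).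
  apply: contrapT => nc.
  have : nbhs t0 ((fun t : R => xi + t *: w) @^-1` (~` closure Omega)).
    apply: cg; apply: open_nbhs_nbhs; split => //; apply: closed_openC; exact: closed_closure.
  move=> /nbhs_ballP[e /= e_gt0 H].
  have [t Tt te] := inf_adherent e_gt0 hT.
  have tt : t0 <= t by apply: ge_inf => //; case: hT.
  have : ball t0 e t by rewrite /ball/= distrC ger0_norm ?subr_ge0// ltrBlDl.
  by move=> /H h; exact: h (proj2 Tt).
have below e : 0 < e -> exists2 t, 0 < t < e & t < t0 /\ ~ closure Omega (xi + (t0 - t) *: w).
  move=> e_gt0; pose t := Num.min (e / 2) (t0 / 2).
  have tt0 : t < t0 by rewrite gt_min; apply/orP; right; lra.
  have t_gt0 : 0 < t by rewrite lt_min !divr_gt0.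
  exists t; first by rewrite t_gt0/= gt_min; apply/orP; left; lra.
  split => // ct; have : T (t0 - t) by split => //; lra.
  by move=> /(ge_inf (proj2 hT)); rewrite -/t0; lra.
have [Ot|nOt] := pselect (Omega (xi + t0 *: w)).
  have : nbhs t0 ((fun t : R => xi + t *: w) @^-1` Omega).
    by apply: cg; exact: open_nbhs_nbhs.
  move=> /nbhs_ballP[e /= e_gt0 H]; have [t /andP[t_gt0 te] [tt0]] := below _ e_gt0.
  apply; apply: subset_closure; apply: H.
  by rewrite /ball/= opprB addrC subrK gtr0_norm.
have t01' : 0 <= t0 <= 1 by rewrite ltW.
have Gt : Gam (xi + t0 *: w) by rewrite GamE; split => //; exact: HO.
have [e e_gt0 H] := crossing Gt (HN _ t01' Gt).
have [t te [tt0]] := below _ e_gt0; apply; apply: subset_closure.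
by have [] := H _ te; rewrite scalerBl addrA.
Qed.

(** If the bound failed, [w = xi - y] or its opposite would satisfy [w . N0 > b |w|], hence have a
    positive product with every vector within [b] of [N0], in particular with all normals met on the
    segment. This contradicts [single_crossing]. *)
Lemma cone_bound xi y N0 b : (forall t, 0 <= t <= 1 -> O (y + t *: (xi - y))) ->
  (forall t, 0 <= t <= 1 -> Gam (y + t *: (xi - y)) -> enorm (N (y + t *: (xi - y)) - N0) <= b) ->
  Gam xi -> Gam y -> `|dotp (xi - y) N0| <= b * enorm (xi - y).
Proof.
move=> HO HN Gxi Gy; rewrite leNgt; apply/negP => H.
have pos (w v : 'rV[R]_m) : enorm (v - N0) <= b -> b * enorm w < dotp w N0 -> 0 < dotp w v.
  move=> hv hw; have -> : v = N0 + (v - N0) by rewrite addrC subrK.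
  rewrite dotpDr; have := cauchy_schwarz w (v - N0); rewrite ler_norml => /andP[h1 _].
  have := ler_wpM2l (enorm_ge0 w) hv; lra.
case/orP: (le_total 0 (dotp (xi - y) N0)) => h; [rewrite ger0_norm// in H|rewrite ler0_norm// in H].
  apply: (@single_crossing y (xi - y)) => //; last by rewrite addrC subrK.
  by move=> t ht Gt; apply: pos H; exact: HN.
have E t : xi + t *: (y - xi) = y + (1 - t) *: (xi - y).
  by apply/rowP => i; rewrite !mxE; ring.
have ht (t : R) : 0 <= t <= 1 -> 0 <= 1 - t <= 1 by lra.
apply: (@single_crossing xi (y - xi)) => //; last by rewrite addrC subrK.
  by move=> t t01; rewrite E; apply: HO; exact: ht.
move=> t t01; rewrite E => Gt; apply: (@pos _ _ (HN _ (ht _ t01) Gt)).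
by rewrite enormC -dotpNl opprB in H.
Qed.

End surface_geometry.

(** * Angles between normals and coordinates adapted to a normal *)

Lemma sin_le_id (R : realType) (x : R) : 0 <= x -> sin x <= x.
Proof.
rewrite le_eqVlt => /predU1P[<-|x0]; first by rewrite sin0.
have [c _] := @MVT_segment R sin cos 0 x (ltW x0) (fun y _ => is_derive_sin y) (continuous_subspaceT (@continuous_sin R)).
by rewrite sin0 !subr0 => ->; rewrite ler_piMl ?cos_le1// ltW.
Qed.

(** The left side is [4 sin^2 (x / 2)]. It is also the squared chord between unit vectors at angle
    [x], so angle bounds become bounds on differences of normals. *)
Lemma one_sub_cos_le (R : realType) (x : R) : 0 <= x -> x <= pi -> 2 - 2 * cos x <= x ^+ 2.
Proof.
move=> x0 xpi; have E : x = x / 2 + x / 2 by field.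
have h : sin (x / 2) ^+ 2 <= (x / 2) ^+ 2.
  rewrite ler_sqr ?nnegrE; [|rewrite sin_ge0_pi//; lra|lra].
  by apply: sin_le_id; lra.
have cx : cos x = cos (x / 2 + x / 2) by rewrite -E.
have := cos2Dsin2 (x / 2); rewrite cx cosD -!expr2; lra.
Qed.

Section frame.
Variables (R : realType) (s : nat) (N0 : 'rV[R]_s.+1).
Hypothesis N01 : enorm N0 = 1.

Definition e0 : 'rV[R]_s.+1 := ins ord0 1 0.
(** The Householder reflection exchanging [e0] and [N0]. When [N0 = e0] the denominator is 0, but
    the quotient multiplies the zero vector and [hh] is the identity. *)
Definition hh (x : 'rV[R]_s.+1) : 'rV[R]_s.+1 :=
  x - (2 * dotp x (N0 - e0) / dotp (N0 - e0) (N0 - e0)) *: (N0 - e0).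
(** Coordinates of the orthogonal projection onto the hyperplane normal to [N0]; [temb] is the
    matching isometric embedding. *)
Definition tproj (x : 'rV[R]_s.+1) : 'rV[R]_s := \row_k hh x ord0 (lift ord0 k).
Definition temb (z : 'rV[R]_s) : 'rV[R]_s.+1 := hh (ins ord0 0 z).

Lemma hhB x y : hh (x - y) = hh x - hh y.
Proof. by rewrite /hh (dotpBl x y); apply/rowP => i; rewrite !mxE; ring. Qed.

Lemma hh_dot x y : dotp (hh x) (hh y) = dotp x y.
Proof.
rewrite /hh; move: (N0 - e0) => u; have [->|u0] := eqVneq u 0; first by rewrite !scaler0 !subr0.
have uu : dotp u u != 0 by rewrite -enorm_sqr expf_neq0// lt0r_neq0// enorm_gt0.
rewrite dotpBl !dotpBr !dotpZl !dotpZr (dotpC u y); field; exact: uu.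
Qed.

Lemma hh_K x : hh (hh x) = x.
Proof.
rewrite /hh; move: (N0 - e0) => u; have [->|u0] := eqVneq u 0.
  by rewrite !scaler0 !subr0.
have uu : dotp u u != 0 by rewrite -enorm_sqr expf_neq0// lt0r_neq0// enorm_gt0.
rewrite dotpBl dotpZl; apply/rowP => i; rewrite !mxE; field; exact: uu.
Qed.

Lemma dotp_e0 x : dotp x e0 = x ord0 ord0.
Proof. by rewrite -{1}(ins_row x ord0) /e0 dotp_ins dotp0r mulr1 addr0. Qed.

Lemma hh_e0 : hh e0 = N0.
Proof.
rewrite /hh; set u := N0 - e0; have [u0|u0] := eqVneq u 0.
  by rewrite u0 scaler0 subr0; apply/esym/eqP; rewrite -subr_eq0 -/u u0.
have uu : dotp u u != 0 by rewrite -enorm_sqr expf_neq0// lt0r_neq0// enorm_gt0.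
have NN : dotp N0 N0 = 1 by rewrite -enorm_sqr N01 expr1n.
have ee : dotp e0 e0 = 1 by rewrite /e0 dotp_ins dotp0r mulr1 addr0.
have E : 2 * dotp e0 u = - dotp u u.
  rewrite /u dotpBr dotpBl !dotpBr NN ee (dotpC e0 N0); ring.
by rewrite E mulNr divff// scaleN1r opprK /u addrC subrK.
Qed.

Lemma hh_first x : hh x ord0 ord0 = dotp x N0.
Proof. by rewrite -dotp_e0 -[in RHS](hh_K x) -[in RHS]hh_e0 hh_dot. Qed.

Lemma enorm_frame x : enorm x ^+ 2 = enorm (tproj x) ^+ 2 + dotp x N0 ^+ 2.
Proof.
rewrite [LHS]enorm_sqr -(hh_dot x x) -enorm_sqr -(ins_row (hh x) ord0) enorm_ins_sqr hh_first.
by rewrite addrC.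
Qed.

Lemma tprojB x y : tproj (x - y) = tproj x - tproj y.
Proof. by apply/rowP => k; rewrite /tproj hhB !mxE. Qed.

Lemma tproj_le x y : enorm (tproj x - tproj y) <= enorm (x - y).
Proof.
rewrite -tprojB -ler_sqr ?nnegrE ?enorm_ge0// (enorm_frame (x - y)) lerDl; exact: sqr_ge0.
Qed.

Lemma tproj_temb z : tproj (temb z) = z.
Proof. by apply/rowP => k; rewrite /tproj /temb hh_K mxE ins_lift. Qed.

Lemma dotp_temb z : dotp (temb z) N0 = 0.
Proof. by rewrite -hh_first /temb hh_K ins_same. Qed.

Lemma tproj_normal a : tproj (a *: N0) = 0.
Proof.
apply: enorm_eq0; apply/eqP; rewrite -sqrf_eq0; apply/eqP.
have := enorm_frame (a *: N0); rewrite enormZ N01 mulr1 dotpZl -enorm_sqr N01 expr1n mulr1.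
by rewrite real_normK ?num_real//; lra.
Qed.

Lemma tprojD x y : tproj (x + y) = tproj x + tproj y.
Proof.
have := tprojB (x + y) y; rewrite addrK => ->; by rewrite subrK.
Qed.

End frame.

(** * Local shape of a Lyapunov surface *)

Section lyapunov_geometry.
Variables (R : realType) (s n : nat) (Omega Gam : set 'rV[R]_s.+2) (N : 'rV[R]_s.+2 -> 'rV[R]_s.+2).
Variables (a kap : R).
Local Notation m := s.+2.
Local Notation O := (@orthant R m n).
Hypothesis Omega_open : open Omega.
Hypothesis GamE : Gam = (closure Omega `\` Omega) `&` O.
Hypothesis N_unit : forall t, Gam t -> enorm (N t) = 1.
Hypothesis N_tangent : forall t, Gam t ->
     (fun xi => dotp (xi - t) (N t) / enorm (xi - t)) x
        @[x --> within (Gam `\ t) (nbhs t)] --> 0.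
Hypothesis N_sides : forall t, Gam t -> exists2 e0 : R, 0 < e0 &
     forall e : R, 0 < e < e0 ->
       Omega (t - e *: N t) /\ ~ closure Omega (t + e *: N t).
Hypothesis a0 : 0 < a.
Hypothesis kap0 : 0 < kap.
Hypothesis N_acos : forall x xi, Gam x -> Gam xi ->
  acos (dotp (N x) (N xi)) <= a * enorm (x - xi) `^ kap.

Lemma normal_holder x xi : Gam x -> Gam xi -> enorm (N x - N xi) <= a * enorm (x - xi) `^ kap.
Proof.
move=> Gx Gxi; apply: le_trans (N_acos Gx Gxi).
have := cauchy_schwarz (N x) (N xi); rewrite !N_unit// mulr1 ler_norml => h.
have [/andP[h0 hpi] hc] := acos_def h.
rewrite -ler_sqr ?nnegrE ?enorm_ge0//; apply: le_trans (one_sub_cos_le h0 hpi); rewrite hc.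
rewrite enorm_sqr dotpBl !dotpBr -!enorm_sqr !N_unit// (dotpC (N xi)); lra.
Qed.

(** A segment between two points of the ball about [p] stays in the ball, so every normal met on it
    differs from [N p] by at most [a * rho^kap], and [cone_bound] applies. *)
Lemma patch_cone (p : 'rV[R]_m) (b rho : R) xi y : Gam p -> 0 <= rho -> a * rho `^ kap <= b ->
  Gam xi -> Gam y -> enorm (xi - p) <= rho -> enorm (y - p) <= rho ->
  `|dotp (xi - y) (N p)| <= b * enorm (xi - y).
Proof.
move=> Gp rho0 hb Gxi Gy xp yp.
have Ox := Gam_orthant GamE Gxi; have Oy := Gam_orthant GamE Gy.
apply: (cone_bound Omega_open GamE N_unit N_tangent N_sides) => // t ht; first exact: orthant_convex.
move=> Gt; apply: le_trans hb; apply: le_trans (normal_holder Gt Gp) _.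
rewrite ler_pM2l// ge0_ler_powR ?nnegrE ?enorm_ge0 ?(ltW kap0)//.
exact: ecball_convex.
Qed.

(** [patch_cone] centred at [xi] itself with radius [|xi - y|], so that the slope is
    [a |xi - y|^kap]. *)
Lemma lyapunov_ineq xi y : Gam xi -> Gam y ->
  `|dotp (xi - y) (N xi)| <= a * enorm (xi - y) `^ kap * enorm (xi - y).
Proof.
move=> Gxi Gy; apply: (@patch_cone xi _ (enorm (xi - y))) => //.
- exact: enorm_ge0.
- by rewrite subrr enorm0 enorm_ge0.
- by rewrite enormC.
Qed.

(** The points over the tangent vector [z] at normal heights [lam] and [- lam] lie beyond the cone
    of slope [b], one outside and one in [Omega]; the segment between them must meet [Gam]. *)
Lemma surface_over_tangent (p : 'rV[R]_m) (b rho : R) (z : 'rV[R]_s.+1) :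
  Gam p -> 0 < rho -> a * rho `^ kap <= b -> 0 < b -> 2 * b < 1 ->
  eball p rho `<=` O -> enorm z < rho * Num.sqrt (1 - (2 * b) ^+ 2) ->
  exists xi, [/\ Gam xi, enorm (xi - p) < rho & tproj (N p) (xi - p) = z].
Proof.
move=> Gp rho0 hb b0 b1 ballO hz.
have cone xi : Gam xi -> enorm (xi - p) < rho -> `|dotp (xi - p) (N p)| <= b * enorm (xi - p).
  move=> Gxi h; apply: (patch_cone Gp (ltW rho0) hb) => //; first exact: ltW.
  by rewrite subrr enorm0 ltW.
have [->|z0] := eqVneq z 0.
  exists p; split => //; first by rewrite subrr enorm0.
  by rewrite subrr; have := tproj_normal (N_unit Gp) 0; rewrite scale0r.
set q := Num.sqrt (1 - (2 * b) ^+ 2) in hz.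
have q2 : 0 < 1 - (2 * b) ^+ 2.
  by rewrite subr_gt0 expr_lt1// ltW// mulr_gt0.
have q0 : 0 < q by rewrite sqrtr_gt0.
have qq : q ^+ 2 = 1 - (2 * b) ^+ 2 by rewrite sqr_sqrtr// ltW.
have zn : 0 < enorm z by rewrite enorm_gt0.
(* The height [2 b r] exceeds the height [b r] of the cone, and [(r q)^2 + lam^2 = r^2] puts both
   ends at distance exactly [r] from [p]. *)
pose r := enorm z / q; pose lam := 2 * b * r.
have r0 : 0 < r by rewrite divr_gt0.
have zE : enorm z = r * q by rewrite /r divfK// lt0r_neq0.
have rr : r < rho by rewrite /r ltr_pdivrMr.
have nv (c : R) : enorm (temb (N p) z + c *: N p) ^+ 2 = (r * q) ^+ 2 + c ^+ 2.
  rewrite (enorm_frame (N_unit Gp)) tprojD tproj_temb (tproj_normal (N_unit Gp)) addr0 zE.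
  by rewrite dotpDl (dotp_temb (N_unit Gp)) add0r dotpZl -enorm_sqr N_unit// expr1n mulr1.
have nvr (c : R) : `|c| = lam -> enorm (temb (N p) z + c *: N p) = r.
  move=> hc; apply/eqP; rewrite -(eqrXn2 (n := 2)) ?enorm_ge0 ?(ltW r0)// nv.
  by rewrite -(@real_normK _ c) ?num_real// hc /lam exprMn qq; apply/eqP; ring.
have dv (c : R) : dotp (temb (N p) z + c *: N p) (N p) = c.
  by rewrite dotpDl (dotp_temb (N_unit Gp)) add0r dotpZl -enorm_sqr N_unit// expr1n mulr1.
have lam0 : 0 < lam by apply: mulr_gt0 => //; exact: mulr_gt0.
have b01 : 0 <= b < 1 by rewrite ltW//=; lra.
have blam : b * r < lam by have := mulr_gt0 b0 r0; rewrite /lam -mulrA; lra.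
have h1 : ~ closure Omega (p + (temb (N p) z + lam *: N p)).
  apply: (cone_out Omega_open GamE N_unit N_sides Gp b01 rho0 ballO cone).
    by rewrite nvr ?gtr0_norm.
  by rewrite nvr ?gtr0_norm// dv.
have h2 : Omega (p + (temb (N p) z + (- lam) *: N p)).
  apply: (cone_in Omega_open GamE N_unit N_sides Gp b01 rho0 ballO cone).
    by rewrite nvr ?normrN ?gtr0_norm.
  by rewrite nvr ?normrN ?gtr0_norm// dv ltrN2.
set x := p + _ in h2; set y := p + _ in h1.
have seg t : x + t *: (y - x) = p + (temb (N p) z + ((2 * t - 1) * lam) *: N p).
  by apply/rowP => i; rewrite !mxE; ring.
have segn t : 0 <= t <= 1 -> enorm (x + t *: (y - x) - p) < rho.
  move=> ht; rewrite seg [X in enorm X]addrC addKr.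
  apply: le_lt_trans rr; rewrite -ler_sqr ?nnegrE ?enorm_ge0 ?(ltW r0)// nv.
  have : ((2 * t - 1) * lam) ^+ 2 <= lam ^+ 2.
    rewrite exprMn ler_piMl ?sqr_ge0// -(@real_normK _ (2 * t - 1)) ?num_real//.
    by rewrite exprn_ile1// ler_norml; lra.
  have : lam ^+ 2 = r ^+ 2 * (2 * b) ^+ 2 by rewrite /lam; ring.
  have -> : (r * q) ^+ 2 = r ^+ 2 * q ^+ 2 by rewrite exprMn.
  rewrite qq; lra.
apply: contrapT => no; apply: h1; apply: subset_closure.
apply: (segment_Omega Omega_open GamE _ _ h2) => t ht; first by apply: ballO; exact: segn.
move=> Gt; apply: no; exists (x + t *: (y - x)); split => //; first exact: segn.
by rewrite seg [X in tproj _ X]addrC addKr tprojD tproj_temb tproj_normal ?N_unit// addr0.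
Qed.

(** With [y] a point of [Gam] nearest to [x], the open ball about [x] of radius [d] misses [Gam] and
    lies on one side. If [x - y] were not the expected multiple of [N y], some direction would enter
    this ball from [y] while crossing the surface towards the other side. *)
Lemma nearest_point t : Gam t -> exists2 e : R, 0 < e & forall x, enorm (x - t) < e -> ~ Gam x ->
  exists y d, [/\ Gam y, 0 < d, d <= enorm (x - t), enorm (y - t) <= 2 * enorm (x - t) &
   (Omega x -> x = y - d *: N y) /\ (~ closure Omega x -> x = y + d *: N y)].
Proof.
move=> Gt; have [r r0 rO] := eball_orthant (Gam_orthant GamE Gt).
exists (r / 2); first by rewrite divr_gt0.
move=> x xt nGx; pose r1 := enorm (x - t).
have xtO y : enorm (y - x) <= r1 -> O y.
  move=> yx; apply: rO; rewrite /eball/=; have := enorm_triangle x y t; rewrite /r1 in yx; lra.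
(* [Gam] is closed only relative to the orthant; its part in a closed ball inside the orthant is
   compact. *)
pose A := (closure Omega `&` ~` Omega) `&` ecball x r1.
have AG y : A y <-> Gam y /\ enorm (y - x) <= r1.
  split; first by move=> [[cy ny] yx]; split => //; rewrite GamE; split => //; exact: xtO.
  by move=> [Gy yx]; split => //; split; [exact: (Gam_closure GamE Gy)|exact: (Gam_NOmega GamE Gy)].
have At : A t by apply/AG; split => //; rewrite enormC.
have cA : compact A.
  apply: (@compact_ecball _ _ x r1); last by move=> y [].
  apply: closedI; last exact: closed_ecball.
  by apply: closedI; [exact: closed_closure|exact: open_closedC].
have [|y yA ymin] := @compact_EVT_min _ R (fun y : 'rV[R]_m => enorm (y - x)) A (ex_intro _ t At) cA.
  by apply: continuous_subspaceT; exact: dist_continuous.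
rewrite inE in yA; have /AG[Gy yx] := yA.
have ymin' eta : Gam eta -> enorm (y - x) <= enorm (eta - x).
  move=> Geta; case: (leP (enorm (eta - x)) r1) => h; last by apply: le_trans yx (ltW h).
  by apply: ymin; rewrite inE; apply/AG.
pose d := enorm (x - y).
have d0 : 0 < d.
  by rewrite enorm_gt0 subr_eq0; apply/eqP => e; apply: nGx; rewrite e.
have dr : d <= r1 by rewrite /d enormC.
have [u uE] : exists u : 'rV[R]_m, u = x - y by exists (x - y).
have NN : dotp (N y) (N y) = 1 by rewrite -enorm_sqr N_unit// expr1n.
have uu : dotp u u = d ^+ 2 by rewrite -enorm_sqr uE.
have inball (w : 'rV[R]_m) : 0 < dotp w u -> exists2 e : R, 0 < e & forall t, 0 < t < e ->
    enorm (y + t *: w - x) < d.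
  move=> wu; have w0 : 0 < dotp w w.
    rewrite -enorm_sqr exprn_gt0// enorm_gt0; apply: contraTneq wu => ->.
    by rewrite dotp0l ltxx.
  exists (dotp w u / dotp w w); first by rewrite divr_gt0.
  move=> tt /andP[t0 te]; rewrite -ltr_sqr ?nnegrE ?enorm_ge0 ?(ltW d0)//.
  rewrite (_ : y + tt *: w - x = tt *: w - u); last by rewrite uE; apply/rowP => i; rewrite !mxE; ring.
  rewrite enorm_sqr dotpBl !dotpBr !dotpZl !dotpZr (dotpC u w) uu.
  rewrite ltr_pdivlMr// in te.
  have := ltr_pM2l t0 (tt * dotp w w) (dotp w u); rewrite te => h.
  have := mulr_gt0 t0 wu; lra.
have segO z t' : enorm (z - x) < d -> 0 <= t' <= 1 -> O (x + t' *: (z - x)) /\ ~ Gam (x + t' *: (z - x)).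
  move=> zx /andP[t0 t1].
  have h : enorm (x + t' *: (z - x) - x) < d.
    rewrite [X in enorm X]addrC addKr enormZ ger0_norm//.
    by apply: le_lt_trans zx; rewrite ler_piMl ?enorm_ge0.
  split; first by apply: xtO; apply: le_trans (ltW h) dr.
  by move=> /ymin'; rewrite leNgt (enormC y) -/d h.
(* The offending direction is [w = u / d - sg N(y)]. Both signs follow from [sg (u . N(y)) < d], the
   strict Cauchy-Schwarz inequality when [u] is not [sg d N(y)]. *)
have key (sg : R) : `|sg| = 1 -> u != sg *: (d *: N y) -> 0 < dotp (d^-1 *: u - sg *: N y) u /\
    sg * dotp (d^-1 *: u - sg *: N y) (N y) < 0.
  move=> sg1 une; have sg2 : sg * sg = 1 by rewrite -expr2 -(@real_normK _ sg) ?num_real// sg1 expr1n.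
  rewrite !dotpBl !dotpZl NN uu.
  have lt1 : sg * dotp u (N y) < d.
    rewrite ltNge; apply/negP => hge; move/eqP: une; apply; apply/eqP; rewrite -subr_eq0; apply/eqP.
    apply: enorm_eq0; apply/eqP; rewrite -sqrf_eq0; apply/eqP/le_anti; rewrite sqr_ge0 andbT.
    rewrite enorm_sqr dotpBl !dotpBr !dotpZl !dotpZr uu NN (dotpC (N y)).
    have := ler_wpM2l (ltW d0) hge; have : sg * (d * (sg * (d * 1))) = d ^+ 2 by transitivity (sg * sg * d ^+ 2); [ring|rewrite sg2 mul1r].
    lra.
  rewrite (dotpC (N y) u).
  have dd : d^-1 * d ^+ 2 = d by rewrite expr2 mulrA mulVf ?mul1r// lt0r_neq0.
  split; first by rewrite dd; lra.
  have -> : sg * (d^-1 * dotp u (N y) - sg * 1) = d^-1 * (sg * dotp u (N y)) - sg * sg by ring.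
  by rewrite sg2 subr_lt0 mulrC ltr_pdivrMr// mul1r.
exists y, d; split => //.
- have := enorm_triangle x y t; rewrite (enormC y x) -/d; move: dr; rewrite /r1; lra.
- split.
  + move=> Ox; have [/eqP E|une] := boolP (u == (-1) *: (d *: N y)).
      by rewrite scaleN1r in E; rewrite -E uE addrC subrK.
    have n1 : `|-1 : R| = 1 by rewrite normrN normr1.
    have [] := key _ n1 une; set w := d^-1 *: u - _ => wu wN; exfalso.
    rewrite mulN1r oppr_lt0 in wN.
    have [e1 e10 H1] := inball _ wu.
    have [e2 e20 H2] := crossing Omega_open GamE N_unit N_tangent N_sides Gy wN.
    pose tt := Num.min (e1 / 2) (e2 / 2).
    have tt0 : 0 < tt by rewrite lt_min !divr_gt0.
    have tt1 : tt < e1 by rewrite gt_min; apply/orP; left; lra.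
    have tt2 : tt < e2 by rewrite gt_min; apply/orP; right; lra.
    have /H2[_] : 0 < tt < e2 by rewrite tt0.
    apply; apply: subset_closure.
    have /H1 zx : 0 < tt < e1 by rewrite tt0.
    by apply: (segment_Omega Omega_open GamE _ _ Ox) => t' /(segO _ _ zx)[].
  + move=> Ox; have [/eqP E|une] := boolP (u == 1 *: (d *: N y)).
      by rewrite scale1r in E; rewrite -E uE addrC subrK.
    have n1 : `|1 : R| = 1 by rewrite normr1.
    have [] := key _ n1 une; set w := d^-1 *: u - _ => wu wN; exfalso.
    rewrite mul1r -oppr_gt0 -dotpNl in wN.
    have [e1 e10 H1] := inball _ wu.
    have [e2 e20 H2] := crossing Omega_open GamE N_unit N_tangent N_sides Gy wN.
    pose tt := Num.min (e1 / 2) (e2 / 2).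
    have tt0 : 0 < tt by rewrite lt_min !divr_gt0.
    have tt1 : tt < e1 by rewrite gt_min; apply/orP; left; lra.
    have tt2 : tt < e2 by rewrite gt_min; apply/orP; right; lra.
    have /H2[] : 0 < tt < e2 by rewrite tt0.
    rewrite scalerN opprK => Oin _.
    have /H1 zx : 0 < tt < e1 by rewrite tt0.
    apply: (segment_NOmega Omega_open GamE _ _ Ox) (subset_closure Oin) => t' /(segO _ _ zx)[] //.
Qed.

(** * Masses of balls for the surface measure *)

Section surface_measure.
Variable sigma : {measure set (borelRm R m) -> \bar R}.
Hypothesis sigmaE : forall A : set (borelRm R m), measurable A -> sigma A = hausdorff (m%:R - 1) (A `&` Gam).
Local Notation hc := (hconst (s.+1%:R : R)).

Lemma measurable_Gam : measurable (Gam : set (borelRm R m)).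
Proof.
rewrite GamE; apply: measurableI; last by apply: open_borelRm; exact: orthant_open.
apply: measurableD; last exact: open_borelRm.
by apply: closed_borelRm; exact: closed_closure.
Qed.

Lemma sigma_hausdorff (A : set (borelRm R m)) : measurable A -> sigma A = hausdorff s.+1%:R (A `&` Gam).
Proof. have E : m%:R - 1 = s.+1%:R :> R by rewrite -(@natr1 R s.+1) addrK.
by move=> mA; rewrite -E; exact: sigmaE. Qed.

Lemma measurable_eball (x : 'rV[R]_m) r : measurable (eball x r : set (borelRm R m)).
Proof. by apply: open_borelRm; exact: open_eball. Qed.

(** On a patch of slope [b] the tangent projection shrinks distances by a factor of at least
    [sqrt (1 - b^2) >= 1 - b], and it maps the ball into a ball of the same radius. *)
Lemma density_upper (p y : 'rV[R]_m) (b rho r : R) : Gam p -> 0 <= rho -> a * rho `^ kap <= b -> b < 1 -> 0 < r ->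
  (sigma (eball p rho `&` ecball y r) <= (hc * (2 * (r / (1 - b))) ^+ s.+1)%:E)%E.
Proof.
move=> Gp rho0 hb b1 r0.
have b0 : 0 <= b by apply: le_trans hb; rewrite mulr_ge0 ?powR_ge0// ltW.
have b1' : 0 < 1 - b by rewrite subr_gt0.
rewrite sigma_hausdorff; last by apply: measurableI; [exact: measurable_eball|exact: closed_borelRm (@closed_ecball _ _ _ _)].
have -> : 2 * (r / (1 - b)) = 2 * (1 - b)^-1 * r by ring.
apply: (@hausdorff_le R s m (tproj (N p)) _ (tproj (N p) y)) => //; first by rewrite invr_gt0.
  move=> x z [[xp _] Gx] [[zp _] Gz].
  have h := patch_cone Gp rho0 hb Gx Gz (ltW xp) (ltW zp).
  have E := enorm_frame (N_unit Gp) (x - z); rewrite tprojB in E.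
  rewrite mulrC ler_pdivlMr// -ler_sqr ?nnegrE ?mulr_ge0 ?enorm_ge0 ?(ltW b1')//.
  have h2 : dotp (x - z) (N p) ^+ 2 <= (b * enorm (x - z)) ^+ 2.
    by rewrite -(@real_normK _ (dotp _ _)) ?num_real// ler_sqr ?nnegrE ?mulr_ge0 ?enorm_ge0.
  rewrite exprMn in h2; rewrite exprMn.
  have : enorm (x - z) ^+ 2 * (1 - b) ^+ 2 <= enorm (x - z) ^+ 2 * (1 - b ^+ 2).
    rewrite ler_wpM2l ?sqr_ge0// -subr_ge0 (_ : _ - _ = 2 * (b * (1 - b))); last by ring.
    by rewrite !mulr_ge0// ltW.
  lra.
by move=> x [[_ xy] _]; apply: le_trans (tproj_le (N_unit Gp) _ _) _.
Qed.

(** The tangent projection is 1-Lipschitz, and its image contains the ball of radius [r (1 - 2 b)]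
    because [1 - 2 b < sqrt (1 - (2 b)^2)]. *)
Lemma density_lower (y : 'rV[R]_m) (b r : R) : Gam y -> 0 < r -> a * r `^ kap <= b -> 2 * b < 1 ->
  eball y r `<=` O -> ((hc * (2 * (r * (1 - 2 * b))) ^+ s.+1)%:E <= sigma (eball y r))%E.
Proof.
move=> Gy r0 hb b1 rO.
have b0 : 0 < b by apply: lt_le_trans hb; rewrite mulr_gt0// powR_gt0.
have r10 : 0 < r * (1 - 2 * b) by rewrite mulr_gt0//; lra.
rewrite sigma_hausdorff; last exact: measurable_eball.
rewrite -(leb_rV_ecballE (tproj (N y) y) r10).
apply: (@hausdorff_ge R m s (tproj (N y))); first exact: (tproj_le (N_unit Gy)).
  exact: measurable_ecball.
move=> z zy; have [|xi [Gxi xiy xiz]] := @surface_over_tangent y b r (z - tproj (N y) y) Gy r0 hb b0 b1 rO.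
  apply: le_lt_trans zy _; rewrite ltr_pM2l//.
  have h1 : 0 <= 1 - 2 * b by lra.
  rewrite -(ger0_norm h1) -sqrtr_sqr ltr_sqrt; last by rewrite subr_gt0 expr_lt1//; lra.
  have := mulr_gt0 b0 (_ : 0 < 1 - 2 * b); rewrite subr_gt0 => /(_ b1); lra.
exists xi => //.
by move: xiz; rewrite tprojB => /addIr.
Qed.

(** A cube containing the bounded surface is cut into finitely many cells of diameter below [rho];
    those that meet [Gam] have finite mass by the density bound at slope 1/2, the others have mass
    0. *)
Lemma sigma_Gam_fin M : (forall x, Omega x -> enorm x <= M) -> (sigma setT < +oo)%E.
Proof.
move=> OM.
have GM x : Gam x -> enorm x < M + 1.
  move=> /(Gam_closure GamE)/closureP_enorm/(_ _ ltr01)[y /OM yM yx].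
  by have := ler_enormD y (x - y); rewrite addrC subrK (enormC x); lra.
(* The solution of [a * rho^kap = 1/2]. *)
pose rho := (2 * a)^-1 `^ (kap^-1).
have a20 : 0 < 2 * a by rewrite mulr_gt0.
have rho0 : 0 < rho by rewrite powR_gt0// invr_gt0.
have hrho : a * rho `^ kap <= 1 / 2.
  rewrite /rho -powRrM mulVf ?lt0r_neq0// powRr1 ?invr_ge0 ?(ltW a20)//.
  by rewrite le_eqVlt; apply/orP; left; apply/eqP; field; exact: lt0r_neq0.
have [[p0 Gp0]|noG] := pselect (Gam !=set0); last first.
  rewrite sigma_hausdorff// setTI (_ : Gam = set0 `&` Gam); last first.
    by rewrite set0I; apply/seteqP; split => // x Gx; apply: noG; exists x.
  by rewrite -sigma_hausdorff// measure0.
have M1 : 0 < M + 1 by apply: le_lt_trans (GM _ Gp0); exact: enorm_ge0.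
pose c0 : 'rV[R]_m := \row_i (- (M + 1)); pose h := 2 * (M + 1).
have h0 : 0 < h by rewrite mulr_gt0.
have sh : 0 < m%:R * h by rewrite mulr_gt0.
have [K K0 hK] := exists_grid (divr_gt0 rho0 sh).
have K0' : 0 < K%:R :> R by rewrite ltr0n.
have t0 : 0 < h / K%:R by rewrite divr_gt0.
have th : m%:R * (h / K%:R) < rho by rewrite mulrA -ltr_pdivlMl// mulrC.
have mc (k : {ffun 'I_m -> 'I_K}) : measurable (cell (subc c0 (h / K%:R) k) (h / K%:R) : set (borelRm R m)).
  exact: measurable_cell.
have -> : sigma setT = sigma (cell c0 h).
  rewrite !sigma_hausdorff//; last exact: measurable_cell.
  congr (hausdorff _ _); rewrite setTI; apply/seteqP; split => [x Gx|x []//]; split => // i.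
  have := le_lt_trans (coord_le_enorm x i) (GM _ Gx); rewrite !mxE ltr_norml /h; lra.
rewrite (cell_grid c0 h0 K0).
have := @measure_finType_bigcup _ _ _ sigma {ffun 'I_m -> 'I_K} (fun _ => true) _ mc (fun k k' x => @cell_disj _ _ c0 _ _ k k' x t0).
rewrite (_ : [set i | true] = setT); last by apply/seteqP; split.
move=> ->; apply: lte_sum_pinfty => k _.
have [[p [cp Gp]]|noG] := pselect (cell (subc c0 (h / K%:R) k) (h / K%:R) `&` Gam !=set0); last first.
  rewrite sigma_hausdorff// (_ : _ `&` _ = set0 `&` Gam); last first.
    by rewrite set0I; apply/seteqP; split => // x Gx; apply: noG; exists x.
  by rewrite -sigma_hausdorff// measure0.
have b12 : 1 / 2 < 1 :> R by lra.
apply: le_lt_trans (ltry (hc * (2 * (rho / (1 - 1 / 2))) ^+ s.+1)).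
apply: le_trans (density_upper p Gp (ltW rho0) hrho b12 rho0).
have mcG : measurable (cell (subc c0 (h / K%:R) k) (h / K%:R) `&` Gam : set (borelRm R m)).
  by apply: measurableI => //; exact: measurable_Gam.
have -> : sigma (cell (subc c0 (h / K%:R) k) (h / K%:R)) = sigma (cell (subc c0 (h / K%:R) k) (h / K%:R) `&` Gam).
  by rewrite (sigma_hausdorff (mc k)) (sigma_hausdorff mcG) -setIA setIid.
apply: le_measure; rewrite ?inE.
- by [].
- by apply: measurableI; [exact: measurable_eball|exact: closed_borelRm (@closed_ecball _ _ _ _)].
- move=> x [cx _]; have hx := le_lt_trans (diam_cell (ltW t0) cx cp) th.
  by split => //; exact: ltW.
Qed.

End surface_measure.

End lyapunov_geometry.

(* Powers as mixtures of exponentials *)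
Local Opaque Gamma.

Section gamma_mixtures.
Variable R : realType.
Local Notation leb := (@lebesgue_measure R).

Lemma tonelli_in d1 d2 (T1 : measurableType d1) (T2 : measurableType d2)
    (m1 : {sigma_finite_measure set T1 -> \bar R}) (m2 : {sigma_finite_measure set T2 -> \bar R})
    (D : set T1) (E : set T2) (F : T1 * T2 -> R) : measurable D -> measurable E ->
  measurable_fun setT F -> (forall x y, D x -> E y -> 0 <= F (x, y)) ->
  (\int[m1]_(x in D) \int[m2]_(y in E) (F (x, y))%:E =
   \int[m2]_(y in E) \int[m1]_(x in D) (F (x, y))%:E)%E.
Proof.
move=> mD mE mF F0.
pose G z := (F z * \1_(D `*` E) z)%:E.
have mG : measurable_fun setT G.
  apply/measurable_EFinP; apply: measurable_funM => //; apply: measurable_indic.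
  exact: measurableX.
have G0 z : (0 <= G z)%E.
  rewrite lee_fin indicE; case: (boolP (z \in _)) => [|_]; last by rewrite mulr0.
  by rewrite inE mulr1; case: z => x y [/= Dx Ey]; exact: F0.
have GE x y : G (x, y) = if (x \in D) && (y \in E) then (F (x, y))%:E else 0%E.
  rewrite /G indicE (_ : (x, y) \in D `*` E = (x \in D) && (y \in E)).
    by case: ifP; rewrite ?mulr1 ?mulr0.
  apply/idP/idP; first by rewrite inE => -[/= Dx Ey]; apply/andP; rewrite !inE.
  by move=> /andP[]; rewrite !inE.
have := @fubini_tonelli _ _ _ _ R m1 m2 G mG G0.
have -> : (\int[m1]_x \int[m2]_y G (x, y) = \int[m1]_(x in D) \int[m2]_(y in E) (F (x, y))%:E)%E.
  rewrite [RHS]integral_mkcond; apply: eq_integral => x _; rewrite patchE; case: ifPn => xD.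
    rewrite [RHS]integral_mkcond; apply: eq_integral => y _; rewrite patchE GE xD /=.
    by case: ifP.
  by rewrite integral0_eq// => y _; rewrite GE (negbTE xD).
move=> ->; rewrite [RHS]integral_mkcond; apply: eq_integral => y _; rewrite patchE; case: ifPn => yE.
  rewrite [RHS]integral_mkcond; apply: eq_integral => x _; rewrite patchE GE yE andbT.
  by case: ifP.
by rewrite integral0_eq// => x _; rewrite GE (negbTE yE) andbF.
Qed.

Lemma measurable_int_param d1 d2 (T1 : measurableType d1) (T2 : measurableType d2)
    (mu : {sigma_finite_measure set T2 -> \bar R}) (D : set T2) (F : T1 * T2 -> R) :
  measurable D -> measurable_fun setT F -> (forall z, 0 <= F z) ->
  measurable_fun setT (fun w => \int[mu]_(x in D) (F (w, x))%:E)%E.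
Proof.
move=> mD mF F0; pose G z := (F z * \1_D z.2)%:E.
have mG : measurable_fun setT G.
  apply/measurable_EFinP; apply: measurable_funM => //.
  exact: (measurableT_comp (measurable_indic mD)).
have G0 z : (0 <= G z)%E by rewrite lee_fin mulr_ge0.
apply: eq_measurable_fun (@measurable_fun_fubini_tonelli_F _ _ _ _ R mu G mG G0) => w _.
rewrite /fubini_F [RHS]integral_mkcond; apply: eq_integral => x _.
by rewrite patchE /G /= indicE; case: (x \in D); rewrite ?mulr1 ?mulr0.
Qed.

(** [Gamma p * f^(-p)] is the integral of [w^(p-1) e^(-w f)] over [w > 0]; Tonelli moves this
    integral outside. For [f] a squared distance only Gaussians remain inside. *)
Lemma gamma_mix d (T : measurableType d) (mu : {sigma_finite_measure set T -> \bar R}) (D : set T)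
    (h f : T -> R) (p : R) : measurable D -> measurable_fun setT h -> measurable_fun setT f ->
  (forall x, D x -> 0 <= h x) -> (forall x, D x -> 0 < f x) -> 0 < p ->
  (\int[mu]_(x in D) (h x * (Gamma p * f x `^ (- p)))%:E =
   \int[leb]_(w in `]0%R, +oo[) ((w `^ (p - 1))%:E * \int[mu]_(x in D) (h x * expR (- (w * f x)))%:E))%E.
Proof.
move=> mD mh mf h0 f0 p0.
pose F (z : T * measurableTypeR R) := h z.1 * (z.2 `^ (p - 1) * expR (- (f z.1 * z.2))).
have mF : measurable_fun setT F.
  apply: measurable_funM; first exact: (measurableT_comp mh).
  apply: measurable_funM; first exact: (measurableT_comp (measurable_powR _)).
  do 2! (apply: measurableT_comp => //); apply: measurable_funM => //.
  exact: (measurableT_comp mf).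
transitivity (\int[mu]_(x in D) \int[leb]_(w in `]0%R, +oo[) (F (x, w))%:E)%E.
  apply: eq_integral => x; rewrite inE => Dx; rewrite EFinM -integral_gamma ?f0//.
  rewrite -ge0_integralZl_fin ?h0//.
  - by apply: measurable_funTS; exact: measurable_powR_expR.
  - by move=> w _; rewrite mulr_ge0 ?powR_ge0 ?expR_ge0.
rewrite tonelli_in//; last by move=> x w Dx _; rewrite mulr_ge0 ?h0// mulr_ge0 ?powR_ge0 ?expR_ge0.
apply: eq_integral => w _; rewrite -ge0_integralZl_fin; last exact: powR_ge0.
- by apply: eq_integral => x _; rewrite /F /= mulrCA [f x * w]mulrC.
- exact: mD.
- apply: measurable_funTS; apply: measurable_funM => //; do 2! (apply: measurableT_comp => //).
  exact: measurable_funM.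
- by move=> x Dx; rewrite mulr_ge0 ?h0 ?expR_ge0.
Qed.

(** The Beta integral on the half-line: mixing [(1 + w)^(-q)] into exponentials separates two Gamma
    integrals. *)
Lemma beta_integral (p q : R) : 0 < p -> p < q ->
  (\int[leb]_(w in `]0%R, +oo[) (w `^ (p - 1) * (Gamma q * (1 + w) `^ (- q)))%:E =
   (Gamma p * Gamma (q - p))%:E)%E.
Proof.
move=> p0 pq; have q0 : 0 < q by exact: lt_trans pq.
rewrite (@gamma_mix _ _ leb `]0%R, +oo[%classic (fun w => w `^ (p - 1)) (fun w => 1 + w) q)//.
- have qp : 0 < q - p by rewrite subr_gt0.
  have := integral_gamma qp (@ltr01 R); rewrite (congr1 (fun h => h _) (powR1 R)) mulr1 => Gqp; rewrite EFinM -Gqp.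
  rewrite -ge0_integralZl_fin ?(ltW (Gamma_gt0 p0))//.
  + apply: eq_integral => v; rewrite inE/= in_itv/= andbT => v0.
    transitivity ((v `^ (q - 1))%:E * ((expR (- v))%:E * (Gamma p * v `^ (- p))%:E))%E.
      congr (_ * _)%E; rewrite -integral_gamma// -ge0_integralZl_fin ?expR_ge0//.
      * by apply: eq_integral => w _; rewrite mulrDr mulr1 opprD expRD; congr EFin; ring.
      * by apply: measurable_funTS; exact: measurable_powR_expR.
      * by move=> w _; rewrite mulr_ge0 ?powR_ge0 ?expR_ge0.
    rewrite -!EFinM mul1r (_ : q - p - 1 = (q - 1) - p); last by ring.
    rewrite [v `^ (q - 1 - p)]powRD; last by rewrite lt0r_neq0// implybT.
    by congr EFin; ring.
  + by apply: measurable_funTS; exact: measurable_powR_expR.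
  + by move=> w _; rewrite mulr_ge0 ?powR_ge0 ?expR_ge0.
- by apply: measurable_funD.
- by move=> x _; exact: powR_ge0.
- by move=> x /=; rewrite in_itv/= andbT => x0; rewrite addr_gt0.
Qed.

(** The sublevel sets of [x^2] have length [2 sqrt u], so the layer-cake formula for the Gaussian
    gives [2 Gamma (3/2) = sqrt pi]. *)
Lemma Gamma_half : Gamma (2^-1 : R) = Num.sqrt pi.
Proof.
have h0 : 0 < 2^-1 :> R by rewrite invr_gt0.
have h1 : 0 < 2^-1 + 1 :> R by rewrite addr_gt0.
have E : (Gamma (2^-1 : R))%:E = (Num.sqrt (pi : R))%:E.
  rewrite -integralT_gauss /gauss_fun.
  rewrite (@exp_layer_cake R _ _ leb setT (fun x : measurableTypeR R => x ^+ 2))//; last by move=> x; exact: sqr_ge0.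
  transitivity (2 * Gamma (2^-1 + 1 : R))%:E; first by rewrite GammaS//; congr EFin; field.
  have := integral_gamma h1 ltr01; rewrite powR1 mulr1 EFinM => <-.
  rewrite -ge0_integralZl_fin//.
  - apply: eq_integral => u; rewrite inE/= in_itv/= andbT => u0.
    rewrite setTI (_ : [set x | _] = `[(- Num.sqrt u), (Num.sqrt u)]%classic); last first.
      apply/seteqP; split => x /=; rewrite in_itv/= -ler_norml -sqrtr_sqr ler_sqrt//; exact: ltW.
    rewrite lebesgue_measure_itv/= lte_fin gtrN ?sqrtr_gt0// -EFinB -EFinM addrK mul1r.
    by rewrite powR12_sqrt ?ltW//; congr EFin; ring.
  - by apply: measurable_funTS; exact: measurable_powR_expR.
  - by move=> w _; rewrite mulr_ge0 ?powR_ge0 ?expR_ge0.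
by case: E.
Qed.

End gamma_mixtures.

(** * Radial integrals from masses of balls *)

Section potentials.
Variables (R : realType) (d : measure_display) (T : measurableType d).
Variables (mu : {sigma_finite_measure set T -> \bar R}) (D : set T) (rho : T -> R) (k : nat).
Local Notation leb := (@lebesgue_measure R).
Hypothesis mD : measurable D.
Hypothesis mrho : measurable_fun setT rho.
Hypothesis rho_ge0 : forall x, 0 <= rho x.

Lemma ball_level (y u : R) : 0 < y -> 0 < u ->
  [set x | (y * rho x ^+ 2 <= u)%R] = [set x | rho x <= Num.sqrt (u / y)].
Proof.
move=> y0 u0; have uy : 0 <= u / y by rewrite divr_ge0// ltW.
have E x : (rho x <= Num.sqrt (u / y)) = (y * rho x ^+ 2 <= u).
  by rewrite -{1}(ger0_norm (rho_ge0 x)) -sqrtr_sqr ler_sqrt// ler_pdivlMr// mulrC.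
by apply/seteqP; split => x /=; rewrite E.
Qed.

Lemma sqrt_exprn (t : R) : 0 <= t -> Num.sqrt t ^+ k = t `^ (k%:R / 2).
Proof.
by move=> t0; rewrite -powR12_sqrt// -powR_mulrn ?powR_ge0// -powRrM mulrC.
Qed.

Lemma layer_gamma (p c y : R) : 0 < p -> 0 <= c -> 0 < y ->
  (\int[leb]_(u in `]0%R, +oo[) ((expR (- u))%:E * (c * (u / y) `^ (p - 1))%:E) =
   (c * Gamma p * y `^ (1 - p))%:E)%E.
Proof.
move=> p0 c0 y0; have := integral_gamma p0 (@ltr01 R); rewrite powR1 mulr1 => G.
rewrite mulrAC EFinM -G -ge0_integralZl_fin ?mulr_ge0 ?powR_ge0//.
- apply: eq_integral => u; rewrite inE/= in_itv/= andbT => u0.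
  rewrite -EFinM powRM ?(ltW u0) ?invr_ge0 ?(ltW y0)// mul1r -powR_inv1 ?(ltW y0)// -powRrM.
  by rewrite (_ : -1 * (p - 1) = 1 - p); [congr EFin; ring|ring].
- by apply: measurable_funTS; exact: measurable_powR_expR.
- by move=> w _; rewrite mulr_ge0 ?powR_ge0 ?expR_ge0.
Qed.

Lemma measurable_sublevel (y : R) :
  measurable_fun setT (fun u : R => mu (D `&` [set x | (y * rho x ^+ 2 <= u)%R])).
Proof.
pose A : set (measurableTypeR R * T) := [set z | D z.2] `&` [set z | y * rho z.2 ^+ 2 <= z.1].
have mA : measurable A.
  apply: measurableI.
    rewrite (_ : [set z | D z.2] = setT `*` D); first exact: measurableX.
    by apply/seteqP; split => z //= -[].
  rewrite -[X in measurable X]setTI; apply: measurable_fun_le => //.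
  apply: measurable_funM => //; apply: measurable_funX; exact: (measurableT_comp mrho).
have := @measurable_fun_xsection _ _ _ _ R mu A mA.
rewrite (_ : _ \o _ = fun u : R => mu (D `&` [set x | (y * rho x ^+ 2 <= u)%R]))//.
by apply/funext => u /=; congr (mu _); apply/seteqP; split => x; rewrite /xsection /= inE.
Qed.

(** [rho] stands for the distance to a fixed point and [k] for the dimension of the measure. The
    layers of the Gaussian are balls of radius [sqrt (u / y)], so mass bounds enter directly. *)
Lemma gauss_upper (A y : R) : 0 <= A -> 0 < y ->
  (forall r, 0 < r -> (mu (D `&` [set x | (rho x <= r)%R]) <= (A * r ^+ k)%:E)%E) ->
  (\int[mu]_(x in D) (expR (- (y * rho x ^+ 2)))%:E <= (A * Gamma (k%:R / 2 + 1) * y `^ (- (k%:R / 2)))%:E)%E.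
Proof.
move=> A0 y0 H; rewrite exp_layer_cake//; last 2 first.
- by apply: measurable_funM => //; exact: measurable_funX.
- by move=> x; rewrite mulr_ge0 ?sqr_ge0// ltW.
have p0 : 0 < k%:R / 2 + 1 :> R by rewrite ltr_wpDl.
rewrite (_ : - (k%:R / 2) = 1 - (k%:R / 2 + 1) :> R); last by ring.
rewrite -layer_gamma//; apply: ge0_le_integral => //.
- by move=> u _; rewrite mule_ge0// lee_fin expR_ge0.
- apply: emeasurable_funM; last by apply: measurable_funTS; exact: measurable_sublevel.
  by apply/measurable_EFinP; apply: measurableT_comp => //; exact: measurableT_comp.
- apply: emeasurable_funM; apply/measurable_EFinP; first by apply: measurableT_comp => //; exact: measurableT_comp.
  apply: measurable_funTS; apply: measurable_funM => //; apply: (measurableT_comp (measurable_powR _)).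
  exact: measurable_funM.
- move=> u /=; rewrite in_itv/= andbT => u0; apply: lee_wpmul2l; first by rewrite lee_fin expR_ge0.
  rewrite ball_level// addrK -sqrt_exprn ?divr_ge0 ?(ltW u0) ?(ltW y0)//.
  by apply: H; rewrite sqrtr_gt0 divr_gt0.
Qed.

(** The mass bound is known below [r0] only; for larger radii [r^k <= r0^(-1/2) r^(k + 1/2)] is
    subtracted, whence the correction term. Half a power is gained and no more: a full one would
    make the later integral against the Poisson weight diverge at 0. *)
Lemma gauss_lower (B r0 y : R) : 0 <= B -> 0 < r0 -> 0 < y ->
  (forall r, 0 < r < r0 -> ((B * r ^+ k)%:E <= mu (D `&` [set x | (rho x <= r)%R]))%E) ->
  ((B * Gamma (k%:R / 2 + 1) * y `^ (- (k%:R / 2)))%:E <=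
   \int[mu]_(x in D) (expR (- (y * rho x ^+ 2)))%:E +
   (B * r0 `^ (- 2^-1) * Gamma (k%:R / 2 + 1 + 4^-1) * y `^ (- (k%:R / 2 + 4^-1)))%:E)%E.
Proof.
move=> B0 r00 y0 H; rewrite exp_layer_cake//; last 2 first.
- by apply: measurable_funM => //; exact: measurable_funX.
- by move=> x; rewrite mulr_ge0 ?sqr_ge0// ltW.
have p0 : 0 < k%:R / 2 + 1 :> R by rewrite ltr_wpDl.
have p4 : 0 < k%:R / 2 + 1 + 4^-1 :> R by rewrite addr_gt0.
rewrite (_ : - (k%:R / 2) = 1 - (k%:R / 2 + 1) :> R); last by ring.
rewrite (_ : - (k%:R / 2 + 4^-1) = 1 - (k%:R / 2 + 1 + 4^-1) :> R); last by ring.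
have c0 : 0 <= B * r0 `^ (- 2^-1) by rewrite mulr_ge0 ?powR_ge0.
have me : measurable_fun (`]0%R, +oo[%classic : set (measurableTypeR R)) (fun u : R => (expR (- u))%:E).
  by apply/measurable_EFinP; apply: measurableT_comp => //; exact: measurableT_comp.
have mpow (c q : R) : measurable_fun (`]0%R, +oo[%classic : set (measurableTypeR R)) (fun u : R => (c * (u / y) `^ q)%:E).
  apply/measurable_EFinP; apply: measurable_funTS; apply: measurable_funM => //.
  by apply: (measurableT_comp (measurable_powR _)); exact: measurable_funM.
rewrite -!layer_gamma//.
rewrite -ge0_integralD//; last 4 first.
- by move=> u _; rewrite mule_ge0// lee_fin expR_ge0.
- by apply: emeasurable_funM => //; apply: measurable_funTS; exact: measurable_sublevel.
- by move=> u _; rewrite -EFinM lee_fin !mulr_ge0 ?powR_ge0 ?expR_ge0.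
- exact: emeasurable_funM.
apply: ge0_le_integral => //.
- by move=> u _; rewrite -EFinM lee_fin !mulr_ge0 ?powR_ge0 ?expR_ge0.
- exact: emeasurable_funM.
- apply: emeasurable_funD; last exact: emeasurable_funM.
  by apply: emeasurable_funM => //; apply: measurable_funTS; exact: measurable_sublevel.
move=> u /=; rewrite in_itv/= andbT => u0; rewrite -muleDr//; last first.
  by rewrite ge0_adde_def// inE// lee_fin mulr_ge0 ?powR_ge0.
apply: lee_wpmul2l; first by rewrite lee_fin expR_ge0.
have uy : 0 < u / y by rewrite divr_gt0.
rewrite ball_level// (_ : k%:R / 2 + 1 - 1 = k%:R / 2 :> R); last by ring.
rewrite (_ : k%:R / 2 + 1 + 4^-1 - 1 = k%:R / 2 + 4^-1 :> R); last by ring.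
rewrite -sqrt_exprn ?(ltW uy)//.
have [lt|ge] := ltP (Num.sqrt (u / y)) r0.
  apply: le_trans (H _ _) _; first by rewrite sqrtr_gt0 uy.
  by apply: leeDl; rewrite lee_fin mulr_ge0 ?powR_ge0.
apply: le_trans (leeDr _ _); last exact: measure_ge0.
rewrite lee_fin powRD; last by rewrite lt0r_neq0// implybT.
rewrite sqrt_exprn ?(ltW uy)// -!mulrA ler_wpM2l// mulrCA; apply: ler_peMr; first exact: powR_ge0.
have -> : (u / y) `^ 4^-1 = Num.sqrt (u / y) `^ 2^-1.
  rewrite -powR12_sqrt ?(ltW uy)// -powRrM; congr (_ `^ _); by field.
rewrite powRN mulrC ler_pdivlMr ?powR_gt0// mul1r.
by apply: ge0_ler_powR; rewrite ?nnegrE ?sqrtr_ge0 ?(ltW r00) ?invr_ge0.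
Qed.

Local Notation pk := (k%:R / 2 + 2^-1 : R).

(** [pk] is half of the ambient dimension [k + 1], so the left integrand is, up to a constant, the
    Poisson kernel of a half-space at height [dd]. *)
Lemma poisson_mix (dd : R) : 0 < dd ->
  (\int[mu]_(x in D) (dd * (Gamma pk * (rho x ^+ 2 + dd ^+ 2) `^ (- pk)))%:E =
   \int[leb]_(w in `]0%R, +oo[) ((w `^ (pk - 1) * (dd * expR (- (dd ^+ 2 * w))))%:E *
     \int[mu]_(x in D) (expR (- (w * rho x ^+ 2)))%:E))%E.
Proof.
move=> d0; rewrite (@gamma_mix R _ _ mu D (fun=> dd) (fun x => rho x ^+ 2 + dd ^+ 2) pk)//.
- apply: eq_integral => w _; rewrite EFinM -muleA; congr (_ * _)%E.
  rewrite -ge0_integralZl_fin; last by apply: mulr_ge0; [exact: ltW|exact: expR_ge0].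
  + by apply: eq_integral => x _; rewrite mulrDr opprD expRD [dd ^+ 2 * w]mulrC; congr EFin; ring.
  + by [].
  + apply: measurable_funTS; do 2! (apply: measurableT_comp => //); apply: measurable_funM => //.
    exact: measurable_funX.
  + by move=> x _; exact: expR_ge0.
- by apply: measurable_funD => //; exact: measurable_funX.
- by move=> x _; exact: ltW.
- by move=> x _; rewrite ltr_wpDl ?sqr_ge0// exprn_gt0.
Qed.

Lemma poisson_gamma (dd c q : R) : 0 < dd -> 0 <= c -> q < pk ->
  (\int[leb]_(w in `]0%R, +oo[) ((w `^ (pk - 1) * (dd * expR (- (dd ^+ 2 * w))))%:E * (c * w `^ (- q))%:E) =
   (dd * c * Gamma (pk - q) * (dd ^+ 2) `^ (- (pk - q)))%:E)%E.
Proof.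
move=> d0 c0 qp; have d20 : 0 < dd ^+ 2 by rewrite exprn_gt0.
have pq : 0 < pk - q by rewrite subr_gt0.
rewrite -mulrA EFinM -integral_gamma// -ge0_integralZl_fin.
- apply: eq_integral => w; rewrite inE/= in_itv/= andbT => w0; rewrite -EFinM.
  rewrite (_ : pk - q - 1 = (pk - 1) - q); last by ring.
  rewrite [w `^ (pk - 1 - q)]powRD; last by rewrite lt0r_neq0// implybT.
  by congr EFin; ring.
- by [].
- by apply: measurable_funTS; exact: measurable_powR_expR.
- by move=> w _; rewrite mulr_ge0 ?powR_ge0 ?expR_ge0.
- by rewrite mulr_ge0// ltW.
Qed.

Lemma measurable_gauss_int :
  measurable_fun (`]0%R, +oo[%classic : set (measurableTypeR R))
    (fun w : R => \int[mu]_(x in D) (expR (- (w * rho x ^+ 2)))%:E)%E.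
Proof.
apply: measurable_funTS.
apply: (@measurable_int_param R _ _ _ _ mu D (fun z : measurableTypeR R * T => expR (- (z.1 * rho z.2 ^+ 2)))) => //.
  do 2! (apply: measurableT_comp => //); apply: measurable_funM => //; apply: measurable_funX.
  exact: (measurableT_comp mrho).
Qed.

Lemma measurable_weight (dd : R) :
  measurable_fun (`]0%R, +oo[%classic : set (measurableTypeR R))
    (fun w : R => (w `^ (pk - 1) * (dd * expR (- (dd ^+ 2 * w))))%:E).
Proof.
apply/measurable_EFinP; apply: measurable_funTS; apply: measurable_funM; first exact: measurable_powR.
by apply: measurable_funM => //; do 2! (apply: measurableT_comp => //); exact: measurable_funM.
Qed.

Lemma measurable_cpow (c q : R) :
  measurable_fun (`]0%R, +oo[%classic : set (measurableTypeR R)) (fun w : R => (c * w `^ q)%:E).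
Proof.
by apply/measurable_EFinP; apply: measurable_funTS; apply: measurable_funM => //; exact: measurable_powR.
Qed.

(** The powers of [dd] cancel, so the bound does not depend on the height. *)
Lemma kernel_upper (A dd : R) : 0 <= A -> 0 < dd ->
  (forall r, 0 < r -> (mu (D `&` [set x | (rho x <= r)%R]) <= (A * r ^+ k)%:E)%E) ->
  (\int[mu]_(x in D) (dd * (Gamma pk * (rho x ^+ 2 + dd ^+ 2) `^ (- pk)))%:E <=
   (A * Gamma (k%:R / 2 + 1) * Gamma 2^-1)%:E)%E.
Proof.
move=> A0 d0 H; rewrite poisson_mix//.
have C0 : 0 <= A * Gamma (k%:R / 2 + 1) by rewrite mulr_ge0// ltW// Gamma_gt0// ltr_wpDl.
have qp : k%:R / 2 < pk by rewrite ltrDl.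
have -> : A * Gamma (k%:R / 2 + 1) * Gamma 2^-1 =
    dd * (A * Gamma (k%:R / 2 + 1)) * Gamma (pk - k%:R / 2) * (dd ^+ 2) `^ (- (pk - k%:R / 2)).
  rewrite [pk - _]addrC addKr powRN powR12_sqrt ?sqr_ge0// sqrtr_sqr gtr0_norm//.
  by move: (Gamma _) (Gamma _) => g1 g2; field; exact: lt0r_neq0.
rewrite -poisson_gamma//; apply: ge0_le_integral => //.
- move=> w _; rewrite mule_ge0//; first by rewrite lee_fin !mulr_ge0 ?powR_ge0 ?expR_ge0// ltW.
  by apply: integral_ge0 => x _; rewrite lee_fin expR_ge0.
- by apply: emeasurable_funM; [exact: measurable_weight|exact: measurable_gauss_int].
- by apply: emeasurable_funM; [exact: measurable_weight|exact: measurable_cpow].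
- move=> w /=; rewrite in_itv/= andbT => w0; apply: lee_wpmul2l.
    by rewrite lee_fin !mulr_ge0 ?powR_ge0 ?expR_ge0// ltW.
  exact: gauss_upper.
Qed.

(** The main term is again independent of [dd]; the correction of [gauss_lower] becomes a multiple
    of [sqrt dd] and vanishes as the surface is approached. *)
Lemma kernel_lower (B r0 dd : R) : 0 <= B -> 0 < r0 -> 0 < dd ->
  (forall r, 0 < r < r0 -> ((B * r ^+ k)%:E <= mu (D `&` [set x | (rho x <= r)%R]))%E) ->
  ((B * Gamma (k%:R / 2 + 1) * Gamma 2^-1)%:E <=
   \int[mu]_(x in D) (dd * (Gamma pk * (rho x ^+ 2 + dd ^+ 2) `^ (- pk)))%:E +
   (B * r0 `^ (- 2^-1) * Gamma (k%:R / 2 + 1 + 4^-1) * Gamma 4^-1 * dd `^ 2^-1)%:E)%E.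
Proof.
move=> B0 r00 d0 H; rewrite poisson_mix//.
have C0 : 0 <= B * Gamma (k%:R / 2 + 1) by rewrite mulr_ge0// ltW// Gamma_gt0// ltr_wpDl.
have C1 : 0 <= B * r0 `^ (- 2^-1) * Gamma (k%:R / 2 + 1 + 4^-1).
  by rewrite !mulr_ge0 ?powR_ge0// ltW// Gamma_gt0// addr_gt0// ltr_wpDl.
have qp : k%:R / 2 < pk by rewrite ltrDl.
have qp4 : k%:R / 2 + 4^-1 < pk by rewrite ltrD2l ltf_pV2 ?posrE// ltr_nat.
have -> : B * Gamma (k%:R / 2 + 1) * Gamma 2^-1 =
    dd * (B * Gamma (k%:R / 2 + 1)) * Gamma (pk - k%:R / 2) * (dd ^+ 2) `^ (- (pk - k%:R / 2)).
  rewrite [pk - _]addrC addKr powRN powR12_sqrt ?sqr_ge0// sqrtr_sqr gtr0_norm//.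
  by move: (Gamma _) (Gamma _) => g1 g2; field; exact: lt0r_neq0.
have -> : B * r0 `^ (- 2^-1) * Gamma (k%:R / 2 + 1 + 4^-1) * Gamma 4^-1 * dd `^ 2^-1 =
    dd * (B * r0 `^ (- 2^-1) * Gamma (k%:R / 2 + 1 + 4^-1)) * Gamma (pk - (k%:R / 2 + 4^-1)) * (dd ^+ 2) `^ (- (pk - (k%:R / 2 + 4^-1))).
  have -> : pk - (k%:R / 2 + 4^-1) = 4^-1 by field.
  rewrite -powR_mulrn ?(ltW d0)// -powRrM.
  have {2}-> : dd = dd `^ 2^-1 * dd `^ 2^-1.
    by rewrite -powRD ?lt0r_neq0 ?implybT// (_ : 2^-1 + 2^-1 = 1) ?powRr1 ?(ltW d0)//; field.
  have -> : 2 * - 4^-1 = - 2^-1 :> R by field.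
  rewrite (powRN dd); move: (Gamma _) (Gamma _) => g1 g2; field; exact: lt0r_neq0 (powR_gt0 _ d0).
rewrite -(poisson_gamma d0 C0 qp) -(poisson_gamma d0 C1 qp4).
have w0' w : 0 <= w `^ (pk - 1) * (dd * expR (- (dd ^+ 2 * w))).
  by rewrite !mulr_ge0 ?powR_ge0 ?expR_ge0// ltW.
have g0' w : (0 <= \int[mu]_(x in D) (expR (- (w * rho x ^+ 2)))%:E)%E.
  by apply: integral_ge0 => x _; rewrite lee_fin expR_ge0.
rewrite -ge0_integralD//; last 4 first.
- by move=> w _; rewrite mule_ge0// lee_fin.
- by apply: emeasurable_funM; [exact: measurable_weight|exact: measurable_gauss_int].
- by move=> w _; rewrite -EFinM lee_fin; apply: mulr_ge0 (w0' w) (mulr_ge0 _ (powR_ge0 _ _)).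
- by apply: emeasurable_funM; [exact: measurable_weight|exact: measurable_cpow].
apply: ge0_le_integral => //.
- by move=> w _; rewrite -EFinM lee_fin; apply: mulr_ge0 (w0' w) (mulr_ge0 _ (powR_ge0 _ _)).
- by apply: emeasurable_funM; [exact: measurable_weight|exact: measurable_cpow].
- apply: emeasurable_funD; apply: emeasurable_funM;
    [exact: measurable_weight|exact: measurable_gauss_int|exact: measurable_weight|exact: measurable_cpow].
move=> w /=; rewrite in_itv/= andbT => w0; rewrite -muleDr//; last first.
  by rewrite ge0_adde_def// inE// lee_fin mulr_ge0 ?powR_ge0.
by apply: lee_wpmul2l; [rewrite lee_fin|exact: gauss_lower].
Qed.

(** A factor [e^(- rho^2)] is inserted first: it replaces [w] by [1 + w] in the Gaussian bound,
    which removes the divergence of the mixture at [w = 0] and leaves a Beta integral. On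
    [rho <= r1] the factor costs at most [e^(r1^2)]. *)
Lemma riesz_bound (A r1 lam : R) : 0 <= A -> 0 < lam -> lam < k%:R ->
  (forall r, 0 < r -> (mu (D `&` [set x | (rho x <= r)%R]) <= (A * r ^+ k)%:E)%E) ->
  (forall x, D x -> 0 < rho x <= r1) ->
  (\int[mu]_(x in D) (rho x `^ (- lam))%:E <=
    (expR (r1 ^+ 2) * (A * Gamma (k%:R / 2 + 1) * Gamma (k%:R / 2 - lam / 2) / Gamma (k%:R / 2)))%:E)%E.
Proof.
move=> A0 l0 lk H Dr.
have p0 : 0 < lam / 2 by rewrite divr_gt0.
have pk2 : lam / 2 < k%:R / 2 by rewrite ltr_pM2r ?invr_gt0.
have k0 : 0 < k%:R / 2 :> R by exact: lt_trans pk2.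
have Gp := Gamma_gt0 p0; have Gk := Gamma_gt0 k0.
have C0 : 0 <= A * Gamma (k%:R / 2 + 1).
  exact: mulr_ge0 A0 (ltW (Gamma_gt0 (addr_gt0 k0 ltr01))).
have mr2 : measurable_fun setT (fun x => rho x ^+ 2) by exact: measurable_funX.
have me : measurable_fun setT (fun x => expR (- (rho x ^+ 2))) by do 2! (apply: measurableT_comp => //).
have key : (\int[mu]_(x in D) (expR (- (rho x ^+ 2)) * (Gamma (lam / 2) * (rho x ^+ 2) `^ (- (lam / 2))))%:E <=
    (A * Gamma (k%:R / 2 + 1) / Gamma (k%:R / 2) * (Gamma (lam / 2) * Gamma (k%:R / 2 - lam / 2)))%:E)%E.
  rewrite (@gamma_mix R _ _ mu D (fun x => expR (- (rho x ^+ 2))) (fun x => rho x ^+ 2))//; last first.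
    by move=> x /Dr/andP[h _]; rewrite exprn_gt0.
  rewrite EFinM -beta_integral// -ge0_integralZl_fin//; last 3 first.
  - apply: measurable_funTS; apply: measurable_funM; first exact: measurable_powR.
    apply: measurable_funM => //; apply: (measurableT_comp (measurable_powR _)); exact: measurable_funD.
  - by move=> w _; exact: mulr_ge0 (powR_ge0 _ _) (mulr_ge0 (ltW Gk) (powR_ge0 _ _)).
  - exact: divr_ge0 C0 (ltW Gk).
  have E w : (\int[mu]_(x in D) (expR (- (rho x ^+ 2)) * expR (- (w * rho x ^+ 2)))%:E =
      \int[mu]_(x in D) (expR (- ((1 + w) * rho x ^+ 2)))%:E)%E.
    by apply: eq_integral => x _; rewrite -expRD mulrDl mul1r opprD.
  apply: ge0_le_integral => //.
  - move=> w _; rewrite mule_ge0 ?lee_fin ?powR_ge0//; apply: integral_ge0 => x _.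
    by rewrite lee_fin mulr_ge0 ?expR_ge0.
  - apply: emeasurable_funM; first by apply/measurable_EFinP; apply: measurable_funTS; exact: measurable_powR.
    apply: measurable_funTS.
    apply: (@eq_measurable_fun _ _ _ _ _ (fun w : measurableTypeR R => \int[mu]_(x in D) (expR (- ((1 + w) * rho x ^+ 2)))%:E)%E).
      by move=> w _; rewrite E.
    apply: (@measurable_int_param R _ _ _ _ mu D (fun z : measurableTypeR R * T => expR (- ((1 + z.1) * rho z.2 ^+ 2)))) => //.
      do 2! (apply: measurableT_comp => //); apply: measurable_funM => //; first exact: measurable_funD.
      exact: (measurableT_comp mr2).
  - apply/measurable_EFinP; apply: measurable_funTS; apply: measurable_funM => //.
    apply: measurable_funM; first exact: measurable_powR.
    apply: measurable_funM => //; apply: (measurableT_comp (measurable_powR _)); exact: measurable_funD.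
  - move=> w /=; rewrite in_itv/= andbT => w0; rewrite E.
    have w1 : 0 < 1 + w by rewrite addr_gt0.
    apply: le_trans (lee_wpmul2l _ (gauss_upper A0 w1 H)) _; first by rewrite lee_fin powR_ge0.
    rewrite -EFinM lee_fin le_eqVlt; apply/orP; left; apply/eqP.
    by move: (lt0r_neq0 Gk); move: (Gamma (k%:R / 2)) (Gamma (k%:R / 2 + 1)) => g1 g2 g10; field.
apply: (@le_trans _ _ ((expR (r1 ^+ 2) / Gamma (lam / 2))%:E *
    \int[mu]_(x in D) (expR (- (rho x ^+ 2)) * (Gamma (lam / 2) * (rho x ^+ 2) `^ (- (lam / 2))))%:E)%E); last first.
  apply: le_trans (lee_wpmul2l _ key) _; first by rewrite lee_fin; exact: divr_ge0 (expR_ge0 _) (ltW Gp).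
  rewrite -EFinM lee_fin le_eqVlt; apply/orP; left; apply/eqP.
  move: (lt0r_neq0 Gk) (lt0r_neq0 Gp); move: (Gamma (k%:R / 2 + 1)) (Gamma (k%:R / 2 - lam / 2)) => g1 g2.
  by move: (Gamma (lam / 2)) (Gamma (k%:R / 2)) => g3 g4 g30 g40; field; apply/andP.
have mpow q : measurable_fun setT (fun x => (rho x ^+ 2) `^ q) by exact: (measurableT_comp (measurable_powR _)).
rewrite -ge0_integralZl_fin//; last 3 first.
- by apply: measurable_funTS; apply: measurable_funM => //; exact: measurable_funM.
- by move=> x _; exact: mulr_ge0 (expR_ge0 _) (mulr_ge0 (ltW Gp) (powR_ge0 _ _)).
- exact: divr_ge0 (expR_ge0 _) (ltW Gp).
apply: ge0_le_integral => //.
- by move=> x _; rewrite lee_fin powR_ge0.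
- by apply/measurable_EFinP; apply: measurable_funTS; exact: (measurableT_comp (measurable_powR _)).
- apply/measurable_EFinP; apply: measurable_funTS; apply: measurable_funM => //; apply: measurable_funM => //.
  exact: measurable_funM.
move=> x /Dr/andP[x0 xr].
have E : (rho x ^+ 2) `^ (- (lam / 2)) = rho x `^ (- lam).
  by rewrite -(powR_mulrn 2 (ltW x0)) -powRrM; congr (_ `^ _); field.
rewrite lee_fin E (_ : _ / _ * _ = expR (r1 ^+ 2 - rho x ^+ 2) * rho x `^ (- lam)); last first.
  by rewrite expRD; move: (lt0r_neq0 Gp); move: (Gamma _) => g g0; field.
rewrite ler_peMl ?powR_ge0// -[leLHS]expR0 ler_expR subr_ge0.
by rewrite ler_sqr ?nnegrE ?(ltW x0)// (le_trans (ltW x0)).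
Qed.

End potentials.

(** * Integrability, dominated convergence and differentiation under the integral *)

Section integrable_bounds.
Context d (T : measurableType d) (R : realType) (mu : {measure set T -> \bar R}) (D : set T).
Hypothesis mD : measurable D.

Lemma EFin_Rintegral (f : T -> R) : mu.-integrable D (EFin \o f) ->
  ((\int[mu]_(x in D) f x)%R%:E = \int[mu]_(x in D) (f x)%:E)%E.
Proof. by move=> h; rewrite fineK// integrable_fin_num. Qed.

Lemma integrable_bounded_by (f g : T -> R) : measurable_fun D f -> mu.-integrable D (EFin \o g) ->
  (forall x, D x -> `|f x| <= g x) -> mu.-integrable D (EFin \o f).
Proof.
move=> mf ig fg; apply: le_integrable ig => //; first exact/measurable_EFinP.
by move=> x Dx /=; rewrite lee_fin (le_trans (fg _ Dx))// ler_norm.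
Qed.

Lemma integrable_ge0_lt (f : T -> R) (c : R) : measurable_fun D f -> (forall x, D x -> 0 <= f x) ->
  (\int[mu]_(x in D) (f x)%:E <= c%:E)%E -> mu.-integrable D (EFin \o f).
Proof.
move=> mf f0 h; apply/integrableP; split; first exact/measurable_EFinP.
apply: le_lt_trans (ltry c); apply: le_trans h; rewrite le_eqVlt; apply/orP; left; apply/eqP.
by apply: eq_integral => x; rewrite inE => Dx /=; rewrite ger0_norm// f0.
Qed.

Lemma Rintegral_le_cst (f : T -> R) (c : R) : measurable_fun D f -> (forall x, D x -> 0 <= f x) ->
  (\int[mu]_(x in D) (f x)%:E <= c%:E)%E -> \int[mu]_(x in D) f x <= c.
Proof.
by move=> mf f0 h; rewrite -lee_fin EFin_Rintegral//; exact: integrable_ge0_lt h.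
Qed.

Lemma Rintegral_dominated_cvg (f : nat -> T -> R) (f0 g : T -> R) :
  (forall n, measurable_fun D (f n)) -> measurable_fun D f0 -> mu.-integrable D (EFin \o g) ->
  (forall n x, D x -> `|f n x| <= g x) -> (forall x, D x -> f n x @[n --> \oo] --> f0 x) ->
  \int[mu]_(x in D) f n x @[n --> \oo] --> \int[mu]_(x in D) f0 x.
Proof.
move=> mf mf0 ig fg cvgf.
have f0g x : D x -> `|f0 x| <= g x.
  move=> Dx; apply: (cvgr_to_le (cvg_norm (cvgf x Dx))).
  by apply: nearW => n; exact: fg.
have ig0 : mu.-integrable D (EFin \o f0) by apply: integrable_bounded_by ig f0g.
apply: fine_cvg; rewrite EFin_Rintegral//.
apply: (@dominated_cvg _ _ _ mu D mD (fun n => EFin \o f n) (EFin \o f0) (EFin \o g)) => //.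
- by move=> n; apply/measurable_EFinP.
- by move=> x Dx; apply: cvg_EFin; [exact: nearW|exact: cvgf].
Qed.

Lemma is_derive_Rintegral (f df : R -> T -> R) (a u v : R) (G : T -> R) : u < a < v ->
  (forall x, u < x < v -> mu.-integrable D (EFin \o f x)) ->
  (forall x y, u < x < v -> D y -> is_derive x 1 (f ^~ y) (df x y)) ->
  mu.-integrable D (EFin \o G) ->
  (forall x y, u < x < v -> D y -> `|df x y| <= G y) ->
  is_derive a 1 (fun x => \int[mu]_(y in D) f x y) (\int[mu]_(y in D) df a y).
Proof.
move=> auv If df1 IG dfG.
have aI : `]u, v[%classic a by rewrite /= in_itv.
have I1 x : `]u, v[%classic x -> mu.-integrable D (EFin \o f x) by rewrite /= in_itv; exact: If.
have I2 x y : `]u, v[%classic x -> D y -> derivable (f ^~ y) x 1.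
  by rewrite /= in_itv => h1 h2; have [] := df1 _ _ h1 h2.
have G0 y : 0 <= `|G y| by [].
have IG' : mu.-integrable D (EFin \o (fun y => `|G y|)) by exact: (integrable_norm IG).
have I3 x y : `]u, v[%classic x -> D y -> `|partial1of2 f x y| <= `|G y|.
  rewrite /= in_itv => h1 h2; have h3 := df1 _ _ h1 h2.
  by rewrite partial1of2E derive_val (le_trans (dfG _ _ h1 h2))// ler_norm.
split; first exact: (derivable_under_integral mD aI I1 I2 G0 IG' I3).
rewrite -derive1E (differentiation_under_integral mD aI I1 I2 G0 IG' I3).
apply: eq_Rintegral => y; rewrite inE => Dy; rewrite partial1of2E.
by have h3 := df1 _ _ auv Dy; rewrite derive_val.
Qed.

End integrable_bounds.

Section derive_rules.
Variable R : realType.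
Implicit Types (f g : R -> R) (x k df dg : R).

Lemma is_derive_cmul g x k dg : is_derive x 1 g dg -> is_derive x 1 (fun y => k * g y) (k * dg).
Proof. by move=> h; exact: (is_deriveZ k h). Qed.

Lemma is_derive_mul f g x df dg : is_derive x 1 f df -> is_derive x 1 g dg ->
  is_derive x 1 (fun y => f y * g y) (f x * dg + g x * df).
Proof. by move=> h1 h2; exact: (is_deriveM h1 h2). Qed.

Lemma is_derive_expR_comp g x dg : is_derive x 1 g dg -> is_derive x 1 (fun y => expR (g y)) (expR (g x) * dg).
Proof. by move=> h; exact: (is_derive1_comp (is_derive_expR (g x)) h). Qed.

Lemma is_derive_Nexp x k : is_derive x 1 (fun y => expR (- (y * k))) (- k * expR (- (x * k))).
Proof.
rewrite (_ : (fun y => _) = (fun y => expR ((- k) * y))); last by apply/funext => y; congr expR; ring.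
have := is_derive_expR_comp (@is_derive_cmul id x (- k) 1 (@is_derive_id _ _ _ _)).
by move=> /is_derive_eq; apply; rewrite mulr1 mulrC !mulNr [k * x]mulrC.
Qed.

End derive_rules.

(** * The Laplace transform of a Beta weight *)

Section beta_weight.
Variable R : realType.
Local Notation leb := (@lebesgue_measure R).

Lemma ge0_integral_onem (f : R -> \bar R) : measurable_fun setT f -> (forall x, 0 <= f x)%E ->
  (\int[leb]_x f (1 - x)%R = \int[leb]_x f x)%E.
Proof.
move=> mf f0; pose phi : measurableTypeR R -> measurableTypeR R := fun x => 1 - x.
have mphi : measurable_fun setT phi by apply: measurable_funB.
pose push : {measure set (measurableTypeR R) -> \bar R} :=
  measure_function_pushforward__canonical__measure_function_Measure leb mphi.
have nuE A : measurable A -> leb A = push A.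
  move=> mA; apply: (@lebesgue_measure_unique R push) => // X [[u v] _ <-].
  rewrite /push /= /pushforward /=.
  have -> : phi @^-1` `]u, v] = `[(1 - v), (1 - u)[%classic.
    by apply/seteqP; split => x /=; rewrite /phi !in_itv/= => /andP[h1 h2]; apply/andP; split; lra.
  rewrite !lebesgue_measure_itv/= !lte_fin ltrD2l ltrN2; case: ifPn => // _.
  by rewrite -!EFinB; congr EFin; ring.
have -> : (\int[leb]_x f x = \int[push]_x f x)%E.
  by apply: eq_measure_integral => A mA _; exact: nuE.
by rewrite ge0_integral_pushforward.
Qed.

Lemma powR_le2 (t e : R) : 2^-1 <= t -> t <= 1 -> -1 <= e -> t `^ e <= 2.
Proof.
move=> t2 t1 e1; have t0 : 0 < t by apply: lt_le_trans t2; rewrite invr_gt0.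
apply: (@le_trans _ _ (t `^ (-1))); first by apply: ger_powR; rewrite ?t0.
by rewrite powR_inv1 ?(ltW t0)// invf_ple ?posrE.
Qed.

Lemma powR_le1 (t e : R) : 0 <= t <= 1 -> 0 <= e -> t `^ e <= 1.
Proof.
move=> /andP[t0 t1] e0; rewrite [leRHS](_ : 1 = 1 `^ e); last by rewrite powR1.
by apply: ge0_ler_powR; rewrite ?nnegrE.
Qed.

Lemma powR_le_expR (q t : R) : 0 < q -> 0 < t -> t `^ q <= (2 * q) `^ q * expR (t / 2).
Proof.
move=> q0 t0.
have -> : expR (t / 2) = (expR (t / (2 * q))) `^ q.
  by rewrite -expRM; congr expR; field; exact: lt0r_neq0.
rewrite -powRM ?expR_ge0//; last by rewrite mulr_ge0// ltW.
apply: ge0_ler_powR; rewrite ?nnegrE ?(ltW q0) ?(ltW t0)//; first by rewrite !mulr_ge0 ?expR_ge0// ltW.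
rewrite mulrC -ler_pdivrMr; last by rewrite mulr_gt0.
by apply: le_trans (expR_ge1Dx _); rewrite lerDr.
Qed.

(** The weight of one variable in Euler's integral, used with [q = 1 - alpha k] and [a = alpha k].
    The exponents are kept apart because differentiation raises [q] alone. *)
Definition bwt (q a t : R) : R := t `^ (q - 1) * (1 - t) `^ (- a).

Lemma bwtE q a t : bwt q a t = t `^ (q - 1) * (1 - t) `^ (- a).
Proof. by []. Qed.

Lemma measurable_bwt q a : measurable_fun setT (bwt q a).
Proof.
apply: measurable_funM; first exact: measurable_powR.
by apply: (measurableT_comp (measurable_powR _)); exact: measurable_funB.
Qed.

Lemma bwt_ge0 q a t : 0 <= bwt q a t.
Proof. by rewrite mulr_ge0 ?powR_ge0. Qed.

Lemma measurable_onem_powR a : measurable_fun setT (fun t : R => (1 - t) `^ (- a)).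
Proof. by apply: (measurableT_comp (measurable_powR _)); exact: measurable_funB. Qed.

Lemma integral_onem_powR a : a < 1 ->
  (\int[leb]_(t in `[0%R, 1%R]) ((1 - t) `^ (- a))%:E = ((1 - a)^-1)%:E)%E.
Proof.
move=> a1; have a0 : 0 < 1 - a by rewrite subr_gt0.
have := integral_powR_itv0 a0 ler01; rewrite powR1 div1r => <-.
rewrite integral_itv_obnd_cbnd; last by apply/measurable_EFinP; apply: measurable_funTS; exact: measurable_powR.
rewrite integral_mkcond [RHS]integral_mkcond -[RHS]ge0_integral_onem.
- apply: eq_integral => t _; rewrite !patchE !mem_setE /= !in_itv/=.
  rewrite (_ : (0 <= 1 - t <= 1) = (0 <= t <= 1)); last by apply/idP/idP => /andP[? ?]; apply/andP; split; lra.
  by case: ifP => // _; rewrite (_ : 1 - a - 1 = - a)//; ring.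
- apply/(measurable_restrictT _ _).1 => //; apply: measurable_funTS; apply/measurable_EFinP; exact: measurable_powR.
- by move=> x; rewrite patchE; case: ifP => // _; rewrite lee_fin powR_ge0.
Qed.

(** Split at [t = 1/2]: below, [(1 - t)^(-a) <= 2]; above, [t^(q-1) <= 2] and
    [e^(-w t) <= e^(-w/2)]. *)
Lemma bwt_exp_le q a w t : 0 < q -> 0 <= a < 1 -> 0 <= w -> 0 <= t <= 1 ->
  bwt q a t * expR (- (w * t)) <= 2 * (t `^ (q - 1) * expR (- (w * t))) + 2 * expR (- (w / 2)) * (1 - t) `^ (- a).
Proof.
move=> q0 /andP[a0 a1] w0 /andP[t0 t1]; rewrite /bwt.
have [h|h] := leP t 2^-1.
  apply: (@le_trans _ _ (2 * (t `^ (q - 1) * expR (- (w * t))))); last first.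
    by rewrite lerDl !mulr_ge0 ?expR_ge0 ?powR_ge0.
  rewrite mulrAC mulrC; apply: ler_wpM2r; first by rewrite mulr_ge0 ?powR_ge0 ?expR_ge0.
  by apply: powR_le2; lra.
apply: (@le_trans _ _ (2 * expR (- (w / 2)) * (1 - t) `^ (- a))); last first.
  by rewrite lerDr !mulr_ge0 ?expR_ge0 ?powR_ge0.
rewrite mulrAC; apply: ler_wpM2r; first exact: powR_ge0.
apply: ler_pM; rewrite ?powR_ge0 ?expR_ge0//; first by apply: powR_le2; lra.
by rewrite ler_expR lerN2 ler_wpM2l// ltW.
Qed.

Lemma integral_bwt_exp_le q a w : 0 < q -> 0 <= a < 1 -> 0 < w ->
  (\int[leb]_(t in `[0%R, 1%R]) (bwt q a t * expR (- (w * t)))%:E <=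
   (2 * (Gamma q * w `^ (- q)) + 2 * expR (- (w / 2)) / (1 - a))%:E)%E.
Proof.
move=> q0 a01 w0; have /andP[a0 a1] := a01.
have m1 : measurable_fun (`[0%R, 1%R]%classic : set (measurableTypeR R)) (fun t : R => 2 * (t `^ (q - 1) * expR (- (w * t)))).
  by apply: measurable_funTS; apply: measurable_funM => //; exact: measurable_powR_expR.
have m2 : measurable_fun (`[0%R, 1%R]%classic : set (measurableTypeR R)) (fun t : R => 2 * expR (- (w / 2)) * (1 - t) `^ (- a)).
  by apply: measurable_funTS; apply: measurable_funM => //; exact: measurable_onem_powR.
apply: (@le_trans _ _ (\int[leb]_(t in `[0%R, 1%R]) ((2 * (t `^ (q - 1) * expR (- (w * t))))%:E + (2 * expR (- (w / 2)) * (1 - t) `^ (- a))%:E))%E).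
  apply: ge0_le_integral => //.
  - by move=> t _; rewrite lee_fin mulr_ge0 ?bwt_ge0 ?expR_ge0.
  - apply/measurable_EFinP; apply: measurable_funTS; apply: measurable_funM; first exact: measurable_bwt.
    by do 2! (apply: measurableT_comp => //); exact: measurable_funM.
  - by apply: emeasurable_funD; apply/measurable_EFinP.
  - by move=> t /=; rewrite in_itv/= => ht; rewrite -EFinD lee_fin; apply: bwt_exp_le => //; exact: ltW.
rewrite ge0_integralD//; last 4 first.
- by move=> t _; rewrite lee_fin !mulr_ge0 ?powR_ge0 ?expR_ge0.
- exact/measurable_EFinP.
- by move=> t _; rewrite lee_fin !mulr_ge0 ?powR_ge0 ?expR_ge0.
- exact/measurable_EFinP.
rewrite EFinD; apply: leeD.
  rewrite [leRHS]EFinM -integral_gamma// -ge0_integralZl_fin//; last 2 first.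
  - by apply: measurable_funTS; exact: measurable_powR_expR.
  - by move=> t _; rewrite mulr_ge0 ?powR_ge0 ?expR_ge0.
  rewrite -integral_itv_obnd_cbnd; last first.
    by apply/measurable_EFinP; apply: measurable_funTS; apply: measurable_funM => //; exact: measurable_powR_expR.
  apply: ge0_subset_integral => //.
  - by apply/measurable_EFinP; apply: measurable_funTS; apply: measurable_funM => //; exact: measurable_powR_expR.
  - by move=> t _; rewrite lee_fin !mulr_ge0 ?powR_ge0 ?expR_ge0.
  - by move=> t /=; rewrite !in_itv/= andbT => /andP[].
rewrite ge0_integralZl_fin//.
- by rewrite integral_onem_powR// -EFinM.
- by apply: measurable_funTS; exact: measurable_onem_powR.
- by move=> t _; exact: powR_ge0.
Qed.

Lemma integrable_bwt q a : 0 < q -> 0 <= a < 1 -> leb.-integrable `[0%R, 1%R] (EFin \o bwt q a).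
Proof.
move=> q0 a01; apply: (@integrable_bounded_by _ _ R leb `[0%R, 1%R]%classic _ _ (fun t => expR 1 * (bwt q a t * expR (- (1 * t))))) => //.
- by apply: measurable_funTS; exact: measurable_bwt.
- have h := @integral_bwt_exp_le q a 1 q0 a01 ltr01.
  have m : measurable_fun (`[0%R, 1%R]%classic : set (measurableTypeR R)) (fun t : R => bwt q a t * expR (- (1 * t))).
    apply: measurable_funTS; apply: measurable_funM; first exact: measurable_bwt.
    by do 2! (apply: measurableT_comp => //); exact: measurable_funM.
  have := @integrable_ge0_lt _ _ R leb `[0%R, 1%R]%classic _ _ m _ h.
  move=> /(_ (fun x _ => mulr_ge0 (bwt_ge0 _ _ _) (expR_ge0 _))) ih.
  exact: (integrableZl _ (expR 1) ih).
- move=> t /=; rewrite in_itv/= => /andP[t0 t1]; rewrite ger0_norm ?bwt_ge0// mulrCA -expRD.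
  by rewrite ler_peMr ?bwt_ge0// -[leLHS]expR0 ler_expR mul1r subr_ge0.
Qed.

(** Up to a Beta value, Kummer's confluent hypergeometric function with parameters [q] and
    [q + 1 - a] at [- w]. *)
Definition bfun (q a w : R) : R := \int[leb]_(t in `[0%R, 1%R]) (bwt q a t * expR (- (w * t))).

Lemma measurable_bwt_exp q a w :
  measurable_fun (`[0%R, 1%R]%classic : set (measurableTypeR R)) (fun t : R => bwt q a t * expR (- (w * t))).
Proof.
apply: measurable_funTS; apply: measurable_funM; first exact: measurable_bwt.
by do 2! (apply: measurableT_comp => //); exact: measurable_funM.
Qed.

Lemma bwt_exp_norm (q a w t : R) : 0 <= t <= 1 -> `|bwt q a t * expR (- (w * t))| <= expR `|w| * bwt q a t.
Proof.
move=> /andP[t0 t1].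
rewrite (@ger0_norm _ (_ * _)); last by rewrite mulr_ge0 ?bwt_ge0 ?expR_ge0.
rewrite mulrC ler_wpM2r ?bwt_ge0// ler_expR.
by rewrite (le_trans (ler_norm _))// normrN normrM (ger0_norm t0) ler_piMr.
Qed.

Section bfun_theory.
Variables (q a : R).
Hypotheses (q0 : 0 < q) (a01 : 0 <= a < 1).

Lemma integrable_bwt_exp w :
  leb.-integrable `[0%R, 1%R] (EFin \o (fun t => bwt q a t * expR (- (w * t)))).
Proof.
apply: (@integrable_bounded_by _ _ R leb `[0%R, 1%R]%classic _ _ (fun t => expR `|w| * bwt q a t)) => //.
- exact: measurable_bwt_exp.
- exact: (integrableZl _ (expR `|w|) (integrable_bwt q0 a01)).
- by move=> t /=; rewrite in_itv/=; exact: bwt_exp_norm.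
Qed.

Lemma bfunE w : (bfun q a w)%:E = (\int[leb]_(t in `[0%R, 1%R]) (bwt q a t * expR (- (w * t)))%:E)%E.
Proof. by rewrite /bfun EFin_Rintegral//; exact: integrable_bwt_exp. Qed.

Lemma bfun_ge0 w : 0 <= bfun q a w.
Proof. by apply: Rintegral_ge0 => t _; rewrite mulr_ge0 ?bwt_ge0 ?expR_ge0. Qed.

Lemma bfun_le0 w : 0 <= w -> bfun q a w <= bfun q a 0.
Proof.
move=> w0; apply: le_Rintegral => //; [exact: integrable_bwt_exp|exact: integrable_bwt_exp|].
move=> t /=; rewrite in_itv/= => /andP[t0 t1].
by rewrite ler_wpM2l ?bwt_ge0// ler_expR mul0r lerN2 mulr_ge0.
Qed.

Lemma bfun_decay : exists2 C, 0 <= C & forall w, 0 < w -> bfun q a w <= C * w `^ (- q).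
Proof.
have /andP[a0 a1] := a01; have G0 := Gamma_gt0 q0.
have a10 : 0 < 1 - a by rewrite subr_gt0.
exists (2 * Gamma q + 2 * (2 * q) `^ q / (1 - a)).
  by rewrite addr_ge0// mulr_ge0// ?mulr_ge0 ?powR_ge0// ?invr_ge0 ltW.
move=> w w0; rewrite -lee_fin bfunE; apply: le_trans (integral_bwt_exp_le q0 a01 w0) _.
rewrite lee_fin.
have -> : (2 * Gamma q + 2 * (2 * q) `^ q / (1 - a)) * w `^ (- q) =
  2 * (Gamma q * w `^ (- q)) + 2 * ((2 * q) `^ q * w `^ (- q)) / (1 - a) by ring.
rewrite lerD2l ler_wpM2r ?invr_ge0 ?(ltW a10)// ler_wpM2l//.
rewrite powRN ler_pdivlMr ?powR_gt0// expRN ler_pdivrMl ?expR_gt0// mulrC.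
exact: powR_le_expR.
Qed.

Lemma bwtS (t : R) : 0 <= t -> bwt (q + 1) a t = t * bwt q a t.
Proof.
move=> t0; rewrite /bwt mulrA; congr (_ * _).
have [->|tn] := eqVneq t 0; first by rewrite mul0r powR0// addrK lt0r_neq0.
by rewrite addrK -{2}(powRr1 t0) -powRD ?tn ?implybT// addrC subrK.
Qed.

Lemma is_derive_bfun (w : R) : is_derive w (1 : R) (bfun q a) (- bfun (q + 1) a w).
Proof.
have q10 : 0 < q + 1 by rewrite addr_gt0.
pose df (w t : R) := bwt q a t * (- t * expR (- (w * t))).
have dfE (x t : R) : 0 <= t <= 1 -> df x t = - 1 * (bwt (q + 1) a t * expR (- (x * t))).
  by move=> /andP[t0 _]; rewrite /df bwtS//; ring.
have -> : - bfun (q + 1) a w = \int[leb]_(t in `[0%R, 1%R]) (df w t).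
  rewrite /bfun -mulN1r -RintegralZl//; last first.
    apply: (@integrable_bounded_by _ _ R leb `[0%R, 1%R]%classic _ _ (fun t => expR `|w| * bwt (q + 1) a t)) => //.
    - exact: measurable_bwt_exp.
    - exact: (integrableZl _ (expR `|w|) (integrable_bwt q10 a01)).
    - by move=> t /=; rewrite in_itv/=; exact: bwt_exp_norm.
  by apply: eq_Rintegral => t; rewrite inE/= in_itv/= => /dfE ->.
apply: (@is_derive_Rintegral _ _ _ leb `[0%R, 1%R]%classic _ (fun w t => bwt q a t * expR (- (w * t))) df w (w - 1) (w + 1) (fun t => expR (`|w| + 1) * bwt (q + 1) a t)) => //.
- by rewrite ltrBlDr !ltrDl ltr01.
- by move=> x _; exact: integrable_bwt_exp.
- by move=> x t _ _; exact: (is_derive_cmul _ (is_derive_Nexp _ _)).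
- exact: (integrableZl _ (expR (`|w| + 1)) (integrable_bwt q10 a01)).
- move=> x t /andP[x1 x2] /=; rewrite in_itv/= => t01; rewrite dfE// mulN1r normrN.
  apply: le_trans (bwt_exp_norm _ _ _ t01) _; rewrite ler_wpM2r ?bwt_ge0// ler_expR.
  by rewrite -lerBlDl (le_trans (lerB_dist _ _))// ler_norml; apply/andP; split; move: x1 x2; lra.
Qed.

End bfun_theory.

Lemma continuous_bfun q a : 0 < q -> 0 <= a < 1 -> continuous (bfun q a).
Proof.
move=> q0 a01 w; apply: differentiable_continuous; apply/derivable1_diffP.
by have [] := is_derive_bfun q0 a01 w.
Qed.

Lemma measurable_bfun q a : 0 < q -> 0 <= a < 1 -> measurable_fun setT (bfun q a).
Proof. by move=> q0 a01; apply: continuous_measurable_fun; exact: continuous_bfun. Qed.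

(** From [(1 - t)^(-a) <= 1 + t (1 - t)^(-a)], equivalent for [t < 1] to [(1 - t)^(1-a) <= 1]: the
    weight is at most the pure power plus the weight with [q + 1], whose transform decays faster. *)
Lemma bfun_upper q a w : 0 < q -> 0 <= a < 1 -> 0 < w ->
  bfun q a w <= Gamma q * w `^ (- q) + bfun (q + 1) a w.
Proof.
move=> q0 a01 w0; have q10 : 0 < q + 1 by rewrite addr_gt0.
have /andP[a0 a1] := a01.
have m1 : measurable_fun (`[0%R, 1%R]%classic : set (measurableTypeR R)) (fun t : R => t `^ (q - 1) * expR (- (w * t))).
  by apply: measurable_funTS; exact: measurable_powR_expR.
rewrite -lee_fin EFinD !bfunE//.
apply: (@le_trans _ _ (\int[leb]_(t in `[0%R, 1%R]) ((t `^ (q - 1) * expR (- (w * t)))%:E + (bwt (q + 1) a t * expR (- (w * t)))%:E))%E).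
  apply: ge0_le_integral => //.
  - by move=> t _; rewrite lee_fin mulr_ge0 ?bwt_ge0 ?expR_ge0.
  - by apply/measurable_EFinP; exact: measurable_bwt_exp.
  - by apply: emeasurable_funD; apply/measurable_EFinP => //; exact: measurable_bwt_exp.
  - have H (t : R) : 0 <= t <= 1 -> bwt q a t <= t `^ (q - 1) + bwt (q + 1) a t.
      move=> /andP[t0 t1]; rewrite bwtS// /bwt.
      have -> : t `^ (q - 1) + t * (t `^ (q - 1) * (1 - t) `^ (- a)) = t `^ (q - 1) * (1 + t * (1 - t) `^ (- a)) by ring.
      rewrite ler_wpM2l ?powR_ge0// -lerBlDr -{1}[_ `^ _]mul1r -mulrBl.
      have [->|tn] := eqVneq t 1; first by rewrite subrr mul0r.
      have t10 : 0 < 1 - t by move: t1; rewrite le_eqVlt (negbTE tn)/= subr_gt0.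
      rewrite -{1}(powRr1 (ltW t10)) -powRD; last by rewrite lt0r_neq0 ?implybT.
      by apply: powR_le1; [rewrite (ltW t10) gerBl t0|rewrite subr_ge0 ltW].
    move=> t /=; rewrite in_itv/= => /H ht.
    by rewrite -EFinD lee_fin -mulrDl ler_wpM2r ?expR_ge0.
rewrite ge0_integralD//; last 4 first.
- by move=> t _; rewrite lee_fin !mulr_ge0 ?powR_ge0 ?expR_ge0.
- exact/measurable_EFinP.
- by move=> t _; rewrite lee_fin mulr_ge0 ?bwt_ge0 ?expR_ge0.
- by apply/measurable_EFinP; exact: measurable_bwt_exp.
apply: leeD2r; rewrite -integral_gamma// -integral_itv_obnd_cbnd; last first.
  by apply/measurable_EFinP; apply: measurable_funTS; exact: measurable_powR_expR.
apply: ge0_subset_integral => //.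
- by apply/measurable_EFinP; apply: measurable_funTS; exact: measurable_powR_expR.
- by move=> t _; rewrite lee_fin !mulr_ge0 ?powR_ge0 ?expR_ge0.
- by move=> t /=; rewrite !in_itv/= andbT => /andP[].
Qed.

(** Below 1 the weight is at least the pure power [t^(q-1)]; from 1 on the missing pure power is at
    most [t^q]. *)
Lemma bfun_lower q a w : 0 < q -> 0 <= a < 1 -> 0 < w ->
  Gamma q * w `^ (- q) <= bfun q a w + Gamma (q + 1) * w `^ (- (q + 1)).
Proof.
move=> q0 a01 w0; have q10 : 0 < q + 1 by rewrite addr_gt0.
have /andP[a0 a1] := a01.
have mo p : measurable_fun (`]0%R, +oo[%classic : set (measurableTypeR R)) (fun t : R => t `^ p * expR (- (w * t))).
  by apply: measurable_funTS; exact: measurable_powR_expR.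
pose P := (fun t : R => (bwt q a t * expR (- (w * t)))%:E) \_ `[0%R, 1%R].
have mP : measurable_fun setT P.
  by apply/(measurable_restrictT _ _).1 => //; apply/measurable_EFinP; exact: measurable_bwt_exp.
have P0 t : (0 <= P t)%E.
  by rewrite /P patchE; case: ifP => // _; rewrite lee_fin mulr_ge0 ?bwt_ge0 ?expR_ge0.
rewrite -lee_fin EFinD !bfunE// -!integral_gamma//.
apply: (@le_trans _ _ (\int[leb]_(t in `]0%R, +oo[) (P t + (t `^ (q + 1 - 1) * expR (- (w * t)))%:E))%E).
  apply: ge0_le_integral => //.
  - by move=> t _; rewrite lee_fin mulr_ge0 ?powR_ge0 ?expR_ge0.
  - exact/measurable_EFinP.
  - apply: emeasurable_funD; [exact: measurable_funTS|exact/measurable_EFinP].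
  - move=> t /=; rewrite in_itv/= andbT => t0; rewrite addrK.
    have [t1|t1] := ltP t 1; last first.
      apply: (@le_trans _ _ (t `^ q * expR (- (w * t)))%:E); last by rewrite leeDr.
      by rewrite lee_fin ler_wpM2r ?expR_ge0// ler_powR// lerBlDr lerDl.
    rewrite -[leLHS]adde0; apply: leeD; last by rewrite lee_fin mulr_ge0 ?powR_ge0 ?expR_ge0.
    rewrite /P patchE mem_set /= ?in_itv/= ?(ltW t0) ?(ltW t1)//.
    rewrite lee_fin ler_wpM2r ?expR_ge0// /bwt ler_peMr ?powR_ge0//.
    have t10 : 0 < 1 - t by rewrite subr_gt0.
    by rewrite powRN invf_ge1 ?powR_gt0// powR_le1// (ltW t10) gerBl ltW.
rewrite ge0_integralD//; last 3 first.
- exact: measurable_funTS.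
- by move=> t _; rewrite lee_fin !mulr_ge0 ?powR_ge0 ?expR_ge0.
- exact/measurable_EFinP.
apply: leeD2r; rewrite [leRHS]integral_mkcond.
by apply: ge0_subset_integral.
Qed.

Lemma bfun_asymp q a : 0 < q -> 0 <= a < 1 -> exists2 C, 0 <= C &
  forall w, 0 < w -> `|bfun q a w - Gamma q * w `^ (- q)| <= C * w `^ (- (q + 1)).
Proof.
move=> q0 a01; have q10 : 0 < q + 1 by rewrite addr_gt0.
have [C C0 H] := bfun_decay q10 a01.
exists (C + Gamma (q + 1)); first by rewrite addr_ge0// ltW// Gamma_gt0.
move=> w w0; rewrite mulrDl ler_norml.
have h1 := bfun_upper q0 a01 w0; have h2 := bfun_lower q0 a01 w0; have h3 := H _ w0.
have h4 : 0 <= C * w `^ (- (q + 1)) by rewrite mulr_ge0 ?powR_ge0.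
have h5 : 0 <= Gamma (q + 1) * w `^ (- (q + 1)) by rewrite mulr_ge0 ?powR_ge0// ltW// Gamma_gt0.
move: h1 h2 h3 h4 h5; move: (bfun q a w) (bfun (q + 1) a w) => u1 u2.
move: (Gamma q * _) (C * _) (Gamma (q + 1) * _) => u3 u4 u5.
by move=> *; apply/andP; split; lra.
Qed.

End beta_weight.

#[global] Opaque bwt bfun.

(** * Half-line integrals with a Gamma weight *)

Section laplace_integral.
Variable R : realType.
Local Notation leb := (@lebesgue_measure R).
Local Notation halfline := (`]0%R, +oo[%classic : set (measurableTypeR R)).
Implicit Types (c e rho M : R) (h : R -> R).

Definition gam c rho (y : R) : R := y `^ (c - 1) * expR (- (rho * y)).

(** With [rho = r^2] and [h] a product of Beta transforms this carries all of the fundamental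
    solution except constants and powers of the coordinates. *)
Definition jint c rho h : R := \int[leb]_(y in `]0%R, +oo[) (gam c rho y * h y).

Lemma gam_ge0 c rho y : 0 <= gam c rho y.
Proof. by rewrite mulr_ge0 ?powR_ge0 ?expR_ge0. Qed.

Lemma measurable_gam c rho : measurable_fun setT (gam c rho).
Proof. exact: measurable_powR_expR. Qed.

Lemma measurable_gamM c rho h : measurable_fun setT h -> measurable_fun halfline (fun y => gam c rho y * h y).
Proof. by move=> mh; apply: measurable_funTS; apply: measurable_funM => //; exact: measurable_gam. Qed.

Lemma integrable_gam c rho : 0 < c -> 0 < rho -> leb.-integrable halfline (EFin \o gam c rho).
Proof.
move=> c0 r0; apply: (@integrable_ge0_lt _ _ R leb halfline _ (Gamma c * rho `^ (- c))).
- by apply: measurable_funTS; exact: measurable_gam.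
- by move=> y _; exact: gam_ge0.
- by rewrite /gam integral_gamma.
Qed.

Lemma Rintegral_gam c rho : 0 < c -> 0 < rho ->
  \int[leb]_(y in `]0%R, +oo[) gam c rho y = Gamma c * rho `^ (- c).
Proof. by move=> c0 r0; rewrite /Rintegral /gam integral_gamma. Qed.

Lemma gam_powN c e rho y : 0 < y -> gam c rho y * y `^ (- e) = gam (c - e) rho y.
Proof.
move=> y0; rewrite /gam mulrAC -powRD; last by rewrite (lt0r_neq0 y0) implybT.
by congr (_ `^ _ * _); ring.
Qed.

Lemma gamS c rho y : 0 < y -> gam c rho y * y = gam (c + 1) rho y.
Proof. by move=> y0; rewrite -{2}[y](@powRr1 R) ?ltW// -[1]opprK gam_powN// opprK. Qed.

Lemma integrable_jint c e rho M h : e < c -> 0 < rho -> measurable_fun setT h ->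
  (forall y, 0 < y -> `|h y| <= M * y `^ (- e)) ->
  leb.-integrable halfline (EFin \o (fun y => gam c rho y * h y)).
Proof.
move=> ec r0 mh hM; have ce : 0 < c - e by rewrite subr_gt0.
apply: (@integrable_bounded_by _ _ R leb halfline _ _ (fun y => M * gam (c - e) rho y)) => //.
- exact: measurable_gamM.
- exact: (integrableZl _ M (integrable_gam ce r0)).
- move=> y /=; rewrite in_itv/= andbT => y0.
  rewrite normrM ger0_norm ?gam_ge0// -gam_powN// mulrCA ler_wpM2l ?gam_ge0//; exact: hM.
Qed.

Lemma jint_le c e rho M h : e < c -> 0 < rho -> measurable_fun setT h ->
  (forall y, 0 < y -> `|h y| <= M * y `^ (- e)) ->
  `|jint c rho h| <= M * (Gamma (c - e) * rho `^ (- (c - e))).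
Proof.
move=> ec r0 mh hM; have ce : 0 < c - e by rewrite subr_gt0.
have I := integrable_jint ec r0 mh hM; rewrite /jint.
apply: le_trans (le_normr_Rintegral _ I) _ => //.
rewrite -Rintegral_gam// -RintegralZl//; last exact: integrable_gam.
apply: le_Rintegral => //.
- exact: (integrable_norm I).
- exact: (integrableZl _ M (integrable_gam ce r0)).
- move=> y /=; rewrite in_itv/= andbT => y0.
  rewrite normrM ger0_norm ?gam_ge0// -gam_powN// mulrCA ler_wpM2l ?gam_ge0//; exact: hM.
Qed.

Lemma jint_asymp c e e' rho M L h : e < c -> e' < c -> 0 < rho -> measurable_fun setT h ->
  (forall y, 0 < y -> `|h y - L * y `^ (- e)| <= M * y `^ (- e')) ->
  `|jint c rho h - L * (Gamma (c - e) * rho `^ (- (c - e)))| <= M * (Gamma (c - e') * rho `^ (- (c - e'))).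
Proof.
move=> ec ec' r0 mh hM; have ce : 0 < c - e by rewrite subr_gt0.
have mp : measurable_fun setT (fun y : R => L * y `^ (- e)).
  by apply: measurable_funM => //; exact: measurable_powR.
have md : measurable_fun setT (fun y => h y - L * y `^ (- e)) by exact: measurable_funB.
have -> : jint c rho h - L * (Gamma (c - e) * rho `^ (- (c - e))) = jint c rho (fun y => h y - L * y `^ (- e)).
  have I2 : leb.-integrable halfline (EFin \o (fun y => gam c rho y * (L * y `^ (- e)))).
    apply: (integrable_jint (M := `|L|) ec r0 mp) => y y0.
    by rewrite normrM (ger0_norm (powR_ge0 _ _)).
  have I1 := integrable_jint ec' r0 md hM.
  have -> : L * (Gamma (c - e) * rho `^ (- (c - e))) = jint c rho (fun y => L * y `^ (- e)).
    rewrite -Rintegral_gam// -RintegralZl//; last exact: integrable_gam.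
    by apply: eq_Rintegral => y; rewrite inE/= in_itv/= andbT => y0; rewrite [RHS]mulrCA (gam_powN c e rho y0).
  have -> : jint c rho h = jint c rho (fun y => h y - L * y `^ (- e)) + jint c rho (fun y => L * y `^ (- e)).
    rewrite /jint -RintegralD//; apply: eq_Rintegral => y _; ring.
  by rewrite addrK.
exact: jint_le.
Qed.

Lemma jint_cvg c rho M (rho_ : nat -> R) (h_ : nat -> R -> R) h : 0 < c -> 0 < rho ->
  (forall k, measurable_fun setT (h_ k)) -> measurable_fun setT h ->
  (forall k y, 0 < y -> `|h_ k y| <= M) -> (forall k, rho <= rho_ k) ->
  (forall y, 0 < y -> h_ k y @[k --> \oo] --> h y) ->
  forall r, rho_ k @[k --> \oo] --> r ->
  jint c (rho_ k) (h_ k) @[k --> \oo] --> jint c r h.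
Proof.
move=> c0 r0 mh_ mh hM rr hc r rc.
apply: (@Rintegral_dominated_cvg _ _ _ leb halfline _ _ _ (fun y => M * gam c rho y)) => //.
- by move=> k; exact: measurable_gamM.
- exact: measurable_gamM.
- exact: (integrableZl _ M (integrable_gam c0 r0)).
- move=> k y /=; rewrite in_itv/= andbT => y0.
  rewrite normrM ger0_norm ?gam_ge0// mulrC; apply: ler_pM => //; [exact: gam_ge0|exact: hM|].
  by rewrite ler_wpM2l ?powR_ge0// ler_expR lerN2 ler_wpM2r// ltW.
- move=> y /=; rewrite in_itv/= andbT => y0; apply: cvgM; last exact: hc.
  apply: cvgM; first exact: cvg_cst.
  apply: continuous_cvg; first exact: continuous_expR.
  by apply: cvgN; apply: cvgM => //; exact: cvg_cst.
Qed.

(** Along a coordinate line [r^2] is the quadratic [rho + u x + x^2]. Differentiating the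
    exponential or [h] brings down one factor [y], hence [c + 1] in both terms. *)
Lemma is_derive_jint c rho (u d0 M : R) (h dh : R -> R -> R) : 0 < c -> 0 < rho -> 0 < d0 ->
  (forall x, measurable_fun setT (h x)) -> measurable_fun setT (dh 0) ->
  (forall x y : R, `|x| < d0 -> 0 < y -> is_derive x (1 : R) (h ^~ y) (- (y * dh x y))) ->
  (forall x y, `|x| < d0 -> 0 < y -> `|h x y| <= M) ->
  (forall x y, `|x| < d0 -> 0 < y -> `|dh x y| <= M) ->
  is_derive (0 : R) (1 : R) (fun x => jint c (rho + u * x + x ^+ 2) (h x))
    (- u * jint (c + 1) rho (h 0) - jint (c + 1) rho (dh 0)).
Proof.
move=> c0 r0 d00 mh mdh derh hM dhM.
have c10 : 0 < c + 1 by rewrite addr_gt0.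
have r20 : 0 < rho / 2 by rewrite divr_gt0.
have u0 : 0 < `|u| + 1 by rewrite ltr_wpDl.
pose rh (x : R) := rho + u * x + x ^+ 2.
(* For [|x| < d] the rate stays above [rho / 2], so a single exponential dominates all
   derivatives. *)
have [d [d_0 dd0 d1 dH]] : exists d, [/\ 0 < d, d <= d0, d <= 1 & forall x, `|x| < d -> rho / 2 <= rh x].
  exists (Num.min (Num.min d0 1) (rho / 2 / (`|u| + 1))); split.
  - by rewrite !lt_min d00 ltr01 divr_gt0.
  - by rewrite !ge_min lexx.
  - by rewrite !ge_min lexx orbT.
  - move=> x; rewrite !lt_min => /andP[/andP[_ x1]]; rewrite ltr_pdivlMr// => xr.
    have h1 : `|u * x + x ^+ 2| <= `|x| * (`|u| + 1).
      rewrite (le_trans (ler_normD _ _))// mulrDr mulr1 normrM mulrC lerD2l normrX expr2.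
      by rewrite ler_piMr// ltW.
    move: (le_lt_trans h1 xr); rewrite ltr_norml => /andP[h2 _].
    by rewrite /rh; lra.
pose f (x y : R) := gam c (rh x) y * h x y.
pose df (x y : R) := - (u + 2 * x) * (gam (c + 1) (rh x) y * h x y) - gam (c + 1) (rh x) y * dh x y.
have xd x : - d < x < d -> `|x| < d by rewrite ltr_norml.
have M0 : 0 <= M by apply: le_trans (hM 0 1 _ ltr01); rewrite // normr0.
have h00 : `|0 : R| < d0 by rewrite normr0.
have rh0 : rh 0 = rho by rewrite /rh; ring.
have Ih : forall x c', - d < x < d -> 0 < c' ->
    leb.-integrable halfline (EFin \o (fun y => gam c' (rh x) y * h x y)).
  move=> x c' hx c'0; apply: (integrable_jint (e := 0) (M := M)) => //.
  - exact: lt_le_trans r20 (dH _ (xd _ hx)).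
  - by move=> y y0; rewrite oppr0 powRr0 mulr1; apply: hM => //; exact: lt_le_trans (xd _ hx) dd0.
have hd0 : - d < 0 < d by rewrite oppr_lt0 d_0.
have Id : leb.-integrable halfline (EFin \o (fun y => gam (c + 1) (rh 0) y * dh 0 y)).
  apply: (integrable_jint (e := 0) (M := M)) => //; first by rewrite rh0.
  by move=> y y0; rewrite oppr0 powRr0 mulr1; apply: dhM.
have -> : - u * jint (c + 1) rho (h 0) - jint (c + 1) rho (dh 0) = \int[leb]_(y in `]0%R, +oo[) df 0 y.
  rewrite /df /jint -rh0 -RintegralZl//; last exact: Ih.
  rewrite -RintegralB//.
    by apply: eq_Rintegral => y _; rewrite mulr0 addr0.
  exact: (integrableZl _ (- u) (Ih _ _ hd0 c10)).
refine (@is_derive_Rintegral _ _ _ leb halfline (measurable_itv _) f df 0 (- d) d (fun y => ((`|u| + 2) * M + M) * gam (c + 1) (rho / 2) y) hd0 _ _ _ _).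
- by move=> x hx; exact: Ih.
- move=> x y hx /=; rewrite in_itv/= andbT => y0.
  have hx' := lt_le_trans (xd _ hx) dd0.
  have Di := @is_derive_id _ _ x (1 : R).
  have D1 : is_derive x 1 (fun x => - (rh x * y)) (- (u + 2 * x) * y).
    rewrite (_ : (fun x => _) = (fun x => (- (u * y)) * x + (- y) * (x * x) + (- (rho * y)))); last first.
      by apply/funext => z; rewrite /rh; ring.
    have := is_deriveD (is_deriveD (is_derive_cmul (- (u * y)) Di) (is_derive_cmul (- y) (is_derive_mul Di Di))) (is_derive_cst (- (rho * y)) x 1).
    by move=> /is_derive_eq; apply; ring.
  have D2 : is_derive x 1 (fun x => gam c (rh x) y) (- (u + 2 * x) * gam (c + 1) (rh x) y).
    have := is_derive_cmul (y `^ (c - 1)) (is_derive_expR_comp D1).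
    by move=> /is_derive_eq; apply; rewrite -gamS// /gam; ring.
  have := is_derive_mul D2 (derh x y hx' y0).
  by move=> /is_derive_eq; apply; rewrite /df -!gamS//; ring.
- exact: (integrableZl _ ((`|u| + 2) * M + M) (integrable_gam c10 r20)).
- move=> x y hx /=; rewrite in_itv/= andbT => y0.
  have hx' := lt_le_trans (xd _ hx) dd0.
  have gl : gam (c + 1) (rh x) y <= gam (c + 1) (rho / 2) y.
    rewrite ler_wpM2l ?powR_ge0// ler_expR lerN2 ler_wpM2r ?(ltW y0)//; exact: dH (xd _ hx).
  have g0 := gam_ge0 (c + 1) (rh x) y.
  rewrite /df; move: (gam (c + 1) (rh x) y) (gam (c + 1) (rho / 2) y) g0 gl => g1 g2 g0 gl.
  apply: le_trans (ler_normB _ _) _; rewrite [leRHS]mulrDl; apply: lerD.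
    rewrite !normrM normrN (ger0_norm g0) -mulrA; apply: ler_pM => //; first by rewrite mulr_ge0.
      rewrite (le_trans (ler_normD _ _))// lerD2l normrM (ger0_norm (ler0n _ _)).
      by rewrite ler_piMr// ltW// (lt_le_trans (xd _ hx)).
    by rewrite mulrC; apply: ler_pM => //; exact: hM.
  by rewrite normrM (ger0_norm g0) mulrC; apply: ler_pM => //; exact: dhM.
Qed.

End laplace_integral.

(** * Products of Beta transforms *)

Section beta_product.
Variable R : realType.
Local Notation leb := (@lebesgue_measure R).
Local Notation halfline := (`]0%R, +oo[%classic : set (measurableTypeR R)).
Implicit Types (z : nat -> R).

Definition bprod (n : nat) (q al z : nat -> R) (y : R) : R := \prod_(k < n) bfun (q k) (al k) (z k * y).

Definition incr (i : nat) (q : nat -> R) (k : nat) : R := if k == i then q k + 1 else q k.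

Lemma sum_incr (n i : nat) (q : nat -> R) : (i < n)%N -> \sum_(k < n) incr i q k = \sum_(k < n) q k + 1.
Proof.
move=> hi; rewrite (bigD1 (Ordinal hi))//= [in RHS](bigD1 (Ordinal hi))//= /incr eqxx addrAC.
congr (_ + _ + _); apply: eq_bigr => k hk; case: ifP => // /eqP E.
by case/eqP: hk; exact/val_inj.
Qed.

Variables (n : nat) (q al : nat -> R).
Hypotheses (q0 : forall k, (k < n)%N -> 0 < q k) (al01 : forall k, (k < n)%N -> 0 <= al k < 1).

Lemma measurable_bprod z : measurable_fun setT (bprod n q al z).
Proof.
rewrite /bprod; apply: measurable_prod => k _.
by apply: (measurableT_comp (measurable_bfun (q0 _) (al01 _))) => //; exact: measurable_funM.
Qed.

Lemma bprod_ge0 z y : 0 <= bprod n q al z y.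
Proof. by apply: prodr_ge0 => k _; exact: bfun_ge0. Qed.

Lemma bprod_bounded z y : (forall k, (k < n)%N -> 0 <= z k) -> 0 < y ->
  `|bprod n q al z y| <= \prod_(k < n) bfun (q k) (al k) 0.
Proof.
move=> z0 y0; rewrite ger0_norm ?bprod_ge0//; apply: ler_prod => k _.
by rewrite bfun_ge0/= bfun_le0 ?q0 ?al01// mulr_ge0 ?z0// ltW.
Qed.

Lemma bprod_cvg (z_ : nat -> nat -> R) z y : (forall k, (k < n)%N -> z_ j k @[j --> \oo] --> z k) ->
  bprod n q al (z_ j) y @[j --> \oo] --> bprod n q al z y.
Proof.
move=> hz; rewrite /bprod; apply: (cvg_big (U := R^o)) => [|k _]; first exact: mul_continuous.
apply: continuous_cvg; first exact: continuous_bfun (q0 _) (al01 _) _.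
by apply: cvgM; [exact: hz|exact: cvg_cst].
Qed.

(** Induction on the number of factors, the error being telescoped as [(P - Q) b + Q (b - g)] with
    the powers of [y] suppressed. One [M] serves the product, its leading coefficient and the error,
    since the step uses all three. *)
Lemma bprod_near (z0 : R) : 0 < z0 -> exists2 M, 0 <= M & forall z, (forall k, (k < n)%N -> z0 <= z k) ->
  forall y, 0 < y ->
  [/\ bprod n q al z y <= M * y `^ (- \sum_(k < n) q k),
      \prod_(k < n) (Gamma (q k) * z k `^ (- q k)) <= M &
     `|bprod n q al z y - \prod_(k < n) (Gamma (q k) * z k `^ (- q k)) * y `^ (- \sum_(k < n) q k)| <=
     M * y `^ (- (\sum_(k < n) q k + 1))].
Proof.
move=> z00; rewrite /bprod; move: q0 al01; elim: n => [_ _|p IH hq hal].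
  exists 1 => // z _ y y0; rewrite !big_ord0 oppr0 powRr0 !mul1r subrr normr0; split => //.
  exact: powR_ge0.
have {IH}[M M0 IH] := IH (fun k kp => hq k (ltnW kp)) (fun k kp => hal k (ltnW kp)).
have qp := hq _ (ltnSn p); have alp := hal _ (ltnSn p).
have Gp := Gamma_gt0 qp.
have [C C0 HC] := bfun_decay qp alp; have [C' C'0 HC'] := bfun_asymp qp alp.
have [D [D0 D1 D2 D3]] : exists D, [/\ 0 <= D, C * z0 `^ (- q p) <= D, Gamma (q p) * z0 `^ (- q p) <= D &
    C' * z0 `^ (- (q p + 1)) <= D].
  have h1 : 0 <= C * z0 `^ (- q p) by rewrite mulr_ge0 ?powR_ge0.
  have h2 : 0 <= Gamma (q p) * z0 `^ (- q p) by rewrite mulr_ge0 ?powR_ge0// ltW.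
  have h3 : 0 <= C' * z0 `^ (- (q p + 1)) by rewrite mulr_ge0 ?powR_ge0.
  exists (C * z0 `^ (- q p) + Gamma (q p) * z0 `^ (- q p) + C' * z0 `^ (- (q p + 1))).
  by move: h1 h2 h3; move: (_ * _) (_ * _) (_ * _) => a b c *; split; lra.
exists (2 * M * D + M * D) => [|z hz y y0]; first by rewrite addr_ge0 ?mulr_ge0.
have zp : z0 <= z p by apply: hz.
have zp0 : 0 < z p := lt_le_trans z00 zp.
have [IH1 IH2 IH3] := IH z (fun k kp => hz k (ltnW kp)) y y0.
rewrite !big_ord_recr /= in IH1 IH2 IH3 *.
set P := \prod_(k < p) bfun _ _ _ in IH1 IH2 IH3 *; set Q := \prod_(k < p) (_ * _) in IH1 IH2 IH3 *.
set s := \sum_(k < p) q k in IH1 IH2 IH3 *.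
have zpow e : 0 <= e -> (z p * y) `^ (- e) <= z0 `^ (- e) * y `^ (- e).
  move=> e0; rewrite powRM ?(ltW zp0) ?(ltW y0)// ler_wpM2r ?powR_ge0// !powRN lef_pV2 ?posrE ?powR_gt0//.
  by apply: ge0_ler_powR; rewrite ?nnegrE ?(ltW qp) ?(ltW z00) ?(ltW zp0).
have zyp : 0 < z p * y by rewrite mulr_gt0.
have B1 : bfun (q p) (al p) (z p * y) <= D * y `^ (- q p).
  apply: le_trans (HC _ zyp) _; apply: (@le_trans _ _ (C * (z0 `^ (- q p) * y `^ (- q p)))).
    by rewrite ler_wpM2l// zpow// ltW.
  by rewrite mulrA ler_wpM2r ?powR_ge0.
have B2 : Gamma (q p) * z p `^ (- q p) <= D.
  apply: le_trans D2; rewrite ler_wpM2l ?(ltW Gp)// !powRN lef_pV2 ?posrE ?powR_gt0//.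
  by apply: ge0_ler_powR; rewrite ?nnegrE ?(ltW qp) ?(ltW z00) ?(ltW zp0).
have B3 : `|bfun (q p) (al p) (z p * y) - Gamma (q p) * z p `^ (- q p) * y `^ (- q p)| <= D * y `^ (- (q p + 1)).
  rewrite -mulrA -powRM ?(ltW zp0) ?(ltW y0)//.
  apply: le_trans (HC' _ zyp) _; apply: (@le_trans _ _ (C' * (z0 `^ (- (q p + 1)) * y `^ (- (q p + 1))))).
    by rewrite ler_wpM2l// zpow// addr_ge0// ltW.
  by rewrite mulrA ler_wpM2r ?powR_ge0.
have P0 : 0 <= P by apply: prodr_ge0 => k _; exact: bfun_ge0.
have Q0 : 0 <= Q by apply: prodr_ge0 => k _; exact: mulr_ge0 (ltW (Gamma_gt0 (hq _ (ltnW (ltn_ord k))))) (powR_ge0 _ _).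
have b0 : 0 <= bfun (q p) (al p) (z p * y) by exact: bfun_ge0.
have yD u v : y `^ u * y `^ v = y `^ (u + v) by rewrite powRD// (lt0r_neq0 y0) implybT.
have M3 : M * D <= 2 * M * D + M * D by rewrite lerDr !mulr_ge0.
split.
- apply: (@le_trans _ _ (M * y `^ (- s) * (D * y `^ (- q p)))); first exact: ler_pM.
  by rewrite mulrACA yD opprD ler_wpM2r ?powR_ge0.
- by apply: le_trans M3; exact: ler_pM Q0 (mulr_ge0 (ltW Gp) (powR_ge0 _ _)) IH2 B2.
- set b := bfun _ _ _ in B1 B3 b0 *; set g := Gamma _ * _ in B2 B3 *.
  have g0 : 0 <= g by exact: mulr_ge0 (ltW Gp) (powR_ge0 _ _).
  have -> : P * b - Q * g * y `^ (- (s + q p)) =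
      (P - Q * y `^ (- s)) * b + Q * y `^ (- s) * (b - g * y `^ (- q p)).
    by rewrite opprD -yD; ring.
  apply: (@le_trans _ _ (M * y `^ (- (s + 1)) * (D * y `^ (- q p)) + M * y `^ (- s) * (D * y `^ (- (q p + 1))))).
    apply: le_trans (ler_normD _ _) _; rewrite !normrM (ger0_norm b0) (ger0_norm Q0) (ger0_norm (powR_ge0 _ _)).
    by apply: lerD; apply: ler_pM; rewrite ?mulr_ge0 ?powR_ge0// ler_wpM2r ?powR_ge0.
  rewrite [X in X + _ <= _]mulrACA [X in _ + X <= _]mulrACA !yD (_ : - (s + 1) + - q p = - (s + q p + 1)); last by ring.
  rewrite (_ : - s + - (q p + 1) = - (s + q p + 1)); last by ring.
  by rewrite -mulrDl ler_wpM2r ?powR_ge0// lerD2r -mulrA ler_peMl ?mulr_ge0// ler1n.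
Qed.

Definition jfun c rho z : R := jint c rho (bprod n q al z).

Lemma eq_jfun c rho z z' : (forall k, (k < n)%N -> z k = z' k) -> jfun c rho z = jfun c rho z'.
Proof.
move=> E; rewrite /jfun /jint; apply: eq_Rintegral => y _; congr (_ * _).
by apply: eq_bigr => k _; rewrite E.
Qed.

Lemma jfun_bounded c rho z : 0 < c -> 0 < rho -> (forall k, (k < n)%N -> 0 <= z k) ->
  `|jfun c rho z| <= \prod_(k < n) bfun (q k) (al k) 0 * (Gamma c * rho `^ (- c)).
Proof.
move=> c0 r0 z0; rewrite -{2 3}[c](subr0 c); apply: jint_le => //; first exact: measurable_bprod.
by move=> y y0; rewrite oppr0 powRr0 mulr1; exact: bprod_bounded.
Qed.

Lemma jfun_near c (z0 : R) : 0 < z0 -> \sum_(k < n) q k < c -> exists2 M, 0 <= M &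
  forall rho z, 0 < rho -> (forall k, (k < n)%N -> z0 <= z k) ->
  `|jfun c rho z| <= M * rho `^ (- (c - \sum_(k < n) q k)).
Proof.
move=> z00 sc; have [M M0 H] := bprod_near z00.
exists (M * Gamma (c - \sum_(k < n) q k)).
  by rewrite mulr_ge0// ltW// Gamma_gt0// subr_gt0.
move=> rho z r0 hz; rewrite -mulrA; apply: jint_le => //; first exact: measurable_bprod.
by move=> y y0; rewrite ger0_norm ?bprod_ge0//; have [] := H z hz y y0.
Qed.

Lemma jfun_asymp c (z0 : R) : 0 < z0 -> \sum_(k < n) q k + 1 < c -> exists2 M, 0 <= M &
  forall rho z, 0 < rho -> (forall k, (k < n)%N -> z0 <= z k) ->
  `|jfun c rho z - \prod_(k < n) (Gamma (q k) * z k `^ (- q k)) *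
     (Gamma (c - \sum_(k < n) q k) * rho `^ (- (c - \sum_(k < n) q k)))| <=
  M * rho `^ (- (c - (\sum_(k < n) q k + 1))).
Proof.
move=> z00 sc; have [M M0 H] := bprod_near z00.
exists (M * Gamma (c - (\sum_(k < n) q k + 1))).
  by rewrite mulr_ge0// ltW// Gamma_gt0// subr_gt0.
move=> rho z r0 hz; rewrite -mulrA; apply: jint_asymp => //; last first.
- by move=> y y0; have [] := H z hz y y0.
- exact: measurable_bprod.
- by apply: lt_trans sc; rewrite ltrDl.
Qed.

Lemma jfun_cvg c rho (rho_ : nat -> R) (z_ : nat -> nat -> R) r z : 0 < c -> 0 < rho ->
  (forall j, rho <= rho_ j) -> (forall j k, (k < n)%N -> 0 <= z_ j k) ->
  rho_ j @[j --> \oo] --> r -> (forall k, (k < n)%N -> z_ j k @[j --> \oo] --> z k) ->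
  jfun c (rho_ j) (z_ j) @[j --> \oo] --> jfun c r z.
Proof.
move=> c0 r0 hr hz cr cz; apply: (jint_cvg (rho := rho) (M := \prod_(k < n) bfun (q k) (al k) 0)) => //.
- by move=> j; exact: measurable_bprod.
- exact: measurable_bprod.
- by move=> j y y0; apply: bprod_bounded => // k kn; exact: hz.
- by move=> y y0; exact: bprod_cvg.
Qed.

Lemma measurable_jfun d (T : measurableType d) c (rho : T -> R) (z : T -> nat -> R) : 0 < c ->
  measurable_fun setT rho -> (forall k, (k < n)%N -> measurable_fun setT (z ^~ k)) ->
  measurable_fun setT (fun x => jfun c (rho x) (z x)).
Proof.
move=> c0 mr mz; rewrite /jfun /jint /Rintegral.
apply: (measurableT_comp (fine_measurable measurableT)) => //.
apply: (@measurable_int_param R _ _ T _ leb halfline (fun w : T * measurableTypeR R => gam c (rho w.1) w.2 * bprod n q al (z w.1) w.2)) => //.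
- apply: measurable_funM; first apply: measurable_funM.
  + by apply: (measurableT_comp (measurable_powR _)).
  + do 2! (apply: measurableT_comp => //); apply: measurable_funM => //.
    exact: measurableT_comp.
  + apply: measurable_prod => k _.
    apply: (measurableT_comp (measurable_bfun (q0 _) (al01 _))) => //; apply: measurable_funM => //.
    exact: (measurableT_comp (mz _ _)).
- by move=> w; rewrite mulr_ge0 ?gam_ge0 ?bprod_ge0.
Qed.

End beta_product.

Section beta_product_derive.
Variable R : realType.
Implicit Types (z q al : nat -> R).
Local Notation leb := (@lebesgue_measure R).
Local Notation halfline := (`]0%R, +oo[%classic : set (measurableTypeR R)).

(** Models how [kz] depends on a step [x] of the first point along coordinate axis [i]. *)
Definition zmove (i : nat) (v : R) z (x : R) (k : nat) : R := if k == i then z k + v * x else z k.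

Lemma zmove0 i v z : zmove i v z 0 = z.
Proof. by apply/funext => k; rewrite /zmove mulr0 addr0; case: ifP. Qed.

Lemma incr_gt0 n i q : (forall k, (k < n)%N -> 0 < q k) -> forall k, (k < n)%N -> 0 < incr i q k.
Proof. by move=> q0 k kn; rewrite /incr; case: ifP => // _; rewrite ?addr_gt0 ?q0. Qed.

Variables (n : nat) (q al : nat -> R).
Hypotheses (q0 : forall k, (k < n)%N -> 0 < q k) (al01 : forall k, (k < n)%N -> 0 <= al k < 1).

Lemma is_derive_bprod (i : nat) (v : R) z (x y : R) : (i < n)%N ->
  is_derive x (1 : R) (fun x => bprod n q al (zmove i v z x) y)
    (- (y * (v * bprod n (incr i q) al (zmove i v z x) y))).
Proof.
move=> hi; pose o := Ordinal hi.
pose rest := \prod_(k < n | k != o) bfun (q k) (al k) (z k * y).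
have zo (k : 'I_n) w : k != o -> zmove i v z w k = z k.
  by move=> ko; rewrite /zmove; case: ifP => // /eqP E; case/eqP: ko; exact/val_inj.
have io (k : 'I_n) : k != o -> incr i q k = q k.
  by move=> ko; rewrite /incr; case: ifP => // /eqP E; case/eqP: ko; exact/val_inj.
have E w : bprod n q al (zmove i v z w) y = rest * bfun (q i) (al i) ((z i + v * w) * y).
  have R1 : \prod_(k < n | k != o) bfun (q k) (al k) (zmove i v z w k * y) = rest.
    by apply: eq_bigr => k ko; rewrite (zo _ _ ko).
  by rewrite /bprod (bigD1 o)//= R1 mulrC {1}/zmove eqxx.
have E' w : bprod n (incr i q) al (zmove i v z w) y = rest * bfun (q i + 1) (al i) ((z i + v * w) * y).
  have R1 : \prod_(k < n | k != o) bfun (incr i q k) (al k) (zmove i v z w k * y) = rest.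
    by apply: eq_bigr => k ko; rewrite (zo _ _ ko) (io _ ko).
  by rewrite /bprod (bigD1 o)//= R1 mulrC {1}/zmove {1}/incr eqxx.
rewrite (_ : (fun x => _) = (fun w => rest * bfun (q i) (al i) ((z i + v * w) * y))); last exact/funext.
rewrite E'.
have D1 : is_derive x (1 : R) (fun w : R => (z i + v * w) * y) (v * y).
  rewrite (_ : (fun w => _) = (fun w : R => (v * y) * w + z i * y)); last by apply/funext => w; ring.
  have := is_deriveD (is_derive_cmul (v * y) (@is_derive_id _ _ x (1 : R))) (is_derive_cst (z i * y) x 1).
  by move=> /is_derive_eq; apply; ring.
have := is_derive_cmul rest (is_derive1_comp (is_derive_bfun (q0 hi) (al01 hi) _) D1).
move=> /is_derive_eq; apply.
by move: (bfun _ _ _) => t; ring.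
Qed.

(** For [i < n] a step along axis [i] moves both [r^2] and entry [i] of [z]. For the other axes,
    treated next, only [r^2] moves. *)
Lemma is_derive_jfun_lt (i : nat) (c rho u v : R) z : (i < n)%N -> 0 < c -> 0 < rho ->
  (forall k, (k < n)%N -> 0 <= z k) -> 0 < z i ->
  is_derive (0 : R) (1 : R) (fun x => jfun n q al c (rho + u * x + x ^+ 2) (zmove i v z x))
    (- u * jfun n q al (c + 1) rho z - v * jfun n (incr i q) al (c + 1) rho z).
Proof.
move=> hi c0 r0 z0 zi.
have qi0 := @incr_gt0 n i q q0.
pose d0 := z i / (`|v| + 1).
have v0 : 0 < `|v| + 1 by rewrite ltr_wpDl.
have d00 : 0 < d0 by rewrite divr_gt0.
pose M1 := \prod_(k < n) bfun (q k) (al k) 0; pose M2 := \prod_(k < n) bfun (incr i q k) (al k) 0.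
have M10 : 0 <= M1 by apply: prodr_ge0 => k _; exact: bfun_ge0.
have M20 : 0 <= M2 by apply: prodr_ge0 => k _; exact: bfun_ge0.
have zm x : `|x| < d0 -> forall k, (k < n)%N -> 0 <= zmove i v z x k.
  rewrite /d0 ltr_pdivlMr// => hx k kn; rewrite /zmove; case: ifP => [/eqP ->|_]; last exact: z0.
  have h : `|v * x| <= `|x| * (`|v| + 1) by rewrite normrM mulrDr mulr1 mulrC lerDl.
  by move: (le_lt_trans h hx); rewrite ltr_norml => /andP[h1 _]; lra.
have := @is_derive_jint R c rho u d0 (M1 + `|v| * M2) (fun x => bprod n q al (zmove i v z x))
  (fun x y => v * bprod n (incr i q) al (zmove i v z x) y) c0 r0 d00.
move=> H; apply: is_derive_eq (H _ _ _ _ _) _.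
- by move=> x; exact: measurable_bprod.
- by apply: measurable_funM => //; exact: measurable_bprod.
- by move=> x y hx y0; exact: is_derive_bprod.
- move=> x y hx y0; apply: (@le_trans _ _ M1); last by rewrite lerDl; exact: mulr_ge0 (normr_ge0 _) M20.
  exact: bprod_bounded q0 al01 _ _ (zm _ hx) y0.
- move=> x y hx y0; rewrite normrM; apply: (@le_trans _ _ (`|v| * M2)); last by rewrite lerDr; exact: M10.
  by apply: ler_wpM2l (normr_ge0 _) _ _ _; exact: bprod_bounded qi0 al01 _ _ (zm _ hx) y0.
- rewrite zmove0 /jfun; congr (_ - _); rewrite /jint -RintegralZl//.
    by apply: eq_Rintegral => y _; rewrite mulrCA.
  apply: (integrable_jint (e := 0) (M := M2)) => //; first by rewrite addr_gt0.
    exact: measurable_bprod.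
  by move=> y y0; rewrite oppr0 powRr0 mulr1; exact: bprod_bounded qi0 al01 _ _ z0 y0.
Qed.

Lemma is_derive_jfun_ge (c rho u : R) z : 0 < c -> 0 < rho -> (forall k, (k < n)%N -> 0 <= z k) ->
  is_derive (0 : R) (1 : R) (fun x => jfun n q al c (rho + u * x + x ^+ 2) z)
    (- u * jfun n q al (c + 1) rho z).
Proof.
move=> c0 r0 z0.
have := @is_derive_jint R c rho u 1 (\prod_(k < n) bfun (q k) (al k) 0) (fun x => bprod n q al z)
  (fun x y => 0) c0 r0 ltr01.
move=> H; apply: is_derive_eq (H _ _ _ _ _) _.
- by move=> x; exact: measurable_bprod.
- by [].
- by move=> x y _ _; rewrite mulr0 oppr0; exact: is_derive_cst.
- by move=> x y _ y0; exact: bprod_bounded.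
- by move=> x y _ _; rewrite normr0; apply: prodr_ge0 => k _; exact: bfun_ge0.
- rewrite [jint _ _ (fun=> 0)](_ : _ = 0) ?subr0// /jint.
  under eq_Rintegral do rewrite mulr0.
  by rewrite /Rintegral integral0.
Qed.

End beta_product_derive.

(** * From Euler's integral over the cube to the half-line *)

Section cube_laplace.
Variable R : realType.
Implicit Types (z q al : nat -> R).
Local Notation leb := (@lebesgue_measure R).
Local Notation halfline := (`]0%R, +oo[%classic : set (measurableTypeR R)).

Lemma eq_cube_int n (F G : (nat -> R) -> R) :
  (forall t, (forall j, 0 <= t j <= 1) -> F t = G t) -> cube_int n F = cube_int n G.
Proof.
elim: n F G => [|n IH] F G H /=; first by apply: H => _; rewrite lexx ler01.
apply: eq_Rintegral => s; rewrite inE/= in_itv/= => s01.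
by apply: IH => t ht; apply: H => j; case: ifP.
Qed.

(** The weight and the exponential of the outermost variable are absorbed into [g], which is why the
    induction runs over general nonnegative integrable [g]; Tonelli then exchanges that variable
    with [y]. *)
Lemma cube_int_laplace n q al z (g : R -> R) :
  (forall k, (k < n)%N -> 0 < q k) -> (forall k, (k < n)%N -> 0 <= al k < 1) ->
  (forall k, (k < n)%N -> 0 <= z k) ->
  measurable_fun setT g -> (forall y, 0 < y -> 0 <= g y) -> leb.-integrable halfline (EFin \o g) ->
  cube_int n (fun t => \prod_(k < n) bwt (q k) (al k) (t k) *
     \int[leb]_(y in `]0%R, +oo[) (g y * \prod_(k < n) expR (- (z k * y * t k)))) =
  \int[leb]_(y in `]0%R, +oo[) (g y * bprod n q al z y).
Proof.
elim: n g => [|n IH] g hq hal hz mg g0 Ig /=.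
  by rewrite big_ord0 mul1r; apply: eq_Rintegral => y _; rewrite /bprod !big_ord0.
have hq' k (kn : (k < n)%N) := hq k (ltnW kn); have hal' k (kn : (k < n)%N) := hal k (ltnW kn).
have hz' k (kn : (k < n)%N) := hz k (ltnW kn).
have qn := hq n (ltnSn n); have aln := hal n (ltnSn n); have zn := hz n (ltnSn n).
pose b (s : R) := bwt (q n) (al n) s.
pose P (y : R) := bprod n q al z y.
have mP : measurable_fun setT P by exact: measurable_bprod.
have P0 y : 0 <= P y by exact: bprod_ge0.
pose ee (s y : R) := expR (- (z n * y * s)).
have mee s : measurable_fun setT (ee s).
  by do 2! (apply: measurableT_comp => //); do 2! apply: measurable_funM => //.
have ee0 s y : 0 <= ee s y by exact: expR_ge0.
have mbge s : measurable_fun setT (fun y => b s * (g y * ee s y)).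
  by apply: measurable_funM => //; apply: measurable_funM.
have step s : 0 <= s <= 1 ->
  cube_int n (fun t => \prod_(k < n.+1) bwt (q k) (al k) (if k == n :> nat then s else t k) *
     \int[leb]_(y in `]0%R, +oo[) (g y * \prod_(k < n.+1) expR (- (z k * y * (if k == n :> nat then s else t k))))) =
  \int[leb]_(y in `]0%R, +oo[) (b s * (g y * ee s y) * P y).
  move=> /andP[s0 s1]; rewrite -IH//; last 2 first.
  - by move=> y y0; rewrite mulr_ge0 ?bwt_ge0// mulr_ge0 ?g0.
  - apply: (@integrable_bounded_by _ _ R leb halfline _ _ (fun y => b s * g y)) => //.
    + by apply: measurable_funTS; exact: mbge.
    + exact: (integrableZl _ (b s) Ig).
    + move=> y /=; rewrite in_itv/= andbT => y0.
      rewrite ger0_norm; last by rewrite mulr_ge0 ?bwt_ge0// mulr_ge0 ?g0.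
      rewrite ler_wpM2l ?bwt_ge0// ler_piMr ?g0//.
      by rewrite /ee -expR0 ler_expR oppr_le0 !mulr_ge0// ltW.
  apply: eq_cube_int => t ht; rewrite !big_ord_recr /= eqxx -mulrA; congr (_ * _).
    by apply: eq_bigr => k _; rewrite (ltn_eqF (ltn_ord k)).
  rewrite -RintegralZl//.
    apply: eq_Rintegral => y _; rewrite !big_ord_recr /= eqxx /b /ee.
    under eq_bigr => k _ do rewrite (ltn_eqF (ltn_ord k)).
    ring.
  apply: (@integrable_bounded_by _ _ R leb halfline _ _ g) => //.
  + apply: measurable_funTS; apply: measurable_funM => //; apply: measurable_prod => k _.
    by do 2! (apply: measurableT_comp => //); do 2! apply: measurable_funM => //.
  + move=> y /=; rewrite in_itv/= andbT => y0.
    rewrite ger0_norm; last by rewrite mulr_ge0 ?g0// prodr_ge0// => k _; exact: expR_ge0.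
    rewrite ler_piMr ?g0//; apply: prodr_ile1 => k _; rewrite expR_ge0/= -expR0 ler_expR oppr_le0.
    by rewrite !mulr_ge0 ?hz ?(ltW y0)//; case: ifP => // _; have /andP[] := ht k.
under eq_Rintegral => s do (rewrite inE/= in_itv/= => hs; rewrite (step s hs)).
pose F (w : measurableTypeR R * measurableTypeR R) : R := b w.1 * (g w.2 * ee w.1 w.2) * P w.2.
have mF : measurable_fun setT F.
  apply: measurable_funM; last exact: (measurableT_comp mP).
  apply: measurable_funM; first exact: (measurableT_comp (measurable_bwt _ _)).
  apply: measurable_funM; first exact: (measurableT_comp mg).
  by do 2! (apply: measurableT_comp => //); do 2! apply: measurable_funM => //.
have E s : 0 <= s <= 1 -> ((\int[leb]_(y in `]0%R, +oo[) F (s, y))%R%:E =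
   \int[leb]_(y in `]0%R, +oo[) (F (s, y))%:E)%E.
  move=> /andP[s0 s1]; rewrite EFin_Rintegral//.
  apply: (@integrable_bounded_by _ _ R leb halfline _ _ (fun y => (b s * \prod_(k < n) bfun (q k) (al k) 0) * g y)) => //.
  + by apply: measurable_funTS; apply: measurable_funM => //; exact: mbge.
  + exact: (integrableZl _ (b s * \prod_(k < n) bfun (q k) (al k) 0) Ig).
  + move=> y /=; rewrite in_itv/= andbT => y0; rewrite /F /=.
    rewrite ger0_norm; last by rewrite mulr_ge0// mulr_ge0 ?bwt_ge0// mulr_ge0 ?g0.
    rewrite [leLHS]mulrAC; apply: ler_pM.
    * by rewrite mulr_ge0 ?bwt_ge0.
    * by rewrite mulr_ge0 ?g0.
    * by apply: ler_wpM2l; [exact: bwt_ge0|have := bprod_bounded hq' hal' hz' y0; rewrite ger0_norm].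
    * by rewrite ler_piMr ?g0// /ee -expR0 ler_expR oppr_le0 !mulr_ge0// ltW.
rewrite /Rintegral; congr fine.
rewrite (eq_integral (fun s => \int[leb]_(y in `]0%R, +oo[) (F (s, y))%:E)%E); last first.
  by move=> s; rewrite inE/= in_itv/= => hs; exact: E.
rewrite (@tonelli_in R _ _ _ _ leb leb `[0%R, 1%R]%classic halfline F)//; last first.
  move=> s y _ /=; rewrite in_itv/= andbT => y0; rewrite /F /=.
  by rewrite mulr_ge0// mulr_ge0 ?bwt_ge0// mulr_ge0 ?g0.
apply: eq_integral => y; rewrite inE/= in_itv/= andbT => y0.
rewrite /bprod big_ord_recr /= -/(bprod n q al z y) -/(P y) mulrA EFinM bfunE// -ge0_integralZl_fin//.
- by apply: eq_integral => s _; rewrite /F /ee /b /=; congr EFin; ring.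
- exact: measurable_bwt_exp.
- by move=> s _; rewrite mulr_ge0 ?bwt_ge0 ?expR_ge0.
- by rewrite mulr_ge0 ?g0.
Qed.

End cube_laplace.

(** * The fundamental solution and its conormal derivative *)

Section singular_kernel.
Variables (R : realType) (m n : nat) (alpha : nat -> R).
Hypotheses (m2 : (2 < m)%N) (nm : (n <= m)%N).
Hypothesis alpha01 : forall k, (k < n)%N -> 0 < 2 * alpha k < 1.
Local Notation leb := (@lebesgue_measure R).
Local Notation halfline := (`]0%R, +oo[%classic : set (measurableTypeR R)).
Local Notation q := (fun k => 1 - alpha k).
Local Notation ab := (abar m n alpha).
Implicit Types (xi x : 'rV[R]_m).

Lemma qexp_gt0 k : (k < n)%N -> 0 < q k.
Proof. by move=> /alpha01 /andP[h1 h2]; lra. Qed.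

Lemma alpha_01 k : (k < n)%N -> 0 <= alpha k < 1.
Proof. by move=> /alpha01 /andP[h1 h2]; apply/andP; split; lra. Qed.

Lemma m2_gt0 : 0 < (m%:R - 2 : R) / 2.
Proof. by rewrite divr_gt0// subr_gt0 ltr_nat. Qed.

Lemma sumq_lt_abar : \sum_(k < n) q k < ab.
Proof. by rewrite /abar ltrDr m2_gt0. Qed.

Lemma abar_gt0 : 0 < ab.
Proof.
apply: le_lt_trans sumq_lt_abar; apply: sumr_ge0 => k _; rewrite ltW//; exact: qexp_gt0.
Qed.

(** The difference between the squared distances to the reflected point and to [x]. It is positive
    in the orthant, so the arguments [sigmak] are negative there, within the range of Euler's
    integral. *)
Definition kz xi x (k : nat) : R := 4 * xc xi k * xc x k.

Lemma rk2E k xi x : (k < m)%N -> rk2 k xi x = rr2 xi x + kz xi x k.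
Proof.
move=> km; rewrite /rk2 /kz !(xc_ord _ km) /rr2 [in RHS](bigD1 (Ordinal km))//=.
rewrite [in LHS](eq_bigl (fun i => i != Ordinal km)); first by ring.
by move=> i; rewrite -val_eqE.
Qed.

Lemma kz_ge0 xi x k : orthant m n xi -> orthant m n x -> (k < n)%N -> 0 < kz xi x k.
Proof. by move=> h1 h2 kn; rewrite /kz !mulr_gt0 ?h1 ?h2. Qed.

(** What is left of [kappa] and of the constants of Euler's integral after cancellation; [Gamma ab]
    is used up by the half-line integral. *)
Definition kcst : R := 2 `^ (2 * ab - m%:R) / pi `^ (m%:R / 2) * \prod_(k < n) (Gamma (q k))^-1.

Local Notation J c xi x := (jfun n q alpha c (rr2 xi x) (kz xi x)).

Lemma Gamma_double_neq0 k : (k < n)%N -> Gamma (2 - 2 * alpha k) != 0.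
Proof. by move=> kn; rewrite lt0r_neq0// Gamma_gt0//; have /andP[] := alpha01 kn; lra. Qed.

Lemma Gamma_q_neq0 k : (k < n)%N -> Gamma (q k) != 0.
Proof. by move=> kn; rewrite lt0r_neq0// Gamma_gt0//; exact: qexp_gt0. Qed.

(** Euler's integrand contains [(S / r^2)^(- ab)] with [S = r^2 + sum_k kz_k t_k]. Written as a
    Gamma integral in [y], the power [S^(- ab)] has an exponential that factorises over [k], and
    each factor integrates to a [bfun]. *)
Lemma qnE xi x : orthant m n xi -> orthant m n x -> 0 < rr2 xi x ->
  qn n alpha xi x = kcst * \prod_(k < n) (xc xi k * xc x k) `^ (1 - 2 * alpha k) * J ab xi x.
Proof.
move=> Oxi Ox r0; have a0 := abar_gt0; have Ga := Gamma_gt0 a0.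
have z0 k : (k < n)%N -> 0 <= kz xi x k by move=> kn; rewrite ltW// kz_ge0.
pose rho := rr2 xi x; pose g y := rho `^ ab / Gamma ab * gam ab rho y.
have Ig : leb.-integrable halfline (EFin \o g).
  exact: (integrableZl _ (rho `^ ab / Gamma ab) (integrable_gam a0 r0)).
rewrite /qn /lauricellaFA (@eq_cube_int R n _ (fun t => \prod_(k < n) bwt (q k) (alpha k) (t k) *
     \int[leb]_(y in `]0%R, +oo[) (g y * \prod_(k < n) expR (- (kz xi x k * y * t k))))); last first.
  move=> t ht; congr (_ * _).
    by apply: eq_bigr => k _; rewrite bwtE; congr (_ `^ _ * _ `^ _); ring.
  pose S := rho + \sum_(k < n) kz xi x k * t k.
  have S0 : 0 < S.
    rewrite ltr_wpDr// sumr_ge0// => k _; rewrite mulr_ge0 ?z0//; by have /andP[] := ht k.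
  have -> : 1 - \sum_(k < n) sigmak k xi x * t k = S / rho.
    rewrite /S mulrDl divff ?lt0r_neq0// mulr_suml -sumrN; congr (_ + _); apply: eq_bigr => k _.
    rewrite /sigmak rk2E; last exact: leq_trans (ltn_ord k) nm.
    by rewrite -/rho; field; exact: lt0r_neq0.
  have -> : \int[leb]_(y in `]0%R, +oo[) (g y * \prod_(k < n) expR (- (kz xi x k * y * t k))) =
      rho `^ ab / Gamma ab * \int[leb]_(y in `]0%R, +oo[) gam ab S y.
    rewrite -RintegralZl//; last exact: integrable_gam.
    apply: eq_Rintegral => y _; rewrite /g -[LHS]mulrA; congr (_ * _); rewrite /gam -[LHS]mulrA; congr (_ * _).
    rewrite -expR_sum -expRD; congr expR; rewrite /S mulrDl opprD; congr (_ + _).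
    by rewrite mulr_suml -sumrN; apply: eq_bigr => k _; ring.
  rewrite Rintegral_gam// powRM ?invr_ge0 ?ltW// [X in _ * X](_ : _ = rho `^ ab); last first.
    by rewrite -powR_inv1 ?ltW// -powRrM mulN1r opprK.
  by field; exact: lt0r_neq0.
have mg : measurable_fun setT g by apply: measurable_funM => //; exact: measurable_gam.
have g0 y : 0 < y -> 0 <= g y 
  by move=> _; apply: mulr_ge0; [apply: divr_ge0; [exact: powR_ge0|exact: ltW]|exact: gam_ge0].
rewrite (@cube_int_laplace R n q alpha (kz xi x) g qexp_gt0 alpha_01 z0 mg g0 Ig).
rewrite -/rho.
have -> : \int[leb]_(y in `]0%R, +oo[) (g y * bprod n q alpha (kz xi x) y) = rho `^ ab / Gamma ab * J ab xi x.
  rewrite /jfun /jint -RintegralZl//.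
    by apply: eq_Rintegral => y _; rewrite /g -[LHS]mulrA.
  apply: (integrable_jint (e := 0) (M := \prod_(k < n) bfun (q k) (alpha k) 0)) => //.
    by apply: measurable_bprod; [exact: qexp_gt0|exact: alpha_01].
  by move=> y y0; rewrite oppr0 powRr0 mulr1; exact: (bprod_bounded qexp_gt0 alpha_01 z0 y0).
rewrite /kappa /kcst powRN.
have E : \prod_(k < n) (Gamma (q k))^-1 = \prod_(k < n) (Gamma (1 - alpha k) / Gamma (2 - 2 * alpha k)) *
    \prod_(k < n) (Gamma (2 - 2 * alpha k) / (Gamma (1 - alpha k) * Gamma (2 - 2 * alpha k - (1 - alpha k)))).
  rewrite -big_split; apply: eq_bigr => k _ /=.
  rewrite [2 - 2 * alpha k - (1 - alpha k)](_ : _ = 1 - alpha k); last by ring.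
  move: (Gamma_double_neq0 (ltn_ord k)) (Gamma_q_neq0 (ltn_ord k)) => /=.
  by move: (Gamma (1 - alpha k)) (Gamma (2 - 2 * alpha k)) => u1 u2 h1 h2; field; rewrite h1 h2.
rewrite E; set P1 := \prod_(k < n) (_ / _); set P2 := \prod_(k < n) (_ / _); set W := \prod_(k < n) _ `^ _.
move: (J ab xi x) => j; field.
by rewrite !lt0r_neq0// ?powR_gt0// pi_gt0.
Qed.

#[local] Opaque jfun.

Lemma is_derive_powR_comp (g : R -> R) (y dg p : R) : 0 < g y -> is_derive y (1 : R) g dg ->
  is_derive y (1 : R) (fun z => g z `^ p) (p * g y `^ (p - 1) * dg).
Proof.
by move=> g0 h; exact: (@is_derive1_comp R (fun w => w `^ p) g y _ _ (is_derive1_powR p g0) h).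
Qed.

Lemma derive_line (f : 'rV[R]_m -> R) xi v df :
  is_derive (0 : R) (1 : R) (fun h => f (xi + h *: v)) df -> 'D_v f xi = df.
Proof.
case=> _ <-; rewrite /derive.
set F := (X in lim (X @ _)); set G := (X in _ = lim (X @ _)).
have -> : F = G by apply/funext => h; rewrite /F /G /= scale0r !addr0 [h *: v + xi]addrC [h *: 1]mulr1.
by [].
Qed.

Lemma xc_line xi (i : 'I_m) (h : R) k : (k < m)%N ->
  xc (xi + h *: evec R i) k = xc xi k + (if k == i :> nat then h else 0).
Proof.
move=> km; rewrite xcD xcZ [xc (evec R i) k](xc_ord _ km) mxE eqxx /= -val_eqE /=.
by case: ifP; rewrite ?mulr1 ?mulr0.
Qed.

Lemma rr2_line xi x (i : 'I_m) (h : R) :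
  rr2 (xi + h *: evec R i) x = rr2 xi x + 2 * (xi ord0 i - x ord0 i) * h + h ^+ 2.
Proof.
rewrite !rr2E !enorm_sqr (_ : xi + h *: evec R i - x = (xi - x) + h *: evec R i); last by rewrite addrAC.
have [w wE] : exists w, w = xi - x by exists (xi - x).
rewrite -wE !(dotpDl, dotpDr, dotpZl, dotpZr).
have e1 : dotp w (evec R i) = xi ord0 i - x ord0 i.
  rewrite /dotp (bigD1 i)//= big1 ?addr0; first by rewrite mxE !eqxx mulr1 wE !mxE.
  by move=> j /negbTE ji; rewrite [evec _ _ _ _]mxE ji andbF mulr0.
have e2 : dotp (evec R i) (evec R i) = 1.
  rewrite /dotp (bigD1 i)//= big1 ?addr0; first by rewrite mxE !eqxx mulr1.
  by move=> j /negbTE ji; rewrite [evec _ _ _ _]mxE ji andbF mulr0.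
by rewrite [dotp (evec R i) w]dotpC e1 e2; ring.
Qed.

Lemma rr2_gt0 xi x : xi != x -> 0 < rr2 xi x.
Proof. by move=> xx; rewrite rr2E exprn_gt0// enorm_gt0 subr_eq0. Qed.

Local Notation Ji i c xi x := (jfun n (incr i q) alpha c (rr2 xi x) (kz xi x)).

(** The contributions to the partial derivative of [(xi_i x_i)^(1 - 2 alpha_i)] and of [kz], with
    the common factor removed. The first has a pole on the hyperplane [xi_i = 0]. *)
Definition ksing i xi x : R := if (i < n)%N then
  (1 - 2 * alpha i) * xc xi i `^ (- 1) * J ab xi x - 4 * xc x i * Ji i (ab + 1) xi x else 0.

Lemma partial_qn (i : 'I_m) xi x : orthant m n xi -> orthant m n x -> xi != x ->
  partial i (fun y => qn n alpha y x) xi =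
  kcst * \prod_(k < n) (xc xi k * xc x k) `^ (1 - 2 * alpha k) *
    (- (2 * (xi ord0 i - x ord0 i)) * J (ab + 1) xi x + ksing i xi x).
Proof.
move=> Oxi Ox xx; apply: derive_line.
have r0 := rr2_gt0 xx; have a0 := abar_gt0.
have z0 k : (k < n)%N -> 0 <= kz xi x k by move=> kn; rewrite ltW// kz_ge0.
pose u := 2 * (xi ord0 i - x ord0 i).
pose f (h : R) := kcst * \prod_(k < n) (xc (xi + h *: evec R i) k * xc x k) `^ (1 - 2 * alpha k) *
  jfun n q alpha ab (rr2 xi x + u * h + h ^+ 2) (kz (xi + h *: evec R i) x).
(* [qnE] is available only in the orthant and away from [x], an open set, so the formula replaces
   [qn] for small [h]. *)
apply: (@near_eq_is_derive _ _ _ f).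
  have oU : open (orthant m n `&` ~` [set x]).
    apply: openI; [exact: orthant_open|apply: closed_openC].
    rewrite (_ : [set x] = ecball x 0); first exact: closed_ecball.
    apply/seteqP; split => y; rewrite /ecball/=; first by move=> ->; rewrite subrr enorm0.
    by move=> h; apply/eqP; rewrite -subr_eq0; apply: contraTT h; rewrite -ltNge enorm_gt0.
  have : nbhs (xi + 0 *: evec R i) (orthant m n `&` ~` [set x]).
    by rewrite scale0r addr0; apply: open_nbhs_nbhs; split => //; split => //; exact/eqP.
  move=> nU.
  have H : \forall h \near (0 : R), (orthant m n `&` ~` [set x]) (xi + h *: evec R i).
    exact: (@line_continuous R m xi (evec R i) (0 : R) _ nU).
  near=> h; have [Oh /eqP hx] : (orthant m n `&` ~` [set x]) (xi + h *: evec R i) by near: h; exact: H.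
  by rewrite /f -rr2_line qnE// rr2_gt0.
rewrite /f /ksing.
have [iN|iN] := ltnP i n; last first.
  have E h k : (k < n)%N -> xc (xi + h *: evec R i) k = xc xi k.
    by move=> kn; rewrite xc_line ?(leq_trans kn nm)// (ltn_eqF (leq_trans kn iN)) addr0.
  rewrite (_ : (fun h => _) = (fun h => kcst * \prod_(k < n) (xc xi k * xc x k) `^ (1 - 2 * alpha k) *
      jfun n q alpha ab (rr2 xi x + u * h + h ^+ 2) (kz xi x))); last first.
    apply/funext => h; rewrite (@eq_jfun _ n q alpha _ _ (kz (xi + h *: evec R i) x) (kz xi x)).
      by congr (_ * _ * jfun _ _ _ _ _ _); apply: eq_bigr => k _; rewrite (E h k (ltn_ord k)).
    by move=> k kn; rewrite /kz (E h k kn).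
  rewrite addr0; apply: is_derive_cmul.
  by apply: is_derive_jfun_ge => //; [exact: qexp_gt0|exact: alpha_01].
pose o := Ordinal iN; pose p := 1 - 2 * alpha i.
pose rest := \prod_(k < n | k != o) (xc xi k * xc x k) `^ (1 - 2 * alpha k).
have Eo (k : 'I_n) : k != o -> (k == i :> nat) = false.
  by move=> ko; apply/negbTE; apply: contraNneq ko => ki; exact/eqP/val_inj.
have Ei h : xc (xi + h *: evec R i) i = xc xi i + h by rewrite xc_line// eqxx.
have xi0 : 0 < xc xi i := Oxi _ iN; have x0 : 0 < xc x i := Ox _ iN.
rewrite (_ : (fun h => _) = (fun h => kcst * rest *
    (((xc x i * h + xc xi i * xc x i) `^ p) *
      jfun n q alpha ab (rr2 xi x + u * h + h ^+ 2) (zmove i (4 * xc x i) (kz xi x) h)))); last first.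
  apply/funext => h.
  rewrite (@eq_jfun _ n q alpha _ _ (kz (xi + h *: evec R i) x) (zmove i (4 * xc x i) (kz xi x) h)); last first.
    move=> k kn; rewrite /zmove /kz (xc_line _ _ _ (leq_trans kn nm)).
    by case: ifP => [/eqP ki|_]; rewrite ?addr0// ki; ring.
  rewrite (bigD1 o)//= Ei.
  rewrite (_ : \prod_(k < n | k != o) _ = rest); last first.
    apply: eq_bigr => k ko; rewrite xc_line ?Eo ?addr0//; exact: leq_trans (ltn_ord k) nm.
  rewrite [(xc xi i + h) * xc x i](_ : _ = xc x i * h + xc xi i * xc x i); last by ring.
  by rewrite -[1 - 2 * alpha i]/p; move: (jfun _ _ _ _ _ _) => j; ring.
have W : \prod_(k < n) (xc xi k * xc x k) `^ (1 - 2 * alpha k) = rest * (xc xi i * xc x i) `^ p.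
  by rewrite (bigD1 o)//= mulrC.
have D1 : is_derive (0 : R) (1 : R) (fun h : R => xc x i * h + xc xi i * xc x i) (xc x i).
  have := is_deriveD (is_derive_cmul (xc x i) (@is_derive_id _ _ (0 : R) (1 : R))) (is_derive_cst (xc xi i * xc x i) (0 : R) 1).
  by move=> /is_derive_eq; apply; ring.
have w0 : 0 < xc x i * 0 + xc xi i * xc x i by rewrite mulr0 add0r mulr_gt0.
have D2 : is_derive (0 : R) (1 : R) (fun h : R => (xc x i * h + xc xi i * xc x i) `^ p)
    (p * (xc x i * 0 + xc xi i * xc x i) `^ (p - 1) * xc x i).
  exact: (@is_derive_powR_comp (fun h : R => xc x i * h + xc xi i * xc x i) 0 (xc x i) p w0 D1).
have D3 := is_derive_jfun_lt qexp_gt0 alpha_01 u (4 * xc x i) iN a0 r0 z0 (kz_ge0 Oxi Ox iN).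
have := is_derive_cmul (kcst * rest) (is_derive_mul D2 D3).
move=> /is_derive_eq; apply; rewrite (powR_inv1 (ltW xi0)) W zmove0 mulr0 !add0r expr0n /= mulr0 !addr0 /u /p.
rewrite [_ `^ (_ - 1)]powRD; last by rewrite (lt0r_neq0 (mulr_gt0 xi0 x0)) implybT.
rewrite powRN powRr1; last by rewrite mulr_ge0// ltW.
move: (J ab xi x) (J (ab + 1) xi x) (Ji i (ab + 1) xi x) => j1 j2 j3.
by field; rewrite !lt0r_neq0.
Unshelve. all: by end_near.
Qed.

(** The conormal weight [xi_k^(2 alpha_k)] times [(xi_k x_k)^(1 - 2 alpha_k)]. A full power of
    [xi_k] remains, just enough to cancel the pole of [ksing]. *)
Definition kW xi x : R := \prod_(k < n) (xc xi k * xc x k `^ (1 - 2 * alpha k)).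
(** The coefficient of the normal component of [xi - x], which carries the leading singularity; [kH]
    collects terms of lower order. *)
Definition kG xi x : R := 2 * kcst * kW xi x * J (ab + 1) xi x.
Definition kH i xi x : R := kcst * kW xi x * ksing i xi x.

Lemma conormalE (N : 'rV[R]_m -> 'rV[R]_m) xi x : orthant m n xi -> orthant m n x -> xi != x ->
  conormal n alpha N (fun y => qn n alpha y x) xi =
  - kG xi x * dotp (xi - x) (N xi) + \sum_(i < m) kH i xi x * N xi ord0 i.
Proof.
move=> Oxi Ox xx; rewrite /conormal /dotp.
have E : \prod_(k < n) xc xi k `^ (2 * alpha k) * \prod_(k < n) (xc xi k * xc x k) `^ (1 - 2 * alpha k) = kW xi x.
  rewrite -big_split /=; apply: eq_bigr => k _.
  have h1 := Oxi _ (ltn_ord k); have h2 := Ox _ (ltn_ord k).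
  rewrite powRM ?ltW// mulrA -powRD; last by rewrite (lt0r_neq0 h1) implybT.
  by rewrite addrC subrK powRr1// ltW.
have P i := partial_qn i Oxi Ox xx.
rewrite [\sum_(i < m) _ in LHS](eq_bigr (fun i => _ * N xi ord0 i) (fun i _ => congr1 (fun w => w * N xi ord0 i) (P i))).
rewrite !mulr_sumr -big_split /=; apply: eq_bigr => i _.
rewrite /kG /kH -E !mxE; ring.
Qed.

Lemma kcst_ge0 : 0 <= kcst.
Proof.
rewrite /kcst mulr_ge0 ?divr_ge0 ?powR_ge0// prodr_ge0// => k _.
by rewrite invr_ge0 ltW// Gamma_gt0// qexp_gt0.
Qed.

Lemma kcstE : kcst = 2 `^ (2 * ab - m%:R) / pi `^ (m%:R / 2) * \prod_(k < n) (Gamma (q k))^-1.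
Proof. by []. Qed.

End singular_kernel.

#[global] Opaque kcst jfun.

(** * Kernel bounds away from the diagonal *)

Section kernel_estimates.
Variables (R : realType) (m n : nat) (alpha : nat -> R).
Hypotheses (m2 : (2 < m)%N) (nm : (n <= m)%N).
Hypothesis alpha01 : forall k, (k < n)%N -> 0 < 2 * alpha k < 1.
Local Notation q := (fun k => 1 - alpha k).
Local Notation ab := (abar m n alpha).
Local Notation J c xi x := (jfun n q alpha c (rr2 xi x) (kz xi x)).
Local Notation Ji i c xi x := (jfun n (incr i q) alpha c (rr2 xi x) (kz xi x)).
Implicit Types (xi x : 'rV[R]_m).

Let q0 := qexp_gt0 alpha01.
Let al01 := alpha_01 alpha01.
Let a0 := abar_gt0 m2 alpha01.

Lemma prod_le_exprn (F : nat -> R) (C : R) : (forall k, (k < n)%N -> 0 <= F k <= C) -> \prod_(k < n) F k <= C ^+ n.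
Proof.
move=> H; rewrite -[n in leRHS]card_ord -prodr_const; apply: ler_prod => k _; exact: H.
Qed.

Lemma prod_near1 (u : nat -> R) (h : R) k : 0 <= h <= 1 -> (forall j, (j < k)%N -> `|u j - 1| <= h) ->
  `|\prod_(j < k) u j - 1| <= (2 ^+ k - 1) * h.
Proof.
move=> /andP[h0 h1]; elim: k => [_|k IH H]; first by rewrite big_ord0 expr0 !subrr mul0r normr0.
have {}IH := IH (fun j jk => H j (ltnW jk)).
have Hk := H k (ltnSn k).
rewrite big_ord_recr /=; set P := \prod_(j < k) u j in IH *.
have -> : P * u k - 1 = (P - 1) * u k + (u k - 1) by ring.
have uk : `|u k| <= 2.
  by rewrite -[u k](subrK 1) (le_trans (ler_normD _ _))// normr1; lra.
rewrite (le_trans (ler_normD _ _))// normrM.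
have : `|P - 1| * `|u k| <= (2 ^+ k - 1) * h * 2 by apply: ler_pM.
by rewrite exprS; move: (2 ^+ k : R) => e; lra.
Qed.

Lemma powR_near1 (w e : R) : 0 < w -> 0 <= e <= 1 -> `|w `^ e - 1| <= `|w - 1|.
Proof.
move=> w0 /andP[e0 e1]; have [w1|w1] := leP 1 w.
  have h1 : 1 <= w `^ e by rewrite -(powRr0 w) ler_powR.
  have h2 : w `^ e <= w by rewrite -{2}(powRr1 (ltW w0)) ler_powR.
  by rewrite !ger0_norm; lra.
have h1 : w `^ e <= 1 by rewrite powR_le1// (ltW w0) ltW.
have h2 : w <= w `^ e by rewrite -{1}(powRr1 (ltW w0)); apply: ger_powR => //; rewrite w0 ltW.
by rewrite !ler0_norm; lra.
Qed.

Lemma kW_ge0 xi x : orthant m n xi -> 0 <= kW n alpha xi x.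
Proof. by move=> O; apply: prodr_ge0 => k _; rewrite mulr_ge0 ?powR_ge0// ltW// O. Qed.

Lemma powR_le_base (u B p : R) : 0 < u -> u <= B -> 1 <= B -> 0 <= p <= 1 -> u `^ p <= B.
Proof.
move=> u0 uB B1 /andP[p0 p1]; apply: (@le_trans _ _ (B `^ p)).
  by apply: ge0_ler_powR; rewrite ?nnegrE// ?(ltW u0)// (le_trans ler01).
by rewrite -{2}[B]powRr1 ?(le_trans ler01)// ler_powR.
Qed.

Lemma oneB2alpha k : (k < n)%N -> 0 <= 1 - 2 * alpha k <= 1.
Proof. by move=> /alpha01 /andP[h1 h2]; apply/andP; split; lra. Qed.

Lemma kW_le xi x (B : R) : 1 <= B -> orthant m n xi -> orthant m n x ->
  (forall k, (k < n)%N -> xc xi k <= B) -> (forall k, (k < n)%N -> xc x k <= B) ->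
  kW n alpha xi x <= (B * B) ^+ n.
Proof.
move=> B1 O1 O2 H1 H2; apply: (@prod_le_exprn (fun k => xc xi k * xc x k `^ (1 - 2 * alpha k))) => k kn.
have h1 := O1 k kn; have h2 := O2 k kn.
rewrite mulr_ge0 ?powR_ge0 ?(ltW h1)//=; apply: ler_pM; rewrite ?powR_ge0 ?(ltW h1)// ?H1//.
by apply: powR_le_base; rewrite ?H2// oneB2alpha.
Qed.

(** Factor [i] of [kW] contains [xi_i], which cancels the inverse; what remains is bounded up to the
    hyperplanes. *)
Lemma kW_div_le xi x (B : R) i : (i < n)%N -> 1 <= B -> orthant m n xi -> orthant m n x ->
  (forall k, (k < n)%N -> xc xi k <= B) -> (forall k, (k < n)%N -> xc x k <= B) ->
  kW n alpha xi x * xc xi i `^ (- 1) <= (B * B) ^+ n.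
Proof.
move=> hi B1 O1 O2 H1 H2; have h := O1 i hi.
pose F k := if k == i then xc x k `^ (1 - 2 * alpha k) else xc xi k * xc x k `^ (1 - 2 * alpha k).
have -> : kW n alpha xi x * xc xi i `^ (- 1) = \prod_(k < n) F k.
  rewrite /kW (bigD1 (Ordinal hi))//= [in RHS](bigD1 (Ordinal hi))//= {1}/F eqxx.
  rewrite (powR_inv1 (ltW h)).
  rewrite [X in _ = _ * X](eq_bigr (fun k : 'I_n => xc xi k * xc x k `^ (1 - 2 * alpha k))); last first.
    move=> k ko; rewrite /F; case: ifP => // /eqP E; case/eqP: ko; exact/val_inj.
  by move: (\prod_(k < n | _) _) => P; field; exact: lt0r_neq0.
apply: prod_le_exprn => k kn; have h1 := O1 k kn; have h2 := O2 k kn.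
have h3 : xc x k `^ (1 - 2 * alpha k) <= B by apply: powR_le_base; rewrite ?H2// oneB2alpha.
rewrite /F; case: ifP => _.
  by rewrite powR_ge0/= (le_trans h3)// ler_peMl// (le_trans ler01).
by rewrite mulr_ge0 ?powR_ge0 ?(ltW h1)//=; apply: ler_pM; rewrite ?powR_ge0 ?(ltW h1)// H1.
Qed.

Lemma kH_le xi x (B C : R) i : 1 <= B -> orthant m n xi -> orthant m n x ->
  (forall k, (k < n)%N -> xc xi k <= B) -> (forall k, (k < n)%N -> xc x k <= B) ->
  `|J ab xi x| <= C -> `|Ji i (ab + 1) xi x| <= C ->
  `|kH n alpha i xi x| <= kcst m n alpha * (B * B) ^+ n * (1 + 4 * B) * C.
Proof.
move=> B1 O1 O2 H1 H2 J1 J2; rewrite /kH /ksing.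
have C0 : 0 <= C by exact: le_trans J1.
have B0 : 0 <= B by exact: le_trans B1.
have k0 := kcst_ge0 m alpha01; have W0 := @kW_ge0 xi x O1.
case: ifPn => [hi|_]; last first.
  by rewrite mulr0 normr0; repeat (apply: mulr_ge0 => //); [rewrite exprn_ge0// mulr_ge0|apply: addr_ge0 => //; apply: mulr_ge0].
have h1 := kW_div_le hi B1 O1 O2 H1 H2; have h2 := kW_le B1 O1 O2 H1 H2.
have xi0 := O1 i hi; have x0 := O2 i hi.
move: J1 J2; move: (J ab xi x) (Ji i (ab + 1) xi x) => j1 j2 J1 J2.
have /andP[p0 p1] := oneB2alpha hi.
move: h1 h2 W0 k0; move: (kW n alpha xi x) (kcst m n alpha) (xc xi i `^ (- 1)) (powR_ge0 (xc xi i) (-1)) => W k y y0 h1 h2 W0 k0.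
rewrite normrM normrM (ger0_norm W0) (ger0_norm k0).
rewrite -!mulrA; apply: ler_wpM2l => //.
apply: (@le_trans _ _ (W * y * C + W * (4 * B) * C)).
  rewrite -!mulrA -mulrDr; apply: ler_wpM2l => //.
  apply: le_trans (ler_normB _ _) _; rewrite !normrM (ger0_norm p0) (ger0_norm y0) (ger0_norm (ltW x0)).
  rewrite (ger0_norm (ler0n _ _)); apply: lerD.
    rewrite mulrA; apply: ler_pM => //; first exact: mulr_ge0.
    by rewrite ler_piMl.
  by apply: ler_wpM2l => //; apply: ler_pM => //; [exact: ltW|exact: H2].
rewrite -mulrDl [leRHS]mulrA; apply: ler_wpM2r => //; rewrite mulrDr mulr1; apply: lerD => //.
by apply: ler_wpM2r => //; rewrite mulr_ge0.
Qed.

Lemma incr_q_gt0 i k : (k < n)%N -> 0 < incr i q k.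
Proof. exact: incr_gt0 q0 k. Qed.

(** Only [r >= d] is used: a Beta transform is bounded by its value at 0, so no lower bound on the
    coordinates enters. *)
Lemma jfun_far (d : R) : 0 < d -> exists2 C, 0 <= C & forall xi x, orthant m n xi -> orthant m n x ->
  d <= enorm (xi - x) -> `|J ab xi x| <= C /\ `|J (ab + 1) xi x| <= C /\
  forall i, (i < n)%N -> `|Ji i (ab + 1) xi x| <= C.
Proof.
move=> d0; have a10 : 0 < ab + 1 by rewrite addr_gt0.
have d20 : 0 < d ^+ 2 by rewrite exprn_gt0.
have [T TE] : exists T : R -> (nat -> R) -> R, forall c p, T c p =
  \prod_(k < n) bfun (p k) (alpha k) 0 * (Gamma c * (d ^+ 2) `^ (- c)) by eexists.
have T0 c p : 0 < c -> 0 <= T c p.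
  move=> c0; rewrite TE mulr_ge0 ?prodr_ge0// => [k _|]; first exact: bfun_ge0.
  by rewrite mulr_ge0 ?powR_ge0// ltW// Gamma_gt0.
have H c p xi x : 0 < c -> (forall k, (k < n)%N -> 0 < p k) -> orthant m n xi -> orthant m n x -> d <= enorm (xi - x) ->
    `|jfun n p alpha c (rr2 xi x) (kz xi x)| <= T c p.
  move=> c0 p0 O1 O2 dx; have r0 : d ^+ 2 <= rr2 xi x by rewrite rr2E lerXn2r ?nnegrE ?enorm_ge0// ltW.
  apply: le_trans (jfun_bounded p0 al01 c0 (lt_le_trans d20 r0) _) _.
    by move=> k kn; rewrite ltW//; apply: (kz_ge0 O1 O2 kn).
  rewrite TE ler_wpM2l ?prodr_ge0// => [k _|]; first exact: bfun_ge0.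
  rewrite ler_wpM2l ?(ltW (Gamma_gt0 _))// !powRN lef_pV2 ?posrE ?powR_gt0//; last exact: lt_le_trans r0.
  by apply: ge0_ler_powR; rewrite ?nnegrE ?(ltW c0) ?(ltW d20)// (le_trans (ltW d20)).
exists (T ab q + T (ab + 1) q + \sum_(i < n) T (ab + 1) (incr i q)).
  by rewrite !addr_ge0 ?T0// sumr_ge0// => i _; rewrite T0.
have S0 : 0 <= \sum_(i < n) T (ab + 1) (incr i q) by rewrite sumr_ge0// => i _; rewrite T0.
have t1 := T0 _ q a0; have t2 := T0 _ q a10.
move=> xi x O1 O2 dx; split; [|split].
- by apply: le_trans (H _ _ _ _ a0 q0 O1 O2 dx) _; move: (T ab q) (T (ab + 1) q) (\sum_(i < n) _) t1 t2 S0 => *; lra.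
- by apply: le_trans (H _ _ _ _ a10 q0 O1 O2 dx) _; move: (T ab q) (T (ab + 1) q) (\sum_(i < n) _) t1 t2 S0 => *; lra.
- move=> i hi; apply: le_trans (H _ _ _ _ a10 (@incr_q_gt0 i) O1 O2 dx) _.
  have S1 : 0 <= \sum_(j < n | j != Ordinal hi) T (ab + 1) (incr j q) by rewrite sumr_ge0// => j _; rewrite T0.
  rewrite (bigD1 (Ordinal hi))//=.
  by move: (T ab q) (T (ab + 1) q) (T _ (incr i q)) (\sum_(j < n | _) _) t1 t2 S1 => *; lra.
Qed.

Lemma coord_le_B xi (B : R) : enorm xi <= B -> forall k, (k < n)%N -> xc xi k <= B.
Proof.
move=> xB k kn; rewrite (xc_ord _ (leq_trans kn nm)) (le_trans (ler_norm _))//.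
by rewrite (le_trans (coord_le_enorm _ _)).
Qed.

Lemma sum_kH_le (N : 'rV[R]_m -> 'rV[R]_m) xi x (C : R) : enorm (N xi) = 1 ->
  (forall i : 'I_m, `|kH n alpha i xi x| <= C) ->
  `|\sum_(i < m) kH n alpha i xi x * N xi ord0 i| <= m%:R * C.
Proof.
move=> N1 H; apply: le_trans (ler_norm_sum _ _ _) _.
rewrite mulr_natl -[m in leRHS]card_ord -sumr_const; apply: ler_sum => i _.
rewrite normrM -[leRHS]mulr1; apply: ler_pM => //.
by rewrite -N1; exact: coord_le_enorm.
Qed.

(** [C] depends on the distance and the size of the points but not on their distance to the
    hyperplanes, as a dominating constant on the far part of the surface must. *)
Lemma kernel_far (N : 'rV[R]_m -> 'rV[R]_m) (d B : R) : 0 < d -> 1 <= B -> exists2 C, 0 <= C &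
  forall xi x, orthant m n xi -> orthant m n x -> enorm xi <= B -> enorm x <= B -> enorm (N xi) = 1 ->
  d <= enorm (xi - x) -> `|conormal n alpha N (fun y => qn n alpha y x) xi| <= C.
Proof.
move=> d0 B1; have [C C0 HC] := jfun_far d0.
have B0 : 0 <= B := le_trans ler01 B1.
have k0 := kcst_ge0 m alpha01.
have BB : 0 <= (B * B) ^+ n by rewrite exprn_ge0// mulr_ge0.
exists (2 * kcst m n alpha * (B * B) ^+ n * C * (2 * B) + m%:R * (kcst m n alpha * (B * B) ^+ n * (1 + 4 * B) * C)).
  by apply: addr_ge0; repeat (apply: mulr_ge0 => //); apply: addr_ge0 => //; apply: mulr_ge0.
move=> xi x O1 O2 xB1 xB2 N1 dx; have [J1 [J2 J3]] := HC _ _ O1 O2 dx.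
have c1 := coord_le_B xB1; have c2 := coord_le_B xB2.
have xx : xi != x.
  by apply: contraTneq (lt_le_trans d0 dx) => ->; rewrite subrr enorm0 ltxx.
rewrite (conormalE m2 nm alpha01)//; apply: le_trans (ler_normD _ _) _; apply: lerD.
  rewrite mulNr normrN normrM; apply: ler_pM => //.
    have W0 := @kW_ge0 xi x O1; have W1 := kW_le B1 O1 O2 c1 c2.
    rewrite /kG; move: (kcst m n alpha) k0 (kW n alpha xi x) W0 W1 (J (ab + 1) xi x) J2 => k k0 W W0 W1 j J2.
    rewrite !normrM (ger0_norm W0) (ger0_norm k0) (ger0_norm (ler0n _ _)).
    apply: ler_pM => //; first by rewrite !mulr_ge0.
    by rewrite ler_wpM2l ?mulr_ge0.
  rewrite (le_trans (cauchy_schwarz _ _))// N1 mulr1 (le_trans (ler_enormB _ _))//.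
  by rewrite mulrDl mul1r lerD.
apply: sum_kH_le => // i; have [hi|hi] := ltnP i n.
  exact: (kH_le B1 O1 O2 c1 c2 J1 (J3 i hi)).
rewrite /kH /ksing ltnNge hi /= mulr0 normr0.
by repeat (apply: mulr_ge0 => //); apply: addr_ge0 => //; apply: mulr_ge0.
Qed.

End kernel_estimates.

(** * Asymptotics of the kernel at the diagonal *)

Section kernel_near_diagonal.
Variables (R : realType) (m n : nat) (alpha : nat -> R).
Hypotheses (m2 : (2 < m)%N) (nm : (n <= m)%N).
Hypothesis alpha01 : forall k, (k < n)%N -> 0 < 2 * alpha k < 1.
Local Notation q := (fun k => 1 - alpha k).
Local Notation ab := (abar m n alpha).
Local Notation J c xi x := (jfun n q alpha c (rr2 xi x) (kz xi x)).
Local Notation Ji i c xi x := (jfun n (incr i q) alpha c (rr2 xi x) (kz xi x)).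
Implicit Types (xi x : 'rV[R]_m).

Let q0 := qexp_gt0 alpha01.
Let al01 := alpha_01 alpha01.
Let a0 := abar_gt0 m2 alpha01.

(** The reciprocal of the area of the unit sphere of R^m, the constant in the gradient of the
    Newtonian kernel. *)
Definition newton_cst : R := Gamma (m%:R / 2) / (2 * pi `^ (m%:R / 2)).
Local Notation c0 := newton_cst.

Lemma newton_cst_gt0 : 0 < c0.
Proof.
rewrite divr_gt0 ?mulr_gt0 ?powR_gt0 ?pi_gt0// Gamma_gt0// divr_gt0// ltr0n.
by rewrite (ltn_trans _ m2).
Qed.

Lemma prod_powRN (b : R) (p : nat -> R) k : 0 < b -> \prod_(j < k) b `^ (- p j) = b `^ (- \sum_(j < k) p j).
Proof.
move=> b0; elim: k => [|k IH]; first by rewrite !big_ord0 oppr0 powRr0.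
rewrite !big_ord_recr /= IH -powRD; last by rewrite (lt0r_neq0 b0) implybT.
by rewrite opprD.
Qed.

(** The powers belonging to one pair of coordinates combine to [(u / v)^a], which tends to 1 on the
    diagonal. *)
Lemma leading_factor (u v a : R) : 0 < u -> 0 < v ->
  (4 * u * v) `^ (- (1 - a)) * (u * v `^ (1 - 2 * a)) = 4 `^ (- (1 - a)) * (u / v) `^ a.
Proof.
move=> u0 v0.
rewrite !powRM ?invr_ge0 ?mulr_ge0 ?(ltW u0) ?(ltW v0)//.
have -> : v^-1 `^ a = v `^ (- a) by rewrite -powR_inv1 ?ltW// -powRrM mulN1r.
have -> : u `^ a = u `^ (- (1 - a)) * u.
  by rewrite -{3}(powRr1 (ltW u0)) -powRD ?(lt0r_neq0 u0) ?implybT//; congr (_ `^ _); ring.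
have -> : v `^ (- a) = v `^ (- (1 - a)) * v `^ (1 - 2 * a).
  by rewrite -powRD ?(lt0r_neq0 v0) ?implybT//; congr (_ `^ _); ring.
ring.
Qed.

(** Since [2 ab - m = 2 sum_k q_k - 2], the powers of 2 collapse to the factor 1/2 of [c0], while
    the Gamma factors of [kcst] cancel those of the leading terms. *)
Lemma leading_coef xi x : orthant m n xi -> orthant m n x ->
  2 * kcst m n alpha * kW n alpha xi x * (\prod_(k < n) (Gamma (q k) * kz xi x k `^ (- q k)) * Gamma (m%:R / 2)) =
  c0 * \prod_(k < n) (xc xi k / xc x k) `^ alpha k.
Proof.
move=> O1 O2; rewrite kcstE.
have E : \prod_(k < n) (Gamma (q k))^-1 * \prod_(k < n) (Gamma (q k) * kz xi x k `^ (- q k)) * kW n alpha xi x =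
   4 `^ (- \sum_(k < n) q k) * \prod_(k < n) (xc xi k / xc x k) `^ alpha k.
  rewrite -(@prod_powRN 4 q n)// -!big_split; apply: eq_bigr => k _ /=.
  rewrite mulKf; last by rewrite lt0r_neq0// Gamma_gt0// q0.
  exact: leading_factor (O1 _ (ltn_ord k)) (O2 _ (ltn_ord k)).
have E2 : 2 * 2 `^ (2 * ab - m%:R) * 4 `^ (- \sum_(k < n) q k) = 2^-1 :> R.
  have -> : 4 `^ (- \sum_(k < n) q k) = 2 `^ (- (2 * \sum_(k < n) q k)) :> R.
    have -> : 4 = 2 `^ 2 :> R by rewrite powR_mulrn// expr2 -natrM.
    by rewrite -powRrM mulrN.
  rewrite -{1}(@powRr1 R 2)// -!powRD ?lt0r_neq0 ?implybT// -powR_inv1//; congr (_ `^ _).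
  by rewrite /abar; field.
rewrite /newton_cst.
move: E E2; move: (\prod_(k < n) (Gamma (q k))^-1) (\prod_(k < n) (Gamma (q k) * _)) (kW n alpha xi x) => P1 P2 W.
move: (\prod_(k < n) _) (4 `^ _) (2 `^ _) => P3 F T E E2.
have -> : 2 * (T / pi `^ (m%:R / 2) * P1) * W * (P2 * Gamma (m%:R / 2)) = 2 * T * (P1 * P2 * W) * (Gamma (m%:R / 2) / pi `^ (m%:R / 2)).
  by ring.
rewrite E [2 * T * (F * P3)]mulrA E2; move: (Gamma _) => g; field.
by rewrite lt0r_neq0// powR_gt0// pi_gt0.
Qed.

Lemma xcB xi x k : xc (xi - x) k = xc xi k - xc x k.
Proof. by rewrite xcD -scaleN1r xcZ mulN1r. Qed.

(** Moving [t] by [e / 2] against axis [k] stays in the orthant, so its coordinate exceeds [e / 2];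
    at most [e / 4] is lost in passing to [y]. *)
Lemma orthant_coord_gt (t : 'rV[R]_m) (e : R) : 0 < e -> eball t e `<=` orthant m n ->
  forall y, enorm (y - t) < e / 4 -> forall k, (k < n)%N -> e / 4 < xc y k.
Proof.
move=> e0 H y yt k kn; have km := leq_trans kn nm.
have h1 : e / 2 < xc t k.
  have : orthant m n (t + (- (e / 2)) *: evec R (Ordinal km)).
    apply: H; rewrite /eball/= addrAC subrr add0r enormZ.
    have -> : enorm (evec R (Ordinal km)) = 1.
      rewrite /enorm /dotp (bigD1 (Ordinal km))//= big1 ?addr0; first by rewrite mxE !eqxx mulr1 sqrtr1.
      by move=> j /negbTE ji; rewrite [evec _ _ _ _]mxE ji andbF mulr0.
    by rewrite normrN ger0_norm; lra.
  by move=> /(_ k kn); rewrite xc_line// eqxx; lra.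
have : `|xc (y - t) k| <= enorm (y - t) by rewrite (xc_ord _ km); exact: coord_le_enorm.
by rewrite xcB ler_norml => /andP[h2 _]; move: h1 h2 yt; lra.
Qed.

(** By [ab - sum_k q_k = (m - 2) / 2] only the integral with [ab + 1] and unraised exponents reaches
    the order [r^(-m)]. Raising one [q] lowers the order again, so the other two integrals are
    [O(r^(2-m))], as is the remainder of the first. *)
Lemma jfun_near_all (z0 : R) : 0 < z0 -> exists2 M, 0 <= M & forall xi x, xi != x ->
  (forall k, (k < n)%N -> z0 <= kz xi x k) ->
  [/\ `|J ab xi x| <= M * rr2 xi x `^ (- ((m%:R - 2) / 2)),
      forall i, (i < n)%N -> `|Ji i (ab + 1) xi x| <= M * rr2 xi x `^ (- ((m%:R - 2) / 2)) &
     `|J (ab + 1) xi x - \prod_(k < n) (Gamma (q k) * kz xi x k `^ (- q k)) *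
        (Gamma (m%:R / 2) * rr2 xi x `^ (- (m%:R / 2)))| <= M * rr2 xi x `^ (- ((m%:R - 2) / 2))].
Proof.
move=> z00; have sq := sumq_lt_abar n alpha m2.
have e1 : ab - \sum_(k < n) q k = (m%:R - 2) / 2 by rewrite /abar addrK.
have e2 : ab + 1 - \sum_(k < n) q k = m%:R / 2 by rewrite addrAC e1; field.
have e3 : ab + 1 - (\sum_(k < n) q k + 1) = (m%:R - 2) / 2 by rewrite -e1; ring.
have [M1 M10 H1] := jfun_near q0 al01 z00 sq.
have /choice[M2 HM2] : forall i : 'I_n, exists M, 0 <= M /\ forall xi x, xi != x ->
    (forall k, (k < n)%N -> z0 <= kz xi x k) -> `|Ji i (ab + 1) xi x| <= M * rr2 xi x `^ (- ((m%:R - 2) / 2)).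
  move=> i; have si : \sum_(k < n) incr i q k < ab + 1 by rewrite sum_incr// ltrD2r.
  have [M M0 H] := jfun_near (@incr_q_gt0 R n alpha alpha01 i) al01 z00 si.
  by exists M; split => // xi x xx hz; have := H _ _ (rr2_gt0 xx) hz; rewrite sum_incr// e3.
have s3 : \sum_(k < n) q k + 1 < ab + 1 by rewrite ltrD2r.
have [M3 M30 H3] := jfun_asymp q0 al01 z00 s3.
have M20 i : 0 <= M2 i by have [] := HM2 i.
have S0 : 0 <= \sum_i M2 i by rewrite sumr_ge0.
exists (M1 + \sum_i M2 i + M3); first by rewrite !addr_ge0.
move=> xi x xx hz; have r0 := rr2_gt0 xx; have p0 := powR_ge0 (rr2 xi x) (- ((m%:R - 2) / 2)).
split.
- have := H1 _ _ r0 hz; rewrite e1 => /le_trans; apply; apply: ler_wpM2r => //.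
  by rewrite -addrA lerDl addr_ge0.
- move=> i hi; have := (HM2 (Ordinal hi)).2 _ _ xx hz => /le_trans; apply; apply: ler_wpM2r => //.
  apply: (@le_trans _ _ (\sum_j M2 j)); last by rewrite addrAC lerDr addr_ge0.
  by rewrite (bigD1 (Ordinal hi))//= lerDl sumr_ge0.
- have := H3 _ _ r0 hz; rewrite e2 e3 => /le_trans; apply; apply: ler_wpM2r => //.
  by rewrite lerDr addr_ge0.
Qed.

(** Each ratio differs from 1 by at most [2 d / (e / 4)], a power with exponent in [[0, 1]] comes no
    further from 1, and [2^n] accounts for the product. *)
Lemma ratio_near1 (e d : R) xi x : 0 < e -> 0 < d -> 8 * d <= e ->
  (forall k, (k < n)%N -> e / 4 < xc xi k) -> (forall k, (k < n)%N -> e / 4 < xc x k) ->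
  enorm (xi - x) <= 2 * d ->
  `|\prod_(k < n) (xc xi k / xc x k) `^ alpha k - 1| <= 2 ^+ n * (8 * d / e).
Proof.
move=> e0 d0 de h1 h2 dx; have e4 : 0 < e / 4 by rewrite divr_gt0.
have e1 : 0 <= 8 * d / e <= 1 by rewrite divr_ge0 ?mulr_ge0 ?(ltW d0) ?(ltW e0)//= ler_pdivrMr// mul1r.
apply: (@le_trans _ _ ((2 ^+ n - 1) * (8 * d / e))); last first.
  by apply: ler_wpM2r; [have /andP[] := e1|rewrite lerBlDr lerDl].
apply: (@prod_near1 _ (fun k => (xc xi k / xc x k) `^ alpha k)) => // k kn.
have x0 : 0 < xc x k := lt_trans e4 (h2 k kn); have xi0 : 0 < xc xi k := lt_trans e4 (h1 k kn).
have /andP[al0 al1] := al01 kn.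
apply: le_trans (powR_near1 _ _) _; [by rewrite divr_gt0|by rewrite al0 ltW|].
have -> : xc xi k / xc x k - 1 = xc (xi - x) k / xc x k.
  by rewrite xcB; field; exact: lt0r_neq0.
rewrite normrM normfV (ger0_norm (ltW x0)) ler_pdivrMr//.
apply: (@le_trans _ _ (2 * d)).
  by apply: le_trans dx; rewrite (xc_ord _ (leq_trans kn nm)); exact: coord_le_enorm.
apply: (@le_trans _ _ (8 * d / e * (e / 4))).
  by rewrite (_ : 8 * d / e * (e / 4) = 2 * d)//; field; exact: lt0r_neq0.
by apply: ler_wpM2l; [have /andP[] := e1|exact: ltW (h2 k kn)].
Qed.

(** [C] is fixed before [eps]: only the replacement of the coordinate ratios by 1 depends on how
    close the two points are to [t]. *)
Lemma kernel_near (N : 'rV[R]_m -> 'rV[R]_m) (t : 'rV[R]_m) : orthant m n t -> exists2 C, 0 <= C &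
  forall eps, 0 < eps -> exists2 d, 0 < d & forall xi x,
  enorm (xi - t) < d -> enorm (x - t) < d -> xi != x -> enorm (N xi) = 1 ->
  `|conormal n alpha N (fun y => qn n alpha y x) xi + c0 * rr2 xi x `^ (- (m%:R / 2)) * dotp (xi - x) (N xi)| <=
  eps * (rr2 xi x `^ (- (m%:R / 2)) * `|dotp (xi - x) (N xi)|) + C * rr2 xi x `^ (- ((m%:R - 2) / 2)).
Proof.
move=> Ot; have [e e0 eO] := open_enormP (@orthant_open R m n) Ot.
have e4 : 0 < e / 4 by rewrite divr_gt0.
pose z0 := 4 * (e / 4) * (e / 4); have z00 : 0 < z0 by rewrite !mulr_gt0.
have [M M0 HM] := jfun_near_all z00.
have [B BE] : exists B, B = enorm t + e + 1 by eexists.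
have B1 : 1 <= B by rewrite BE lerDr addr_ge0 ?enorm_ge0 ?ltW.
have B0 : 0 <= B := le_trans ler01 B1.
have k0 := kcst_ge0 m alpha01; have c00 := newton_cst_gt0.
have BB : 0 <= (B * B) ^+ n by rewrite exprn_ge0// mulr_ge0.
exists (2 * kcst m n alpha * (B * B) ^+ n * M * (2 * B) + m%:R * (kcst m n alpha * (B * B) ^+ n * (1 + 4 * B) * M)).
  by apply: addr_ge0; repeat (apply: mulr_ge0 => //); apply: addr_ge0 => //; apply: mulr_ge0.
move=> eps eps0.
have [K KE] : exists K : R, K = c0 * 2 ^+ n * 8 + 1 by eexists.
have K0 : 0 < K.
  rewrite KE; apply: ltr_wpDl => //; apply: mulr_ge0 => //; apply: mulr_ge0; [exact: ltW|exact: exprn_ge0].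
have [d [d0 de dK]] : exists d : R, [/\ 0 < d, 8 * d <= e & d * K <= eps * e].
  exists (Num.min (e / 8) (eps * e / K)); split; first by rewrite lt_min !divr_gt0 ?mulr_gt0.
    by rewrite mulrC -ler_pdivlMr// ge_min lexx.
  by rewrite -ler_pdivlMr// ge_min lexx orbT.
exists d => // xi x h1 h2 xx N1.
have g1 := orthant_coord_gt e0 eO (y := xi) (ltac:(lra)).
have g2 := orthant_coord_gt e0 eO (y := x) (ltac:(lra)).
have O1 : orthant m n xi by move=> k kn; exact: lt_trans (g1 k kn).
have O2 : orthant m n x by move=> k kn; exact: lt_trans (g2 k kn).
have hB y : enorm (y - t) < d -> enorm y <= B.
  by move=> yt; have := ler_enormD (y - t) t; rewrite subrK BE; lra.
have c1 := coord_le_B nm (hB _ h1); have c2 := coord_le_B nm (hB _ h2).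
have dx : enorm (xi - x) <= 2 * d.
  by have := enorm_triangle t xi x; rewrite (enormC t x); lra.
have hz k : (k < n)%N -> z0 <= kz xi x k.
  move=> kn; have := g1 k kn; have := g2 k kn => u1 u2.
  rewrite /z0 /kz -[leLHS]mulrA -[leRHS]mulrA; apply: ler_wpM2l => //.
  by apply: ler_pM; [exact: ltW|exact: ltW|exact: ltW|exact: ltW].
have [J1 J2 J3] := HM _ _ xx hz.
have RN := ratio_near1 e0 d0 de g1 g2 dx.
have LC := leading_coef O1 O2.
rewrite (conormalE m2 nm alpha01)//.
have HS : `|\sum_(i < m) kH n alpha i xi x * N xi ord0 i| <=
    m%:R * (kcst m n alpha * (B * B) ^+ n * (1 + 4 * B) * (M * rr2 xi x `^ (- ((m%:R - 2) / 2)))).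
  apply: sum_kH_le => // i; have [hi|hi] := ltnP i n.
    exact: (kH_le alpha01 B1 O1 O2 c1 c2 J1 (J2 i hi)).
  rewrite /kH /ksing ltnNge hi /= mulr0 normr0.
  by repeat (apply: mulr_ge0 => //); try exact: powR_ge0; apply: addr_ge0 => //; apply: mulr_ge0.
have DB : `|dotp (xi - x) (N xi)| <= 2 * B.
  rewrite (le_trans (cauchy_schwarz _ _))// N1 mulr1 (le_trans (ler_enormB _ _))//.
  by rewrite mulrDl mul1r lerD// hB.
have W0 := @kW_ge0 R m n alpha xi x O1; have W1 := kW_le alpha01 B1 O1 O2 c1 c2.
have r1 := powR_ge0 (rr2 xi x) (- (m%:R / 2)); have r2 := powR_ge0 (rr2 xi x) (- ((m%:R - 2) / 2)).
move: HS LC J3 RN DB r1 r2; rewrite /kG.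
move: (rr2 xi x `^ (- (m%:R / 2))) (rr2 xi x `^ (- ((m%:R - 2) / 2))) (dotp (xi - x) (N xi)) => r1 r2 D.
move: (kW n alpha xi x) W0 W1 (kcst m n alpha) k0 (J (ab + 1) xi x) => W W0 W1 k k0 j.
move: (\sum_(i < m) _) => S.
move: (\prod_(k < n) (Gamma (q k) * _)) (\prod_(k < n) (_ / _) `^ _) (Gamma _) => P Q G HS LC J3 RN DB r10 r20.
(* Three errors: the asymptotics of the half-line integral, the leading coefficient against [c0],
   and the lower-order sum. *)
have -> : - (2 * k * W * j) * D + S + c0 * r1 * D =
  - (2 * k * W * (j - P * (G * r1))) * D + (c0 - 2 * k * W * (P * G)) * (r1 * D) + S by ring.
rewrite LC.
have T1 : `|- (2 * k * W * (j - P * (G * r1))) * D| <= 2 * k * (B * B) ^+ n * M * (2 * B) * r2.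
  rewrite !normrM normrN !normrM (ger0_norm k0) (ger0_norm W0) (ger0_norm (ler0n _ 2)).
  rewrite [leRHS](_ : _ = 2 * k * (B * B) ^+ n * (M * r2) * (2 * B)); last by ring.
  apply: ler_pM => //; first by rewrite !mulr_ge0.
  apply: ler_pM => //; first by rewrite !mulr_ge0.
  by rewrite ler_wpM2l ?mulr_ge0.
have T2 : `|(c0 - c0 * Q) * (r1 * D)| <= eps * (r1 * `|D|).
  rewrite normrM normrM (ger0_norm r10); apply: ler_wpM2r; first by rewrite mulr_ge0.
  rewrite -{1}[c0]mulr1 -mulrBr normrM (ger0_norm (ltW c00)) distrC.
  apply: (@le_trans _ _ (c0 * (2 ^+ n * (8 * d / e)))); first by rewrite ler_wpM2l// ltW.
  rewrite (_ : _ * _ = (c0 * 2 ^+ n * 8 * d) / e); last by ring.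
  by rewrite ler_pdivrMr//; apply: le_trans dK; rewrite KE [leRHS]mulrDr mulr1 [leLHS]mulrC lerDl ltW.
apply: le_trans (ler_normD _ _) _.
apply: le_trans (lerD (ler_normD _ _) HS) _.
rewrite [leRHS](_ : _ = 2 * k * (B * B) ^+ n * M * (2 * B) * r2 + eps * (r1 * `|D|) +
  m%:R * (k * (B * B) ^+ n * (1 + 4 * B) * (M * r2))); last by ring.
by rewrite lerD2r lerD.
Qed.

End kernel_near_diagonal.

(** * Continuity and measurability of the kernel *)

Section kernel_regularity.
Variables (R : realType) (m n : nat) (alpha : nat -> R).
Hypotheses (m2 : (2 < m)%N) (nm : (n <= m)%N).
Hypothesis alpha01 : forall k, (k < n)%N -> 0 < 2 * alpha k < 1.
Local Notation q := (fun k => 1 - alpha k).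
Local Notation ab := (abar m n alpha).
Implicit Types (xi x : 'rV[R]_m).

Let q0 := qexp_gt0 alpha01.
Let al01 := alpha_01 alpha01.
Let a0 := abar_gt0 m2 alpha01.
Let a10 : 0 < ab + 1. Proof. by rewrite addr_gt0. Qed.

Lemma cvg_powR (u : nat -> R) (x p : R) : 0 < x -> u j @[j --> \oo] --> x -> u j `^ p @[j --> \oo] --> x `^ p.
Proof. by move=> x0 cu; exact: (cvg_comp _ _ cu (@continuous_powR R p x x0)). Qed.

Lemma kernel_cvg (N : 'rV[R]_m -> 'rV[R]_m) xi x (x_ : nat -> 'rV[R]_m) (d : R) : 0 < d ->
  orthant m n xi -> orthant m n x -> (forall j, orthant m n (x_ j)) -> (forall j, d <= enorm (xi - x_ j)) ->
  x_ j @[j --> \oo] --> x ->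
  conormal n alpha N (fun y => qn n alpha y (x_ j)) xi @[j --> \oo] -->
  conormal n alpha N (fun y => qn n alpha y x) xi.
Proof.
move=> d0 Oxi Ox Ox_ dx cx.
have cxc k : xc (x_ j) k @[j --> \oo] --> xc x k by exact: (cvg_comp _ _ cx (@xc_continuous R m k x)).
have cdist : enorm (xi - x_ j) @[j --> \oo] --> enorm (xi - x).
  under eq_fun do rewrite enormC; rewrite enormC; exact: (cvg_comp _ _ cx (@dist_continuous R m xi x)).
have dxx : d <= enorm (xi - x) by apply: (cvgr_to_ge cdist); exact: nearW.
have ne y : d <= enorm (xi - y) -> xi != y.
  by move=> h; apply: contraTneq (lt_le_trans d0 h) => ->; rewrite subrr enorm0 ltxx.
rewrite (_ : (fun j => _) = fun j => - kG n alpha xi (x_ j) * dotp (xi - x_ j) (N xi) +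
    \sum_(i < m) kH n alpha i xi (x_ j) * N xi ord0 i); last first.
  by apply/funext => j; rewrite (conormalE m2 nm alpha01)// ne.
rewrite (conormalE m2 nm alpha01)//; last exact: ne.
have crr : rr2 xi (x_ j) @[j --> \oo] --> rr2 xi x.
  under eq_fun do rewrite rr2E; rewrite rr2E; exact: (cvg_comp _ _ cdist (@exprn_continuous _ 2 _)).
have ckz k : kz xi (x_ j) k @[j --> \oo] --> kz xi x k by apply: cvgM => //; exact: cvg_cst.
have cJ c p : 0 < c -> (forall k, (k < n)%N -> 0 < p k) ->
    jfun n p alpha c (rr2 xi (x_ j)) (kz xi (x_ j)) @[j --> \oo] --> jfun n p alpha c (rr2 xi x) (kz xi x).
  move=> c0 p0; apply: (@jfun_cvg _ _ _ _ p0 al01 _ (d ^+ 2)) => //.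
  - by rewrite exprn_gt0.
  - by move=> j; rewrite rr2E lerXn2r ?nnegrE ?enorm_ge0// ltW.
  - by move=> j k kn; rewrite ltW//; exact: (kz_ge0 Oxi (Ox_ j) kn).
have cp k : (k < n)%N -> xc (x_ j) k `^ (1 - 2 * alpha k) @[j --> \oo] --> xc x k `^ (1 - 2 * alpha k).
  by move=> kn; exact: (@cvg_powR (fun j => xc (x_ j) k) (xc x k) (1 - 2 * alpha k) (Ox _ kn) (cxc k)).
have cW : kW n alpha xi (x_ j) @[j --> \oo] --> kW n alpha xi x.
  rewrite /kW; apply: (cvg_big (U := R^o)) => [|k _]; first exact: mul_continuous.
  apply: cvgM; first exact: cvg_cst.
  exact: cp (ltn_ord k).
apply: cvgD.
  apply: cvgM.
    apply: cvgN; rewrite /kG; apply: cvgM; last exact: cJ.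
    by apply: cvgM => //; exact: cvg_cst.
  have cB : xi - x_ j @[j --> \oo] --> xi - x by apply: cvgB => //; exact: cvg_cst.
  exact: (cvg_comp _ _ cB (@dotp_continuous R m (N xi) (xi - x))).
apply: (cvg_big (U := R^o)) => [|i _]; first exact: add_continuous.
apply: cvgM; last exact: cvg_cst.
rewrite /kH; apply: cvgM; first by apply: cvgM => //; exact: cvg_cst.
rewrite /ksing; have [hi|hi] := boolP (i < n)%N; last exact: cvg_cst.
apply: cvgB; first by apply: cvgM; [exact: cvg_cst|exact: cJ].
apply: cvgM; last by apply: cJ => //; exact: incr_q_gt0.
by apply: cvgM => //; exact: cvg_cst.
Qed.

Lemma measurable_xc k : measurable_fun setT (fun xi : borelRm R m => xc (xi : 'rV[R]_m) k).
Proof. exact: continuous_borelRm (@xc_continuous R m k). Qed.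

Lemma measurable_conormal (N : 'rV[R]_m -> 'rV[R]_m) x (D : set (borelRm R m)) : measurable D ->
  D `<=` orthant m n -> orthant m n x -> ~ D x ->
  (forall i, measurable_fun D (fun xi : borelRm R m => N xi ord0 i)) ->
  measurable_fun D (fun xi : borelRm R m => conormal n alpha N (fun y => qn n alpha y x) xi).
Proof.
move=> mD DO Ox nDx mN.
have mxc := measurable_xc.
have mrr : measurable_fun setT (fun xi : borelRm R m => rr2 (xi : 'rV[R]_m) x).
  rewrite (_ : (fun _ => _) = fun xi : borelRm R m => enorm ((xi : 'rV[R]_m) - x) ^+ 2).
    by apply: measurable_funX; apply: continuous_borelRm; exact: dist_continuous.
  by apply/funext => xi; rewrite rr2E.
have mkz k : measurable_fun setT (fun xi : borelRm R m => kz (xi : 'rV[R]_m) x k).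
  by do 2! (apply: measurable_funM => //).
have mW : measurable_fun setT (fun xi : borelRm R m => kW n alpha (xi : 'rV[R]_m) x).
  by apply: measurable_prod => k _; apply: measurable_funM => //.
have mJ c p : 0 < c -> (forall k, (k < n)%N -> 0 < p k) ->
    measurable_fun setT (fun xi : borelRm R m => jfun n p alpha c (rr2 (xi : 'rV[R]_m) x) (kz (xi : 'rV[R]_m) x)).
  by move=> c0 p0; apply: measurable_jfun.
apply: (@eq_measurable_fun _ _ _ _ D (fun xi : borelRm R m => - kG n alpha xi x * dotp ((xi : 'rV[R]_m) - x) (N xi) +
    \sum_(i < m) kH n alpha i xi x * N xi ord0 i)).
  move=> xi; rewrite inE => Dxi; rewrite (conormalE m2 nm alpha01)//; first exact: DO.
  by apply: contra_not_neq nDx => <-.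
apply: measurable_funD.
  apply: measurable_funM.
    apply: measurable_funTS; apply: measurableT_comp => //; rewrite /kG.
    by apply: measurable_funM; [apply: measurable_funM => //|exact: mJ].
  rewrite /dotp; apply: measurable_sum => i; apply: measurable_funM => //.
  apply: measurable_funTS; under eq_fun do rewrite !mxE.
  by apply: measurable_funB => //; exact: measurable_coord_rV.
apply: measurable_sum => i; apply: measurable_funM => //; apply: measurable_funTS.
rewrite /kH; apply: measurable_funM; first exact: measurable_funM.
rewrite /ksing; have [hi|hi] := boolP (i < n)%N; last by [].
apply: measurable_funB.
  apply: measurable_funM; last exact: mJ.
  by apply: measurable_funM => //; exact: (measurableT_comp (measurable_powR _)).
by apply: measurable_funM => //; apply: mJ => //; exact: incr_q_gt0.
Qed.

End kernel_regularity.

(** * Pointwise comparison with the Poisson kernel *)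

Section pointwise_estimate.
Variables (R : realType) (m : nat).
Implicit Types (v A B : 'rV[R]_m).

Lemma powRN_near1 (p u h : R) (k : nat) : 0 <= p <= k%:R -> 0 <= h <= 2^-1 -> `|u - 1| <= h ->
  `|u `^ (- p) - 1| <= 2 ^+ k * (2 * h).
Proof.
move=> /andP[p0 pk] /andP[h0 h2]; rewrite ler_distl => /andP[u1 u2].
have u0 : 0 < u by lra.
have v0 : 0 < u^-1 by rewrite invr_gt0.
have vE : `|u^-1 - 1| <= 2 * h.
  rewrite ler_distl; apply/andP; split.
    by rewrite -[leRHS]mul1r ler_pdivlMr//; nra.
  by rewrite -[leLHS]mul1r ler_pdivrMr//; nra.
have E : `|u^-1 ^+ k - 1| <= 2 ^+ k * (2 * h).
  have h12 : 0 <= 2 * h <= 1 by apply/andP; split; lra.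
  have := @prod_near1 R (fun _ => u^-1) (2 * h) k h12 (fun _ _ => vE).
  rewrite prodr_const card_ord => /le_trans; apply.
  by apply: ler_wpM2r; [lra|rewrite lerBlDr lerDl].
apply: le_trans E; rewrite powRN -[X in _ <= `|X - 1|]powR_mulrn ?(ltW v0)//.
have -> : (u `^ p)^-1 = u^-1 `^ p by rewrite -powRN -powR_inv1 ?(ltW u0)// -powRrM mulN1r.
have [w1|w1] := leP 1 u^-1.
  have a1 : 1 <= u^-1 `^ p by rewrite -(powRr0 u^-1) ler_powR.
  have a2 : u^-1 `^ p <= u^-1 `^ k%:R by rewrite ler_powR.
  by rewrite !ger0_norm; lra.
have w01 : 0 < u^-1 <= 1 by rewrite v0 ltW.
have a1 : u^-1 `^ p <= 1 by apply: powR_le1 => //; rewrite !ltW.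
have a2 : u^-1 `^ k%:R <= u^-1 `^ p by apply: ger_powR.
by rewrite !ler0_norm; lra.
Qed.

Lemma powRN_ratio (p Q W h : R) (k : nat) : 0 <= p <= k%:R -> 0 <= h <= 2^-1 -> 0 < Q -> `|W - Q| <= h * Q ->
  `|W `^ (- p) - Q `^ (- p)| <= 2 ^+ k * (2 * h) * Q `^ (- p).
Proof.
move=> pk h01 Q0 WQ; have u1 : `|W / Q - 1| <= h.
  rewrite (_ : W / Q - 1 = (W - Q) / Q); last by field; exact: lt0r_neq0.
  by rewrite normrM normfV (ger0_norm (ltW Q0)) ler_pdivrMr.
have W0 : 0 <= W / Q by move: u1 h01; rewrite ler_distl => /andP[? ?] /andP[? ?]; lra.
have -> : W `^ (- p) = (W / Q) `^ (- p) * Q `^ (- p) by rewrite -powRM ?(ltW Q0)// divfK// lt0r_neq0.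
rewrite -{2}[Q `^ (- p)]mul1r -mulrBl normrM [`|Q `^ _|]ger0_norm ?powR_ge0//.
by apply: ler_wpM2r; [exact: powR_ge0|exact: powRN_near1].
Qed.

(** In use [v = xi - y], [A = N y], [B = N xi] and [w = xi - x] with [x = y - sg d N(y)]. The
    flatness [a |v|^k] makes [|w|^2] comparable to [|v|^2 + d^2] and [w . B] close to [sg d]; so [K]
    is [- sg c0] times the Poisson kernel, up to a small multiple of that kernel and the integrable
    power [|v|^(k+1-m)]. *)
Lemma pointwise_estimate (a k c0 C eps K sg d : R) v A B :
  0 < k <= 1 -> 0 <= a -> 0 <= c0 -> 0 <= C -> 0 <= eps <= 1 -> 0 <= d -> (2 <= m)%N ->
  sg * sg = 1 -> enorm A = 1 -> enorm B = 1 -> 0 < enorm v <= 1 -> a * enorm v `^ k <= 2^-1 ->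
  `|dotp v A| <= a * enorm v `^ k * enorm v -> `|dotp v B| <= a * enorm v `^ k * enorm v ->
  enorm (A - B) <= a * enorm v `^ k ->
  (let w := v + (sg * d) *: A in let W := enorm w ^+ 2 in
   `|K + c0 * W `^ (- (m%:R / 2)) * dotp w B| <=
     eps * (W `^ (- (m%:R / 2)) * `|dotp w B|) + C * W `^ (- ((m%:R - 2) / 2))) ->
  `|K + sg * c0 * (d * (enorm v ^+ 2 + d ^+ 2) `^ (- (m%:R / 2)))| <=
    (1 + 2 ^+ m) * (3 * c0 * (a * enorm v `^ k) + 2 * eps) * (d * (enorm v ^+ 2 + d ^+ 2) `^ (- (m%:R / 2))) +
    (1 + 2 ^+ m) * (a * (c0 + 1) + C) * enorm v `^ (- (m%:R - 1 - k)).
Proof.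
move=> /andP[k0 k1] a0 c00 C0 /andP[eps0 eps1] d0 m2 sg1 A1 B1 /andP[v0 v1] eta2 vA vB AB /=.
have m2r : 2 <= m%:R :> R by rewrite ler_nat.
have [eta etaE] : exists eta, eta = a * enorm v `^ k by eexists.
have eta0 : 0 <= eta by rewrite etaE mulr_ge0 ?powR_ge0.
rewrite -!etaE in eta2 vA vB AB *.
have eta21 : 2 * eta <= 1 by lra.
have eta1 : eta <= 1 by lra.
have [w wE] : exists w, w = v + (sg * d) *: A by eexists.
rewrite -wE; pose W := enorm w ^+ 2; pose Q := enorm v ^+ 2 + d ^+ 2.
rewrite -/W -/Q => HK.
have v20 : 0 < enorm v ^+ 2 by rewrite exprn_gt0.
have Q0 : 0 < Q by rewrite ltr_wpDr// sqr_ge0.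
(* The cross term [2 sg d (v . A)] is at most [2 d eta |v| <= eta (|v|^2 + d^2)]. *)
have WQ : `|W - Q| <= eta * Q.
  have -> : W - Q = 2 * (sg * d) * dotp v A.
    have A2 : dotp A A = 1 by rewrite -enorm_sqr A1 expr1n.
    rewrite /W /Q wE !enorm_sqr !(dotpDl, dotpDr, dotpZl, dotpZr) [dotp A v]dotpC A2.
    have -> : sg * d * (sg * d * 1) = d ^+ 2 by rewrite mulr1 mulrACA sg1 mul1r expr2.
    ring.
  have sgn : `|sg| = 1.
    have /eqP := sg1; rewrite -expr2 sqrf_eq1 => /orP[] /eqP ->; rewrite ?normrN normr1//.
  rewrite !normrM sgn mul1r (ger0_norm d0) (ger0_norm (ler0n _ _)).
  apply: (@le_trans _ _ (2 * d * (eta * enorm v))); first by rewrite ler_wpM2l// mulr_ge0.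
  rewrite (_ : 2 * d * (eta * enorm v) = eta * (2 * (enorm v * d))); last by ring.
  rewrite ler_wpM2l// /Q; have := sqr_ge0 (enorm v - d); rewrite sqrrB; lra.
have etah : 0 <= eta <= 2^-1 by rewrite eta0.
have pm : 0 <= (m%:R / 2 : R) <= m%:R by clear -m2r; apply/andP; split; lra.
have pm' : 0 <= ((m%:R - 2) / 2 : R) <= m%:R by clear -m2r; apply/andP; split; lra.
have R1 := powRN_ratio pm etah Q0 WQ; have R2 := powRN_ratio pm' etah Q0 WQ.
have [Qp QpE] : exists Qp, Qp = Q `^ (- (m%:R / 2)) by eexists.
have [Wp WpE] : exists Wp, Wp = W `^ (- (m%:R / 2)) by eexists.
have [Qq QqE] : exists Qq, Qq = Q `^ (- ((m%:R - 2) / 2)) by eexists.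
have [Wq WqE] : exists Wq, Wq = W `^ (- ((m%:R - 2) / 2)) by eexists.
have Qp0 : 0 <= Qp by rewrite QpE powR_ge0.
have Qq0 : 0 <= Qq by rewrite QqE powR_ge0.
have Wp0 : 0 <= Wp by rewrite WpE powR_ge0.
rewrite -WpE -WqE in HK; rewrite -WpE -QpE in R1; rewrite -WqE -QqE in R2; rewrite -QpE.
have [E E0] : exists E : R, E = 2 ^+ m by eexists.
rewrite -E0 in R1 R2 *; have E1 : 1 <= E by rewrite E0 exprn_ege1// ler1n.
have E00 : 0 <= E := le_trans ler01 E1.
have E10 : 0 <= 1 + E by rewrite addr_ge0.
have Qpv : Qp * enorm v <= enorm v `^ (- (m%:R - 1)).
  have -> : enorm v `^ (- (m%:R - 1)) = enorm v `^ (- m%:R) * enorm v.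
    rewrite -{3}[enorm v](powRr1 (ltW v0)) -powRD ?(lt0r_neq0 v0) ?implybT//; congr (_ `^ _); ring.
  rewrite ler_wpM2r ?(ltW v0)// QpE.
  have -> : enorm v `^ (- m%:R) = (enorm v ^+ 2) `^ (- (m%:R / 2)).
    by rewrite -powR_mulrn ?(ltW v0)// -powRrM; congr (_ `^ _); field.
  rewrite !powRN lef_pV2 ?posrE ?powR_gt0//; apply: ge0_ler_powR; rewrite ?nnegrE ?(ltW v20) ?(ltW Q0)//.
  by rewrite /Q lerDl sqr_ge0.
have Qqv : Qq <= enorm v `^ (- (m%:R - 1 - k)).
  apply: (@le_trans _ _ (enorm v `^ (- (m%:R - 2)))).
    rewrite QqE; have -> : enorm v `^ (- (m%:R - 2)) = (enorm v ^+ 2) `^ (- ((m%:R - 2) / 2)).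
      by rewrite -powR_mulrn ?(ltW v0)// -powRrM; congr (_ `^ _); field.
    rewrite !powRN lef_pV2 ?posrE ?powR_gt0//; apply: ge0_ler_powR; rewrite ?nnegrE ?(ltW v20) ?(ltW Q0)//.
      by case/andP: pm'.
    by rewrite /Q lerDl sqr_ge0.
  by apply: ger_powR; [rewrite v0|lra].
have [L LE] : exists L, L = enorm v `^ (- (m%:R - 1 - k)) by eexists.
rewrite -LE in Qqv *.
have L0 : 0 <= L by rewrite LE powR_ge0.
(* On a surface of dimension [m - 1] the power [|v|^(1-m)] is critical; the flatness factor makes it
   integrable. *)
have etav : eta * enorm v * Qp <= a * L.
  rewrite etaE -!mulrA ler_wpM2l//; apply: (@le_trans _ _ (enorm v `^ k * enorm v `^ (- (m%:R - 1)))).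
    by rewrite ler_wpM2l ?powR_ge0// mulrC.
  rewrite -powRD ?(lt0r_neq0 v0) ?implybT// LE le_eqVlt; apply/orP; left; apply/eqP; congr (_ `^ _); ring.
have wB : `|dotp w B - sg * d| <= eta * enorm v + d * eta.
  have -> : dotp w B - sg * d = dotp v B + sg * d * dotp (A - B) B.
    have B2 : dotp B B = 1 by rewrite -enorm_sqr B1 expr1n.
    by rewrite wE dotpDl dotpZl dotpBl B2; ring.
  have sgn : `|sg| = 1.
    have /eqP := sg1; rewrite -expr2 sqrf_eq1 => /orP[] /eqP ->; rewrite ?normrN normr1//.
  apply: le_trans (ler_normD _ _) _; apply: lerD => //.
  rewrite !normrM sgn mul1r (ger0_norm d0) ler_wpM2l//.
  by apply: le_trans (cauchy_schwarz _ _) _; rewrite B1 mulr1.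
have wB2 : `|dotp w B| <= 2 * d + eta * enorm v.
  have sgn : `|sg * d| = d.
    have /eqP := sg1; rewrite -expr2 sqrf_eq1 => /orP[] /eqP ->; rewrite ?mulN1r ?mul1r ?normrN ger0_norm//.
  rewrite -[dotp w B](subrK (sg * d)); apply: le_trans (ler_normD _ _) _; rewrite sgn.
  have de : d * eta <= d by rewrite ler_piMr.
  apply: le_trans (lerD wB (lexx d)) _.
  rewrite (_ : 2 * d + eta * enorm v = eta * enorm v + d + d); last by ring.
  by rewrite lerD2r lerD2l.
have Wp1 : Wp <= (1 + E) * Qp.
  move: R1; rewrite ler_distl => /andP[_ h]; apply: le_trans h _; rewrite [leRHS]mulrDl mul1r lerD2l; apply: ler_wpM2r => //.
  by rewrite ler_piMr.
have Wq1 : Wq <= (1 + E) * Qq.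
  move: R2; rewrite ler_distl => /andP[_ h]; apply: le_trans h _; rewrite [leRHS]mulrDl mul1r lerD2l; apply: ler_wpM2r => //.
  by rewrite ler_piMr.
have -> : K + sg * c0 * (d * Qp) = (K + c0 * Wp * dotp w B) - c0 * Wp * (dotp w B - sg * d) - sg * d * c0 * (Wp - Qp) by ring.
have T1 : `|c0 * Wp * (dotp w B - sg * d)| <= c0 * ((1 + E) * Qp) * (eta * enorm v + d * eta).
  rewrite normrM (ger0_norm (mulr_ge0 c00 Wp0)); apply: ler_pM => //; first exact: mulr_ge0.
  by rewrite ler_wpM2l.
have T2 : `|sg * d * c0 * (Wp - Qp)| <= d * c0 * (E * (2 * eta) * Qp).
  have sgn : `|sg * d| = d.
    have /eqP := sg1; rewrite -expr2 sqrf_eq1 => /orP[] /eqP ->; rewrite ?mulN1r ?mul1r ?normrN ger0_norm//.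
  by rewrite 2!normrM sgn (ger0_norm c00) ler_wpM2l// mulr_ge0.
have T3 : eps * (Wp * `|dotp w B|) <= eps * ((1 + E) * Qp * (2 * d + eta * enorm v)).
  by rewrite ler_wpM2l//; apply: ler_pM.
have T4 : C * Wq <= C * ((1 + E) * L).
  by rewrite ler_wpM2l// (le_trans Wq1)// ler_wpM2l.
apply: le_trans (ler_normB _ _) _; apply: le_trans (lerD (ler_normB _ _) T2) _.
apply: le_trans (lerD (lerD (le_trans HK (lerD T3 T4)) T1) (lexx _)) _.
have F1 : eps * ((1 + E) * (eta * enorm v * Qp)) <= (1 + E) * (a * L).
  apply: (@le_trans _ _ (1 * ((1 + E) * (eta * enorm v * Qp)))).
    by rewrite ler_wpM2r// !mulr_ge0// ?enorm_ge0.
  by rewrite mul1r ler_wpM2l.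
have F2 : c0 * ((1 + E) * (eta * enorm v * Qp)) <= c0 * ((1 + E) * (a * L)).
  by rewrite ler_wpM2l// ler_wpM2l.
have F3 : 0 <= c0 * d * eta * Qp by rewrite !mulr_ge0.
rewrite -subr_ge0.
have -> : (1 + E) * (3 * c0 * eta + 2 * eps) * (d * Qp) + (1 + E) * (a * (c0 + 1) + C) * L -
  (eps * ((1 + E) * Qp * (2 * d + eta * enorm v)) + C * ((1 + E) * L) +
   c0 * ((1 + E) * Qp) * (eta * enorm v + d * eta) + d * c0 * (E * (2 * eta) * Qp)) =
  2 * (c0 * d * eta * Qp) + ((1 + E) * (a * L) - eps * ((1 + E) * (eta * enorm v * Qp))) +
  (c0 * ((1 + E) * (a * L)) - c0 * ((1 + E) * (eta * enorm v * Qp))) by ring.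
by rewrite addr_ge0// ?subr_ge0// addr_ge0 ?subr_ge0// mulr_ge0.
Qed.

End pointwise_estimate.

(** * Poisson and Riesz integrals over a surface patch *)

Lemma exists_small_powR (R : realType) (A p b : R) : 0 <= A -> 0 < p -> 0 < b ->
  exists2 rho0, 0 < rho0 & forall rho, 0 <= rho <= rho0 -> A * rho `^ p <= b.
Proof.
move=> A0 p0 b0; have A1 : 0 < A + 1 by rewrite ltr_wpDl.
exists ((b / (A + 1)) `^ p^-1); first by rewrite powR_gt0// divr_gt0.
move=> rho /andP[r0 r1]; apply: (@le_trans _ _ ((A + 1) * rho `^ p)); first by rewrite ler_wpM2r ?powR_ge0// lerDl.
rewrite mulrC -ler_pdivlMr//; apply: (@le_trans _ _ (((b / (A + 1)) `^ p^-1) `^ p)).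
  by apply: ge0_ler_powR; rewrite ?nnegrE ?powR_ge0 ?(ltW p0).
by rewrite -powRrM mulVf ?lt0r_neq0// powRr1// divr_ge0// ltW.
Qed.

Lemma Rintegral_compare d (T : measurableType d) (R : realType) (mu : {measure set T -> \bar R}) (D : set T)
    (f k1 k2 : T -> R) (c c1 c2 : R) : measurable D -> measurable_fun D f ->
  mu.-integrable D (EFin \o k1) -> mu.-integrable D (EFin \o k2) ->
  (forall x, D x -> `|f x + c * k1 x| <= c1 * k1 x + c2 * k2 x) ->
  mu.-integrable D (EFin \o f) /\
  `|\int[mu]_(x in D) f x + c * \int[mu]_(x in D) k1 x| <= c1 * \int[mu]_(x in D) k1 x + c2 * \int[mu]_(x in D) k2 x.
Proof.
move=> mD mf I1 I2 H.
have Z1 b : mu.-integrable D (EFin \o (fun x => b * k1 x)) by exact: (integrableZl mD b I1).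
have Z2 b : mu.-integrable D (EFin \o (fun x => b * k2 x)) by exact: (integrableZl mD b I2).
have Ig : mu.-integrable D (EFin \o (fun x => c1 * k1 x + c2 * k2 x)) by exact: (integrableD mD (Z1 c1) (Z2 c2)).
have mk : measurable_fun D (fun x => c * k1 x).
  by apply/measurable_EFinP; exact: measurable_int (Z1 c).
have Is : mu.-integrable D (EFin \o (fun x => f x + c * k1 x)).
  by apply: integrable_bounded_by Ig H => //; exact: measurable_funD.
have If : mu.-integrable D (EFin \o f).
  have := integrableB mD Is (Z1 c); apply: eq_integrable => // x _ /=.
  by rewrite -EFinB addrK.
split => //.
rewrite -RintegralZl// -RintegralD//.
apply: le_trans (le_normr_Rintegral mD Is) _.
rewrite -!RintegralZl// -RintegralD//.
by apply: le_Rintegral => //; exact: (integrable_norm Is).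
Qed.

Section layer_patch.
Variables (R : realType) (s n : nat) (Omega Gam : set 'rV[R]_s.+2) (N : 'rV[R]_s.+2 -> 'rV[R]_s.+2).
Variables (a kap : R).
Local Notation m := s.+2.
Local Notation O := (@orthant R m n).
Local Notation hc := (hconst (s.+1%:R : R)).
Hypothesis Omega_open : open Omega.
Hypothesis GamE : Gam = (closure Omega `\` Omega) `&` O.
Hypothesis N_unit : forall t, Gam t -> enorm (N t) = 1.
Hypothesis N_tangent : forall t, Gam t ->
     (fun xi => dotp (xi - t) (N t) / enorm (xi - t)) x
        @[x --> within (Gam `\ t) (nbhs t)] --> 0.
Hypothesis N_sides : forall t, Gam t -> exists2 e0 : R, 0 < e0 &
     forall e : R, 0 < e < e0 ->
       Omega (t - e *: N t) /\ ~ closure Omega (t + e *: N t).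
Hypothesis a0 : 0 < a.
Hypothesis kap0 : 0 < kap.
Hypothesis N_acos : forall x xi, Gam x -> Gam xi ->
  acos (dotp (N x) (N xi)) <= a * enorm (x - xi) `^ kap.
Variable sigma : {sigma_finite_measure set (borelRm R m) -> \bar R}.
Hypothesis sigmaE : forall A : set (borelRm R m), measurable A -> sigma A = hausdorff (m%:R - 1) (A `&` Gam).
Variable t : 'rV[R]_m.
Hypothesis Gt : Gam t.

Let mGam : measurable (Gam : set (borelRm R m)) := measurable_Gam Omega_open GamE.
Let hc0 : 0 < hc. Proof. exact: hconst_gt0. Qed.

(** [y] is taken out so that distances to it are positive on the patch; a single point of [Gam]
    carries no surface mass. *)
Definition patch (rho : R) (y : 'rV[R]_m) : set (borelRm R m) := (Gam `&` eball t rho) `\` [set y].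

Lemma measurable_set1 (y : 'rV[R]_m) : measurable ([set y] : set (borelRm R m)).
Proof.
rewrite (_ : [set y] = ecball y 0); first exact: measurable_ecball.
apply/seteqP; split => x; rewrite /ecball/=; first by move=> ->; rewrite subrr enorm0.
by move=> h; apply/eqP; rewrite -subr_eq0; apply: contraTT h; rewrite -ltNge enorm_gt0.
Qed.

Lemma measurable_patch rho y : measurable (patch rho y).
Proof.
apply: measurableD; last exact: measurable_set1.
by apply: measurableI => //; exact: measurable_eball.
Qed.

Lemma exists_radius (b : R) : 0 < b -> exists2 rho0, 0 < rho0 & forall rho, 0 <= rho <= rho0 -> a * rho `^ kap <= b.
Proof. by move=> b0; exact: exists_small_powR (ltW a0) kap0 b0. Qed.

Lemma patch_density (y : 'rV[R]_m) (b rho r : R) : 0 <= rho -> a * rho `^ kap <= b -> b < 1 -> 0 < r ->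
  (sigma (patch rho y `&` [set x : borelRm R m | (enorm ((x : 'rV[R]_m) - y) <= r)%R]) <=
   (hc * (2 / (1 - b)) ^+ s.+1 * r ^+ s.+1)%:E)%E.
Proof.
move=> r0 ab b1 rr.
apply: (@le_trans _ _ (sigma (eball t rho `&` ecball y r))); last first.
  have := density_upper Omega_open GamE N_unit N_tangent N_sides a0 kap0 N_acos sigmaE y Gt r0 ab b1 rr.
  move=> /le_trans; apply; rewrite lee_fin -mulrA -exprMn (_ : 2 / (1 - b) * r = 2 * (r / (1 - b)))//.
  by rewrite mulrAC mulrA.
apply: le_measure; rewrite ?inE.
- apply: measurableI; first exact: measurable_patch.
  exact: (measurable_ecball y r).
- by apply: measurableI; [exact: measurable_eball|exact: measurable_ecball].
- by move=> x [[[_ h1] _] h2].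
Qed.

Lemma sigma_set1 y : Gam y -> sigma [set y] = 0%E.
Proof.
move=> Gy; have h2 : 0 < 2^-1 :> R by rewrite invr_gt0.
have [rho0 r00 H] := exists_radius h2.
have Hr := H rho0; rewrite lexx (ltW r00) in Hr; have {}Hr := Hr isT.
have C0 : 0 <= hc * 4 ^+ s.+1 by rewrite mulr_ge0 ?exprn_ge0// ltW.
apply/eqP; rewrite eq_le measure_ge0 andbT; apply/lee_addgt0Pr => e e0; rewrite add0e.
have [r [r0 r1 rC]] : exists r : R, [/\ 0 < r, r <= 1 & hc * 4 ^+ s.+1 * r <= e].
  exists (Num.min 1 (e / (hc * 4 ^+ s.+1 + 1))).
  have h : 0 < hc * 4 ^+ s.+1 + 1 by rewrite ltr_wpDl.
  split; [by rewrite lt_min ltr01 divr_gt0|by rewrite ge_min lexx|].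
  apply: (@le_trans _ _ ((hc * 4 ^+ s.+1 + 1) * (e / (hc * 4 ^+ s.+1 + 1)))).
    by apply: ler_pM; rewrite ?lerDl// ?ge_min ?lexx ?orbT// le_min ler01 divr_ge0 ?ltW.
  by rewrite mulrC divfK// lt0r_neq0.
have b1 : 2^-1 < 1 :> R by rewrite invf_lt1// ltr1n.
have := density_upper Omega_open GamE N_unit N_tangent N_sides a0 kap0 N_acos sigmaE y Gy (ltW r00) Hr b1 r0.
move=> D; apply: le_trans (le_trans _ D) _.
  apply: le_measure; rewrite ?inE.
  - exact: measurable_set1.
  - by apply: measurableI; [exact: measurable_eball|exact: measurable_ecball].
  - by move=> x ->; split; rewrite /eball /ecball/= subrr enorm0// ltW.
rewrite lee_fin; apply: le_trans rC.
rewrite (_ : 2 * (r / (1 - 2^-1)) = 4 * r); last by field.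
rewrite exprMn mulrA ler_wpM2l// exprS ler_piMr ?(ltW r0)// exprn_ile1 ?(ltW r0)//.
Qed.

(** The Hausdorff normalisation, the layers of the Gaussian and the Poisson mixture contribute one
    Gamma or power each. Against the denominator [2 pi^(m/2)] of [c0] the product leaves the 1/2 of
    the jump. *)
Lemma jump_const : hc * 2 ^+ s.+1 * Gamma (s.+1%:R / 2 + 1) * Gamma 2^-1 = pi `^ (m%:R / 2) :> R.
Proof.
rewrite /hconst -powR_mulrn// Gamma_half -powR12_sqrt ?pi_ge0//.
have G0 : Gamma (s.+1%:R / 2 + 1) != 0 :> R by rewrite lt0r_neq0// Gamma_gt0// ltr_wpDl// divr_ge0.
have P0 : (2 : R) `^ s.+1%:R != 0 by rewrite lt0r_neq0// powR_gt0.
have -> : pi `^ (m%:R / 2) = pi `^ (s.+1%:R / 2) * pi `^ 2^-1 :> R.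
  rewrite -powRD ?(lt0r_neq0 (pi_gt0 R)) ?implybT//; congr (_ `^ _).
  by rewrite -[m%:R]natr1 mulrDl div1r.
move: (Gamma _) G0 ((2 : R) `^ _) P0 (pi `^ _) (pi `^ _) => g g0 p p0 u v.
by field; rewrite g0 p0.
Qed.

(** The Poisson kernel at height [d] over the foot point [y], without normalisation, taken on the
    curved surface in place of a hyperplane. *)
Definition kerf (y : 'rV[R]_m) (d : R) (x : 'rV[R]_m) : R :=
  d * (enorm (x - y) ^+ 2 + d ^+ 2) `^ (- (m%:R / 2)).

Lemma kerf_ge0 y d x : 0 <= d -> 0 <= kerf y d x.
Proof. by move=> d0; rewrite mulr_ge0 ?powR_ge0. Qed.

Lemma measurable_kerf y d : measurable_fun setT (kerf y d : borelRm R m -> R).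
Proof.
apply: measurable_funM => //; apply: (measurableT_comp (measurable_powR _)).
apply: measurable_funD => //; apply: measurable_funX; exact: continuous_borelRm (@dist_continuous R m y).
Qed.

Local Notation c0 := (newton_cst R m).

Lemma integral_kerf rho y d : 0 <= d ->
  (\int[sigma]_(x in patch rho y) (c0 * kerf y d x)%:E =
   ((2 * pi `^ (m%:R / 2))^-1)%:E * \int[sigma]_(x in patch rho y)
     (d * (Gamma (s.+1%:R / 2 + 2^-1) * (enorm ((x : 'rV[R]_m) - y) ^+ 2 + d ^+ 2) `^ (- (s.+1%:R / 2 + 2^-1))))%:E)%E.
Proof.
move=> d0; have E : s.+1%:R / 2 + 2^-1 = m%:R / 2 :> R by rewrite -[m%:R]natr1 mulrDl div1r.
rewrite E -ge0_integralZl_fin.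
- by apply: eq_integral => x _; congr EFin; rewrite /newton_cst /kerf; move: (Gamma _) (_ `^ (- _)) => g1 g2; ring.
- exact: measurable_patch.
- apply: measurable_funTS; apply: measurable_funM => //; apply: measurable_funM => //.
  apply: (measurableT_comp (measurable_powR _)); apply: measurable_funD => //; apply: measurable_funX.
  exact: continuous_borelRm (@dist_continuous R m y).
- move=> x _; rewrite mulr_ge0// mulr_ge0 ?powR_ge0// ltW// Gamma_gt0// divr_gt0// ltr0n.
- by rewrite invr_ge0 mulr_ge0 ?powR_ge0.
Qed.

Let mdist y : measurable_fun setT (fun x : borelRm R m => enorm ((x : 'rV[R]_m) - y)).
Proof. exact: continuous_borelRm (@dist_continuous R m y). Qed.

Lemma kerf_upper (y : 'rV[R]_m) (b rho d : R) : 0 <= rho -> a * rho `^ kap <= b -> b < 1 -> 0 < d ->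
  (\int[sigma]_(x in patch rho y) (c0 * kerf y d x)%:E <= (2^-1 * (1 - b)^-1 ^+ s.+1)%:E)%E.
Proof.
move=> r0 ab b1 d0; rewrite integral_kerf ?(ltW d0)//.
have A0 : 0 <= hc * (2 / (1 - b)) ^+ s.+1.
  by rewrite mulr_ge0 ?(ltW hc0)// exprn_ge0// divr_ge0// subr_ge0 ltW.
have p0 : 0 < 2 * pi `^ (m%:R / 2) :> R by rewrite mulr_gt0 ?powR_gt0 ?pi_gt0.
have := @kernel_upper R _ _ sigma (patch rho y) (fun x => enorm ((x : 'rV[R]_m) - y)) s.+1 (measurable_patch _ _)
  (mdist y) (fun x => enorm_ge0 _) _ _ A0 d0 (fun r => patch_density y r0 ab b1 (r := r)).
move=> K; apply: (@le_trans _ _ (((2 * pi `^ (m%:R / 2))^-1)%:E * (hc * (2 / (1 - b)) ^+ s.+1 * Gamma (s.+1%:R / 2 + 1) * Gamma 2^-1)%:E)%E).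
  by apply: lee_wpmul2l => //; rewrite lee_fin invr_ge0 ltW.
rewrite -EFinM lee_fin le_eqVlt; apply/orP; left; apply/eqP.
have -> : hc * (2 / (1 - b)) ^+ s.+1 * Gamma (s.+1%:R / 2 + 1) * Gamma 2^-1 = pi `^ (m%:R / 2) * (1 - b)^-1 ^+ s.+1.
  by rewrite -jump_const exprMn; move: (Gamma _) (Gamma _) => g1 g2; ring.
by field; rewrite lt0r_neq0// powR_gt0// pi_gt0.
Qed.

(** [C] depends neither on [y] nor on [d]: for [y] within [rho / 2] of [t] the patch contains, up to
    the point [y], the surface part of every ball about [y] of radius below [rho / 2]. *)
Lemma kerf_lower (b rho : R) : 0 < rho -> a * rho `^ kap <= b -> 2 * b < 1 -> eball t rho `<=` O ->
  exists2 C, 0 <= C & forall y d, Gam y -> enorm (y - t) < rho / 2 -> 0 < d ->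
  ((2^-1 * (1 - 2 * b) ^+ s.+1)%:E <= \int[sigma]_(x in patch rho y) (c0 * kerf y d x)%:E + (C * d `^ 2^-1)%:E)%E.
Proof.
move=> r0 ab b1 tO.
have p0 : 0 < 2 * pi `^ (m%:R / 2) :> R by rewrite mulr_gt0 ?powR_gt0 ?pi_gt0.
have [B BE] : exists B, B = hc * (2 * (1 - 2 * b)) ^+ s.+1 by eexists.
have B0 : 0 <= B by rewrite BE mulr_ge0 ?(ltW hc0)// exprn_ge0// mulr_ge0// subr_ge0 ltW.
have [C CE] : exists C, C = B * (rho / 2) `^ (- 2^-1) * Gamma (s.+1%:R / 2 + 1 + 4^-1) * Gamma 4^-1 by eexists.
have C0 : 0 <= C.
  rewrite CE; repeat (apply: mulr_ge0 => //); rewrite ?powR_ge0// ltW// Gamma_gt0//.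
exists (C / (2 * pi `^ (m%:R / 2))); first by rewrite divr_ge0// ltW.
move=> y d Gy yt d0; rewrite integral_kerf ?(ltW d0)//.
have r20 : 0 < rho / 2 by rewrite divr_gt0.
have H r : 0 < r < rho / 2 -> ((B * r ^+ s.+1)%:E <= sigma (patch rho y `&` [set x : borelRm R m | (enorm ((x : 'rV[R]_m) - y) <= r)%R]))%E.
  move=> /andP[rr0 rr1].
  have yO : eball y r `<=` eball t rho.
    move=> x; rewrite /eball/= => xy; have := enorm_triangle y x t; move: xy yt rr1; lra.
  have ar : a * r `^ kap <= b.
    apply: le_trans ab; rewrite ler_wpM2l ?(ltW a0)//; apply: ge0_ler_powR; rewrite ?nnegrE ?(ltW kap0) ?(ltW rr0) ?(ltW r0)//.
    by move: rr1; lra.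
  have := density_lower Omega_open GamE N_unit N_tangent N_sides a0 kap0 N_acos sigmaE Gy rr0 ar b1 (subset_trans yO tO).
  rewrite (_ : hc * (2 * (r * (1 - 2 * b))) ^+ s.+1 = B * r ^+ s.+1); last first.
    by rewrite BE -mulrA -exprMn; congr (_ * _ ^+ _); ring.
  move=> /le_trans; apply.
  have mE := @measurable_eball R s y r.
  have mD : measurable ((eball y r `&` Gam) `\` [set y] : set (borelRm R m)).
    by apply: measurableD; [exact: measurableI|exact: measurable_set1].
  have E1 : sigma (eball y r) = sigma (eball y r `&` Gam).
    by rewrite !sigmaE//; [rewrite -setIA setIid|exact: measurableI].
  have E2 : (sigma (eball y r) <= sigma ((eball y r `&` Gam) `\` [set y]))%E.
    rewrite E1; apply: (@le_trans _ _ (sigma (((eball y r `&` Gam) `\` [set y]) `|` [set y]))).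
      apply: le_measure; rewrite ?inE; [exact: measurableI|by apply: measurableU => //; exact: measurable_set1|].
      by move=> x h; have [->|/eqP xy] := eqVneq x y; [right|left].
    apply: le_trans (measureU2 _ _ _) _ => //; first exact: measurable_set1.
    by rewrite [X in (_ + X)%E]sigma_set1// adde0.
  apply: (le_trans E2).
  apply: le_measure; rewrite ?inE.
  - by apply: measurableD; [exact: measurableI|exact: measurable_set1].
  - apply: measurableI; [exact: measurable_patch|exact: (measurable_ecball y r)].
  - by move=> x [[h1 h2] h3]; split; [split=> //; split=> //; exact: yO|exact: ltW].
have := @kernel_lower R _ _ sigma (patch rho y) (fun x => enorm ((x : 'rV[R]_m) - y)) s.+1 (measurable_patch _ _)
  (mdist y) (fun x => enorm_ge0 _) _ _ _ B0 r20 d0 H.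
move=> K.
have pe : (0 <= ((2 * pi `^ (m%:R / 2))^-1 : R)%:E)%E by rewrite lee_fin invr_ge0 ltW.
have {}K := lee_wpmul2l pe K; rewrite ge0_muleDr in K; last 2 first.
- apply: integral_ge0 => x _; rewrite lee_fin mulr_ge0 ?(ltW d0)// mulr_ge0 ?powR_ge0// ltW// Gamma_gt0//.
- by rewrite lee_fin -CE mulr_ge0 ?powR_ge0.
apply: le_trans (le_trans _ K) _.
  rewrite -EFinM lee_fin le_eqVlt; apply/orP; left; apply/eqP.
  have -> : B * Gamma (s.+1%:R / 2 + 1) * Gamma 2^-1 = pi `^ (m%:R / 2) * (1 - 2 * b) ^+ s.+1.
    by rewrite -jump_const BE exprMn; move: (Gamma _) (Gamma _) => g1 g2; ring.
  by field; rewrite lt0r_neq0// powR_gt0// pi_gt0.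
apply: leeD => //; rewrite -EFinM lee_fin -CE le_eqVlt; apply/orP; left; apply/eqP.
by ring.
Qed.

Lemma integrable_kerf (y : 'rV[R]_m) (b rho d : R) : 0 <= rho -> a * rho `^ kap <= b -> b < 1 -> 0 <= d ->
  sigma.-integrable (patch rho y) (EFin \o (fun x => c0 * kerf y d x)).
Proof.
move=> r0 ab b1; rewrite le_eqVlt => /orP[/eqP <-|d0].
  apply: eq_integrable (integrable0 _ _) => //; first exact: measurable_patch.
  by move=> x _ /=; rewrite /kerf mul0r mulr0.
have c00 : 0 <= c0.
  by rewrite divr_ge0 ?mulr_ge0 ?powR_ge0// ltW// Gamma_gt0// divr_gt0// ltr0n.
apply: (integrable_ge0_lt _ _ (kerf_upper y r0 ab b1 d0)).
- by apply: measurable_funTS; apply: measurable_funM => //; exact: measurable_kerf.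
- by move=> x _; rewrite mulr_ge0// kerf_ge0// ltW.
Qed.

(** By Bernoulli's inequality slope [b] costs an error of at most [(s + 1) b] on either side of 1/2;
    the lower bound loses a further multiple of [sqrt d]. *)
Lemma kerf_near (eps : R) : 0 < eps -> exists2 rho0, 0 < rho0 &
  forall rho, 0 < rho <= rho0 -> eball t rho `<=` O -> exists2 del, 0 < del &
  forall y d, Gam y -> enorm (y - t) < del -> 0 < d < del ->
  `|\int[sigma]_(x in patch rho y) (c0 * kerf y d x) - 2^-1| <= eps.
Proof.
move=> eps0; have K0 : 0 < s.+1%:R :> R by rewrite ltr0n.
have [b [b0 b4 bK]] : exists b : R, [/\ 0 < b, b <= 4^-1 & s.+1%:R * b <= eps / 2 /\ s.+1%:R * b <= 4^-1].
  exists (Num.min 4^-1 (eps / 2) / s.+1%:R); have h : 0 < Num.min (4^-1 : R) (eps / 2) by rewrite lt_min invr_gt0 divr_gt0 ?andbT//.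
  split; first by rewrite divr_gt0.
    rewrite ler_pdivrMr//; apply: (@le_trans _ _ 4^-1); first by rewrite ge_min lexx.
    by rewrite ler_peMr ?invr_ge0// ler1n.
  by rewrite mulrC divfK ?lt0r_neq0// !ge_min !lexx ?orbT.
have [bK1 bK2] := bK.
have b1 : b < 1 by lra.
have b2 : 2 * b < 1 by lra.
have [rho0 r00 H0] := exists_radius b0.
exists rho0 => // rho /andP[r0 r1] tO.
have ab : a * rho `^ kap <= b by apply: H0; rewrite (ltW r0).
have [C C0 HC] := kerf_lower r0 ab b2 tO.
have C1 : 0 < C + 1 by rewrite ltr_wpDl.
have e1 : 0 < eps / 2 / (C + 1) by rewrite !divr_gt0.
exists (Num.min (rho / 2) ((eps / 2 / (C + 1)) ^+ 2)); first by rewrite lt_min divr_gt0//= exprn_gt0.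
move=> y d Gy; rewrite lt_min => /andP[y1 _] /andP[d0]; rewrite lt_min => /andP[_ d2].
have U := kerf_upper y (ltW r0) ab b1 d0; have L := HC y d Gy y1 d0.
have I := integrable_kerf y (ltW r0) ab b1 (ltW d0).
rewrite -EFin_Rintegral ?lee_fin in U => //; last exact: measurable_patch.
rewrite -EFin_Rintegral -?EFinD ?lee_fin in L => //; last exact: measurable_patch.
have dC : C * d `^ 2^-1 <= eps / 2.
  have : d `^ 2^-1 <= eps / 2 / (C + 1).
    rewrite powR12_sqrt ?(ltW d0)// -[leRHS]ger0_norm ?(ltW e1)// -sqrtr_sqr.
    by rewrite ler_sqrt; [exact: ltW|rewrite exprn_ge0// ltW].
  rewrite ler_pdivlMr// => h; have : 0 <= d `^ 2^-1 by exact: powR_ge0.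
  by move: h; move: (d `^ 2^-1) => u h u0; nra.
have B1 := @bernoulli_ineq R b s.+1; have B2 := @bernoulli_ineq R (2 * b) s.+1.
have {}B1 : 1 - s.+1%:R * b <= (1 - b) ^+ s.+1 by apply: B1; rewrite (ltW b0) ltW.
have {}B2 : 1 - s.+1%:R * (2 * b) <= (1 - 2 * b) ^+ s.+1 by apply: B2; rewrite mulr_ge0 ?(ltW b0)//= ltW.
have B3 : (1 - b)^-1 ^+ s.+1 <= 1 + 2 * (s.+1%:R * b).
  rewrite exprVn; apply: (@le_trans _ _ (1 - s.+1%:R * b)^-1).
    rewrite lef_pV2 ?posrE//; [by rewrite exprn_gt0// subr_gt0|by lra].
  rewrite -[leLHS]mul1r ler_pdivrMr; last by lra.
  have : 0 <= s.+1%:R * b by rewrite mulr_ge0// ltW.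
  by move: bK2; move: (s.+1%:R * b) => u u1 u0; nra.
by rewrite ler_distl; apply/andP; split; lra.
Qed.

(** The exponent is subcritical for a surface of dimension [s.+1]. Only half of the Hölder gain is
    spent on integrability; the other half supplies the small factor [(2 rho)^(kap/2)] in
    [patch_estimate]. *)
Lemma patch_riesz : kap <= 1 -> (0 < s)%N -> exists2 C, 0 <= C & exists2 rho0, 0 < rho0 &
  forall rho y, 0 <= rho <= rho0 -> enorm (y - t) < rho ->
  sigma.-integrable (patch rho y) (EFin \o (fun x => enorm ((x : 'rV[R]_m) - y) `^ (- (s.+1%:R - kap / 2)))) /\
  \int[sigma]_(x in patch rho y) enorm ((x : 'rV[R]_m) - y) `^ (- (s.+1%:R - kap / 2)) <= C.
Proof.
move=> k1 s0; have h2 : 0 < 2^-1 :> R by rewrite invr_gt0.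
have [rho1 r10 H] := exists_radius h2.
have lam0 : 0 < s.+1%:R - kap / 2.
  by have : 1 <= s.+1%:R :> R by [rewrite ler1n]; lra.
have lam1 : s.+1%:R - kap / 2 < s.+1%:R by move: kap0; lra.
have [A AE] : exists A, A = hc * (2 / (1 - 2^-1)) ^+ s.+1 by eexists.
have A0 : 0 <= A by rewrite AE mulr_ge0 ?(ltW hc0)// exprn_ge0// divr_ge0//; lra.
pose C := expR (1 ^+ 2) * (A * Gamma (s.+1%:R / 2 + 1) * Gamma (s.+1%:R / 2 - (s.+1%:R - kap / 2) / 2) / Gamma (s.+1%:R / 2)).
have C0 : 0 <= C.
  apply: mulr_ge0; [exact: expR_ge0|apply: divr_ge0; last by rewrite ltW// Gamma_gt0// divr_gt0// ltr0n].
  apply: mulr_ge0; last by rewrite ltW// Gamma_gt0//; move: kap0; lra.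
  by rewrite mulr_ge0// ltW// Gamma_gt0// ltr_wpDl// divr_ge0.
exists C => //; exists (Num.min rho1 2^-1); first by rewrite lt_min r10.
move=> rho y /andP[r0]; rewrite le_min => /andP[rr1 rr2] yt.
have ab : a * rho `^ kap <= 2^-1 by apply: H; rewrite r0.
have b1 : 2^-1 < 1 :> R by lra.
have B : (\int[sigma]_(x in patch rho y) (enorm ((x : 'rV[R]_m) - y) `^ (- (s.+1%:R - kap / 2)))%:E <= C%:E)%E.
  apply: (@riesz_bound R _ _ sigma (patch rho y) (fun x => enorm ((x : 'rV[R]_m) - y)) s.+1 (measurable_patch _ _)
    (mdist y) (fun x => enorm_ge0 _) A 1 (s.+1%:R - kap / 2) A0 lam0 lam1).
    by move=> r rr; rewrite AE; exact: patch_density.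
  move=> x [[_ xt] xy]; rewrite enorm_gt0 subr_eq0; apply/andP; split; first exact/eqP.
  by have := enorm_triangle t x y; move: xt yt rr2; rewrite /eball/= (enormC t y); lra.
have mf : measurable_fun (patch rho y) (fun x : borelRm R m => enorm ((x : 'rV[R]_m) - y) `^ (- (s.+1%:R - kap / 2))).
  by apply: measurable_funTS; exact: (measurableT_comp (measurable_powR _) (mdist y)).
split; first by apply: integrable_ge0_lt B => // x _; exact: powR_ge0.
by apply: Rintegral_le_cst B => //; [exact: measurable_patch|move=> x _; exact: powR_ge0].
Qed.

End layer_patch.

(** * The layer potential over a small patch *)

Lemma ltr_quartersD (R : realFieldType) (a b r : R) : a < r / 4 -> b < r / 4 -> 0 < r -> a + b < r.
Proof. by lra. Qed.

(** The preimage of an interval is the trace on [A] of a union of open balls, hence Borel, although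
    the function is controlled on [A] only. *)
Lemma measurable_enorm_continuous (R : realType) (m : nat) (A : set 'rV[R]_m) (f : 'rV[R]_m -> R) :
  measurable (A : set (borelRm R m)) ->
  (forall x, A x -> forall e, 0 < e -> exists2 d, 0 < d & forall y, A y -> enorm (y - x) < d -> `|f y - f x| < e) ->
  measurable_fun (A : set (borelRm R m)) (f : borelRm R m -> R).
Proof.
move=> mA H; apply: (measurability (@RGenOpens.G R)); first exact: RGenOpens.measurableE.
move=> _ [_ [a [b ->] <-]].
pose I := [set p : 'rV[R]_m * R | A p.1 /\ forall y, A y -> enorm (y - p.1) < p.2 -> `]a, b[%classic (f y)].
have -> : A `&` f @^-1` `]a, b[%classic = A `&` \bigcup_(p in I) eball p.1 p.2.
  apply/seteqP; split => [x [Ax fx]|x [Ax [p [Ap Hp] xp]]]; last by split => //; apply: Hp.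
  split => //.
  have ofx : nbhs (f x) `]a, b[%classic by apply: open_nbhs_nbhs; split => //; exact: interval_open.
  move: ofx => /nbhs_ballP[e /= e0 He]; have [d d0 Hd] := H x Ax e e0.
  exists (x, d); last by rewrite /eball/= subrr enorm0.
  split => // y Ay yx; apply: He; rewrite /ball/= distrC; exact: Hd.
apply: measurableI => //; apply: open_borelRm; apply: bigcup_open => p _; exact: open_eball.
Qed.

Section layer_limit.
Variables (R : realType) (s n : nat) (Omega Gam : set 'rV[R]_s.+2) (N : 'rV[R]_s.+2 -> 'rV[R]_s.+2).
Variables (a kap : R) (alpha : nat -> R).
Local Notation m := s.+2.
Local Notation O := (@orthant R m n).
Hypothesis Omega_open : open Omega.
Hypothesis GamE : Gam = (closure Omega `\` Omega) `&` O.
Hypothesis N_unit : forall t, Gam t -> enorm (N t) = 1.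
Hypothesis N_tangent : forall t, Gam t ->
     (fun xi => dotp (xi - t) (N t) / enorm (xi - t)) x
        @[x --> within (Gam `\ t) (nbhs t)] --> 0.
Hypothesis N_sides : forall t, Gam t -> exists2 e0 : R, 0 < e0 &
     forall e : R, 0 < e < e0 ->
       Omega (t - e *: N t) /\ ~ closure Omega (t + e *: N t).
Hypothesis a0 : 0 < a.
Hypotheses (kap0 : 0 < kap) (kap1 : kap <= 1).
Hypothesis N_acos : forall x xi, Gam x -> Gam xi ->
  acos (dotp (N x) (N xi)) <= a * enorm (x - xi) `^ kap.
Variable sigma : {sigma_finite_measure set (borelRm R m) -> \bar R}.
Hypothesis sigmaE : forall A : set (borelRm R m), measurable A -> sigma A = hausdorff (m%:R - 1) (A `&` Gam).
Hypotheses (s0 : (0 < s)%N) (nm : (n <= m)%N).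
Hypothesis alpha01 : forall k, (k < n)%N -> 0 < 2 * alpha k < 1.
Variables (mu : 'rV[R]_m -> R) (Mmu : R).
Hypothesis mu_le : forall x, Gam x -> `|mu x| <= Mmu.
Hypothesis mu_cont : forall x, Gam x -> forall e, 0 < e -> exists2 d, 0 < d &
  forall y, Gam y -> enorm (y - x) < d -> `|mu y - mu x| < e.

Let mGam : measurable (Gam : set (borelRm R m)) := measurable_Gam Omega_open GamE.
Let m2 : (2 < m)%N. Proof. by rewrite !ltnS. Qed.
Local Notation c0 := (newton_cst R m).
Let c00 : 0 < c0 := newton_cst_gt0 R m2.

Definition layer (x xi : 'rV[R]_m) : R := mu xi * conormal n alpha N (fun y => qn n alpha y x) xi.

Lemma measurable_density : measurable_fun (Gam : set (borelRm R m)) (mu : borelRm R m -> R).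
Proof. exact: measurable_enorm_continuous mGam mu_cont. Qed.

Lemma measurable_normal i : measurable_fun (Gam : set (borelRm R m)) (fun xi : borelRm R m => N xi ord0 i).
Proof.
apply: (measurable_enorm_continuous (f := fun xi => N xi ord0 i) mGam) => x Gx e e0.
have [d d0 H] := exists_radius a0 kap0 (divr_gt0 e0 (ltr0n R 2)).
exists d => // y Gy yx; apply: le_lt_trans (_ : e / 2 < e); last by lra.
have -> : N y ord0 i - N x ord0 i = (N y - N x) ord0 i by rewrite !mxE.
apply: le_trans (coord_le_enorm _ _) _.
apply: le_trans (normal_holder N_unit N_acos Gy Gx) _.
by apply: H; rewrite enorm_ge0 ltW.
Qed.

Lemma measurable_layer x (D : set (borelRm R m)) : measurable D -> D `<=` Gam -> O x -> ~ D x ->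
  measurable_fun D (layer x : borelRm R m -> R).
Proof.
move=> mD DG Ox nDx; apply: measurable_funM.
  exact: measurable_funS measurable_density.
apply: (measurable_conormal m2 nm alpha01) => //.
  by move=> y /DG; exact: Gam_orthant GamE _.
by move=> i; exact: measurable_funS (measurable_normal i).
Qed.

Variable t : 'rV[R]_m.
Hypothesis Gt : Gam t.
Local Notation patch := (patch Gam t).

(** [sg] is 1 for [x] on the inner normal and -1 on the outer one. The value [d = 0] is allowed:
    [kerf] then vanishes, and the estimate says that the patch contributes little to the direct
    value at a surface point. *)
Lemma patch_estimate (eps : R) : 0 < eps -> exists2 rho0, 0 < rho0 & forall rho, 0 < rho <= rho0 ->
  eball t rho `<=` O /\
  forall sg y d x, sg * sg = 1 -> Gam y -> enorm (y - t) < rho / 4 -> 0 <= d < rho / 4 ->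
  x = y - (sg * d) *: N y -> ~ patch rho y x ->
  sigma.-integrable (patch rho y) (EFin \o layer x) /\
  `|\int[sigma]_(xi in patch rho y) layer x xi +
    sg * mu t * \int[sigma]_(xi in patch rho y) (c0 * kerf y d xi)| <= eps.
Proof.
move=> eps0.
have Mm0 : 0 <= Mmu by apply: le_trans (mu_le Gt).
have Ot := Gam_orthant GamE Gt.
have [C C0 Hnear] := kernel_near m2 nm alpha01 N Ot.
have [Rz Rz0 [rhor rhor0 HRz]] := patch_riesz Omega_open GamE N_unit N_tangent N_sides a0 kap0 N_acos sigmaE Gt kap1 s0.
have [E EE] : exists E : R, E = 1 + 2 ^+ m by eexists.
have E0 : 0 < E by rewrite EE ltr_pwDl.
have [A1 A1E] : exists A1, A1 = E * (a * (c0 + 1) + C) by eexists.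
have A10 : 0 <= A1.
  by rewrite A1E mulr_ge0 ?(ltW E0)// addr_ge0// mulr_ge0 ?(ltW a0)// addr_ge0// ltW.
have [U UE] : exists U : R, U = 2 ^+ s by eexists.
have U0 : 0 < U by rewrite UE exprn_gt0.
(* [U = 2^s] bounds the mass of the normalised Poisson kernel at slope 1/2. Flatness, [eps1] and the
   oscillation of [mu] cost [e'] times that mass each, and the Riesz term a fourth [eps / 4]. *)
have [e' e'E] : exists e', e' = eps / (4 * U) by eexists.
have e'0 : 0 < e' by rewrite e'E divr_gt0// mulr_gt0.
have K1 : 0 < (Mmu + 1) * E * 2 by rewrite !mulr_gt0// ltr_wpDl.
have [eps1 [eps10 eps11 eps1K]] : exists eps1, [/\ 0 < eps1, eps1 <= 1 & (Mmu + 1) * E * 2 * eps1 <= e' * c0].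
  exists (Num.min 1 (e' * c0 / ((Mmu + 1) * E * 2))); split.
  - by rewrite lt_min ltr01 divr_gt0// mulr_gt0.
  - by rewrite ge_min lexx.
  - by rewrite mulrC -ler_pdivlMr// ge_min lexx orbT.
have [dn dn0 {}Hnear] := Hnear _ eps10.
have [dw dw0 Hw] := mu_cont Gt e'0.
have [e eO0 eO] := open_enormP (@orthant_open R m n) Ot.
have [r1 r10 H1] := exists_small_powR (ltW a0) kap0 (ltac:(by rewrite invr_gt0) : 0 < 2^-1 :> R).
have B0 : 0 <= (Mmu + 1) * E * 3 * a by rewrite !mulr_ge0 ?(ltW E0) ?(ltW a0)// addr_ge0.
have [r2 r20 H2] := exists_small_powR B0 kap0 e'0.
have B3 : 0 <= Mmu * A1 * Rz by rewrite !mulr_ge0.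
have k20 : 0 < kap / 2 by rewrite divr_gt0.
have e40 : 0 < eps / 4 by rewrite divr_gt0.
have [r3 r30 H3] := exists_small_powR B3 k20 e40.
pose mn := Num.min (Num.min (Num.min rhor dn) (Num.min dw e)) (Num.min (Num.min (r1 / 2) (r2 / 2)) (Num.min (r3 / 2) 2^-1)).
exists mn; first by rewrite !lt_min rhor0 dn0 dw0 eO0 !divr_gt0// invr_gt0 ltr0n.
move=> rho /andP[rho0]; rewrite !le_min -!andbA => /and5P[hr hdn hdw he /and4P[h1 h2 h3 h4]].
have rO : eball t rho `<=` O.
  by apply: subset_trans eO => y; rewrite /eball/= => /lt_le_trans; apply.
split => // sg y d x sg1 Gy yt /andP[d0 d1] xE npx.
have r20' : 0 <= 2 * rho by rewrite mulr_ge0// ltW.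
have {}H1 : a * (2 * rho) `^ kap <= 2^-1 by apply: H1; rewrite r20' /= mulrC -ler_pdivlMr.
have {}H2 : (Mmu + 1) * E * 3 * a * (2 * rho) `^ kap <= e' by apply: H2; rewrite r20' /= mulrC -ler_pdivlMr.
have {}H3 : Mmu * A1 * Rz * (2 * rho) `^ (kap / 2) <= eps / 4 by apply: H3; rewrite r20' /= mulrC -ler_pdivlMr.
have Ny := N_unit Gy.
have sgn : `|sg| = 1.
  by have /eqP := sg1; rewrite -expr2 sqrf_eq1 => /orP[] /eqP ->; rewrite ?normrN normr1.
have xt : enorm (x - t) < rho.
  have : enorm (x - y) = d by rewrite xE addrAC subrr add0r enormN enormZ Ny mulr1 normrM sgn mul1r ger0_norm.
  by move=> xy; apply: le_lt_trans (enorm_triangle y x t) _; rewrite xy; exact: ltr_quartersD d1 yt rho0.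
have Ox : O x by exact: rO.
have yr : enorm (y - t) < rho by apply: lt_trans yt _; rewrite ltr_pdivrMr// ltr_pMr// ltr1n.
have ar : a * rho `^ kap <= 2^-1.
  apply: le_trans H1; rewrite ler_wpM2l ?(ltW a0)//; apply: ge0_ler_powR; rewrite ?nnegrE ?(ltW kap0) ?(ltW rho0)//.
  by rewrite ler_peMl ?(ltW rho0)// ler1n.
have mP := @measurable_patch _ _ _ _ _ Omega_open GamE t rho y.
have PG : patch rho y `<=` Gam by move=> z [[]].
have hlt : 2^-1 < 1 :> R by rewrite invf_lt1// ltr1n.
have I1 := integrable_kerf Omega_open GamE N_unit N_tangent N_sides a0 kap0 N_acos sigmaE Gt y (ltW rho0) ar hlt d0.
have rb : 0 <= rho <= rhor by rewrite (ltW rho0).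
have [I2 I2C] := HRz rho y rb yr.
have ml := measurable_layer mP PG Ox npx.
(* The density is frozen at [t]: with [k] the normalised Poisson kernel, [mu xi * K + sg * mu t * k
   = mu xi * (K + sg * k) - sg * (mu xi - mu t) * k], and the pointwise estimate bounds
   [K + sg * k]. *)
have PW xi : patch rho y xi -> `|layer x xi + sg * mu t * (c0 * kerf y d xi)| <=
    3 * e' * (c0 * kerf y d xi) + Mmu * A1 * (2 * rho) `^ (kap / 2) * enorm (xi - y) `^ (- (s.+1%:R - kap / 2)).
  move=> Pxi; have [[Gxi xit] /eqP xiy] := Pxi.
  have [v vE] : exists v, v = xi - y by eexists.
  have v0 : 0 < enorm v by rewrite vE enorm_gt0 subr_eq0.
  have v2 : enorm v <= 2 * rho.
    rewrite vE mulr_natl mulr2n; apply: le_trans (enorm_triangle t xi y) _.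
    by rewrite (enormC t y); exact: lerD (ltW xit) (ltW yr).
  have v1 : enorm v <= 1 by apply: le_trans v2 _; rewrite mulrC -ler_pdivlMr// div1r.
  have vp q : 0 < q -> enorm v `^ q <= (2 * rho) `^ q.
    by move=> q0; apply: ge0_ler_powR; rewrite ?nnegrE ?(ltW q0) ?(ltW v0).
  have av : a * enorm v `^ kap <= 2^-1.
    by apply: le_trans H1; rewrite ler_wpM2l ?(ltW a0)// vp.
  have xix : xi - x = v + (sg * d) *: N y by rewrite vE xE opprB addrA addrAC.
  have nx : xi != x by apply/eqP => xx; apply: npx; rewrite -xx.
  have HK := Hnear xi x (lt_le_trans xit hdn) (lt_le_trans xt hdn) nx (N_unit Gxi).
  rewrite rr2E xix in HK.
  have ly1 : `|dotp v (N y)| <= a * enorm v `^ kap * enorm v.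
    have := lyapunov_ineq Omega_open GamE N_unit N_tangent N_sides a0 kap0 N_acos Gy Gxi.
    by rewrite (enormC y xi) -opprB dotpNl normrN vE.
  have ly2 : `|dotp v (N xi)| <= a * enorm v `^ kap * enorm v.
    by have := lyapunov_ineq Omega_open GamE N_unit N_tangent N_sides a0 kap0 N_acos Gxi Gy; rewrite vE.
  have nh : enorm (N y - N xi) <= a * enorm v `^ kap.
    by have := normal_holder N_unit N_acos Gy Gxi; rewrite (enormC y xi) vE.
  have k01 : 0 < kap <= 1 by rewrite kap0.
  have e01 : 0 <= eps1 <= 1 by rewrite (ltW eps10).
  have v01 : 0 < enorm v <= 1 by rewrite v0.
  have PE := pointwise_estimate k01 (ltW a0) (ltW c00) C0 e01 d0 (isT : (2 <= m)%N) sg1 Ny (N_unit Gxi) v01 av ly1 ly2 nh HK.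
  have kf0 : 0 <= kerf y d xi by exact: kerf_ge0.
  rewrite vE -/(kerf y d xi) -vE -EE -A1E in PE.
  have L1 : enorm v `^ (- (m%:R - 1 - kap)) <= (2 * rho) `^ (kap / 2) * enorm v `^ (- (s.+1%:R - kap / 2)).
    have -> : - (m%:R - 1 - kap) = kap / 2 + - (s.+1%:R - kap / 2) by rewrite -[m%:R]natr1; field.
    by rewrite powRD ?(lt0r_neq0 v0) ?implybT// ler_wpM2r ?powR_ge0// vp.
  have M1 : Mmu <= Mmu + 1 by rewrite lerDl.
  have mw := ltW (Hw _ Gxi (lt_le_trans xit hdw)).
  have T2 : Mmu * (E * (3 * c0 * (a * enorm v `^ kap))) <= e' * c0.
    rewrite (_ : _ * (_ * _) = (Mmu * E * 3 * a * enorm v `^ kap) * c0); last by ring.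
    rewrite ler_wpM2r ?(ltW c00)//; apply: le_trans H2; apply: ler_pM; rewrite ?powR_ge0 ?vp//.
      by rewrite !mulr_ge0 ?(ltW E0) ?(ltW a0).
    by do 3! (apply: ler_wpM2r; rewrite ?(ltW E0) ?(ltW a0)//).
  have T3 : Mmu * (E * (2 * eps1)) <= e' * c0.
    apply: le_trans eps1K; rewrite (_ : _ * (_ * _) = Mmu * E * 2 * eps1); last by ring.
    by do 3! (apply: ler_wpM2r; rewrite ?(ltW E0) ?(ltW eps10)//).
  rewrite -vE /layer; move: (conormal _ _ _ _ _) (kerf y d xi) (mu_le Gxi) (enorm v `^ (- (m%:R - 1 - kap))) (enorm v `^ (- (s.+1%:R - kap / 2))) PE L1 kf0 mw T2.
  move: (mu xi) ((2 * rho) `^ (kap / 2)) (enorm v `^ kap) => mx rk vk K kf mxM L Lq PE L1 kf0 mw T2.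
  have -> : mx * K + sg * mu t * (c0 * kf) = mx * (K + sg * c0 * kf) - sg * ((mx - mu t) * (c0 * kf)) by ring.
  apply: le_trans (ler_normB _ _) _; rewrite [X in X + _]normrM [X in _ + X]normrM sgn mul1r [X in _ + X]normrM.
  rewrite [`|c0 * kf|]ger0_norm; last by rewrite mulr_ge0// ltW.
  apply: (@le_trans _ _ (Mmu * (E * (3 * c0 * (a * vk) + 2 * eps1) * kf + A1 * (rk * Lq)) + e' * (c0 * kf))).
    apply: lerD; last by rewrite ler_wpM2r// mulr_ge0// ltW.
    by apply: ler_pM => //; apply: le_trans PE _; rewrite lerD2l ler_wpM2l.
  have T4 := ler_wpM2r kf0 T2; have T5 := ler_wpM2r kf0 T3.
  rewrite -subr_ge0.
  have -> : 3 * e' * (c0 * kf) + Mmu * A1 * rk * Lq -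
     (Mmu * (E * (3 * c0 * (a * vk) + 2 * eps1) * kf + A1 * (rk * Lq)) + e' * (c0 * kf)) =
     (e' * c0 * kf - Mmu * (E * (3 * c0 * (a * vk))) * kf) + (e' * c0 * kf - Mmu * (E * (2 * eps1)) * kf) by ring.
  by rewrite addr_ge0// subr_ge0.
have [If HF] := Rintegral_compare mP ml I1 I2 PW.
split => //; apply: le_trans HF _.
have IU : \int[sigma]_(xi in patch rho y) (c0 * kerf y d xi) <= U.
  move: d0; rewrite le_eqVlt => /orP[/eqP <-|dd0].
    rewrite (_ : Rintegral _ _ _ = 0); first exact: ltW.
    rewrite /Rintegral integral0_eq// => z _.
    by rewrite /kerf mul0r mulr0.
  have KU := kerf_upper Omega_open GamE N_unit N_tangent N_sides a0 kap0 N_acos sigmaE Gt y (ltW rho0) ar hlt dd0.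
  rewrite -EFin_Rintegral ?lee_fin in KU => //.
  apply: le_trans KU _; rewrite UE (_ : (1 - 2^-1)^-1 = 2 :> R); last by field.
  by rewrite exprS mulrA mulVf// mul1r.
have e'U : e' * U = eps / 4 by rewrite e'E; field; exact: lt0r_neq0.
have P0 : 0 <= (2 * rho) `^ (kap / 2) by exact: powR_ge0.
apply: (@le_trans _ _ (3 * e' * U + Mmu * A1 * (2 * rho) `^ (kap / 2) * Rz)).
  by apply: lerD; apply: ler_wpM2l => //; rewrite !mulr_ge0// ltW.
rewrite -[3 * e' * U]mulrA e'U [X in _ + X](_ : _ = Mmu * A1 * Rz * (2 * rho) `^ (kap / 2)); last by ring.
by apply: le_trans (lerD (lexx _) H3) _; rewrite le_eqVlt; apply/orP; left; apply/eqP; field.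
Qed.

End layer_limit.

(** * The far part of the surface and the jump relation *)

Lemma eighth_bounds (R : realFieldType) (a b d r : R) : b <= 2 * a -> a < r / 8 -> d <= a -> 0 < r ->
  [/\ b < r / 4, d < r / 4, a < r / 2 & b < r].
Proof. by move=> *; split; lra. Qed.

Section sigma_finite_pack.
Variables (d : measure_display) (T : measurableType d) (R : realType) (mu : {measure set T -> \bar R}).
Hypothesis mu_fin : (mu setT < +oo)%E.

Let sfin : sigma_finite setT mu.
Proof. by exists (fun=> setT); [rewrite bigcup_const//; exists 0%N|move=> _; split]. Qed.

Let packed : set T -> \bar R := mu.
HB.instance Definition _ := Measure.on packed.
HB.instance Definition _ := Measure_isSigmaFinite.Build d T R packed sfin.

(** Tonelli wants sigma-finiteness in the type, whereas the surface measure is given as a plain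
    measure whose finiteness is a proved fact. *)
Lemma exists_sigma_finite : exists nu : {sigma_finite_measure set T -> \bar R}, (nu : set T -> \bar R) = mu.
Proof. by exists packed. Qed.

End sigma_finite_pack.

Lemma integrable_setU d (T : measurableType d) (R : realType) (mu : {measure set T -> \bar R}) (A B : set T)
    (f : T -> \bar R) : measurable A -> measurable B -> [disjoint A & B] ->
  mu.-integrable A f -> mu.-integrable B f -> mu.-integrable (A `|` B) f.
Proof.
move=> mA mB AB /integrableP[mfA IA] /integrableP[mfB IB].
have mf : measurable_fun (A `|` B) f by apply/measurable_funU.
apply/integrableP; split => //; rewrite ge0_integral_setU//; first exact: lte_add_pinfty.
exact: measurableT_comp.
Qed.

Section layer_jump.
Variables (R : realType) (s n : nat) (Omega Gam : set 'rV[R]_s.+2) (N : 'rV[R]_s.+2 -> 'rV[R]_s.+2).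
Variables (a kap : R) (alpha : nat -> R).
Local Notation m := s.+2.
Local Notation O := (@orthant R m n).
Hypothesis Omega_open : open Omega.
Hypothesis GamE : Gam = (closure Omega `\` Omega) `&` O.
Hypothesis N_unit : forall t, Gam t -> enorm (N t) = 1.
Hypothesis N_tangent : forall t, Gam t ->
     (fun xi => dotp (xi - t) (N t) / enorm (xi - t)) x
        @[x --> within (Gam `\ t) (nbhs t)] --> 0.
Hypothesis N_sides : forall t, Gam t -> exists2 e0 : R, 0 < e0 &
     forall e : R, 0 < e < e0 ->
       Omega (t - e *: N t) /\ ~ closure Omega (t + e *: N t).
Hypothesis a0 : 0 < a.
Hypotheses (kap0 : 0 < kap) (kap1 : kap <= 1).
Hypothesis N_acos : forall x xi, Gam x -> Gam xi ->
  acos (dotp (N x) (N xi)) <= a * enorm (x - xi) `^ kap.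
Variable sigma : {sigma_finite_measure set (borelRm R m) -> \bar R}.
Hypothesis sigmaE : forall A : set (borelRm R m), measurable A -> sigma A = hausdorff (m%:R - 1) (A `&` Gam).
Hypothesis sigma_fin : (sigma setT < +oo)%E.
Hypotheses (s0 : (0 < s)%N) (nm : (n <= m)%N).
Hypothesis alpha01 : forall k, (k < n)%N -> 0 < 2 * alpha k < 1.
Variables (mu : 'rV[R]_m -> R) (Mmu M : R).
Hypothesis Gam_bounded : forall x, Gam x -> enorm x <= M.
Hypothesis mu_le : forall x, Gam x -> `|mu x| <= Mmu.
Hypothesis mu_cont : forall x, Gam x -> forall e, 0 < e -> exists2 d, 0 < d &
  forall y, Gam y -> enorm (y - x) < d -> `|mu y - mu x| < e.

Let mGam : measurable (Gam : set (borelRm R m)) := measurable_Gam Omega_open GamE.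
Let m2 : (2 < m)%N. Proof. by rewrite !ltnS. Qed.
Local Notation c0 := (newton_cst R m).
Variable t : 'rV[R]_m.
Hypothesis Gt : Gam t.
Local Notation patch := (patch Gam t).
Local Notation layer := (layer n N alpha mu).

Definition far (rho : R) : set (borelRm R m) := Gam `\` eball t rho.

Lemma measurable_far rho : measurable (far rho).
Proof. by apply: measurableD => //; exact: measurable_eball. Qed.

Lemma integrable_cst_far (rho C : R) : 0 <= C -> sigma.-integrable (far rho) (EFin \o (fun=> C)).
Proof.
move=> C0; have fin : (sigma (far rho) < +oo)%E.
  by apply: le_lt_trans sigma_fin; apply: le_measure; rewrite ?inE//; exact: measurable_far.
apply: (@integrable_ge0_lt _ _ R sigma (far rho) _ (C * fine (sigma (far rho)))) => //.
rewrite integral_cst//; last exact: measurable_far.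
by rewrite EFinM fineK// ge0_fin_numE.
Qed.

Lemma far_bound rho : 0 < rho -> exists2 C, 0 <= C & forall x, O x -> enorm (x - t) < rho / 2 ->
  forall xi, far rho xi -> `|layer x xi| <= C.
Proof.
move=> r0; have r20 : 0 < rho / 2 by rewrite divr_gt0.
have Mm0 : 0 <= Mmu by apply: le_trans (mu_le Gt).
have [B BE] : exists B, B = enorm t + rho + `|M| + 1 by eexists.
have B1 : 1 <= B by rewrite BE lerDr !addr_ge0 ?enorm_ge0 ?(ltW r0).
have [C C0 HC] := kernel_far m2 nm alpha01 N r20 B1.
exists (Mmu * C); first by rewrite mulr_ge0.
move=> x Ox xt xi [Gxi nxi]; rewrite normrM; apply: ler_pM => //; first exact: mu_le.
apply: HC => //.
- exact: Gam_orthant GamE _ Gxi.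
- apply: le_trans (Gam_bounded Gxi) _; rewrite BE.
  by have := ler_norm M; have := enorm_ge0 t; move: r0; lra.
- have := ler_enormD (x - t) t; rewrite subrK BE; have := normr_ge0 M; move: xt r0; lra.
- exact: N_unit.
- have : rho <= enorm (xi - t) by rewrite leNgt; apply/negP.
  by have := enorm_triangle x xi t; move: xt; lra.
Qed.

Lemma far_notin rho x : 0 < rho -> enorm (x - t) < rho / 2 -> ~ far rho x.
Proof.
move=> r0 xt [_]; apply; rewrite /eball/=; apply: (lt_trans xt).
by rewrite ltr_pdivrMr// ltr_pMr// ltr1n.
Qed.

Lemma measurable_far_layer rho x : 0 < rho -> O x -> enorm (x - t) < rho / 2 ->
  measurable_fun (far rho) (layer x : borelRm R m -> R).
Proof.
move=> r0 Ox xt.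
apply: (measurable_layer Omega_open GamE N_unit a0 kap0 N_acos s0 nm alpha01 mu_cont) => //.
- exact: measurable_far.
- by move=> z [].
- exact: far_notin.
Qed.

Lemma integrable_far_layer rho x : 0 < rho -> O x -> enorm (x - t) < rho / 2 ->
  sigma.-integrable (far rho) (EFin \o layer x).
Proof.
move=> r0 Ox xt; have [C C0 HC] := far_bound r0.
apply: integrable_bounded_by (integrable_cst_far rho C0) _ => //.
- exact: measurable_far.
- exact: measurable_far_layer.
- exact: HC.
Qed.

(** By contradiction along a sequence tending to [t], because dominated convergence is
    sequential. *)
Lemma far_continuous rho (eps : R) : 0 < rho -> 0 < eps -> exists2 del, 0 < del &
  forall x, O x -> enorm (x - t) < del ->
  `|\int[sigma]_(xi in far rho) layer x xi - \int[sigma]_(xi in far rho) layer t xi| <= eps.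
Proof.
move=> r0 eps0; have r20 : 0 < rho / 2 by rewrite divr_gt0.
have Ot := Gam_orthant GamE Gt.
have [C C0 HC] := far_bound r0.
apply: contrapT => H.
have /choice[x_ Hx] : forall j : nat, exists x, [/\ O x, enorm (x - t) < Num.min (rho / 2) j.+1%:R^-1 &
    eps < `|\int[sigma]_(xi in far rho) layer x xi - \int[sigma]_(xi in far rho) layer t xi|].
  move=> j; apply: contrapT => nx; apply: H; exists (Num.min (rho / 2) j.+1%:R^-1).
    by rewrite lt_min r20 invr_gt0 ltr0n.
  move=> x Ox xt; rewrite leNgt; apply/negP => h; apply: nx; exists x; split => //.
have x1 j : O (x_ j) by have [] := Hx j.
have x2 j : enorm (x_ j - t) < rho / 2 by have [_ + _] := Hx j; rewrite lt_min => /andP[].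
have x3 j : enorm (x_ j - t) < j.+1%:R^-1 by have [_ + _] := Hx j; rewrite lt_min => /andP[].
have cx : x_ j @[j --> \oo] --> t.
  move=> A /nbhs_eballP[e e0 eA].
  have := near_infty_natSinv_lt (PosNum e0); apply: filterS => j je.
  by apply: eA; apply: lt_trans (x3 j) je.
have tt : enorm (t - t) < rho / 2 by rewrite subrr enorm0.
have cI : \int[sigma]_(xi in far rho) layer (x_ j) xi @[j --> \oo] --> \int[sigma]_(xi in far rho) layer t xi.
  apply: (@Rintegral_dominated_cvg _ _ _ sigma (far rho) (measurable_far rho) (fun j => layer (x_ j)) (layer t) (fun=> C)).
  - by move=> j; exact: measurable_far_layer.
  - exact: measurable_far_layer.
  - exact: integrable_cst_far.
  - by move=> j xi Dxi; apply: HC.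
  - move=> xi [Gxi nxi]; rewrite /layer; apply: cvgM; first exact: cvg_cst.
    apply: (@kernel_cvg R m n alpha m2 nm alpha01 N xi t x_ (rho / 2)) => //.
      exact: Gam_orthant GamE _ Gxi.
    move=> j; have : rho <= enorm (xi - t) by rewrite leNgt; apply/negP.
    by have := enorm_triangle (x_ j) xi t; move: (x2 j); lra.
have /cvgrPdist_lt /(_ _ eps0) [j _ /(_ j (leqnn j))] := cI.
by rewrite distrC => h; have [_ _ /(lt_trans h)] := Hx j; rewrite ltxx.
Qed.

(** The puncture [y] varies with [x]; as a null set it does not affect the integral over [Gam]. *)
Lemma layer_split rho y x : 0 < rho -> Gam y -> enorm (y - t) < rho -> O x -> enorm (x - t) < rho / 2 ->
  sigma.-integrable (patch rho y) (EFin \o layer x) ->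
  \int[sigma]_(xi in Gam) layer x xi =
  \int[sigma]_(xi in patch rho y) layer x xi + \int[sigma]_(xi in far rho) layer x xi.
Proof.
move=> r0 Gy yt Ox xt IP; have IF := integrable_far_layer r0 Ox xt.
have mP := @measurable_patch _ _ _ _ _ Omega_open GamE t rho y; have mF := measurable_far rho.
have my := @measurable_set1 R s y.
have s1 := sigma_set1 Omega_open GamE N_unit N_tangent N_sides a0 kap0 N_acos sigmaE Gy.
have I1 : sigma.-integrable [set y] (EFin \o layer x).
  by apply: null_set_integrable => //; exact: measurable_fun_set1.
have D1 : [disjoint patch rho y & far rho].
  by apply/disj_setPS => z [[[_ h] _] [_ /(_ h)]].
have D2 : [disjoint [set y] & (patch rho y `|` far rho)].
  apply/disj_setPS => z [-> [[_ h]|[_ h]]]; first exact: h.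
  by apply: h.
have GE : (Gam : set (borelRm R m)) = [set y] `|` (patch rho y `|` far rho).
  apply/seteqP; split => z; last by move=> [->//|[[[]]|[]]].
  move=> Gz; have [->|/eqP zy] := eqVneq z y; [by left|right].
  by have [h|h] := pselect (eball t rho z); [left; split|right; split].
have mPF : measurable (patch rho y `|` far rho) by exact: measurableU.
have IPF : sigma.-integrable (patch rho y `|` far rho) (EFin \o layer x) by exact: integrable_setU.
transitivity (\int[sigma]_(xi in [set y] `|` (patch rho y `|` far rho)) layer x xi); first by rewrite -GE.
rewrite Rintegral_setU//; last exact: integrable_setU.
rewrite Rintegral_setU// (_ : \int[sigma]_(xi in [set y]) _ = 0) ?add0r//.
by rewrite /Rintegral null_set_integral//; exact: measurable_fun_set1.
Qed.

Lemma jump_combine (wx wt Px Pt Fx Ft I sg mt e : R) : wx = Px + Fx -> wt = Pt + Ft ->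
  `|Px + sg * mt * I| <= e / 4 -> `|Pt| <= e / 4 -> `|Fx - Ft| <= e / 4 -> `|sg * mt * (2^-1 - I)| <= e / 4 ->
  `|wx - (wt - sg / 2 * mt)| <= e.
Proof.
move=> -> -> h1 h2 h3 h4.
have -> : Px + Fx - (Pt + Ft - sg / 2 * mt) =
  (Px + sg * mt * I) + sg * mt * (2^-1 - I) - Pt + (Fx - Ft) by ring.
apply: le_trans (ler_normD _ _) _; apply: le_trans (lerD (ler_normB _ _) h3) _.
apply: le_trans (lerD (lerD (ler_normD _ _) h2) (lexx _)) _.
apply: le_trans (lerD (lerD (lerD h1 h4) (lexx _)) (lexx _)) _.
by rewrite le_eqVlt; apply/orP; left; apply/eqP; field.
Qed.

(** The radius [rho] is fixed first, making the two patch estimates small; only then is [x] brought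
    close to [t], for the Poisson mass to approach 1/2 and the far part to settle. *)
Lemma layer_jump (eps : R) : 0 < eps -> exists2 del, 0 < del & forall x sg, O x -> enorm (x - t) < del ->
  (sg = 1 /\ Omega x) \/ (sg = -1 /\ ~ closure Omega x) ->
  `|\int[sigma]_(xi in Gam) layer x xi - (\int[sigma]_(xi in Gam) layer t xi - sg / 2 * mu t)| <= eps.
Proof.
move=> eps0; have Ot := Gam_orthant GamE Gt.
have Mm0 : 0 <= Mmu by apply: le_trans (mu_le Gt).
have e40 : 0 < eps / 4 by rewrite divr_gt0.
have M10 : 0 < Mmu + 1 by rewrite ltr_wpDl.
have [r1 r10 H1] := patch_estimate Omega_open GamE N_unit N_tangent N_sides a0 kap0 kap1 N_acos sigmaE s0 nm alpha01 mu_le mu_cont Gt e40.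
have [r2 r20 H2] := kerf_near Omega_open GamE N_unit N_tangent N_sides a0 kap0 N_acos sigmaE Gt (divr_gt0 e40 M10).
have [rho rho0 [rr1 rr2]] : exists2 rho, 0 < rho & rho <= r1 /\ rho <= r2.
  by exists (Num.min r1 r2); [rewrite lt_min r10|rewrite !ge_min !lexx orbT].
have [|rO {}H1] := H1 rho; first by rewrite rho0.
have [|//|dk dk0 {}H2] := H2 rho; first by rewrite rho0.
have [e e0 HN] := nearest_point Omega_open GamE N_unit N_tangent N_sides Gt.
have [df df0 HF] := far_continuous rho0 e40.
exists (Num.min (Num.min e df) (Num.min (rho / 8) (dk / 2))); first by rewrite !lt_min e0 df0 !divr_gt0.
move=> x sg Ox; rewrite !lt_min => /andP[/andP[xe xdf] /andP[xr xk]] side.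
have nGx : ~ Gam x.
  by move=> Gx; case: side => -[_ h]; [exact: (Gam_NOmega GamE Gx)|apply: h; exact: (Gam_closure GamE Gx)].
have [y [d [Gy d0 d1 yt [xin xout]]]] := HN x xe nGx.
have sg1 : sg * sg = 1 by case: side => -[-> _]; ring.
have xE : x = y - (sg * d) *: N y.
  case: side => -[-> h]; first by rewrite mul1r xin.
  by rewrite mulN1r scaleNr opprK xout.
have tt : enorm (t - t) < rho / 4 by rewrite subrr enorm0 divr_gt0.
have [yr4 dr4' xr2 yr] : [/\ enorm (y - t) < rho / 4, d < rho / 4, enorm (x - t) < rho / 2 & enorm (y - t) < rho].
  exact: eighth_bounds yt xr d1 rho0.
have [tr tr2] : enorm (t - t) < rho /\ enorm (t - t) < rho / 2 by rewrite subrr enorm0 divr_gt0.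
have dr4 : 0 <= d < rho / 4 by rewrite (ltW d0).
have dd : 0 < d < dk by rewrite d0 /=; apply: le_lt_trans d1 (lt_trans xk _); rewrite ltr_pdivrMr// ltr_pMr// ltr1n.
have ydk : enorm (y - t) < dk by apply: le_lt_trans yt _; rewrite mulrC -ltr_pdivlMr.
have t0 : (0 : R) <= 0 < rho / 4 by rewrite lexx divr_gt0.
have tE : t = t - (1 * 0) *: N t by rewrite mulr0 scale0r subr0.
have [IP PE] := H1 sg y d x sg1 Gy yr4 dr4 xE (fun p => nGx p.1.1).
(* The direct value at [t]: height 0 over the foot point [t] itself, where the sign is
   immaterial. *)
have [IPt PEt] := H1 1 t 0 t (mulr1 1) Gt tt t0 tE (fun p => p.2 erefl).
have I0 : \int[sigma]_(xi in patch rho t) (c0 * kerf t 0 xi) = 0.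
  by rewrite /Rintegral integral0_eq// => z _; rewrite /kerf mul0r mulr0.
rewrite I0 mulr0 addr0 in PEt.
have KN := H2 y d Gy ydk dd.
have sgn : `|sg| = 1 by case: side => -[-> _]; rewrite ?normrN normr1.
have T : `|sg * mu t * (2^-1 - \int[sigma]_(x0 in patch rho y) (c0 * kerf y d x0))| <= eps / 4.
  rewrite !normrM sgn mul1r distrC; apply: (@le_trans _ _ (Mmu * (eps / 4 / (Mmu + 1)))).
    by apply: ler_pM => //; exact: mu_le.
  by rewrite mulrCA ler_piMr ?(ltW e40)// ler_pdivrMr// mul1r lerDl.
exact: (jump_combine (layer_split rho0 Gy yr Ox xr2 IP) (layer_split rho0 Gt tr Ot tr2 IPt) PE PEt (HF x Ox xdf) T).
Qed.

End layer_jump.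

(** * Passage to the theorem *)

(** On a bounded set the Hölder exponent can be lowered to at most 1 by changing the constant. The
    pointwise estimate needs this so that [|v|^(2-m)] is dominated by [|v|^(kap+1-m)] for
    [|v| <= 1]. *)
Lemma holder_exponent_min (R : realType) (a kap D r : R) : 0 < a -> 0 < kap -> 1 <= D -> 0 <= r <= D ->
  a * r `^ kap <= a * D `^ (kap - Num.min kap 1) * r `^ Num.min kap 1.
Proof.
move=> a0 k0 D1 /andP[r0 rD]; have D0 : 0 < D := lt_le_trans ltr01 D1.
have mk : Num.min kap 1 <= kap by rewrite ge_min lexx.
rewrite -mulrA ler_wpM2l ?(ltW a0)//.
have [->|rn] := eqVneq r 0; first by rewrite powR0 ?lt0r_neq0// mulr_ge0 ?powR_ge0.
have -> : r `^ kap = r `^ (kap - Num.min kap 1) * r `^ Num.min kap 1.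
  by rewrite -powRD ?rn ?implybT// subrK.
rewrite ler_wpM2r ?powR_ge0//.
by apply: ge0_ler_powR; rewrite ?nnegrE ?subr_ge0 ?(ltW D0).
Qed.

Lemma within_cvg_enorm (R : realType) (m : nat) (A : set 'rV[R]_m) (t : 'rV[R]_m) (f : 'rV[R]_m -> R) (l : R) :
  (forall eps, 0 < eps -> exists2 del, 0 < del & forall x, A x -> enorm (x - t) < del -> `|f x - l| <= eps) ->
  f x @[x --> within A (nbhs t)] --> l.
Proof.
move=> H; apply/cvgrPdist_le => eps eps0; have [del del0 Hd] := H _ eps0.
rewrite near_withinE; apply/nbhs_eballP; exists del => // x xt Ax.
by rewrite distrC; exact: Hd.
Qed.


Theorem theorem3 (R : realType) (m n : nat) (alpha : nat -> R)
  (Omega Gam : set 'rV[R]_m) (N : 'rV[R]_m -> 'rV[R]_m)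
  (sigma : {measure set (borelRm R m) -> \bar R})
  (mu : 'rV[R]_m -> R) :
  (2 < m)%N -> (1 <= n <= m)%N ->
  (forall k, (k < n)%N -> 0 < 2 * alpha k < 1) ->
  finite_domain Omega -> Omega `<=` orthant m n ->
  lyapunov_surface n Omega Gam N ->
  (* sigma is the surface measure: (m-1)-dim Hausdorff measure restricted to Gamma *)
  (forall A : set (borelRm R m), measurable A ->
     sigma A = hausdorff (m%:R - 1) (A `&` Gam)) ->
  {within closure Gam, continuous mu} ->
  let w := fun x : 'rV[R]_m =>
    \int[sigma]_(xi in Gam) (mu xi * conormal n alpha N (fun y => qn n alpha y x) xi) in
  let Kn := fun s t : 'rV[R]_m => conormal n alpha N (fun y => qn n alpha y t) s in
  forall t, Gam t ->
    (w x @[x --> within Omega (nbhs t)] -->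
       - (1/2) * mu t + \int[sigma]_(s in Gam) (mu s * Kn s t)) /\
    (w x @[x --> within (orthant m n `\` closure Omega) (nbhs t)] -->
       (1/2) * mu t + \int[sigma]_(s in Gam) (mu s * Kn s t)).
Proof.
(* As [m > 2], the preceding sections, in dimension [s.+2], are applied with a positive [s]. *)
case: m Omega Gam N sigma mu => [|[|[|s]]] // Omega Gam N sigma mu _ /andP[n1 nm] alpha01.
case=> Omega_open [_ [_ [M OM]]] OO.
case=> GamE [N_unit [N_tangent [N_sides [[a [kap [a0 [kap0 N_acos]]]] _]]]] sigmaE muc w Kn.
have clM (A : set 'rV[R]_s.+3) : (forall x, A x -> enorm x <= M) -> closure A `<=` ecball 0 M.
  move=> AM x cx; rewrite closureE in cx; apply: cx; split; first exact: closed_ecball.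
  by move=> y Ay; rewrite /ecball/= subr0; exact: AM.
have GM x : Gam x -> enorm x <= M.
  by move=> /(Gam_closure GamE)/(clM _ OM); rewrite /ecball/= subr0.
have GclM := clM _ GM.
(* [D] exceeds every distance between two points of the surface, which lies in the ball of radius
   [M]. *)
pose k1 := Num.min kap 1; pose D := 2 * `|M| + 1; pose a1 := a * D `^ (kap - k1).
have D1 : 1 <= D by rewrite /D lerDr mulr_ge0.
have k10 : 0 < k1 by rewrite lt_min kap0 ltr01.
have k11 : k1 <= 1 by rewrite ge_min lexx orbT.
have a10 : 0 < a1 by rewrite mulr_gt0// powR_gt0// (lt_le_trans ltr01).
have N_acos1 x xi : Gam x -> Gam xi -> acos (dotp (N x) (N xi)) <= a1 * enorm (x - xi) `^ k1.
  move=> Gx Gxi; apply: le_trans (N_acos _ _ Gx Gxi) _; apply: holder_exponent_min => //.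
  rewrite enorm_ge0 /D /= (le_trans (ler_enormB _ _))//.
  by have := GM _ Gx; have := GM _ Gxi; have := ler_norm M; lra.
have sfin := sigma_Gam_fin Omega_open GamE N_unit N_tangent N_sides a10 k10 N_acos1 sigmaE OM.
have [nu nuE] := exists_sigma_finite sfin.
have wE x : w x = \int[nu]_(xi in Gam) layer n N alpha mu x xi by rewrite /w /Rintegral nuE.
have KE t : \int[sigma]_(s in Gam) (mu s * Kn s t) = w t by [].
rewrite -nuE in sigmaE sfin.
have mucl x : closure Gam x -> forall e, 0 < e -> exists2 d, 0 < d &
    forall y, closure Gam y -> enorm (y - x) < d -> `|mu y - mu x| < e.
  move=> cx e e0; have /subspace_continuousP /(_ x cx) /cvgrPdist_lt /(_ e e0) := muc.
  rewrite near_withinE => /nbhs_eballP[d d0 H]; exists d => // y cy yx.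
  by rewrite distrC; exact: H.
have subG := @subset_closure _ Gam.
have mu_cont x : Gam x -> forall e, 0 < e -> exists2 d, 0 < d &
    forall y, Gam y -> enorm (y - x) < d -> `|mu y - mu x| < e.
  by move=> Gx e e0; have [d d0 H] := mucl x (subG _ Gx) e e0; exists d => // y /subG; exact: H.
(* Continuity up to the edge of the surface enters here: the closure of [Gam] is compact, so the
   density is bounded. *)
have [Mmu mu_le] : exists Mmu, forall x, Gam x -> `|mu x| <= Mmu.
  have cG : compact (closure Gam).
    exact: (compact_ecball (@closed_closure _ Gam) GclM).
  have := compact_bounded (continuous_compact muc cG) => -[B [_ HB]].
  exists (B + 1) => x Gx; apply: (HB (B + 1)); first by rewrite ltrDl.
  by exists x => //; exact: subG.
move=> t Gt.
have J := layer_jump Omega_open GamE N_unit N_tangent N_sides a10 k10 k11 N_acos1 sigmaE sfin (ltn0Sn s) nm alpha01 GM mu_le mu_cont Gt.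
have {}J eps : 0 < eps -> exists2 del, 0 < del & forall x sg, orthant s.+3 n x -> enorm (x - t) < del ->
    (sg = 1 /\ Omega x) \/ (sg = -1 /\ ~ closure Omega x) -> `|w x - (w t - sg / 2 * mu t)| <= eps.
  move=> eps0; have [del del0 H] := J eps eps0; exists del => // x sg Ox xt side.
  by rewrite !wE; exact: H.
rewrite KE; clear KE wE; clearbody w.
split; apply: within_cvg_enorm => eps eps0; have [del del0 H] := J eps eps0; exists del => // x.
  move=> Ox xt; rewrite mulNr [- _ + _]addrC.
  exact: H x 1 (OO _ Ox) xt (or_introl (conj erefl Ox)).
move=> [Ox nx] xt; have := H x (-1) Ox xt (or_intror (conj erefl nx)).
by rewrite !mulNr opprK [w t + _]addrC.
Qed.
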